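(* Let $H:\mathbb R^d\times\mathbb R^d\to\mathbb R$ and $f:\mathbb R^d\to\mathbb R$ be such that $H(p,\cdot)$ and $f$ are $\mathbb Z^d$-periodic, $H$ satisfies $\lim_{|p|\to\infty}\inf_{y}H(p,y)=+\infty$ and is bounded and Lipschitz on $B_R\times\mathbb R^d$ for every $R>0$, and $$H\ge0,\quad H(0,\cdot)=0,\quad f\in BUC(\mathbb R^d),\quad \max_{\mathbb R^d}f=-\min_{\mathbb R^d}f=1.$$ Let $\eta(\epsilon)>0$ satisfy $\lim_{\epsilon\to0}\eta(\epsilon)=0$ and $\lim_{\epsilon\to0}\frac{\epsilon}{\eta(\epsilon)}=0$. Let $\{X^1_k,X^2_k\}_{k=0}^\infty$ be independent real random variables on a probability space $(\Omega,\mathcal F,\mathbb P)$ such that, for all $k$, $\mathbb P(X^1_k>0)=\mathbb P(X^1_k<0)$; $\{X^2_k\}_k$ are identically distributed with $\mathbb E|X^2_k|^2=1$; and $\operatorname{ess\,sup}_\Omega\sup_k|X^2_k/X^1_k|<\infty$. For $i=1,2$ define $W^{i,\epsilon}_0=0$ and, for $k\in\{0,1,2,\dots\}$ and $t\in[k\eta(\epsilon),(k+1)\eta(\epsilon)]$, $$W^{i,\epsilon}_t=W^{i,\epsilon}_{k\eta(\epsilon)}+\frac{t-k\eta(\epsilon)}{\eta(\epsilon)^{1/2}}X^i_k.$$ Let $u^\epsilon$ be the solution of $$u^\epsilon_t+H(Du^\epsilon,x/\epsilon)\,\dot W^{1,\epsilon}_t+f(x/\epsilon)\,\dot W^{2,\epsilon}_t=0\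 \text{ in }\mathbb R^d\times(0,\infty),\qquad u^\epsilon(\cdot,0)=0.$$ Then, for every $x\in\mathbb R^d$, as $\epsilon\to0$, the law $\mu^\epsilon_x$ of $t\mapsto u^\epsilon(x,t)$ on $C([0,\infty),\mathbb R)$ converges weakly to the Wiener measure $\overline\mu$ (the law of standard one-dimensional Brownian motion started at $0$).
   Context: $B_R=\{p\in\mathbb R^d:|p|\le R\}$; $BUC(\mathbb R^d)$: bounded uniformly continuous functions. The space $X=C([0,\infty),\mathbb R)$ carries the metric $d(f,g)=\sum_{n\ge1}2^{-n}\min(1,\sup_{[0,n]}|f-g|)$ of locally uniform convergence, and $\mu^\epsilon_x(A)=\mathbb P(u^\epsilon(x,\cdot)\in A)$ for Borel $A\subset X$. Weak convergence means $\int_X\phi\,d\mu^\epsilon_x\to\int_X\phi\,d\overline\mu$ for every bounded continuous $\phi:X\to\mathbb R$. For each $\omega\in\Omega$, $u^\epsilon$ is the viscosity solution obtained by solving forward in time successively on each interval where $(\dot W^{1,\epsilon},\dot W^{2,\epsilon})$ is constant. The condition on $X^2_k/X^1_k$ is understood to include $X^1_k\ne0$ almost surely. *)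

(* Defs.v *)
From HB Require Import structures.
From mathcomp Require Import all_boot all_order all_algebra.
From mathcomp Require Import all_classical all_reals all_analysis ess_sup_inf.

Set Implicit Arguments.
Unset Strict Implicit.
Unset Printing Implicit Defensive.

Import Order.TTheory GRing.Theory Num.Theory.
Import numFieldNormedType.Exports.

Local Open Scope classical_set_scope.
Local Open Scope ring_scope.

(** ** The path space C([0,oo), R) *)

(* An element of C([0,oo), R) is represented by its unique continuous extension
   to R that is constant on ]-oo, 0], so that extensional equality on R is
   equality on [0,oo). *)
Record path_space (R : realType) := PathSpace {
  path_fun :> R -> R ;
  path_continuous : continuous path_fun ;
  path_neg : forall t, t <= 0 -> path_fun t = path_fun 0
}.

Section path_space_metric.
Variable R : realType.
Implicit Types f g h : path_space R.

HB.instance Definition _ := gen_eqMixin (path_space R).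
HB.instance Definition _ := gen_choiceMixin (path_space R).

Lemma path_spaceP f g : (forall t, 0 <= t -> f t = g t) -> f = g.
Proof.
move=> fg; have {}fg : path_fun f = path_fun g.
  apply/funext => t; have [t0|/ltW t0] := leP 0 t; first exact: fg.
  by rewrite !path_neg// fg.
case: f g fg => [f cf nf] [g cg ng] /= fg; subst g.
by congr PathSpace; exact: Prop_irrelevance.
Qed.

Fact path0_subproof : continuous (fun _ : R => 0 : R).
Proof. by move=> ?; exact: cvg_cst. Qed.

HB.instance Definition _ := isPointed.Build (path_space R)
  (@PathSpace R (fun=> 0) path0_subproof (fun _ _ => erefl)).

Definition sup_dist f g (n : nat) : R :=
  sup [set `|f t - g t| | t in `[0, n%:R]].

Definition path_dist_term f g (n : nat) : R :=
  (2 ^+ n)^-1 * Num.min 1 (sup_dist f g n).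

(* [series] sums from index 0, hence the shift. *)
Definition path_dist f g : R :=
  limn (series (fun k => path_dist_term f g k.+1)).

Lemma sup_dist_has_sup f g n : has_sup [set `|f t - g t| | t in `[0, n%:R]].
Proof.
split; first by exists `|f 0 - g 0|; exists 0; rewrite //= in_itv /= lexx ler0n.
have cfg : {within `[0, n%:R], continuous (fun t => `|f t - g t|)}.
  apply: continuous_subspaceT => t; apply: cvg_norm.
  by apply: cvgB; exact: path_continuous.
have [c _ hc] := EVT_max (ler0n R n) cfg.
by exists `|f c - g c| => _ [t tn <-]; exact: hc.
Qed.

Lemma sup_dist_ub f g n t : 0 <= t <= n%:R -> `|f t - g t| <= sup_dist f g n.
Proof.
move=> tn; apply: (sup_upper_bound (sup_dist_has_sup f g n)).
by exists t; rewrite //= in_itv.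
Qed.

Lemma sup_dist_le f g n c :
  (forall t, 0 <= t <= n%:R -> `|f t - g t| <= c) -> sup_dist f g n <= c.
Proof.
move=> fgc; apply: ge_sup; first by case: (sup_dist_has_sup f g n).
by move=> _ [t /= + <-]; rewrite in_itv; exact: fgc.
Qed.

Lemma sup_dist_ge0 f g n : 0 <= sup_dist f g n.
Proof. by rewrite (le_trans (normr_ge0 (f 0 - g 0)))// sup_dist_ub// lexx ler0n. Qed.

Lemma path_dist_term_ge0 f g n : 0 <= path_dist_term f g n.
Proof.
by rewrite mulr_ge0 ?invr_ge0 ?exprn_ge0// le_min ler01 sup_dist_ge0.
Qed.

Lemma path_dist_term_cvg f g :
  cvgn (series (fun k => path_dist_term f g k.+1)).
Proof.
apply: (@series_le_cvg _ _ (geometric 2^-1 2^-1)).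
- by move=> n; exact: path_dist_term_ge0.
- by move=> n; rewrite /geometric /= mulr_ge0 ?exprn_ge0 ?invr_ge0.
- move=> n; rewrite /geometric /= -exprS exprVn /path_dist_term.
  by rewrite ler_piMr ?invr_ge0 ?exprn_ge0// ge_min lexx.
- by apply: is_cvg_geometric_series; rewrite gtr0_norm ?invr_gt0// invf_lt1 ?ltr1n.
Qed.

Lemma path_distxx f : path_dist f f = 0.
Proof.
rewrite /path_dist (_ : series _ = fun=> 0) ?lim_cst//.
apply/funext => n; rewrite /series /= big1// => k _.
rewrite /path_dist_term; suff -> : sup_dist f f k.+1 = 0.
  by rewrite minEle ler10 mulr0.
apply/eqP; rewrite eq_le sup_dist_ge0 andbT; apply: sup_dist_le => t _.
by rewrite subrr normr0.
Qed.

Lemma path_dist_positivity f g : path_dist f g = 0 -> f = g.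
Proof.
move=> fg0; apply: path_spaceP => t t0.
have [n tn] : exists n, t <= n.+1%:R.
  exists (Num.truncn t).+1; apply: ltW; apply: (lt_trans (truncnS_gt t)).
  by rewrite ltr_nat.
have term0 : path_dist_term f g n.+1 <= 0.
  rewrite -fg0 /path_dist.
  apply: (@le_trans _ _ (series (fun k => path_dist_term f g k.+1) n.+1)).
    rewrite /series /= big_nat_recr//= lerDr sumr_ge0// => k _.
    exact: path_dist_term_ge0.
  apply: nondecreasing_cvgn_le; last exact: path_dist_term_cvg.
  by apply: nondecreasing_series => k _ _; exact: path_dist_term_ge0.
have : Num.min 1 (sup_dist f g n.+1) <= 0.
  by move: term0; rewrite /path_dist_term pmulr_rle0// invr_gt0 exprn_gt0.
rewrite ge_min ler10 /= => d0; apply/eqP; rewrite -subr_eq0 -normr_le0.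
by rewrite (le_trans _ d0)// sup_dist_ub// t0.
Qed.

Lemma path_dist_sym f g : path_dist f g = path_dist g f.
Proof.
congr (limn (series _)); apply/funext => k.
congr (_ * Num.min _ (sup _)); apply: eq_imagel => t _; exact: distrC.
Qed.

Lemma path_dist_triangle g f h :
  path_dist f h <= path_dist f g + path_dist g h.
Proof.
rewrite /path_dist -limD; [|exact: path_dist_term_cvg..].
apply: ler_lim; first exact: path_dist_term_cvg.
  by apply: is_cvgD; exact: path_dist_term_cvg.
apply: nearW => n; rewrite -[leRHS]/(series _ n + series _ n) /series /= -big_split /=.
apply: ler_sum => k _.
rewrite /path_dist_term -mulrDr ler_wpM2l ?invr_ge0 ?exprn_ge0//.
have fgh : sup_dist f h k.+1 <= sup_dist f g k.+1 + sup_dist g h k.+1.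
  apply: sup_dist_le => t tk; rewrite (le_trans (ler_distD (g t) _ _))//.
  by rewrite lerD// sup_dist_ub.
have := sup_dist_ge0 f g k.+1; have := sup_dist_ge0 g h k.+1.
move: fgh; set a := sup_dist f h _; set b := sup_dist f g _.
set c := sup_dist g h _ => abc c0 b0.
rewrite ge_min; have [b1|b1] := leP 1 b; first by rewrite lerDl le_min ler01 c0.
have [c1|c1] := leP 1 c; first by rewrite lerDr b0.
by rewrite abc orbT.
Qed.

HB.instance Definition _ := @isMetric.Build R (path_space R) path_dist
  path_distxx path_dist_positivity path_dist_sym path_dist_triangle.

(* The Borel sigma-algebra of the metric [path_dist]. *)
HB.instance Definition _ := @isMeasurable.Build
  (sigma_display (@open (path_space R))) (path_space R) <<s @open (path_space R) >>
  (@sigma_algebra0 _ setT _) (@sigma_algebraC _ _) (@sigma_algebra_bigcup _ setT _).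

End path_space_metric.

Definition weakly_converges (R : realType) (I : Type) (F : set_system I)
    (mu_ : I -> set (path_space R) -> \bar R) (mu : set (path_space R) -> \bar R) :=
  forall phi : path_space R -> R, continuous phi ->
    [bounded phi g | g in [set: path_space R]] ->
    (\int[mu_ i]_g (phi g)%:E)%E @[i --> F] --> (\int[mu]_g (phi g)%:E)%E.

Definition mutually_independent d (T : measurableType d) (R : realType)
    (P : probability T R) (I : choiceType) (Y : I -> T -> R) :=
  forall (s : seq I) (A : I -> set R), uniq s -> (forall i, measurable (A i)) ->
    P (\bigcap_(i in [set` s]) (Y i @^-1` A i)) =
    (\prod_(i <- s) P (Y i @^-1` A i))%E.

(* [normal_prob m s] has standard deviation [s], and is not a Dirac mass when
   s = 0, whence the strict inequality below. *)
Definition is_wiener_measure (R : realType) (mu : probability (path_space R) R) :=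
  [/\ mu [set g : path_space R | g 0 = 0] = 1%E,
      forall s t : R, 0 <= s -> s < t -> forall A : set R, measurable A ->
        mu [set g : path_space R | A (g t - g s)] =
        normal_prob 0 (Num.sqrt (t - s)) A
    & forall t : nat -> R, 0 <= t 0%N -> (forall i, t i <= t i.+1) ->
        mutually_independent mu
          (fun i (g : path_space R) => g (t i.+1) - g (t i))].

(** ** Hamilton-Jacobi equations *)

Section hamilton_jacobi.
Variables (R : realType) (d : nat).
Local Notation space := 'rV[R]_d.
Local Notation spacetime := (space * R)%type.

(* [`|_|] on ['rV[R]_d] is the maximum norm; the hypotheses below that involve
   it do not depend on the choice of a norm on R^d. *)

Definition Zd_periodic (T : Type) (g : space -> T) :=
  forall (y : space) (z : 'rV[int]_d), g (y + map_mx intr z) = g y.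

Definition coercive (H : space -> space -> R) :=
  forall M : R, exists r : R, forall p : space, r <= `|p| -> M <= inf (range (H p)).

Definition BUC (V : normedModType R) (A : set V) (g : V -> R) :=
  [bounded g x | x in A] /\ unif_continuous (sigL A g).

Definition C1_on (U : set spacetime) (phi : spacetime -> R) :=
  forall z, U z -> differentiable phi z /\
    forall v : spacetime, {for z, continuous (fun z' => 'd phi z' v)}.

Definition time_deriv (phi : spacetime -> R) (z : spacetime) : R :=
  'd phi z (0, 1).

Definition gradient (phi : spacetime -> R) (z : spacetime) : space :=
  \row_j 'd phi z (delta_mx 0 j, 0).

(* v_t + F((x,t), Dv) = 0 in the open set U *)
Definition viscosity_subsolution (U : set spacetime)
    (F : spacetime -> space -> R) (v : spacetime -> R) :=
  forall phi, C1_on U phi -> forall z, U z ->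
    (\forall z' \near z, v z' - phi z' <= v z - phi z) ->
    time_deriv phi z + F z (gradient phi z) <= 0.

Definition viscosity_supersolution (U : set spacetime)
    (F : spacetime -> space -> R) (v : spacetime -> R) :=
  forall phi, C1_on U phi -> forall z, U z ->
    (\forall z' \near z, v z - phi z <= v z' - phi z') ->
    0 <= time_deriv phi z + F z (gradient phi z).

Definition viscosity_solution (U : set spacetime)
    (F : spacetime -> space -> R) (v : spacetime -> R) :=
  [/\ forall z, U z -> {for z, continuous v},
      viscosity_subsolution U F v & viscosity_supersolution U F v].

Definition interpolated_walk (eta : R) (X : nat -> R) (W : R -> R) :=
  W 0 = 0 /\ forall (k : nat) (t : R), k%:R * eta <= t <= k.+1%:R * eta ->
    W t = W (k%:R * eta) + (t - k%:R * eta) / Num.sqrt eta * X k.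

(* Solution of u_t + H(Du, x/eps) W1'(t) + f(x/eps) W2'(t) = 0, u(.,0) = 0, for
   W1 and W2 affine on each [k eta, (k+1) eta]: u is a viscosity solution on
   each strip, the value at time k eta being the initial datum for the next
   one.  The class BUC(R^d x [0,T]), T > 0, is the one in which the solution is
   unique. *)
Definition is_solution (H : space -> space -> R) (f : space -> R) (eps eta : R)
    (W1 W2 : R -> R) (u : space -> path_space R) :=
  let v (z : spacetime) := u z.1 z.2 in
  [/\ forall x, u x 0 = 0,
      forall T : R, 0 < T -> @BUC spacetime ([set: space] `*` `[0, T]) v
    & forall k : nat,
        viscosity_solution ([set: space] `*` `]k%:R * eta, k.+1%:R * eta[)
          (fun z p => H p (eps^-1 *: z.1) * derive1 W1 z.2
                      + f (eps^-1 *: z.1) * derive1 W2 z.2) v].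

End hamilton_jacobi.

(* Main.v *)
(** On a strip where [X1 k] and [X2 k] are frozen, the equation has a coercive nonnegative
    Hamiltonian (after a change of sign of [u] if [X1 k < 0]) and a periodic forcing.  Comparison
    bounds the motion of the infimum by that of [xi k = - sg (X1 k) * |X2 k|] times
    [(t - k * eta) / sqrt eta], and [H >= 0] gives the opposite bound at the points where [f] is
    extremal, so the solution moves like this everywhere up to its spatial oscillation.  Coercivity at
    speed comparable to the forcing ([|X2 k| <= C |X1 k|]) makes the oscillation contract to order
    [eps] unless [X2 k] is small; since the [X2 k] are i.i.d. and not identically zero, the
    oscillation over [eps] is dominated by a process with bounded second moment, and its accumulated
    effect over [T / eta] strips is of order [eps / eta].  Hence [u] is uniformly close to the random
    walk with the i.i.d. symmetric steps [sqrt eta * xi k] of variance [eta], and Donsker's theorem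
    applies; it is proved by Lindeberg replacement for the increments over blocks and
    Ottaviani's inequality for the oscillation inside blocks.  Finally, bounded continuous functionals
    are approximated from below by Lipschitz ones. *)

Require Import Defs.
From HB Require Import structures.
From mathcomp Require Import all_boot all_order all_algebra.
From mathcomp Require Import all_classical all_reals all_analysis ess_sup_inf measurable_realfun.
From mathcomp Require Import ring lra.
Import Order.TTheory GRing.Theory Num.Theory.
Import numFieldNormedType.Exports.
Local Open Scope classical_set_scope.
Local Open Scope ring_scope.

Set Implicit Arguments.
Unset Strict Implicit.
Unset Printing Implicit Defensive.

(** The obstacle is that neither [|X1 k|] nor [|X2 k|] is bounded below: on a strip with weak
    forcing the oscillation may grow, and on one with [X2 k = 0] it need not shrink. The growth
    factor is therefore recorded strip by strip: [1] for zero forcing, [1 / 2] for forcing at least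
    [dl], [5 / 4] in between. As [E |X2 k|^2 = 1] makes [X2 k <> 0] an event of positive
    probability, a small [dl] brings the mean square of the factor below [1]. Contraction moreover
    needs a strip that lasts a full relaxation time, which holds while the oscillation stays below
    order [sqrt eta]; this uses [eps / eta -> 0] a second time.

    Only second moments are at hand, so the replacement errors are measured by a truncated third
    moment. Of the Wiener measure, the start at [0], the law and independence of increments and the
    continuity of paths are used; the last gives control of the walk inside blocks by comparison,
    without higher moments.

    The solution is given for each [omega] separately, so that its measurability in [omega] has to
    be derived, from continuous dependence on finitely many data. *)

Ltac feed H :=
  match type of H with ?A -> _ =>
    let HA := fresh in assert (HA : A); [|specialize (H HA); clear HA] end.

(** * Sub- and supersolutions *)

Definition C1fun (R : realType) (q q' : R -> R) :=
  (forall s, is_derive s (1:R) q (q' s)) /\ continuous q'.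

(* Separable test functions are enough for the comparison and barrier arguments below.  A
   supersolution [v] for [F] is treated as the subsolution [- v] for [fun x p => - F x (- p)]. *)
Definition sub_on (R : realType) (d : nat) (t0 t1 : R)
    (F : 'rV[R]_d -> 'rV[R]_d -> R) (v : 'rV[R]_d -> R -> R) :=
  forall (q q' : 'I_d -> R -> R) (tau tau' : R -> R),
  (forall i, C1fun (q i) (q' i)) -> C1fun tau tau' ->
  forall (x : 'rV[R]_d) (t : R), t0 < t < t1 ->
  (exists2 r, 0 < r & forall y s, `|y - x| < r -> `|s - t| < r ->
     v y s - (\sum_i q i (y 0 i) + tau s) <=
     v x t - (\sum_i q i (x 0 i) + tau t)) ->
  tau' t + F x (\row_i q' i (x 0 i)) <= 0.

Lemma separable_is_diff (R : realType) (d : nat) (q q' : 'I_d -> R -> R)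
    (tau tau' : R -> R) (z : 'rV[R]_d * R) :
  (forall i, C1fun (q i) (q' i)) -> C1fun tau tau' ->
  is_diff z (fun z : 'rV[R]_d * R => \sum_i q i (z.1 0 i) + tau z.2)
    (fun v => \sum_i q' i (z.1 0 i) * v.1 0 i + tau' z.2 * v.2).
Proof.
move=> hq [ht _].
have dcoord i : is_diff z (fun z : 'rV[R]_d * R => z.1 0 i) (fun z => z.1 0 i).
  pose L0 : 'rV[R]_d * R -> R := fun z => z.1 0 i.
  have lin : forall (k : R) (u v : 'rV[R]_d * R), L0 (k *: u + v) = k *: L0 u + L0 v.
    by move=> k u v; rewrite /L0 /= !mxE.
  pose L : {linear ('rV[R]_d * R)%type -> R} :=
    HB.pack L0 (GRing.isLinear.Build R ('rV[R]_d * R)%type R *:%R L0 lin).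
  have cL : continuous L.
    move=> y; apply: (@continuous_comp _ _ _ fst (fun u : 'rV[R]_d => u 0 i)).
      exact: cvg_fst.
    exact: coord_continuous.
  have dL : differentiable L z by apply: linear_differentiable.
  by apply: DiffDef; [exact: dL|exact: (diff_lin z cL)].
have dq i : is_diff z (fun z : 'rV[R]_d * R => q i (z.1 0 i))
                     (fun v => q' i (z.1 0 i) * v.1 0 i).
  have dqi : is_diff (z.1 0 i) (q i) (fun v => q' i (z.1 0 i) * v).
    have [hqi _] := hq i; have [h1 h2] := hqi (z.1 0 i).
    have df : differentiable (q i) (z.1 0 i) by exact/derivable1_diffP.
    apply: DiffDef => //; apply/funext => v.
    have := diff1E df; rewrite derive1E h2 => ->.
    by rewrite /= mulrC.
  have := is_diff_comp (dcoord i) dqi. exact.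
have dt : is_diff z (fun z : 'rV[R]_d * R => tau z.2) (fun v : 'rV[R]_d * R => tau' z.2 * v.2).
  have dti : is_diff (z.2) tau (fun v => tau' z.2 * v).
    have [h1 h2] := ht z.2.
    have df : differentiable tau z.2 by exact/derivable1_diffP.
    apply: DiffDef => //; apply/funext => v.
    have := diff1E df; rewrite derive1E h2 => ->.
    by rewrite /= mulrC.
  have d2 : is_diff z (@snd 'rV[R]_d R) (@snd 'rV[R]_d R).
    have cs : continuous (@snd 'rV[R]_d R : {linear ('rV[R]_d * R)%type -> R}) by move=> y; apply: cvg_snd.
    apply: DiffDef; first exact: linear_differentiable.
    by rewrite diff_lin.
  have := is_diff_comp d2 dti. exact.
apply: (@is_diff_eq _ _ _ _ (fun v : 'rV[R]_d * R => (\sum_i (fun v : 'rV[R]_d * R => q' i (z.1 0 i) * v.1 0 i)) v + tau' z.2 * v.2)); last first.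
  by apply/funext => v; rewrite fct_sumE.
have -> : (fun z : 'rV[R]_d * R => \sum_i q i (z.1 0 i) + tau z.2) =
   (\sum_i (fun z : 'rV[R]_d * R => q i (z.1 0 i))) + (fun z => tau z.2).
  by apply/funext => v; rewrite fctE fct_sumE.
apply: is_diffD.
elim/big_ind2 : _ => //.
  exact: is_diff_cst.
by move=> f f' g g' *; apply: is_diffD.
Qed.

Lemma separable_C1 (R : realType) (d : nat) (q q' : 'I_d -> R -> R)
    (tau tau' : R -> R) (U : set ('rV[R]_d * R)) :
  (forall i, C1fun (q i) (q' i)) -> C1fun tau tau' ->
  C1_on U (fun z : 'rV[R]_d * R => \sum_i q i (z.1 0 i) + tau z.2).
Proof.
move=> hq ht z _; split.
  by have [] := separable_is_diff z hq ht.
move=> v.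
have E z' : 'd (fun z : 'rV[R]_d * R => \sum_i q i (z.1 0 i) + tau z.2) z' v =
   \sum_i q' i (z'.1 0 i) * v.1 0 i + tau' z'.2 * v.2.
  by have := separable_is_diff z' hq ht => hd; rewrite diff_val.
rewrite (funext E).
apply: cvgD.
  apply: (cvg_big (op:=+%R)) => [|i _]; first exact: add_continuous.
  apply: cvgMr_tmp.
  apply: (@continuous_comp _ _ _ (fun z : 'rV[R]_d * R => z.1 0 i) (q' i)); last exact: (hq i).2.
  apply: (@continuous_comp _ _ _ fst (fun u : 'rV[R]_d => u 0 i)).
    exact: cvg_fst.
  exact: coord_continuous.
apply: cvgMr_tmp.
apply: (@continuous_comp _ _ _ snd tau'); last exact: ht.2.
exact: cvg_snd.
Qed.

Lemma sub_on_of_viscosity (R : realType) (d : nat) (t0 t1 : R)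
    (F : 'rV[R]_d * R -> 'rV[R]_d -> R) (F0 : 'rV[R]_d -> 'rV[R]_d -> R)
    (v : 'rV[R]_d -> R -> R) :
  (forall x t p, t0 < t < t1 -> F (x, t) p = F0 x p) ->
  viscosity_subsolution ([set: 'rV[R]_d] `*` `]t0, t1[) F
    (fun z => v z.1 z.2) ->
  sub_on t0 t1 F0 v.
Proof.
move=> FF0 hv q q' tau tau' hq ht x t tt [r r0 hr].
pose phi := fun z : 'rV[R]_d * R => \sum_i q i (z.1 0 i) + tau z.2.
have zU : ([set: 'rV[R]_d] `*` `]t0, t1[) (x, t) by split => //=; rewrite in_itv.
have near_max : \forall z' \near (x, t),
    v z'.1 z'.2 - phi z' <= v (x, t).1 (x, t).2 - phi (x, t).
  apply/nbhs_ballP; exists r => // -[y s] [/= by1 bs]; apply: hr.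
    by move: by1; rewrite -ball_normE /= distrC.
  by move: bs; rewrite -ball_normE /= distrC.
have := hv phi (separable_C1 hq ht) (x, t) zU near_max.
have D := separable_is_diff (x, t) hq ht.
have E w : 'd phi (x, t) w = \sum_i q' i (x 0 i) * w.1 0 i + tau' t * w.2.
  by rewrite /phi diff_val.
rewrite FF0// /time_deriv E /= mulr1 big1 ?add0r; last first.
  by move=> i _; rewrite mxE mulr0.
congr (_ + F0 _ _ <= _).
apply/rowP => j; rewrite !mxE E /= mulr0 addr0 (bigD1 j)//= big1 => [|i ij].
  by rewrite mxE !eqxx mulr1 addr0.
by rewrite mxE eqxx /= (negbTE ij) mulr0.
Qed.

Lemma C1funN (R : realType) (q q' : R -> R) :
  C1fun q q' -> C1fun (fun s => - q s) (fun s => - q' s).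
Proof.
move=> [h1 h2]; split; last by move=> s; apply: cvgN; exact: h2.
by move=> s; apply: is_deriveN; exact: h1.
Qed.

Lemma super_on_of_viscosity (R : realType) (d : nat) (t0 t1 : R)
    (F : 'rV[R]_d * R -> 'rV[R]_d -> R) (F0 : 'rV[R]_d -> 'rV[R]_d -> R)
    (v : 'rV[R]_d -> R -> R) :
  (forall x t p, t0 < t < t1 -> F (x, t) p = F0 x p) ->
  viscosity_supersolution ([set: 'rV[R]_d] `*` `]t0, t1[) F
    (fun z => v z.1 z.2) ->
  sub_on t0 t1 (fun x p => - F0 x (- p)) (fun x t => - v x t).
Proof.
move=> FF0 hv q0 q0' tau0 tau0' hq0 ht0 x t tt [r r0 hr].
pose q i s := - q0 i s; pose q' i s := - q0' i s.
pose tau s := - tau0 s; pose tau' s := - tau0' s.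
have hq i : C1fun (q i) (q' i) by apply: C1funN.
have ht : C1fun tau tau' by apply: C1funN.
pose phi := fun z : 'rV[R]_d * R => \sum_i q i (z.1 0 i) + tau z.2.
have zU : ([set: 'rV[R]_d] `*` `]t0, t1[) (x, t) by split => //=; rewrite in_itv.
have near_max : \forall z' \near (x, t),
    v (x, t).1 (x, t).2 - phi (x, t) <= v z'.1 z'.2 - phi z'.
  apply/nbhs_ballP; exists r => // -[y s] [/= by1 bs].
  have : - v y s - (\sum_i q0 i (y 0 i) + tau0 s) <=
     - v x t - (\sum_i q0 i (x 0 i) + tau0 t).
    apply: hr.
      by move: by1; rewrite -ball_normE /= distrC.
    by move: bs; rewrite -ball_normE /= distrC.
  rewrite /phi /q /tau /= !sumrN; lra.
have := hv phi (separable_C1 hq ht) (x, t) zU near_max.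
have D := separable_is_diff (x, t) hq ht.
have E w : 'd phi (x, t) w = \sum_i q' i (x 0 i) * w.1 0 i + tau' t * w.2.
  by rewrite /phi diff_val.
rewrite FF0// /time_deriv E /= mulr1 big1 ?add0r; last first.
  by move=> i _; rewrite mxE mulr0.
suff -> : gradient phi (x, t) = - \row_i q0' i (x 0 i).
  by rewrite /tau' -oppr_ge0 opprD opprK.
apply/rowP => j; rewrite !mxE E /= mulr0 addr0 (bigD1 j)//= big1 => [|i ij].
  by rewrite mxE !eqxx mulr1 addr0.
by rewrite mxE eqxx /= (negbTE ij) mulr0.
Qed.

Lemma C1fun_cst (R : realType) (c : R) : C1fun (fun _ : R => c) (fun _ => 0).
Proof. by split=> [s|s]; [exact: is_derive_cst|exact: cvg_cst]. Qed.

Lemma C1funD (R : realType) (p p' q q' : R -> R) :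
  C1fun p p' -> C1fun q q' -> C1fun (fun s => p s + q s) (fun s => p' s + q' s).
Proof.
move=> [h1 h2] [k1 k2]; split=> s.
  exact: is_deriveD.
by apply: cvgD; [exact: h2|exact: k2].
Qed.

Lemma C1funZ (R : realType) (c : R) (q q' : R -> R) :
  C1fun q q' -> C1fun (fun s => c * q s) (fun s => c * q' s).
Proof.
move=> [h1 h2]; split=> s.
  exact: is_deriveZ.
by apply: cvgMl_tmp; exact: h2.
Qed.

Lemma C1fun_comp (R : realType) (p p' q q' : R -> R) :
  C1fun p p' -> C1fun q q' -> C1fun (fun s => p (q s)) (fun s => q' s * p' (q s)).
Proof.
move=> [h1 h2] [k1 k2]; split=> s.
  have := is_derive1_comp (h1 (q s)) (k1 s); rewrite mulrC; exact.
apply: cvgM; first exact: k2.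
apply: continuous_comp; last exact: h2.
by have [/derivable1_diffP/differentiable_continuous] := k1 s.
Qed.

Lemma C1fun_id (R : realType) : C1fun (fun s : R => s) (fun _ => 1).
Proof. by split=> [s|s]; [exact: is_derive_id|exact: cvg_cst]. Qed.

Lemma C1fun_sq (R : realType) (c : R) :
  C1fun (fun s : R => (s - c) ^+ 2) (fun s => 2 * (s - c)).
Proof.
have h : C1fun (fun s : R => s - c) (fun _ => 1 + 0).
  by apply: C1funD; [exact: C1fun_id|exact: C1fun_cst].
split=> s; last first.
  by apply: cvgMl_tmp; apply: cvgB; [exact: cvg_id|exact: cvg_cst].
have := is_deriveM (h.1 s) (h.1 s).
rewrite (_ : _ * _ = (fun s0 : R => (s0 - c) ^+ 2)); last first.
  by apply/funext => y; rewrite /= expr2.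
move=> hd; apply: (is_derive_eq hd).
by rewrite /GRing.scale /= addr0 mulr1 mulr_natl mulr2n.
Qed.

Lemma separable_continuous (R : realType) (d : nat) (q q' : 'I_d -> R -> R)
    (tau tau' : R -> R) :
  (forall i, C1fun (q i) (q' i)) -> C1fun tau tau' ->
  continuous (fun z : 'rV[R]_d * R => \sum_i q i (z.1 0 i) + tau z.2).
Proof.
move=> hq ht z; have [h _] := separable_is_diff z hq ht.
exact: (differentiable_continuous h).
Qed.

Definition bounded_on (R : realType) (d : nat) (t0 t1 M : R)
    (u : 'rV[R]_d -> R -> R) :=
  forall x t, t0 <= t <= t1 -> `|u x t| <= M.

Definition unif_on (R : realType) (d : nat) (t0 t1 : R)
    (u : 'rV[R]_d -> R -> R) :=
  forall e, 0 < e -> exists2 r, 0 < r & forall x y s t,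
    t0 <= s <= t1 -> t0 <= t <= t1 -> `|x - y| <= r -> `|s - t| <= r ->
    `|u x s - u y t| <= e.

Definition clamp (R : realType) (a b t : R) := Num.max a (Num.min b t).

Section clamp_lemmas.
Variables (R : realType) (a b : R).
Hypothesis ab : a <= b.

Lemma clamp_in t : a <= clamp a b t <= b.
Proof. by rewrite /clamp le_max lexx /= ge_max ab ge_min lexx. Qed.

Lemma clamp_id t : a <= t <= b -> clamp a b t = t.
Proof. by rewrite /clamp => /andP[h1 h2]; rewrite min_r// max_r. Qed.

Lemma clamp_lip s t : `|clamp a b s - clamp a b t| <= `|s - t|.
Proof.
rewrite /clamp /Num.max /Num.min.
by case: (ltP b s) => ?; case: (ltP b t) => ?; repeat case: ifP => /negP ?;
  rewrite ler_norml; apply/andP; split; case: (ler0P (s - t)) => ?; lra.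
Qed.

End clamp_lemmas.

(** Freezing the time outside [[t0, t1]] gives a function continuous on all of spacetime, to which
    compactness applies without subspace topologies. *)
Lemma unif_continuous_clamp (R : realType) (d : nat) (t0 t1 : R)
    (u : 'rV[R]_d -> R -> R) : t0 <= t1 -> unif_on t0 t1 u ->
  continuous (fun z : 'rV[R]_d * R => u z.1 (clamp t0 t1 z.2)).
Proof.
move=> tt uu z; apply/cvgrPdist_le => e e0.
have [r r0 hr] := uu e e0.
exists (ball z.1 r, ball z.2 r) => /=; first by split; exact: nbhsx_ballx.
move=> -[y s] [/= h1 h2]; apply: hr.
- exact: clamp_in.
- exact: clamp_in.
- by move: h1; rewrite -ball_normE /= => /ltW.
- by apply: (le_trans (clamp_lip _ _ _ _)); move: h2; rewrite -ball_normE /= => /ltW.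
Qed.

(** Penalised functions on the noncompact [D] fall below their value at a reference point [z1]
    outside a compact [K]; the maximum over [K] is then global. *)
Lemma max_on_compact (R : realType) (T : topologicalType) (f : T -> R)
    (K D : set T) (z1 : T) :
  compact K -> K z1 -> K `<=` D -> continuous f ->
  (forall z, D z -> ~ K z -> f z <= f z1) ->
  exists2 z, D z & forall z', D z' -> f z' <= f z.
Proof.
move=> cK Kz1 KD cf hD.
have [|c cK' hc] := @compact_EVT_max T R f K (ex_intro _ z1 Kz1) cK.
  exact: continuous_subspaceT.
rewrite inE in cK'; exists c; first exact: KD.
move=> z' Dz'; have [Kz'|nKz'] := pselect (K z').
  by apply: hc; rewrite inE.
by apply: (le_trans (hD _ Dz' nKz')); apply: hc; rewrite inE.
Qed.

Lemma compact_box (R : realType) (d : nat) (r a b : R) :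
  compact ([set x : 'rV[R]_d | `|x| <= r] `*` `[a, b]).
Proof.
apply: compact_setX; last exact: segment_compact.
apply: bounded_closed_compact.
  exists r; split; first exact: num_real.
  by move=> M rM x /= xr; exact: (le_trans xr (ltW rM)).
apply: (@closed_comp _ _ (fun x : 'rV[R]_d => `|x|) [set y | y <= r]).
  by move=> x _; exact: norm_continuous.
exact: closed_le.
Qed.

Lemma coord_le_norm (R : realType) (d : nat) (x : 'rV[R]_d) i :
  `|x 0 i| <= `|x|.
Proof.
rewrite [leRHS]/Num.norm /= mx_normrE.
by apply/bigmax_geP; right; exists (0, i).
Qed.

Lemma norm_le_coord (R : realType) (d : nat) (x : 'rV[R]_d) c : 0 <= c ->
  (forall i, `|x 0 i| <= c) -> `|x| <= c.
Proof.
move=> c0 h; rewrite [leLHS]/Num.norm /= mx_normrE.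
by apply/bigmax_leP; split => // -[i j] _; rewrite ord1.
Qed.

Lemma sq_norm_le (R : realType) (d : nat) (x : 'rV[R]_d) :
  `|x| ^+ 2 <= \sum_i (x 0 i) ^+ 2.
Proof.
have S0 : 0 <= \sum_i (x 0 i) ^+ 2 by apply: sumr_ge0 => i _; rewrite sqr_ge0.
rewrite -(sqr_sqrtr S0) lerXn2r ?nnegrE ?sqrtr_ge0//.
apply: norm_le_coord => [|i]; first exact: sqrtr_ge0.
rewrite -sqrtr_sqr ler_sqrt//.
by rewrite (bigD1 i)//= lerDl sumr_ge0// => j _; rewrite sqr_ge0.
Qed.

(** Made for time barriers [c * expR (k * (t - h))]: they have size [c] at the final time [h], at
    most [e] at a time earlier by [a], and a derivative of the favourable sign. The bound
    [expR y >= 1 + y] suffices for the choice of [k]. *)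
Lemma exp_pen (R : realType) (c e a : R) : 0 <= c -> 0 < e -> 0 < a ->
  exists2 k, 0 < k & c * expR (- (k * a)) <= e.
Proof.
move=> c0 e0 a0; exists ((c + 1) / (e * a)).
  by rewrite divr_gt0// ?mulr_gt0// ltr_wpDl.
have -> : (c + 1) / (e * a) * a = (c + 1) / e by field; rewrite !gt_eqF.
rewrite expRN.
rewrite -(ler_pM2l (expR_gt0 ((c + 1) / e))) mulrCA mulfV ?gt_eqF ?expR_gt0//.
rewrite mulr1.
have /(ler_wpM2r (ltW e0)) := expR_ge1Dx ((c + 1) / e).
apply: le_trans.
by rewrite mulrDl mul1r divfK ?gt_eqF//; lra.
Qed.

Lemma C1fun_exp (R : realType) (c k h : R) :
  C1fun (fun s : R => c * expR (k * (s - h))) (fun s => c * (k * expR (k * (s - h)))).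
Proof.
apply: C1funZ.
have E : C1fun (@expR R) expR by split=> [s|s]; [exact: is_derive_expR|exact: continuous_expR].
have L : C1fun (fun s : R => k * (s - h)) (fun s => k * (1 + 0)).
  by apply: C1funZ; apply: C1funD; [exact: C1fun_id|exact: C1fun_cst].
have := C1fun_comp E L; rewrite addr0 mulr1; exact.
Qed.

(** Continuity is only asked for where [G x p <= Q]. In the comparison argument the gradient has no
    a priori bound, but the subsolution inequality bounds [G] there, and [L] may depend on that
    level alone. Coercive Hamiltonians satisfy this because the level bounds the gradient. *)
Definition ham_mod (R : realType) (d : nat) (G : 'rV[R]_d -> 'rV[R]_d -> R) :=
  forall Q, exists2 L, 0 <= L & forall x y p p', G x p <= Q -> `|p - p'| <= 1 ->
    `|G y p' - G x p| <= L * (`|x - y| + `|p - p'|).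

(** If [u] exceeded the barrier, the difference minus a small increasing function of time would have
    a maximum inside the strip. There the barrier is an admissible test function, and the strict
    inequality of the last hypothesis contradicts the subsolution property. Coercivity of the sum of
    the [q i], with the lower bound [- N] of [tau], replaces compactness of space. *)
Lemma barrier (R : realType) (d : nat) (t0 t1 s0 M N : R)
    (F : 'rV[R]_d -> 'rV[R]_d -> R) (u : 'rV[R]_d -> R -> R)
    (q q' : 'I_d -> R -> R) (tau tau' : R -> R) :
  t0 <= s0 -> sub_on t0 t1 F u -> bounded_on s0 t1 M u -> unif_on s0 t1 u ->
  (forall i, C1fun (q i) (q' i)) -> C1fun tau tau' ->
  (forall i s, 0 <= q i s) ->
  (forall n : R, exists r, forall x : 'rV[R]_d, r < `|x| -> n <= \sum_i q i (x 0 i)) ->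
  (forall t, s0 <= t <= t1 -> - N <= tau t) ->
  (forall x, u x s0 <= \sum_i q i (x 0 i) + tau s0) ->
  (forall x t, s0 < t < t1 -> u x t <= \sum_i q i (x 0 i) + tau t \/
     0 < tau' t + F x (\row_i q' i (x 0 i))) ->
  forall x t, s0 <= t < t1 -> u x t <= \sum_i q i (x 0 i) + tau t.
Proof.
move=> ts su bu uu hq ht q0 qc tauN u0 hF x1 s1 /andP[s01 s1t].
have st1 : s0 < t1 by exact: le_lt_trans s01 s1t.
rewrite leNgt; apply/negP => ltu.
pose D := u x1 s1 - (\sum_i q i (x1 0 i) + tau s1).
have D0 : 0 < D by rewrite /D; lra.
pose h := (s1 + t1) / 2.
have [s1h ht1] : s1 < h /\ h < t1 by rewrite /h; split; lra.
have M0 : 0 <= M by apply: le_trans (normr_ge0 (u x1 s1)) (bu _ _ _); rewrite s01 ltW.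
pose c := `|M| + `|N| + 1.
have c0 : 0 <= c by rewrite /c addr_ge0// addr_ge0.
have [k k0 hk] := @exp_pen _ c (D / 2) (h - s1) c0 ltac:(lra) ltac:(lra).
have hqn (x : 'rV[R]_d) : 0 <= \sum_i q i (x 0 i).
  by apply: sumr_ge0 => i _; exact: q0.
(* At time [h] this term exceeds any possible gap between [u] and the barrier, so the maximum over
   [[s0, h]] is not taken at [h]; at [s1] it costs at most half of the gap [D]. *)
pose E t := c * expR (k * (t - h)).
have E0 t : 0 <= E t by rewrite /E mulr_ge0// expR_ge0.
have Eh : E h = c by rewrite /E subrr mulr0 expR0 mulr1.
have Es1 : E s1 <= D / 2.
  by rewrite /E; move: hk; congr (_ * expR _ <= _); lra.
pose uc x t := u x (clamp s0 t1 t).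
pose Psi (z : 'rV[R]_d * R) := uc z.1 z.2 - (\sum_i q i (z.1 0 i) + (tau z.2 + E z.2)).
have hE : C1fun E (fun s => c * (k * expR (k * (s - h)))) by exact: C1fun_exp.
have htE := C1funD ht hE.
have cPsi : continuous Psi.
  move=> z; apply: cvgB.
    exact: (unif_continuous_clamp (ltW st1) uu).
  exact: (separable_continuous hq htE).
have [r hr] := qc (`|M| + `|N| + 1).
pose r1 := Num.max r `|x1|.
have Psi1 : 0 < Psi (x1, s1).
  rewrite /Psi /uc /= clamp_id; last by rewrite s01 ltW.
  move: Es1; rewrite /D; lra.
have boundP y t : s0 <= t <= h -> uc y t <= M.
  move=> /andP[h1 h2]; rewrite /uc clamp_id; last by rewrite h1; lra.
  apply: le_trans (ler_norm _) (bu _ _ _); rewrite h1; lra.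
have tauP t : s0 <= t <= h -> - N <= tau t.
  by move=> /andP[h1 h2]; apply: tauN; rewrite h1; lra.
have MM := ler_norm M; have NN := ler_norm N.
have [|||[xm tm] /= tmh hmax] := @max_on_compact R _ Psi
   ([set x : 'rV[R]_d | `|x| <= r1] `*` `[s0, h])
   [set z | s0 <= z.2 <= h] (x1, s1) (@compact_box R d r1 s0 h) _ _ cPsi _.
- by split => /=; [rewrite /r1 le_max lexx orbT|rewrite in_itv/= s01 ltW].
- by move=> [y t] [/= _]; rewrite in_itv.
- move=> [y t] /= tt nK; apply: le_trans (ltW Psi1).
  rewrite /Psi /=.
  have yr : r1 < `|y|.
    rewrite ltNge; apply/negP => yr; apply: nK; split => //=; by rewrite in_itv.
  have := hr y (le_lt_trans _ yr); rewrite /r1 le_max lexx => /(_ erefl).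
  by have := boundP y t tt; have := E0 t; have := tauP t tt; lra.
have Pm : 0 < Psi (xm, tm).
  by apply: lt_le_trans Psi1 (hmax _ _) => /=; rewrite s01 ltW.
move: tmh => /andP[stm tmh].
have um : uc xm tm = u xm tm by rewrite /uc clamp_id// stm; lra.
have tm0 : s0 < tm.
  rewrite lt_neqAle stm andbT; apply/eqP => E1.
  move: Pm; rewrite /Psi /= um -E1; have := u0 xm; have := E0 s0; lra.
have tmh' : tm < h.
  rewrite lt_neqAle tmh andbT; apply/eqP => E1.
  move: Pm; rewrite /Psi /= E1 Eh; have := boundP xm h; have := tauP h.
  have := hqn xm; rewrite lexx andbT (ltW (le_lt_trans s01 s1h)) => h1 h2 h3.
  move: (h2 erefl) (h3 erefl); rewrite /c; lra.
pose rr := Num.min (tm - s0) (h - tm).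
have [] := hF xm tm; first by rewrite tm0 (lt_trans tmh').
  by move: Pm; rewrite /Psi /= um; have := E0 tm; lra.
have tt : t0 < tm < t1 by rewrite (le_lt_trans ts) ?(lt_trans tmh').
have HH := su q q' _ _ hq htE xm tm tt.
feed HH.
  exists rr; first by rewrite /rr lt_min !subr_gt0 tm0.
  move=> y s _; rewrite /rr lt_min !ltr_norml => /andP[/andP[h1 h2] /andP[h3 h4]].
  have ss : s0 <= s <= h by apply/andP; split; lra.
  have := hmax (y, s) ss; rewrite /Psi /= um /uc clamp_id//.
  by move: ss => /andP[-> ?]; lra.
move: HH; have : 0 <= c * (k * expR (k * (tm - h))) by rewrite !mulr_ge0// ?expR_ge0// ltW.
lra.
Qed.

Lemma sub_on_restrict (R : realType) (d : nat) (t0 t1 s0 s1 : R)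
    (F : 'rV[R]_d -> 'rV[R]_d -> R) (u : 'rV[R]_d -> R -> R) :
  t0 <= s0 -> s1 <= t1 -> sub_on t0 t1 F u -> sub_on s0 s1 F u.
Proof.
move=> h0 h1 su q q' tau tau' hq ht x t /andP[a b] hm.
by apply: (su q q' tau tau') => //; rewrite (le_lt_trans h0)// (lt_le_trans b).
Qed.

Definition unif_cont (R : realType) (d : nat) (g : 'rV[R]_d -> R) :=
  forall e, 0 < e -> exists2 r, 0 < r & forall x y, `|x - y| <= r -> `|g x - g y| <= e.

Lemma le_of_sq (R : realType) (a b c m : R) : 0 < a -> 0 < m -> 0 <= b ->
  a * b ^+ 2 <= c -> c < a * m ^+ 2 -> b <= m.
Proof.
move=> a0 m0 b0 h1 h2; rewrite leNgt; apply/negP => mb.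
have mb2 : m ^+ 2 <= b ^+ 2 by rewrite lerXn2r ?nnegrE// ltW.
by have := ler_wpM2l (ltW a0) mb2; lra.
Qed.

Lemma cvg_sqr (R : realType) (T : Type) (F : set_system T) (f : T -> R) (l : R) :
  Filter F -> f @ F --> l -> (fun x => f x ^+ 2) @ F --> l ^+ 2.
Proof.
move=> FF fl; rewrite (_ : (fun x => f x ^+ 2) = (fun x => f x * f x)).
  by rewrite expr2; exact: cvgM.
by apply/funext => x; rewrite expr2.
Qed.

(** * Doubling of variables and the comparison principle *)

Definition sq_dist (R : realType) (d : nat) (x y : 'rV[R]_d) : R :=
  \sum_i (x 0 i - y 0 i) ^+ 2.

(* Besides the doubling penalties and the confinement term in [gam], the maximised function
   carries time barriers [E1] and [E2], which keep its maximum away from the final time. *)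
Definition doubling (R : realType) (d : nat) (A B gam t0 t1 : R) (E1 E2 : R -> R)
    (u v : 'rV[R]_d -> R -> R) (z : ('rV[R]_d * R) * ('rV[R]_d * R)) : R :=
  u z.1.1 (clamp t0 t1 z.1.2) - v z.2.1 (clamp t0 t1 z.2.2) -
  (A * sq_dist z.1.1 z.2.1 + B * (z.1.2 - z.2.2) ^+ 2 +
   (gam * sq_dist z.1.1 0 + E1 z.1.2) + (gam * sq_dist z.2.1 0 + E2 z.2.2)).

Section doubling.
Variables (R : realType) (d : nat) (A B gam t0 t1 : R) (E1 E1' E2 E2' : R -> R)
  (u v : 'rV[R]_d -> R -> R).
Hypotheses (A0 : 0 < A) (B0 : 0 < B) (g0 : 0 < gam) (t01 : t0 < t1).
Hypotheses (hE1 : C1fun E1 E1') (hE2 : C1fun E2 E2').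
Hypotheses (uu : unif_on t0 t1 u) (uv : unif_on t0 t1 v).
Local Notation Psi := (doubling A B gam t0 t1 E1 E2 u v).

Lemma sq_dist_ge0 (x y : 'rV[R]_d) : 0 <= sq_dist x y.
Proof. by apply: sumr_ge0 => i _; rewrite sqr_ge0. Qed.

Lemma sq_dist_norm (x y : 'rV[R]_d) : `|x - y| ^+ 2 <= sq_dist x y.
Proof.
apply: le_trans (sq_norm_le _) _; rewrite le_eqVlt; apply/orP; left; apply/eqP.
by apply: eq_bigr => i _; rewrite !mxE.
Qed.

Lemma sq_distC (x y : 'rV[R]_d) : sq_dist x y = sq_dist y x.
Proof. by apply: eq_bigr => i _; rewrite -sqrrN opprB. Qed.

Lemma sq_distxx (x : 'rV[R]_d) : sq_dist x x = 0.
Proof. by rewrite /sq_dist big1// => i _; rewrite subrr expr0n. Qed.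

Lemma doubling_continuous : continuous Psi.
Proof.
have cts2 (f : 'rV[R]_d * R -> R) : continuous f ->
   continuous (fun z : ('rV[R]_d * R) * ('rV[R]_d * R) => f z.1).
  by move=> cf z; apply: (@continuous_comp _ _ _ fst f); [exact: cvg_fst|exact: cf].
have cts3 (f : 'rV[R]_d * R -> R) : continuous f ->
   continuous (fun z : ('rV[R]_d * R) * ('rV[R]_d * R) => f z.2).
  by move=> cf z; apply: (@continuous_comp _ _ _ snd f); [exact: cvg_snd|exact: cf].
have ccoord i : continuous (fun z : 'rV[R]_d * R => z.1 0 i).
  move=> z; apply: (@continuous_comp _ _ _ fst (fun u : 'rV[R]_d => u 0 i)).
    exact: cvg_fst.
  exact: coord_continuous.
have csnd : continuous (fun z : 'rV[R]_d * R => z.2) by move=> z; exact: cvg_snd.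
have csq E E' : C1fun E E' -> continuous (fun z : 'rV[R]_d * R => gam * sq_dist z.1 0 + E z.2).
  move=> hE.
  have H := @separable_continuous R d (fun _ s => gam * (s - 0) ^+ 2) _ E _
    (fun _ => C1funZ gam (C1fun_sq 0)) hE.
  rewrite (_ : (fun z => gam * sq_dist z.1 0 + E z.2) =
     (fun z : 'rV[R]_d * R => \sum_i gam * (z.1 0 i - 0) ^+ 2 + E z.2)) //.
  apply/funext => w; rewrite /sq_dist mulr_sumr; congr (_ + _).
  by apply: eq_bigr => i _; rewrite mxE.
move=> z; apply: cvgB.
  apply: cvgB.
    exact: (cts2 _ (unif_continuous_clamp (ltW t01) uu)).
  exact: (cts3 _ (unif_continuous_clamp (ltW t01) uv)).
apply: cvgD; last exact: (cts3 _ (csq _ _ hE2)).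
apply: cvgD; last exact: (cts2 _ (csq _ _ hE1)).
apply: cvgD; apply: cvgMl_tmp.
  apply: (cvg_big (op:=+%R)) => [|i _]; first exact: add_continuous.
  apply: cvg_sqr.
  by apply: cvgB; [exact: (cts2 _ (ccoord i))|exact: (cts3 _ (ccoord i))].
apply: cvg_sqr.
by apply: cvgB; [exact: (cts2 _ csnd)|exact: (cts3 _ csnd)].
Qed.

Variables (M h : R).
Hypotheses (h1 : h <= t1) (bu : bounded_on t0 t1 M u) (bv : bounded_on t0 t1 M v).
Hypotheses (E1p : forall t, t0 <= t -> 0 <= E1 t) (E2p : forall t, t0 <= t -> 0 <= E2 t).

(** All penalties are nonnegative, so any of them may be kept alone. At the maximum, where
    [doubling] is bounded below, each is therefore bounded separately. *)
Lemma doubling_pen y t y' t' : t0 <= t <= h -> t0 <= t' <= h ->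
  [/\ Psi ((y, t), (y', t')) <= 2 * M - A * sq_dist y y',
      Psi ((y, t), (y', t')) <= 2 * M - B * (t - t') ^+ 2,
      Psi ((y, t), (y', t')) <= 2 * M - gam * sq_dist y 0 &
      Psi ((y, t), (y', t')) <= 2 * M - gam * sq_dist y' 0] /\
  [/\ Psi ((y, t), (y', t')) <= 2 * M - E1 t,
      Psi ((y, t), (y', t')) <= 2 * M - E2 t' &
      Psi ((y, t), (y', t')) <= u y t - v y' t'].
Proof.
move=> /andP[a1 a2] /andP[b1 b2].
have p1 : 0 <= A * sq_dist y y' by rewrite mulr_ge0 ?sq_dist_ge0// ltW.
have p2 : 0 <= B * (t - t') ^+ 2 by rewrite mulr_ge0 ?sqr_ge0// ltW.
have p3 : 0 <= gam * sq_dist y 0 by rewrite mulr_ge0 ?sq_dist_ge0// ltW.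
have p4 : 0 <= gam * sq_dist y' 0 by rewrite mulr_ge0 ?sq_dist_ge0// ltW.
have p6 := E1p a1; have p7 := E2p b1.
have it : t0 <= t <= t1 by rewrite a1 (le_trans a2).
have it' : t0 <= t' <= t1 by rewrite b1 (le_trans b2).
have /ler_normlP[_ q1] := bu y it; have /ler_normlP[q2 _] := bv y' it'.
rewrite /doubling /= !clamp_id//.
move: (u y t) (v y' t') (E1 t) (E2 t') q1 q2 p6 p7 => U V e1 e2 q1 q2 p6 p7.
by split; split; lra.
Qed.

Lemma doubling_max (x1 : 'rV[R]_d) s1 : t0 <= s1 <= h ->
  exists xm tm ym sm, [/\ t0 <= tm <= h, t0 <= sm <= h &
    forall y t y' t', t0 <= t <= h -> t0 <= t' <= h ->
    Psi ((y, t), (y', t')) <= Psi ((xm, tm), (ym, sm))].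
Proof.
move=> /andP[s0 sh]; set z1 := ((x1, s1), (x1, s1)).
pose m := `|2 * M - Psi z1| + 1.
have m0 : 2 * M - m <= Psi z1 by have := ler_norm (2 * M - Psi z1); rewrite /m; lra.
have m1 : 1 <= m by rewrite /m lerDr.
(* Since [gam * (m + 1 / gam) ^+ 2 >= 2 * m], beyond this radius the confinement alone pushes the
   function below its value at [z1]. *)
pose r1 := Num.max (m + 1 / gam) `|x1|.
have r1big (y : 'rV[R]_d) : r1 < `|y| -> m <= gam * sq_dist y 0.
  rewrite /r1 gt_max => /andP[a1 _].
  have := sq_dist_norm y 0; rewrite subr0; set ny := `|y| in a1 *; move=> a2.
  have gg0 : gam * (1 / gam) = 1 by rewrite mulrC divfK// gt_eqF.
  have ig0 : 0 < 1 / gam by rewrite divr_gt0.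
  apply: le_trans (ler_wpM2l (ltW g0) a2).
  have k1 : 0 <= m + 1 / gam by lra.
  have : (m + 1 / gam) ^+ 2 <= ny ^+ 2.
    by rewrite lerXn2r ?nnegrE// (ltW (le_lt_trans k1 a1), ltW a1).
  move/(ler_wpM2l (ltW g0)); apply: le_trans.
  have -> : gam * (m + 1 / gam) ^+ 2 = gam * m ^+ 2 + 2 * m * (gam * (1 / gam)) + (gam * (1 / gam)) * (1 / gam) by ring.
  rewrite gg0; have : 0 <= gam * m ^+ 2 by rewrite mulr_ge0 ?sqr_ge0// ltW.
  lra.
have [|||[[xm tm] [ym sm]] [/= tmh smh] hmax] := @max_on_compact R _ Psi
   (([set x : 'rV[R]_d | `|x| <= r1] `*` `[t0, h]) `*` ([set x : 'rV[R]_d | `|x| <= r1] `*` `[t0, h]))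
   [set z | t0 <= z.1.2 <= h /\ t0 <= z.2.2 <= h] z1
   (compact_setX (@compact_box R d r1 t0 h) (@compact_box R d r1 t0 h)) _ _ doubling_continuous _.
- by split; split => /=; rewrite ?in_itv/= ?s0 ?sh// /r1 le_max lexx orbT.
- by move=> [[y t] [y' t']] [[/= _ +] [/= _ +]]; rewrite !in_itv.
- move=> [[y t] [y' t']] [/= tt tt'] nK; apply: le_trans m0.
  have [[_ _ P1 P2] _] := doubling_pen y y' tt tt'.
  have [/r1big|yr] := ltP r1 `|y|; first by lra.
  have [/r1big|yr'] := ltP r1 `|y'|; first by lra.
  by exfalso; apply: nK; split; split => //=; rewrite in_itv.
exists xm, tm, ym, sm; split=> // y t y' t' tt tt'.
exact: (hmax ((y, t), (y', t')) (conj tt tt')).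
Qed.

End doubling.

(** The space penalty [A] creates gradients that grow with [A]; what stays bounded independently of
    [A] is the value of [G] at such a gradient, through the time penalty [B]. Hence the order of the
    choices: [B] first, then the constant [L] of [G] at the resulting level, and only afterwards [A]
    and the confinement [gam]. *)
Lemma comparison (R : realType) (d : nat) (t0 t1 M Mg c0 c1 : R)
    (G : 'rV[R]_d -> 'rV[R]_d -> R) (g g' : 'rV[R]_d -> R)
    (u v : 'rV[R]_d -> R -> R) :
  ham_mod G -> (forall x, `|g x| <= Mg) -> unif_cont g ->
  0 <= c1 -> (forall x, g' x <= g x + c1) ->
  sub_on t0 t1 (fun x p => G x p + g x) u ->
  sub_on t0 t1 (fun x p => - (G x (- p) + g' x)) (fun x t => - v x t) ->
  bounded_on t0 t1 M u -> bounded_on t0 t1 M v -> unif_on t0 t1 u -> unif_on t0 t1 v ->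
  (forall x, u x t0 - v x t0 <= c0) ->
  forall x t, t0 <= t < t1 -> u x t - v x t <= c0 + c1 * (t - t0).
Proof.
move=> hG gM ug c10 gg su sv bu bv uu uv uv0 x1 s1 /andP[s01 s1t].
have st1 : t0 < t1 by exact: le_lt_trans s01 s1t.
rewrite leNgt; apply/negP => ltu.
(* Of the excess [8 * e], the slope [delta], the two time barriers and the confinement use at most
   [e] each kind; the remaining [5 * e] beat the error [e] of uniform continuity if the maximum sits
   at time [t0]. *)
pose e := (u x1 s1 - v x1 s1 - (c0 + c1 * (s1 - t0))) / 8.
have e0 : 0 < e by rewrite /e divr_gt0// subr_gt0.
have De : u x1 s1 - v x1 s1 = c0 + c1 * (s1 - t0) + 8 * e by rewrite /e; clear; field.
clearbody e.
pose h := (s1 + t1) / 2.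
have [s1h ht1] : s1 < h /\ h < t1 by rewrite /h; clear -s1t; split; lra.
clearbody h.
have M0 : 0 <= M by apply: le_trans (normr_ge0 (u x1 s1)) (bu _ _ _); rewrite s01 ltW.
have Mg0 : 0 <= Mg by apply: le_trans (normr_ge0 (g x1)) (gM _).
have [ac0 c0a c0b] : [/\ 0 <= `|c0|, c0 <= `|c0| & - c0 <= `|c0|].
  by split; [|exact: ler_norm|rewrite -normrN; exact: ler_norm].
have s1t0 : 0 < 1 + (s1 - t0) by clear -s01; lra.
pose delta := e / (1 + (s1 - t0)).
have d0 : 0 < delta by rewrite divr_gt0.
have de : delta * (s1 - t0) <= e.
  rewrite /delta -mulrA ler_piMr// ?(ltW e0)// mulrC ler_pdivrMr//; clear; lra.
clearbody delta.
(* The surplus [delta] in the slope finally absorbs three errors of size [delta / 4]: the change of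
   [G] between the two points, its change under the gradient of the confinement, and the modulus of
   [g]. *)
pose lam := c1 + delta.
have lam0 : 0 < lam by rewrite /lam; clear -d0 c10; lra.
pose c := 2 * M + `|c0| + 1.
have cc0 : 0 <= c by rewrite /c; clear -M0 ac0; lra.
have [k k0 hk] : exists2 k, 0 < k & c * expR (- (k * (h - s1))) <= e / 2.
  by apply: exp_pen => //; [rewrite divr_gt0|rewrite subr_gt0].
pose E t := c * expR (k * (t - h)).
have E0 t : 0 <= E t by rewrite /E mulr_ge0// expR_ge0.
have Eh : E h = c by rewrite /E subrr mulr0 expR0 mulr1.
have Es1 : E s1 <= e / 2 by rewrite /E -opprB mulrN.
pose E' t := c * (k * expR (k * (t - h))).
have E'0 t : 0 <= E' t by rewrite /E' !mulr_ge0// ?expR_ge0// ltW.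
have hE : C1fun E E' by exact: C1fun_exp.
clearbody E E'.
pose M' := 2 * M + `|c0|.
have M'0 : 0 <= M' by rewrite /M'; clear -M0 ac0; lra.
have M'1 : 0 < M' + 1 by clear -M'0; lra.
have [r [r0 ru rv]] : exists r, [/\ 0 < r,
   forall x y s t, t0 <= s <= t1 -> t0 <= t <= t1 -> `|x - y| <= r -> `|s - t| <= r ->
    `|u x s - u y t| <= e &
   forall x y s t, t0 <= s <= t1 -> t0 <= t <= t1 -> `|x - y| <= r -> `|s - t| <= r ->
    `|v x s - v y t| <= e].
  have [ra ra0 ha] := uu e e0; have [rb rb0 hb] := uv e e0.
  exists (Num.min ra rb); split; first by rewrite lt_min ra0.
    by move=> x y s t hs ht; rewrite !le_min => /andP[? _] /andP[? _]; exact: ha.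
  by move=> x y s t hs ht; rewrite !le_min => /andP[_ ?] /andP[_ ?]; exact: hb.
have r20 : 0 < r ^+ 2 by rewrite exprn_gt0.
have [B B0 Br] : exists2 B, 0 < B & B * r ^+ 2 = M' + 1.
  by exists ((M' + 1) / r ^+ 2); [exact: divr_gt0|rewrite divfK// gt_eqF].
have [L L0 hL] := hG (2 * B * r + Mg).
have [rg rg0 hg] := ug (delta / 4) (divr_gt0 d0 (ltr0n _ 4)).
have L10 : 0 < 4 * (L + 1) by clear -L0; lra.
have L160 : 0 < 16 * (L + 1) by clear -L0; lra.
have [rho [rho0 rhor rhog rhoL]] : exists rho,
    [/\ 0 < rho, rho <= r, rho <= rg & L * rho <= delta / 4].
  exists (Num.min (Num.min r rg) (delta / (4 * (L + 1)))).
  set rho := Num.min _ _.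
  have rho0 : 0 < rho by rewrite !lt_min r0 rg0 divr_gt0.
  split => //; [by rewrite !ge_min lexx|by rewrite !ge_min lexx orbT|].
  have : rho <= delta / (4 * (L + 1)) by rewrite !ge_min lexx orbT.
  rewrite ler_pdivlMr//; clearbody rho; clear -rho0 L0; nra.
have rho20 : 0 < rho ^+ 2 by rewrite exprn_gt0.
have [A A0 Ar] : exists2 A, 0 < A & A * rho ^+ 2 = M' + 1.
  by exists ((M' + 1) / rho ^+ 2); [exact: divr_gt0|rewrite divfK// gt_eqF].
have [m [m0 m4 mL]] : exists m, [/\ 0 < m, 4 * m <= 1 & L * (4 * m) <= delta / 4].
  exists (Num.min (1 / 4) (delta / (16 * (L + 1)))); set m := Num.min _ _.
  have m0 : 0 < m by rewrite lt_min (divr_gt0 d0 L160) andbT; clear; lra.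
  have m1 : m <= 1 / 4 by rewrite ge_min lexx.
  have : m <= delta / (16 * (L + 1)) by rewrite ge_min lexx orbT.
  rewrite ler_pdivlMr//; clearbody m; clear -m0 m1 L0 => ?; split => //; nra.
pose S1 := sq_dist x1 0.
have S10 : 0 <= S1 by exact: sq_dist_ge0.
have S11 : 0 < 2 * (1 + S1) by clear -S10; lra.
have m20 : 0 < m ^+ 2 by rewrite exprn_gt0.
(* Small enough to cost at most [e] at [x1], and to keep [gam] times the norm below [m] at both
   points of the maximum, so that the confinement contributes a gradient of at most [4 * m] in
   all. *)
have [gam [g0 gamS gamm]] : exists gam,
    [/\ 0 < gam, 2 * gam * S1 <= e & gam * M' < m ^+ 2].
  exists (Num.min (m ^+ 2 / (M' + 1)) (e / (2 * (1 + S1)))); set gam := Num.min _ _.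
  have g0 : 0 < gam by rewrite lt_min (divr_gt0 m20 M'1) (divr_gt0 e0 S11).
  have a1 : gam <= e / (2 * (1 + S1)) by rewrite ge_min lexx orbT.
  have a2 : gam <= m ^+ 2 / (M' + 1) by rewrite ge_min lexx.
  move: a1 a2; rewrite !ler_pdivlMr// => a1 a2; clearbody gam S1 M'; split=> //.
    by clear -a1 g0; nra.
  by clear -a2 g0; nra.
pose E1 t := lam * (t - t0) + E t.
have hE1 : C1fun E1 (fun s => lam * (1 + 0) + E' s).
  apply: C1funD => //; apply: C1funZ; apply: C1funD; [exact: C1fun_id|exact: C1fun_cst].
have E1p t : t0 <= t -> E t <= E1 t.
  by move=> tt; rewrite /E1 lerDr mulr_ge0 ?subr_ge0// ltW.
have E1p0 t : t0 <= t -> 0 <= E1 t by move=> tt; exact: le_trans (E0 _) (E1p _ tt).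
have E2p0 t : t0 <= t -> 0 <= E t by move=> _.
pose Psi := doubling A B gam t0 t1 E1 E u v.
have s1i : t0 <= s1 <= h by rewrite s01 ltW.
have Psi1 : c0 + 5 * e <= Psi ((x1, s1), (x1, s1)).
  rewrite /Psi /doubling /= !clamp_id; [|by rewrite s01 ltW..].
  rewrite sq_distxx subrr expr0n /= !mulr0 !add0r -/S1 De /E1 /lam.
  clear -de Es1 gamS; lra.
have penP := fun y t y' t' => @doubling_pen R d A B gam t0 t1 E1 E u v A0 B0 g0 M h (ltW ht1) bu bv E1p0 E2p0 y t y' t'.
have [xm [tm [ym [sm [tmh smh hmax]]]]] := @doubling_max R d A B gam t0 t1 E1 _ E _ u v
   A0 B0 g0 st1 hE1 hE uu uv M h (ltW ht1) bu bv E1p0 E2p0 x1 s1 s1i.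
have Pm : c0 + 5 * e <= Psi ((xm, tm), (ym, sm)).
  exact: le_trans Psi1 (hmax _ _ _ _ s1i s1i).
have [[P1 P2 P3 P4] [P5 P6 P7]] := penP xm tm ym sm tmh smh.
rewrite -/Psi in P1 P2 P3 P4 P5 P6 P7.
have dxy : `|xm - ym| <= rho.
  apply: (@le_of_sq _ A _ M') => //; last by rewrite Ar ltrDl.
  apply: le_trans (ler_wpM2l (ltW A0) (sq_dist_norm xm ym)) _.
  by rewrite /M'; clear -P1 Pm c0b e0; lra.
have dts : `|tm - sm| <= r.
  apply: (@le_of_sq _ B _ M') => //; last by rewrite Br ltrDl.
  by rewrite real_normK ?num_real// /M'; clear -P2 Pm c0b e0; lra.
have gnorm (y : 'rV[R]_d) : gam * sq_dist y 0 <= M' -> gam * `|y| <= m.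
  move=> hy; apply: (@le_of_sq _ 1 _ (gam * M')) => //; last by rewrite mul1r.
    by rewrite mulr_ge0// ltW.
  rewrite mul1r exprMn expr2 -mulrA ler_wpM2l ?(ltW g0)//.
  by apply: le_trans hy; rewrite ler_wpM2l ?(ltW g0)// -[X in `|X|]subr0 sq_dist_norm.
have gx : gam * `|xm| <= m by apply: gnorm; rewrite /M'; clear -P3 Pm c0b e0; lra.
have gy : gam * `|ym| <= m by apply: gnorm; rewrite /M'; clear -P4 Pm c0b e0; lra.
move: (tmh) (smh) => /andP[tm0 tm1] /andP[sm0 sm1].
have tmi : t0 <= tm <= t1 by rewrite tm0 (le_trans tm1)// ltW.
have smi : t0 <= sm <= t1 by rewrite sm0 (le_trans sm1)// ltW.
have t0i : t0 <= t0 <= t1 by rewrite lexx ltW.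
have tmgt : t0 < tm.
  rewrite lt_neqAle tm0 andbT; apply/eqP => Et.
  have := rv xm ym t0 sm t0i smi (le_trans dxy rhor); rewrite {1}Et => /(_ dts).
  move=> /ler_normlP[q1 q2]; have := uv0 xm.
  by move: q1 q2; rewrite Et; clear -P7 Pm e0; lra.
have smgt : t0 < sm.
  rewrite lt_neqAle sm0 andbT; apply/eqP => Et.
  have := ru xm ym tm t0 tmi t0i (le_trans dxy rhor); rewrite {1}Et => /(_ dts).
  move=> /ler_normlP[q1 q2]; have := uv0 ym.
  by move: q1 q2; rewrite Et; clear -P7 Pm e0; lra.
have tmlt : tm < h.
  rewrite lt_neqAle tm1 andbT; apply/eqP => Et.
  move: P5; have := E1p _ tm0; rewrite Et Eh /c -Et; clear -Pm c0b e0; lra.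
have smlt : sm < h.
  rewrite lt_neqAle sm1 andbT; apply/eqP => Et.
  move: P6; rewrite Et Eh /c -Et; clear -Pm c0b e0; lra.
have hq (w : 'rV[R]_d) i : C1fun (fun s => A * (s - w 0 i) ^+ 2 + gam * (s - 0) ^+ 2)
    (fun s => A * (2 * (s - w 0 i)) + gam * (2 * (s - 0))).
  by apply: C1funD; apply: C1funZ; exact: C1fun_sq.
have htu : C1fun (fun s => B * (s - sm) ^+ 2 + E1 s)
    (fun s => B * (2 * (s - sm)) + (lam * (1 + 0) + E' s)).
  by apply: C1funD => //; apply: C1funZ; exact: C1fun_sq.
have htv : C1fun (fun s => B * (s - tm) ^+ 2 + E s)
    (fun s => B * (2 * (s - tm)) + E' s).
  by apply: C1funD => //; apply: C1funZ; exact: C1fun_sq.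
have qsum (z w : 'rV[R]_d) : \sum_i (A * (z 0 i - w 0 i) ^+ 2 + gam * (z 0 i - 0) ^+ 2)
    = A * sq_dist z w + gam * sq_dist z 0.
  rewrite big_split /= -!mulr_sumr; congr (_ + _ * _).
  by apply: eq_bigr => i _; rewrite mxE.
have nearP (a b : R) : t0 < a < h -> `|b - a| < Num.min (a - t0) (h - a) -> t0 <= b <= h.
  move=> _; rewrite lt_min !ltr_norml => /andP[/andP[b1 b2] /andP[b3 b4]].
  by apply/andP; clear -b1 b2 b3 b4; split; lra.
have HH := su _ _ _ _ (hq ym) htu xm tm ltac:(by rewrite tmgt (lt_trans tmlt)).
feed HH.
- exists (Num.min (tm - t0) (h - tm)); first by rewrite lt_min !subr_gt0 tmgt.
  move=> y s _ /nearP; rewrite tmgt tmlt => /(_ erefl) ss.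
  have := hmax y s ym sm ss smh.
  have si : t0 <= s <= t1 by move: ss => /andP[-> /le_trans]; apply; exact: ltW.
  rewrite /doubling /= !qsum !clamp_id//; clear; lra.
have HH2 := sv _ _ _ _ (hq xm) htv ym sm ltac:(by rewrite smgt (lt_trans smlt)).
feed HH2.
- exists (Num.min (sm - t0) (h - sm)); first by rewrite lt_min !subr_gt0 smgt.
  move=> y s _ /nearP; rewrite smgt smlt => /(_ erefl) ss.
  have := hmax xm tm y s tmh ss.
  have si : t0 <= s <= t1 by move: ss => /andP[-> /le_trans]; apply; exact: ltW.
  rewrite /doubling /= !qsum !clamp_id// !(sq_distC xm).
  rewrite -(sqrrN (tm - s)) -(sqrrN (tm - sm)) !opprB; clear; lra.
set p1 := \row_i _ in HH; set p2 := \row_i _ in HH2.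
have pd : `|p1 - - p2| <= 4 * m.
  have -> : p1 - - p2 = (2 * gam) *: xm + (2 * gam) *: ym.
    by apply/rowP => i; rewrite !mxE; clear; ring.
  apply: le_trans (ler_normD _ _) _; have g2 : `|2 * gam| = 2 * gam by rewrite ger0_norm// mulr_ge0// ltW.
  have nZ (y : 'rV[R]_d) : `|(2 * gam) *: y| = 2 * gam * `|y|.
    by rewrite normrZ; congr (_ * _); exact: g2.
  rewrite !nZ; clear -gx gy; lra.
(* Read off from the subsolution inequality: the time derivative of the test function is at least
   [- (2 * B * r)], however large [A] is. *)
have Gx : G xm p1 <= 2 * B * r + Mg.
  have := gM xm => /ler_normlP[g1 g2].
  have Bts : - (2 * B * r) <= B * (2 * (tm - sm)).
    move/ler_normlP: dts => [d1 d2].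
    have := ler_wpM2l (ltW B0) d1; clear; lra.
  have := E'0 tm.
  clear -HH g1 g2 Bts lam0; lra.
have Gdiff := hL xm ym p1 (- p2) Gx (le_trans pd m4).
have Ldiff : L * (`|xm - ym| + `|p1 - - p2|) <= delta / 4 + delta / 4.
  apply: le_trans (lerD rhoL mL); rewrite -mulrDr; apply: ler_wpM2l => //.
  exact: lerD.
have gdiff := hg xm ym (le_trans dxy rhog).
have := gg ym; have := E'0 tm; have := E'0 sm.
move/ler_normlP: gdiff => [g1 g2]; move/ler_normlP: Gdiff => [G1 G2].
move: HH HH2; rewrite /lam; clear -Ldiff g1 g2 G1 G2 d0; lra.
Qed.

(** * Oscillation on a strip *)

Definition strip_sol (R : realType) (d : nat) (t0 t1 : R)
    (G : 'rV[R]_d -> 'rV[R]_d -> R) (g : 'rV[R]_d -> R) (u : 'rV[R]_d -> R -> R) :=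
  [/\ sub_on t0 t1 (fun x p => G x p + g x) u,
      sub_on t0 t1 (fun x p => - (G x (- p) + g x)) (fun x t => - u x t),
      exists M, bounded_on t0 t1 M u & unif_on t0 t1 u].

Definition ham_good (R : realType) (d : nat) (G : 'rV[R]_d -> 'rV[R]_d -> R) :=
  [/\ ham_mod G, (forall x p, 0 <= G x p) & forall x, G x 0 = 0].

Lemma unif_onN (R : realType) (d : nat) (t0 t1 : R) (u : 'rV[R]_d -> R -> R) :
  unif_on t0 t1 u -> unif_on t0 t1 (fun x t => - u x t).
Proof.
move=> h e e0; have [r r0 hr] := h e e0; exists r => // x y s t hs ht h1 h2.
by rewrite -opprD normrN; exact: hr.
Qed.

Lemma unif_on_restrict (R : realType) (d : nat) (t0 t1 s0 s1 : R)
    (u : 'rV[R]_d -> R -> R) : t0 <= s0 -> s1 <= t1 ->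
  unif_on t0 t1 u -> unif_on s0 s1 u.
Proof.
move=> h0 h1 h e e0; have [r r0 hr] := h e e0; exists r => // x y s t.
move=> /andP[a b] /andP[a' b'] ? ?; apply: hr => //.
  by rewrite (le_trans h0)// (le_trans b).
by rewrite (le_trans h0)// (le_trans b').
Qed.

Lemma bounded_on_restrict (R : realType) (d : nat) (t0 t1 s0 s1 M : R)
    (u : 'rV[R]_d -> R -> R) : t0 <= s0 -> s1 <= t1 ->
  bounded_on t0 t1 M u -> bounded_on s0 s1 M u.
Proof.
move=> h0 h1 h x t /andP[a b]; apply: h.
by rewrite (le_trans h0)// (le_trans b).
Qed.

Lemma strip_sol_restrict (R : realType) (d : nat) (t0 t1 s0 s1 : R) G g
    (u : 'rV[R]_d -> R -> R) : t0 <= s0 -> s1 <= t1 ->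
  strip_sol t0 t1 G g u -> strip_sol s0 s1 G g u.
Proof.
move=> h0 h1 [a b [M c] e]; split.
- exact: sub_on_restrict a.
- exact: sub_on_restrict b.
- by exists M; exact: bounded_on_restrict c.
- exact: unif_on_restrict e.
Qed.

(** Barriers and comparison speak of times before [t1] only; continuity in time carries their bounds
    to [t1] itself. *)
Lemma end_le (R : realType) (d : nat) (t0 t1 : R) (u : 'rV[R]_d -> R -> R) x
    (psi : R -> R) : t0 < t1 -> unif_on t0 t1 u -> {for t1, continuous psi} ->
  (forall t, t0 <= t < t1 -> u x t <= psi t) -> u x t1 <= psi t1.
Proof.
move=> tt uu cpsi hu; apply/ler_addgt0Pr => e e0.
have e20 : 0 < e / 2 by rewrite divr_gt0.
have [r r0 hr] := uu _ e20.
have /cvgrPdist_le/(_ _ e20)/nbhs_ballP[r' /= r'0 hr'] := cpsi.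
pose m := Num.min (Num.min r (r' / 2)) (t1 - t0).
have m0 : 0 < m by rewrite !lt_min r0 divr_gt0// subr_gt0.
have m1 : m <= r by rewrite !ge_min lexx.
have m2 : m <= r' / 2 by rewrite !ge_min lexx orbT.
have m3 : m <= t1 - t0 by rewrite !ge_min lexx !orbT.
clearbody m.
have i1 : t0 <= t1 - m < t1 by apply/andP; clear -m0 m3; split; lra.
have i2 : t0 <= t1 - m <= t1 by case/andP: i1 => -> /ltW ->.
have i3 : t0 <= t1 <= t1 by rewrite lexx ltW.
have d1 : `|t1 - (t1 - m)| <= r by rewrite opprB addrC subrK ger0_norm// ltW.
have := hr x x t1 (t1 - m) i3 i2; rewrite subrr normr0 => /(_ (ltW r0) d1).
have b1 : ball t1 r' (t1 - m).
  by rewrite -ball_normE /= opprB addrC subrK ger0_norm ?ltW//; clear -m2 r'0; lra.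
move: (hr' _ b1) (hu _ i1) => /= /ler_normlP[q1 q2] q3 /ler_normlP[q4 q5].
by clear -q1 q2 q3 q4 q5; lra.
Qed.

Lemma C1fun_lin (R : realType) (a b s : R) :
  C1fun (fun t => a + b * (t - s)) (fun _ => 0 + b * (1 + 0)).
Proof.
apply: C1funD; first exact: C1fun_cst.
by apply: C1funZ; apply: C1funD; [exact: C1fun_id|exact: C1fun_cst].
Qed.

Lemma C1fun_continuous (R : realType) (q q' : R -> R) : C1fun q q' -> continuous q.
Proof.
by move=> [h _] s; have [/derivable1_diffP/differentiable_continuous] := h s.
Qed.

Lemma norm_sub_ge (R : realType) (d : nat) (x y : 'rV[R]_d) : `|x| - `|y| <= `|x - y|.
Proof. exact: le_trans (ler_norm _) (ler_dist_dist _ _). Qed.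

Lemma quad_coercive (R : realType) (d : nat) (A : R) (c : 'rV[R]_d) (n : R) : 0 < A ->
  exists r, forall x : 'rV[R]_d, r < `|x| -> n <= \sum_i A * (x 0 i - c 0 i) ^+ 2.
Proof.
move=> A0; exists (`|c| + 1 + `|n| / A) => x xr.
rewrite -mulr_sumr.
have n0 : 0 <= `|n| / A by rewrite divr_ge0// ltW.
have h1 : 1 + `|n| / A <= `|x - c|.
  by have := norm_sub_ge x c; move: xr; clear; lra.
have h2 : (1 + `|n| / A) ^+ 2 <= `|x - c| ^+ 2.
  by rewrite lerXn2r ?nnegrE// addr_ge0.
have := ler_wpM2l (ltW A0) (le_trans h2 (sq_dist_norm x c)).
apply: le_trans; rewrite sqrrD mulrDr mulrDr.
have -> : A * (1 * (`|n| / A) *+ 2) = 2 * `|n|.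
  by rewrite mul1r -mulr_natl; field; rewrite gt_eqF.
have := ler_norm n; have : 0 <= A * (`|n| / A) ^+ 2 by rewrite mulr_ge0 ?sqr_ge0// ltW.
by have := normr_ge0 n; clear -A0; lra.
Qed.

(** As [G >= 0], a steep quadratic around [y] cannot spoil the strict supersolution property,
    whatever its gradient. It is taken so steep that the barrier lies above [u] outside a ball of
    radius [r], inside which [g] is within [dl] of [g y]. *)
Lemma strip_pointwise (R : realType) (d : nat) (t0 t1 b : R) G g (u : 'rV[R]_d -> R -> R) :
  (forall x p, 0 <= G x p) -> (forall x, `|g x| <= b) -> unif_cont g ->
  strip_sol t0 t1 G g u ->
  forall y t, t0 <= t <= t1 -> u y t <= u y t0 - g y * (t - t0).
Proof.
move=> G0 gb ug [su _ [M bu] uu] y t /andP[tt0 tt1].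
have [<-|tneq] := eqVneq t0 t; first by rewrite subrr mulr0 subr0.
have tlt : t0 < t by rewrite lt_neqAle tneq.
have t01 : t0 < t1 by exact: lt_le_trans tt1.
have b0 : 0 <= b by exact: le_trans (gb y).
have M0 : 0 <= M by apply: le_trans (normr_ge0 (u y t0)) (bu _ _ _); rewrite lexx ltW.
have T0 : 0 < t1 - t0 by rewrite subr_gt0.
apply/ler_addgt0Pr => e e0.
pose dl := e / (1 + 2 * (t1 - t0)).
have k0 : 0 < 1 + 2 * (t1 - t0) by clear -T0; lra.
have dl0 : 0 < dl by rewrite divr_gt0.
have dle : dl * (1 + 2 * (t1 - t0)) = e by rewrite divfK// gt_eqF.
clearbody dl.
have [r1 r10 hr1] := uu _ dl0; have [r2 r20 hr2] := ug _ dl0.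
pose r := Num.min r1 r2.
have r0 : 0 < r by rewrite lt_min r10.
have rr1 : r <= r1 by rewrite ge_min lexx.
have rr2 : r <= r2 by rewrite ge_min lexx orbT.
clearbody r.
pose m := 2 * M + (b + 2 * dl) * (t1 - t0) + 1.
have bd0 : 0 <= (b + 2 * dl) * (t1 - t0) by rewrite mulr_ge0//; clear -b0 dl0 T0; lra.
have m0 : 0 < m by rewrite /m; clear -M0 bd0; lra.
have r2p : 0 < r ^+ 2 by rewrite exprn_gt0.
have [A A0 Ar] : exists2 A, 0 < A & A * r ^+ 2 = m.
  by exists (m / r ^+ 2); [exact: divr_gt0|rewrite divfK// gt_eqF].
have hq i : C1fun (fun s : R => A * (s - y 0 i) ^+ 2) (fun s => A * (2 * (s - y 0 i))).
  by apply: C1funZ; exact: C1fun_sq.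
have ht := C1fun_lin (u y t0 + dl) (- g y + 2 * dl) t0.
set tau := (fun t => _) in ht; set tau' := (fun _ => _) in ht.
have /ler_normlP[gy1 gy2] := gb y.
have i0 : t0 <= t0 <= t1 by rewrite lexx ltW.
have /ler_normlP[uy1 uy2] := bu y t0 i0.
have tau_ge s : t0 <= s <= t1 -> - (M + (b + 2 * dl) * (t1 - t0)) <= tau s.
  move=> /andP[s0 s1]; rewrite /tau.
  have : - ((b + 2 * dl) * (t1 - t0)) <= (- g y + 2 * dl) * (s - t0).
    have : - ((b + 2 * dl) * (t1 - t0)) <= - ((b + 2 * dl) * (s - t0)).
      by rewrite lerN2 ler_wpM2l//; [clear -b0 dl0|clear -s1]; lra.
    move=> /le_trans; apply; rewrite -mulNr ler_wpM2r//; first by rewrite subr_ge0.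
    by clear -gy2 dl0; lra.
  by clear -uy1 dl0; lra.
have far (x : 'rV[R]_d) : r < `|x - y| -> m <= \sum_i A * (x 0 i - y 0 i) ^+ 2.
  move=> xr; rewrite -mulr_sumr -Ar ler_pM2l//.
  by apply: le_trans (sq_dist_norm x y); rewrite lerXn2r ?nnegrE// ltW.
have qge (x : 'rV[R]_d) : 0 <= \sum_i A * (x 0 i - y 0 i) ^+ 2.
  by apply: sumr_ge0 => i _; rewrite mulr_ge0 ?sqr_ge0// ltW.
have farle (x : 'rV[R]_d) s : t0 <= s <= t1 -> r < `|x - y| ->
    u x s <= \sum_i A * (x 0 i - y 0 i) ^+ 2 + tau s.
  move=> si /far xr; have := tau_ge s si; have /ler_normlP[_] := bu x s si.
  by move: xr; rewrite /m; clear; lra.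
have main : forall x s, t0 <= s < t1 -> u x s <= \sum_i A * (x 0 i - y 0 i) ^+ 2 + tau s.
  apply: (@barrier R d t0 t1 t0 M (M + (b + 2 * dl) * (t1 - t0))
    (fun x p => G x p + g x) u _ _ tau tau' (lexx _) su bu uu hq ht) => //.
  - by move=> i s; rewrite mulr_ge0 ?sqr_ge0// ltW.
  - by move=> n; exact: quad_coercive.
  - move=> x; have [xr|xr] := leP `|x - y| r; last exact: farle.
    have := hr1 x y t0 t0 i0 i0 (le_trans xr rr1); rewrite subrr normr0 => /(_ (ltW r10)).
    move=> /ler_normlP[_ q1]; have := qge x.
    by rewrite /tau subrr mulr0; move: q1; clear; lra.
  - move=> x s /andP[s0 s1]; have [xr|xr] := leP `|x - y| r; last first.
      by left; apply: farle => //; rewrite !ltW.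
    right; rewrite /tau'.
    have /ler_normlP[q1 _] := hr2 x y (le_trans xr rr2).
    by have := G0 x (\row_i (A * (2 * (x 0 i - y 0 i)))); move: q1; clear -dl0; lra.
have uyt : u y t <= tau t.
  have E0 : \sum_i A * (y 0 i - y 0 i) ^+ 2 = 0.
    by rewrite big1// => i _; rewrite subrr expr0n mulr0.
  have [tt|tt] := ltP t t1.
    by have := main y t; rewrite E0 add0r tt0 tt => /(_ erefl).
  have -> : t = t1 by apply/eqP; rewrite eq_le tt1.
  apply: (end_le t01 uu); first by exact: (C1fun_continuous ht).
  by move=> s si; have := main y s si; rewrite E0 add0r.
apply: le_trans uyt _; rewrite /tau.
have : 2 * dl * (t - t0) <= 2 * dl * (t1 - t0).
  by rewrite ler_wpM2l//; [clear -dl0|clear -tt1]; lra.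
by move: dle; clear; lra.
Qed.

(** Since [G x 0 = 0], the function [c - b * (t - t0)] is a subsolution. The confining quadratic has
    a gradient of at most [2 * m] wherever the barrier could fail, and for so small a gradient
    [ham_mod] at level [0] keeps [G] below [dl]. *)
Lemma strip_lower (R : realType) (d : nat) (t0 t1 b c : R) G g (u : 'rV[R]_d -> R -> R) :
  ham_good G -> (forall x, `|g x| <= b) ->
  strip_sol t0 t1 G g u -> (forall x, c <= u x t0) ->
  forall y t, t0 <= t <= t1 -> c - b * (t - t0) <= u y t.
Proof.
move=> [hG G0 G00] gb [_ sv [M bu] uu] cu y t /andP[tt0 tt1].
have [<-|tneq] := eqVneq t0 t; first by rewrite subrr mulr0 subr0.
have tlt : t0 < t by rewrite lt_neqAle tneq.
have t01 : t0 < t1 by exact: lt_le_trans tt1.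
have b0 : 0 <= b by exact: le_trans (gb y).
have i0 : t0 <= t0 <= t1 by rewrite lexx ltW.
have M0 : 0 <= M by apply: le_trans (normr_ge0 (u y t0)) (bu _ _ i0).
have T0 : 0 < t1 - t0 by rewrite subr_gt0.
have cM : c <= M by apply: le_trans (cu y) _; apply: le_trans (ler_norm _) (bu _ _ i0).
apply/ler_addgt0Pr => e e0.
pose Sy := sq_dist y 0; have Sy0 : 0 <= Sy by exact: sq_dist_ge0.
pose dl := e / (1 + (t1 - t0) + Sy).
have k0 : 0 < 1 + (t1 - t0) + Sy by clear -T0 Sy0; lra.
have dl0 : 0 < dl by rewrite divr_gt0.
have dle : dl * (1 + (t1 - t0) + Sy) = e by rewrite divfK// gt_eqF.
clearbody dl.
have [L L0 hL] := hG 0.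
have L1 : 0 < 4 * (L + 1) by clear -L0; lra.
have [m [m0 m4 mL]] : exists m, [/\ 0 < m, 2 * m <= 1 & L * (2 * m) < dl].
  exists (Num.min (1 / 4) (dl / (4 * (L + 1)))); set m := Num.min _ _.
  have m0 : 0 < m by rewrite lt_min (divr_gt0 dl0 L1) andbT; clear; lra.
  have m1 : m <= 1 / 4 by rewrite ge_min lexx.
  have : m <= dl / (4 * (L + 1)) by rewrite ge_min lexx orbT.
  rewrite ler_pdivlMr//; clearbody m; clear -m0 m1 L0 dl0 => ?; split => //; nra.
pose M' := M + `|c| + 1.
have M'0 : 0 < M' by rewrite /M'; have := normr_ge0 c; clear -M0; lra.
pose gam := Num.min dl (m ^+ 2 / (2 * M')).
have g0 : 0 < gam by rewrite lt_min dl0 divr_gt0 ?exprn_gt0// mulr_gt0.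
have gdl : gam <= dl by rewrite ge_min lexx.
have gm : gam * M' < m ^+ 2.
  have M'2 : 0 < 2 * M' by rewrite mulr_gt0.
  have : gam <= m ^+ 2 / (2 * M') by rewrite ge_min lexx orbT.
  rewrite ler_pdivlMr// => h; have : 0 < gam * M' by rewrite mulr_gt0.
  by move: h; clear; lra.
clearbody gam.
have hq (i : 'I_d) : C1fun (fun s : R => gam * (s - 0) ^+ 2) (fun s => gam * (2 * (s - 0))).
  by apply: C1funZ; exact: C1fun_sq.
have ht := C1fun_lin (- c + dl) (b + dl) t0.
set tau := (fun t => _) in ht; set tau' := (fun _ => _) in ht.
have tau_ge s : t0 <= s <= t1 -> - `|c| <= tau s.
  move=> /andP[s0 s1]; rewrite /tau.
  have : 0 <= (b + dl) * (s - t0) by rewrite mulr_ge0 ?subr_ge0// addr_ge0// ltW.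
  by have := ler_norm c; move: dl0; clear; lra.
have qge (x : 'rV[R]_d) : 0 <= \sum_i gam * (x 0 i - 0) ^+ 2.
  by apply: sumr_ge0 => i _; rewrite mulr_ge0 ?sqr_ge0// ltW.
have qE (x : 'rV[R]_d) : \sum_i gam * (x 0 i - 0) ^+ 2 = gam * sq_dist x 0.
  by rewrite -mulr_sumr; congr (_ * _); apply: eq_bigr => i _; rewrite mxE.
have bnu : bounded_on t0 t1 M (fun x t => - u x t) by move=> x s si; rewrite normrN; exact: bu.
have main : forall x s, t0 <= s < t1 -> - u x s <= \sum_i gam * (x 0 i - 0) ^+ 2 + tau s.
  apply: (@barrier R d t0 t1 t0 M `|c| _ _ (fun i s => gam * (s - 0) ^+ 2)
     (fun i s => gam * (2 * (s - 0))) tau tau' (lexx _) sv bnu (unif_onN uu) hq ht) => //.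
  - by move=> i s; rewrite mulr_ge0 ?sqr_ge0// ltW.
  - move=> n; have [r hr] := @quad_coercive R d gam 0 n g0; exists r => x xr.
    by have := hr x xr; under eq_bigr do rewrite mxE.
  - move=> x; have := qge x; have := cu x; rewrite /tau subrr mulr0; clear -dl0; lra.
  - move=> x s /andP[s0 s1].
    have si : t0 <= s <= t1 by rewrite !ltW.
    have [?|big] := leP (- u x s) (\sum_i gam * (x 0 i - 0) ^+ 2 + tau s); first by left.
    right.
    have xm : gam * `|x| <= m.
      apply: (@le_of_sq _ 1 _ (gam * M')) => //; last by rewrite mul1r.
        by rewrite mulr_ge0// ltW.
      rewrite mul1r exprMn expr2 -mulrA ler_wpM2l ?(ltW g0)//.
      have : gam * `|x| ^+ 2 <= gam * sq_dist x 0.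
        by rewrite ler_wpM2l ?(ltW g0)// -[X in `|X|]subr0 sq_dist_norm.
      move=> /le_trans; apply; rewrite -qE.
      have := tau_ge s si; have /ler_normlP[q1 _] := bu x s si.
      by move: big q1; rewrite /M'; clear; lra.
    set p := \row_i _.
    have pn : `|0 - - p| <= 2 * m.
      rewrite sub0r opprK.
      have -> : p = (2 * gam) *: x by apply/rowP => i; rewrite !mxE; clear; ring.
      have -> : `|(2 * gam) *: x| = 2 * gam * `|x|.
        by rewrite normrZ; congr (_ * _); rewrite ger0_norm// mulr_ge0// ltW.
      by move: xm; clear; lra.
    have := hL x x 0 (- p) ltac:(by rewrite G00) (le_trans pn m4).
    rewrite subrr normr0 add0r G00 subr0 => /ler_normlP[_ q1].
    have := ler_wpM2l L0 pn; have /ler_normlP[_ q2] := gb x.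
    by rewrite /tau'; move: q1 q2 mL; clear; lra.
have uyt : - u y t <= gam * Sy + tau t.
  have [tt|tt] := ltP t t1.
    by have := main y t; rewrite qE tt0 tt => /(_ erefl).
  have -> : t = t1 by apply/eqP; rewrite eq_le tt1.
  apply: (@end_le _ _ _ _ (fun x t => - u x t) y (fun t => gam * Sy + tau t) t01 (unif_onN uu)).
    by apply: cvgD; [exact: cvg_cst|exact: (C1fun_continuous ht)].
  by move=> s si; have := main y s si; rewrite qE.
move: uyt; rewrite /tau.
have : gam * Sy <= dl * Sy by rewrite ler_wpM2r.
have : dl * (t - t0) <= dl * (t1 - t0).
  by rewrite ler_wpM2l ?(ltW dl0)// lerB.
by move: dle; clear; lra.
Qed.

(** * Smoothed separable cones and the contraction of the oscillation *)

Lemma sqrt_cone_le (R : realType) (x k : R) : 0 <= k ->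
  Num.sqrt (x ^+ 2 + k ^+ 2) <= `|x| + k.
Proof.
move=> k0.
rewrite -[leRHS]ger0_norm ?addr_ge0// -sqrtr_sqr ler_wsqrtr//.
rewrite sqrrD real_normK ?num_real// lerD2r lerDl mulrn_wge0// mulr_ge0//.
Qed.

Lemma sqrt_cone_ge (R : realType) (x k : R) : `|x| <= Num.sqrt (x ^+ 2 + k ^+ 2).
Proof. by rewrite -sqrtr_sqr ler_wsqrtr// lerDl sqr_ge0. Qed.

Lemma C1fun_cone (R : realType) (rho k c : R) : 0 < k ->
  C1fun (fun s => rho * Num.sqrt ((s - c) ^+ 2 + k ^+ 2))
    (fun s => rho * ((2 * (s - c) + 0) * (2 * Num.sqrt ((s - c) ^+ 2 + k ^+ 2))^-1)).
Proof.
move=> k0; apply: C1funZ.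
have hs : C1fun (fun s : R => (s - c) ^+ 2 + k ^+ 2) (fun s => 2 * (s - c) + 0).
  by apply: C1funD; [exact: C1fun_sq|exact: C1fun_cst].
have pos s : 0 < (s - c) ^+ 2 + k ^+ 2 by rewrite ltr_wpDl ?sqr_ge0// exprn_gt0.
split=> s.
  have := @is_derive1_comp R Num.sqrt (fun s : R => (s - c) ^+ 2 + k ^+ 2) s _ _ (is_derive1_sqrt (pos s)) (hs.1 s).
  rewrite mulrC; exact.
have cs : continuous (fun s : R => Num.sqrt ((s - c) ^+ 2 + k ^+ 2)).
  move=> y; apply: (@continuous_comp _ _ _ (fun s : R => (s - c) ^+ 2 + k ^+ 2) Num.sqrt).
    exact: (C1fun_continuous hs).
  exact: sqrt_continuous.
apply: cvgM; first exact: hs.2.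
apply: cvgV; first by rewrite mulf_neq0// gt_eqF// sqrtr_gt0.
by apply: cvgMl_tmp; exact: cs.
Qed.

(** For [|s| >= k] the square root is at most [2 * |s|], so smoothing costs a factor of two in the
    slope: gradients of size [rho] come from cones of slope [2 * rho]. *)
Lemma cone_grad (R : realType) (rho k s : R) : 0 < k -> 0 <= rho -> k <= `|s| ->
  rho <= `|(2 * rho) * ((2 * s + 0) * (2 * Num.sqrt (s ^+ 2 + k ^+ 2))^-1)|.
Proof.
move=> k0 r0 ks; have s0 : 0 < `|s| by exact: lt_le_trans ks.
set q := Num.sqrt _.
have q0 : 0 < q by rewrite sqrtr_gt0 ltr_wpDl ?sqr_ge0// exprn_gt0.
have qs : q <= 2 * `|s|.
  by apply: le_trans (sqrt_cone_le _ (ltW k0)) _; rewrite -/q; move: ks; clear; lra.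
have -> : 2 * rho * ((2 * s + 0) * (2 * q)^-1) = 2 * rho * (s / q).
  by field; rewrite gt_eqF.
rewrite normrM ger0_norm ?mulr_ge0// normrM normfV (gtr0_norm q0).
have : 1 / 2 <= `|s| / q by rewrite ler_pdivlMr//; move: qs; clear; lra.
move: (`|s| / q) => z hz; have := ler_wpM2l r0 hz; clear; lra.
Qed.

Lemma cone_coercive (R : realType) (d : nat) (rho k : R) (c : 'rV[R]_d) (n : R) : 0 < rho ->
  exists r, forall x : 'rV[R]_d, r < `|x| ->
    n <= \sum_i rho * Num.sqrt ((x 0 i - c 0 i) ^+ 2 + k ^+ 2).
Proof.
move=> r0; exists (`|c| + `|n| / rho) => x xr.
have h1 : `|n| / rho <= `|x - c| by have := norm_sub_ge x c; move: xr; clear; lra.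
have h2 : `|x - c| <= \sum_i Num.sqrt ((x 0 i - c 0 i) ^+ 2 + k ^+ 2).
  apply: norm_le_coord => [|i]; first by apply: sumr_ge0 => i _; rewrite sqrtr_ge0.
  rewrite !mxE; apply: le_trans (sqrt_cone_ge _ k) _.
  by rewrite (bigD1 i)//= lerDl sumr_ge0// => j _; rewrite sqrtr_ge0.
rewrite -mulr_sumr; apply: le_trans (ler_norm n) _.
by rewrite mulrC -ler_pdivrMr//; exact: le_trans h2.
Qed.

(* Coercivity makes the cone of slope [2 * rho] a barrier: the part of [u] above it decreases at
   speed at least [K], so it has disappeared after time [O / K]. *)
Lemma strip_cone (R : realType) (d : nat) (t0 t1 b K rho O : R) G g
    (u : 'rV[R]_d -> R -> R) :
  (forall x p, 0 <= G x p) -> (forall x, `|g x| <= b) -> unif_cont g ->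
  0 < rho -> (forall x p, rho <= `|p| -> K <= G x p) -> 0 < K ->
  strip_sol t0 t1 G g u -> (forall x y, u x t0 - u y t0 <= O) ->
  t0 < t1 -> K * (t1 - t0) = O ->
  forall y z, u y t1 <= u z t0 + b * (t1 - t0) + 2 * rho * \sum_i `|y 0 i - z 0 i|.
Proof.
move=> G0 gb ug rho0 GK K0 ss osc t01 KO y z.
have [su _ [M bu] uu] := ss.
have b0 : 0 <= b by exact: le_trans (gb y).
have i0 : t0 <= t0 <= t1 by rewrite lexx ltW.
have M0 : 0 <= M by apply: le_trans (normr_ge0 (u y t0)) (bu _ _ i0).
have T0 : 0 < t1 - t0 by rewrite subr_gt0.
have dR : 0 <= d%:R :> R by rewrite ler0n.
apply/ler_addgt0Pr => e e0.
have k0 : 0 < 1 + (t1 - t0) + 2 * rho * d%:R.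
  by have : 0 <= rho * d%:R; [rewrite mulr_ge0// ltW|clear -T0; lra].
pose dl := e / (1 + (t1 - t0) + 2 * rho * d%:R).
have dl0 : 0 < dl by rewrite divr_gt0.
have dle : dl * (1 + (t1 - t0) + 2 * rho * d%:R) = e by rewrite divfK// gt_eqF.
clearbody dl.
have [r1 r10 hr1] := uu _ dl0.
pose k := Num.min r1 dl.
have kp : 0 < k by rewrite lt_min r10.
have kr1 : k <= r1 by rewrite ge_min lexx.
have kdl : k <= dl by rewrite ge_min lexx orbT.
clearbody k.
have r20 : 0 < 2 * rho by rewrite mulr_gt0.
have hq i := C1fun_cone (2 * rho) (z 0 i) kp.
(* The tip starts [O] above [u z t0], so the cone is above [u] everywhere, and it sinks at speed
   [K - b]. As [K * (t1 - t0) = O], at time [t1] it has come down to [u z t0 + b * (t1 - t0)], up to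
   terms of order [dl]. *)
have ht := C1fun_lin (u z t0 + O + dl) (b - K + dl) t0.
set tau := (fun t => _) in ht; set tau' := (fun _ => _) in ht.
pose N := M + O + 2 * M + 2 * K * (t1 - t0).
have O0 : 0 <= O by have := osc y y; rewrite subrr.
have /ler_normlP[uz1 uz2] := bu z t0 i0.
have tau_ge s : t0 <= s <= t1 -> u z t0 + dl + b * (s - t0) <= tau s.
  move=> /andP[s0 s1]; rewrite /tau -KO.
  have : K * (s - t0) <= K * (t1 - t0) by rewrite ler_wpM2l ?(ltW K0)// lerB.
  have : 0 <= dl * (s - t0) by rewrite mulr_ge0 ?subr_ge0// ltW.
  clear; lra.
have qge (x : 'rV[R]_d) : 0 <= \sum_i 2 * rho * Num.sqrt ((x 0 i - z 0 i) ^+ 2 + k ^+ 2).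
  by apply: sumr_ge0 => i _; rewrite mulr_ge0 ?sqrtr_ge0// ltW.
have main : forall x s, t0 <= s < t1 ->
    u x s <= \sum_i 2 * rho * Num.sqrt ((x 0 i - z 0 i) ^+ 2 + k ^+ 2) + tau s.
  apply: (@barrier R d t0 t1 t0 M M
    (fun x p => G x p + g x) u _ _ tau tau' (lexx _) su bu uu hq ht) => //.
  - by move=> i s; rewrite mulr_ge0 ?sqrtr_ge0// ltW.
  - by move=> n; exact: cone_coercive.
  - move=> s si; apply: le_trans (tau_ge s si); move/andP: si => [s0 _].
    have : 0 <= b * (s - t0) by rewrite mulr_ge0// subr_ge0.
    by move: uz1 dl0; clear; lra.
  - move=> x; have := osc x z; have := qge x; rewrite /tau subrr mulr0.
    by move: dl0; clear; lra.
  - move=> x s /andP[s0 s1].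
    have si : t0 <= s <= t1 by rewrite !ltW.
    (* If some coordinate is far from [z], the slope of the cone activates coercivity. Otherwise [x]
       is within [k] of [z], and the pointwise upper bound already puts [u] below the barrier. *)
    have [|nex] := pselect (exists i, k <= `|x 0 i - z 0 i|).
      move=> [i ki]; right; rewrite /tau'; set p := \row_i _.
      have pr : rho <= `|p|.
        apply: le_trans (coord_le_norm p i); rewrite mxE.
        by apply: cone_grad => //; exact: ltW.
      have := GK x p pr; have /ler_normlP[q1 _] := gb x.
      by move: q1 dl0; clear; lra.
    left.
    have xz : `|x - z| <= k.
      apply: norm_le_coord => [|i]; first exact: ltW.
      rewrite !mxE leNgt; apply/negP => h; apply: nex; exists i; exact: ltW.
    have p1 := strip_pointwise G0 gb ug ss x si.
    have := hr1 x z t0 t0 i0 i0 (le_trans xz kr1); rewrite subrr normr0 => /(_ (ltW r10)).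
    move=> /ler_normlP[_ q2].
    have /ler_normlP[q1 _] := gb x.
    have : - g x * (s - t0) <= b * (s - t0) by rewrite ler_wpM2r// subr_ge0 ltW.
    by have := tau_ge s si; have := qge x; move: p1 q2; clear; lra.
have fin : u y t1 <= \sum_i 2 * rho * Num.sqrt ((y 0 i - z 0 i) ^+ 2 + k ^+ 2) + tau t1.
  apply: (@end_le _ _ _ _ u y (fun t => \sum_i 2 * rho * Num.sqrt ((y 0 i - z 0 i) ^+ 2 + k ^+ 2) + tau t) t01 uu).
    by apply: cvgD; [exact: cvg_cst|exact: (C1fun_continuous ht)].
  by move=> s si; exact: main.
apply: le_trans fin _; rewrite -mulr_sumr.
have S1 : \sum_i Num.sqrt ((y 0 i - z 0 i) ^+ 2 + k ^+ 2) <= \sum_i `|y 0 i - z 0 i| + d%:R * dl.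
  rewrite -[d in d%:R]card_ord -sum1_card natr_sum mulr_suml -big_split /=.
  apply: ler_sum => i _; rewrite mul1r.
  by apply: le_trans (sqrt_cone_le _ (ltW kp)) _; rewrite lerD2l.
have := ler_wpM2l (ltW r20) S1; rewrite /tau.
by move: dle KO; clear; lra.
Qed.

Lemma strip_osc_basic (R : realType) (d : nat) (t0 t1 b O : R) G g
    (u : 'rV[R]_d -> R -> R) :
  ham_good G -> (forall x, `|g x| <= b) -> unif_cont g ->
  strip_sol t0 t1 G g u -> (forall x y, u x t0 - u y t0 <= O) ->
  forall x y t, t0 <= t <= t1 -> u x t - u y t <= O + 2 * b * (t - t0).
Proof.
move=> hG gb ug ss osc x y t ti.
have [_ G0 _] := hG.
have p1 := strip_pointwise G0 gb ug ss x ti.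
have lo : forall z, u x t0 - O <= u z t0 by move=> z; have := osc x z; clear; lra.
have p2 := strip_lower hG gb ss lo y ti.
have /ler_normlP[q1 _] := gb x; move/andP: ti => [a1 a2].
have : - g x * (t - t0) <= b * (t - t0) by rewrite ler_wpM2r// subr_ge0.
by move: p1 p2; clear; lra.
Qed.

Definition cell_periodic (R : realType) (d : nat) (e : R) (w : 'rV[R]_d -> R) :=
  forall (x : 'rV[R]_d) (k : 'rV[int]_d), w (x + e *: map_mx intr k) = w x.

Lemma cell_shift (R : realType) (d : nat) (e : R) (y z : 'rV[R]_d) : 0 < e ->
  exists k : 'rV[int]_d, \sum_i `|y 0 i - (z + e *: map_mx intr k) 0 i| <= d%:R * e.
Proof.
move=> e0; exists (\row_i Num.floor ((y 0 i - z 0 i) / e)).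
rewrite -[X in X%:R]card_ord -sum1_card natr_sum mulr_suml.
apply: ler_sum => i _; rewrite !mxE mul1r.
set w := (y 0 i - z 0 i) / e.
have -> : y 0 i - (z 0 i + e * (Num.floor w)%:~R) = e * (w - (Num.floor w)%:~R).
  by rewrite /w; field; rewrite gt_eqF.
rewrite normrM (gtr0_norm e0) ler_piMr ?(ltW e0)//.
have := Num.Theory.floor_le_tmp w; have := Num.Theory.floorD1_gt w; rewrite intrD.
move: (_%:~R) => fw h1 h2; rewrite ger0_norm; move: h1 h2; clear; lra.
Qed.

(** Every point has a periodic copy within [d%:R * e] of [x] in the sum norm, so the cone estimate
    bounds all initial values from below in terms of [u x t1]; [strip_lower] transports this bound
    to time [t1]. The initial oscillation [O] has disappeared from the result. *)
Lemma strip_osc_cone (R : realType) (d : nat) (t0 t1 b K rho O e : R) G g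
    (u : 'rV[R]_d -> R -> R) :
  ham_good G -> (forall x, `|g x| <= b) -> unif_cont g ->
  0 < rho -> (forall x p, rho <= `|p| -> K <= G x p) -> 0 < K ->
  strip_sol t0 t1 G g u -> (forall x y, u x t0 - u y t0 <= O) ->
  0 < e -> cell_periodic e (u^~ t0) ->
  t0 < t1 -> K * (t1 - t0) = O ->
  forall x y, u x t1 - u y t1 <= 2 * rho * (d%:R * e) + 2 * b * (t1 - t0).
Proof.
move=> hG gb ug rho0 GK K0 ss osc e0 per t01 KO x y.
have [_ G0 _] := hG.
have i1 : t0 <= t1 <= t1 by rewrite lexx ltW.
have lo : forall z, u x t1 - b * (t1 - t0) - 2 * rho * (d%:R * e) <= u z t0.
  move=> z; have [k hk] := cell_shift x z e0.
  have := strip_cone G0 gb ug rho0 GK K0 ss osc t01 KO x (z + e *: map_mx intr k).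
  rewrite per.
  have r20 : 0 <= 2 * rho by rewrite mulr_ge0// ltW.
  have := ler_wpM2l r20 hk; clear; lra.
have := strip_lower hG gb ss lo y i1; clear; lra.
Qed.

(** The strip is cut into steps of length [O / K]. By [8 * b <= K] the forcing adds at most [O / 4]
    during a step, and [4 * rho * (d%:R * e) <= O] bounds the cone term by [O / 2], so the bound [O]
    is reproduced at each node. An incomplete last step adds another [O / 4], whence [5 / 4 * O];
    after one complete step only [O / 4 + O / 4] is left besides the cone term. *)
Lemma strip_osc (R : realType) (d : nat) (t0 t1 b K rho O e : R) G g
    (u : 'rV[R]_d -> R -> R) :
  ham_good G -> (forall x, `|g x| <= b) -> unif_cont g ->
  0 < rho -> (forall x p, rho <= `|p| -> K <= G x p) -> 0 < K -> 8 * b <= K ->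
  strip_sol t0 t1 G g u -> (forall x y, u x t0 - u y t0 <= O) ->
  0 < e -> (forall t, t0 <= t <= t1 -> cell_periodic e (u^~ t)) ->
  0 < O -> 4 * rho * (d%:R * e) <= O ->
  (forall x y t, t0 <= t <= t1 -> u x t - u y t <= 5 / 4 * O) /\
  (t0 <= t1 -> O <= K * (t1 - t0) -> forall x y, u x t1 - u y t1 <= 2 * rho * (d%:R * e) + O / 2).
Proof.
move=> hG gb ug rho0 GK K0 Kb ss osc e0 per O0 Oe.
pose tau := O / K; have tau0 : 0 < tau by rewrite divr_gt0.
have Ktau : K * tau = O by rewrite /tau mulrC divfK// gt_eqF.
have b0 : 0 <= b by exact: le_trans (gb 0).
have btau : 2 * b * tau <= O / 4.
  by have := ler_wpM2r (ltW tau0) Kb; rewrite Ktau; clear; lra.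
have step : forall j : nat, t0 + j%:R * tau <= t1 ->
    (forall x y, u x (t0 + j%:R * tau) - u y (t0 + j%:R * tau) <= O) /\
    ((0 < j)%N -> forall x y, u x (t0 + j%:R * tau) - u y (t0 + j%:R * tau) <=
       2 * rho * (d%:R * e) + O / 4).
  elim=> [|j IH] jt; first by rewrite mul0r addr0; split.
  rewrite -natr1 mulrDl mul1r addrA in jt *.
  set s := t0 + j%:R * tau in IH jt *.
  have ts : t0 <= s by rewrite /s lerDl mulr_ge0 ?ler0n// ltW.
  have st : s <= t1 by apply: le_trans jt; rewrite lerDl ltW.
  have [IH1 _] := IH st.
  have ss' := strip_sol_restrict ts jt ss.
  have si : t0 <= s <= t1 by rewrite ts.
  have st' : s < s + tau by rewrite ltrDl.
  have KO : K * (s + tau - s) = O by rewrite addrC addKr.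
  have H := strip_osc_cone hG gb ug rho0 GK K0 ss' IH1 e0 (per s si) st' KO.
  have H' x y : u x (s + tau) - u y (s + tau) <= 2 * rho * (d%:R * e) + O / 4.
    apply: le_trans (H x y) _.
    have -> : s + tau - s = tau by rewrite addrC addKr.
    by move: btau; clear; lra.
  split=> // x y; apply: le_trans (H' x y) _; move: Oe O0; clear; lra.
have at_t : forall t, t0 <= t <= t1 -> exists j : nat,
   let s := t0 + j%:R * tau in [/\ s <= t, t <= s + tau, s <= t1 & (tau <= t - t0) -> (0 < j)%N].
  move=> t /andP[a1 a2]; exists (Num.truncn ((t - t0) / tau)); set n := Num.truncn _.
  have nn : 0 <= (t - t0) / tau by rewrite divr_ge0 ?subr_ge0// ltW.
  have h1 : n%:R <= (t - t0) / tau by rewrite truncn_le.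
  have h2 : (t - t0) / tau < n.+1%:R by exact: truncnS_gt.
  rewrite ler_pdivlMr// in h1; rewrite ltr_pdivrMr// -natr1 in h2.
  split.
  - by move: h1; clear; lra.
  - by move: h2; clear; lra.
  - by move: h1 a2; clear; lra.
  - move=> tt; rewrite lt0n; apply/eqP => n0; move: h2; rewrite n0; move: tt; clear; lra.
split=> [x y t ti|t01 OK x y].
  have [j [s1 s2 s3 _]] := at_t t ti; set s := t0 + _ in s1 s2 s3.
  have [IH _] := step j s3.
  have ts : t0 <= s by rewrite /s lerDl mulr_ge0 ?ler0n// ltW.
  have ss' := strip_sol_restrict ts (lexx t1) ss.
  have ti' : s <= t <= t1 by rewrite s1; case/andP: ti.
  have := strip_osc_basic hG gb ug ss' IH x y ti'.
  have : 2 * b * (t - s) <= 2 * b * tau.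
    by rewrite ler_wpM2l ?mulr_ge0//; move: s2; clear; lra.
  by move: btau; clear; lra.
have [|j [s1 s2 s3 s4]] := at_t t1; first by rewrite t01 lexx.
set s := t0 + _ in s1 s2 s3.
have [_ IH] := step j s3.
have j0 : (0 < j)%N by apply: s4; rewrite -(ler_pM2l K0) Ktau.
have ts : t0 <= s by rewrite /s lerDl mulr_ge0 ?ler0n// ltW.
have ss' := strip_sol_restrict ts (lexx t1) ss.
have ti' : s <= t1 <= t1 by rewrite s1 lexx.
have := strip_osc_basic hG gb ug ss' (IH j0) x y ti'.
have : 2 * b * (t1 - s) <= 2 * b * tau.
  by rewrite ler_wpM2l ?mulr_ge0//; move: s2; clear; lra.
by move: btau; clear; lra.
Qed.

(** At the maximum point [y0] of [g] the pointwise upper bound and the global lower bound both move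
    with speed [- b]; the oscillations at the two times carry this from [y0] to [x]. *)
Lemma strip_track (R : realType) (d : nat) (t0 t1 b O O' : R) G g
    (u : 'rV[R]_d -> R -> R) y0 :
  ham_good G -> (forall x, `|g x| <= b) -> unif_cont g -> g y0 = b ->
  strip_sol t0 t1 G g u -> (forall x y, u x t0 - u y t0 <= O) ->
  forall t, t0 <= t <= t1 -> (forall x y, u x t - u y t <= O') ->
  forall x, `|u x t - u x t0 + b * (t - t0)| <= O + O'.
Proof.
move=> hG gb ug gy ss osc t ti osc' x.
have [_ G0 _] := hG.
have p1 := strip_pointwise G0 gb ug ss y0 ti.
have lo : forall z, u x t0 - O <= u z t0 by move=> z; have := osc x z; clear; lra.
have p2 := strip_lower hG gb ss lo x ti.
have := osc y0 x; have := osc' x y0; have := osc x x; have := osc' x x.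
rewrite gy in p1; move: p1 p2 => p1 p2 o1 o2 o3 o4.
by rewrite ler_norml; apply/andP; clear -p1 p2 o1 o2 o3 o4; split; lra.
Qed.

(** * The scaled Hamilton-Jacobi equation *)

Lemma BUC_unif (R : realType) (V : normedModType R) (A : set V) (g : V -> R) :
  BUC A g -> (exists M, forall x, A x -> `|g x| <= M) /\
  (forall e, 0 < e -> exists2 r, 0 < r &
     forall x y, A x -> A y -> `|x - y| <= r -> `|g x - g y| <= e).
Proof.
move=> [hb hu]; split.
  by have [M [_ hM]] := hb; exists (M + 1) => x Ax; apply: hM => //; rewrite ltrDl.
move=> e e0; have [r r0 hr] := (unif_continuousP _).1 hu e e0.
exists (r / 2); first by rewrite divr_gt0.
move=> x y Ax Ay xy.
have xyb : ball x r y.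
  by rewrite -ball_normE /=; apply: (le_lt_trans xy); move: r0; clear; lra.
have : ball (g x) e (g y) := hr (SigSub (mem_set Ax), SigSub (mem_set Ay)) xyb.
by rewrite -ball_normE /= => /ltW.
Qed.

Record ham_struct (R : realType) (d : nat) (H : 'rV[R]_d -> 'rV[R]_d -> R) := HamStruct {
  hs_ge0 : forall p y, 0 <= H p y ;
  hs_0 : forall y, H 0 y = 0 ;
  hs_per : forall p y (z : 'rV[int]_d), H p (y + map_mx intr z) = H p y ;
  hs_coer : forall M, exists2 r, 0 < r & forall p y, r <= `|p| -> M <= H p y ;
  hs_lip : forall r, 0 < r -> exists2 L, 0 <= L & forall p q y z,
    `|p| <= r -> `|q| <= r -> `|H p y - H q z| <= L * (`|p - q| + `|y - z|)
}.

Lemma ham_structP (R : realType) (d : nat) (H : 'rV[R]_d -> 'rV[R]_d -> R) :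
  (forall p, Zd_periodic (H p)) -> coercive H ->
  (forall r : R, 0 < r ->
    [lipschitz H z.1 z.2 | z in [set z : 'rV[R]_d * 'rV[R]_d | `|z.1| <= r]]) ->
  (forall p y, 0 <= H p y) -> (forall y, H 0 y = 0) -> ham_struct H.
Proof.
move=> Hper Hcoer Hlip H0 H00; split=> //.
  move=> M; have [r hr] := Hcoer M; exists (`|r| + 1).
    by rewrite ltr_wpDl.
  move=> p y rp; apply: le_trans (hr p _) _.
    by apply: le_trans rp; apply: le_trans (ler_norm r) _; rewrite lerDl.
  (* [inf] is a lower bound only for sets that are bounded below, which [H >= 0] provides. *)
  apply: ge_inf; last by exists y.
  by exists 0 => _ [z _ <-]; exact: H0.
move=> r r0; have [M [_ hM]] := Hlip r r0.
exists (`|M| + 1); first by rewrite addr_ge0.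
move=> p q y z pr qr.
have := hM (`|M| + 1) _ ((p, y), (q, z)); move=> /(_ _)/= h.
apply: le_trans (h _ _) _.
- by apply: le_lt_trans (ler_norm M) _; rewrite ltrDl.
- by split.
apply: ler_wpM2l; first by rewrite addr_ge0.
rewrite prod_normE /= ge_max; apply/andP; split; [rewrite lerDl|rewrite lerDr];
  exact: normr_ge0.
Qed.

Definition reflected_ham (R : realType) (d : nat) (H : 'rV[R]_d -> 'rV[R]_d -> R) :=
  fun p y => H (- p) y.

Lemma ham_struct_reflected (R : realType) (d : nat) (H : 'rV[R]_d -> 'rV[R]_d -> R) :
  ham_struct H -> ham_struct (reflected_ham H).
Proof.
move=> [a b c e l]; split => //.
- by move=> p y; exact: a.
- by move=> y; rewrite /reflected_ham oppr0.
- by move=> p y z; exact: c.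
- by move=> M; have [r r0 hr] := e M; exists r => // p y; rewrite -(normrN p) => pr; exact: hr pr.
- move=> r r0; have [L L0 hL] := l r r0; exists L => // p q y z.
  rewrite -(normrN p) -(normrN q) => pr qr; apply: le_trans (hL _ _ y z pr qr) _.
  by rewrite -opprD normrN.
Qed.

Definition scaled_ham (R : realType) (d : nat) (H : 'rV[R]_d -> 'rV[R]_d -> R) (eps a : R)
  (x p : 'rV[R]_d) := a * H p (eps^-1 *: x).
Definition scaled_forcing (R : realType) (d : nat) (f : 'rV[R]_d -> R) (eps b : R)
  (x : 'rV[R]_d) := b * f (eps^-1 *: x).

(** For [a > 0] a level [Q] confines [p] to a ball by coercivity, and [H] is Lipschitz on the ball
    one unit larger, with a factor [eps^-1] from the fast variable. For [a = 0] the Hamiltonian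
    vanishes. *)
Lemma scaled_ham_good (R : realType) (d : nat) (H : 'rV[R]_d -> 'rV[R]_d -> R) (eps a : R) :
  ham_struct H -> 0 < eps -> 0 <= a -> ham_good (scaled_ham H eps a).
Proof.
move=> hH e0 a0; split; last 2 first.
- by move=> x p; rewrite /scaled_ham mulr_ge0// (hs_ge0 hH).
- by move=> x; rewrite /scaled_ham (hs_0 hH) mulr0.
move=> Q; have [az|an] := eqVneq a 0.
  exists 0 => // x y p p' _ _; rewrite /scaled_ham az !mul0r subrr normr0//.
have ap : 0 < a by rewrite lt_neqAle eq_sym an.
have [r r0 hr] := hs_coer hH (`|Q| / a + 1).
have r10 : 0 < r + 1 by rewrite addr_gt0.
have [L L0 hL] := hs_lip hH r10.
have ie : 0 <= eps^-1 by rewrite invr_ge0 ltW.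
exists (a * L * (1 + eps^-1)); first by rewrite !mulr_ge0// addr_ge0.
move=> x y p p' GQ pp.
have pr : `|p| <= r.
  rewrite leNgt; apply/negP => rp; have := hr p (eps^-1 *: x) (ltW rp).
  have := GQ; rewrite /scaled_ham -ler_pdivlMl// mulrC.
  have : Q / a <= `|Q| / a by rewrite ler_pM2r ?invr_gt0// ler_norm.
  clear; lra.
have p'r : `|p'| <= r + 1.
  have -> : p' = p - (p - p') by rewrite opprB addrC subrK.
  by apply: le_trans (ler_normB _ _) _; exact: lerD.
have pr1 : `|p| <= r + 1 by apply: le_trans pr _; rewrite lerDl.
rewrite /scaled_ham -mulrBr normrM (ger0_norm a0).
have := hL p' p (eps^-1 *: y) (eps^-1 *: x) p'r pr1.
rewrite -scalerBr.
have -> : `|eps^-1 *: (y - x)| = eps^-1 * `|y - x|.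
  by rewrite normrZ; congr (_ * _); rewrite ger0_norm.
rewrite (distrC p') (distrC y) => /(ler_wpM2l a0)/le_trans; apply.
rewrite -!mulrA; apply: ler_wpM2l => //; apply: ler_wpM2l => //.
have := normr_ge0 (p - p'); have := normr_ge0 (x - y).
move: (`|x - y|) (`|p - p'|) => X Y X0 Y0.
have h1 : 0 <= eps^-1 * Y by rewrite mulr_ge0.
move: X0 h1; clear; lra.
Qed.

Lemma scaled_forcing_bound (R : realType) (d : nat) (f : 'rV[R]_d -> R) (eps b : R) :
  (forall y, `|f y| <= 1) -> forall x, `|scaled_forcing f eps b x| <= `|b|.
Proof. by move=> hf x; rewrite /scaled_forcing normrM ler_piMr. Qed.

Lemma scaled_forcing_unif (R : realType) (d : nat) (f : 'rV[R]_d -> R) (eps b : R) :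
  unif_cont f -> 0 < eps -> unif_cont (scaled_forcing f eps b).
Proof.
move=> hf e0 e ep; have b1 : 0 < `|b| + 1 by rewrite ltr_wpDl.
have [r r0 hr] := hf (e / (`|b| + 1)) (divr_gt0 ep b1).
exists (eps * r); first by rewrite mulr_gt0.
move=> x y xy; rewrite /scaled_forcing -mulrBr normrM.
have h : `|eps^-1 *: x - eps^-1 *: y| <= r.
  rewrite -scalerBr.
  have -> : `|eps^-1 *: (x - y)| = eps^-1 * `|x - y|.
    by rewrite normrZ; congr (_ * _); rewrite ger0_norm// invr_ge0 ltW.
  by rewrite ler_pdivrMl.
have := hr _ _ h; rewrite ler_pdivlMr// mulrC; apply: le_trans.
by rewrite ler_wpM2r// lerDl.
Qed.

(** * Affine changes of variables and continuous dependence on the data *)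

Lemma sub_on_affine (R : realType) (d : nat) (t0 t1 s0 c : R) (z : 'rV[R]_d)
    (F : 'rV[R]_d -> 'rV[R]_d -> R) (u : 'rV[R]_d -> R -> R) :
  0 < c -> sub_on (s0 + c * t0) (s0 + c * t1) F u ->
  sub_on t0 t1 (fun x p => c * F (x + z) p) (fun x t => u (x + z) (s0 + c * t)).
Proof.
move=> c0 su q q' tau tau' hq ht x t /andP[a1 a2] [r r0 hr].
pose Q (i : 'I_d) (s : R) := q i (s - z 0 i).
pose Q' (i : 'I_d) (s : R) := 1 * q' i (s - z 0 i).
have hQ i : C1fun (Q i) (Q' i).
  have h : C1fun (fun s : R => s - z 0 i) (fun _ => 1 + 0).
    by apply: C1funD; [exact: C1fun_id|exact: C1fun_cst].
  by have := C1fun_comp (hq i) h; rewrite addr0.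
pose T (s : R) := tau (c^-1 * (s - s0)).
pose T' (s : R) := c^-1 * tau' (c^-1 * (s - s0)).
have hT : C1fun T T'.
  have h : C1fun (fun s : R => c^-1 * (s - s0)) (fun _ => c^-1 * (1 + 0)).
    by apply: C1funZ; apply: C1funD; [exact: C1fun_id|exact: C1fun_cst].
  by have := C1fun_comp ht h; rewrite addr0 mulr1.
have ct : c^-1 * (s0 + c * t - s0) = t by rewrite addrC addKr mulKf// gt_eqF.
have HH := su Q Q' T T' hQ hT (x + z) (s0 + c * t).
have Qs (y : 'rV[R]_d) : \sum_i Q i (y 0 i) = \sum_i q i ((y - z) 0 i).
  by apply: eq_bigr => i _; rewrite /Q !mxE.
feed HH; first by rewrite !ltrD2l !ltr_pM2l// a1.
feed HH.
  exists (Num.min r (c * r)); first by rewrite lt_min r0 mulr_gt0.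
  move=> y s; rewrite !lt_min => /andP[h1 _] /andP[_ h2].
  rewrite !Qs /T ct addrK.
  have := hr (y - z) (c^-1 * (s - s0)).
  rewrite subrK mulVKf ?gt_eqF// [s0 + _]addrC subrK.
  have -> : y - z - x = y - (x + z) by rewrite opprD addrA addrAC.
  move=> H; apply: (H h1).
  have -> : c^-1 * (s - s0) - t = c^-1 * (s - (s0 + c * t)).
    by field; rewrite gt_eqF.
  by rewrite normrM gtr0_norm ?invr_gt0// ltr_pdivrMl.
move: HH; rewrite /T' ct.
have -> : \row_i Q' i ((x + z) 0 i) = \row_i q' i (x 0 i).
  by apply/rowP => i; rewrite !mxE /Q' mul1r addrK.
by rewrite -(pmulr_rle0 _ c0) mulrDr mulVKf// gt_eqF.
Qed.

Lemma unif_on_affine (R : realType) (d : nat) (t0 t1 s0 c : R) (z : 'rV[R]_d)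
    (u : 'rV[R]_d -> R -> R) : 0 < c ->
  unif_on (s0 + c * t0) (s0 + c * t1) u ->
  unif_on t0 t1 (fun x t => u (x + z) (s0 + c * t)).
Proof.
move=> c0 uu e e0; have [r r0 hr] := uu e e0.
exists (Num.min r (c^-1 * r)); first by rewrite lt_min r0 mulr_gt0// invr_gt0.
move=> x y s t si ti; rewrite !le_min => /andP[h1 _] /andP[_ h2].
apply: hr; rewrite ?lerD2l ?ler_pM2l//.
  by rewrite opprD addrACA subrr addr0.
have -> : s0 + c * s - (s0 + c * t) = c * (s - t) by ring.
by rewrite normrM gtr0_norm// -ler_pdivlMl.
Qed.

(** Dilating time multiplies Hamiltonian and forcing by the same factor. With [z = 0] this changes
    the amplitude [a]; with [c = 1] it gives translations in time and by a period. *)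
Lemma strip_sol_affine (R : realType) (d : nat) (t0 t1 s0 c : R) (z : 'rV[R]_d) G g
    (u : 'rV[R]_d -> R -> R) : 0 < c ->
  strip_sol (s0 + c * t0) (s0 + c * t1) G g u ->
  strip_sol t0 t1 (fun x p => c * G (x + z) p) (fun x => c * g (x + z))
    (fun x t => u (x + z) (s0 + c * t)).
Proof.
move=> c0 [su sv [M bu] uu]; split.
- have := sub_on_affine (z:=z) c0 su; congr sub_on.
  by apply/funext => x; apply/funext => p; rewrite mulrDr.
- have := sub_on_affine (z:=z) c0 sv; congr sub_on.
  by apply/funext => x; apply/funext => p; rewrite mulrN mulrDr.
- by exists M => x t ti; apply: bu; rewrite !lerD2l !ler_pM2l.
- exact: unif_on_affine.
Qed.

Lemma strip_compare (R : realType) (d : nat) (t0 t1 c0 c1 Mg : R) G g g'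
    (u v : 'rV[R]_d -> R -> R) :
  ham_good G -> (forall x, `|g x| <= Mg) -> (forall x, `|g' x| <= Mg) ->
  unif_cont g -> unif_cont g' -> 0 <= c1 -> (forall x, `|g x - g' x| <= c1) ->
  strip_sol t0 t1 G g u -> strip_sol t0 t1 G g' v ->
  (forall x, `|u x t0 - v x t0| <= c0) ->
  forall x t, t0 <= t <= t1 -> `|u x t - v x t| <= c0 + c1 * (t - t0).
Proof.
move=> [hG _ _] gM gM' ug ug' c10 gg [su su' [M bu] uu] [sv sv' [M' bv] uv] uv0 x t /andP[tt0 tt1].
have [<-|tneq] := eqVneq t0 t; first by rewrite subrr mulr0 addr0.
have tlt : t0 < t by rewrite lt_neqAle tneq.
have t01 : t0 < t1 by exact: lt_le_trans tt1.
pose N := Num.max M M'.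
have bu' : bounded_on t0 t1 N u by move=> y s si; rewrite le_max bu.
have bv' : bounded_on t0 t1 N v by move=> y s si; rewrite le_max bv// orbT.
have side g1 g2 (w1 w2 : 'rV[R]_d -> R -> R) : (forall x, `|g1 x| <= Mg) -> unif_cont g1 ->
    (forall x, g2 x <= g1 x + c1) ->
    sub_on t0 t1 (fun x p => G x p + g1 x) w1 ->
    sub_on t0 t1 (fun x p => - (G x (- p) + g2 x)) (fun x t => - w2 x t) ->
    bounded_on t0 t1 N w1 -> bounded_on t0 t1 N w2 -> unif_on t0 t1 w1 -> unif_on t0 t1 w2 ->
    (forall x, w1 x t0 - w2 x t0 <= c0) -> w1 x t - w2 x t <= c0 + c1 * (t - t0).
  move=> h1 h2 h3 h4 h5 h6 h7 h8 h9 h10.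
  have main := comparison hG h1 h2 c10 h3 h4 h5 h6 h7 h8 h9 h10.
  have [tt|tt] := ltP t t1; first by apply: main; rewrite tt0.
  have -> : t = t1 by apply/eqP; rewrite eq_le tt1.
  have uw : unif_on t0 t1 (fun x t => w1 x t - w2 x t).
    move=> e e0; have e20 : 0 < e / 2 by rewrite divr_gt0.
    have [ra ra0 ha] := h8 _ e20; have [rb rb0 hb] := h9 _ e20.
    exists (Num.min ra rb); first by rewrite lt_min ra0.
    move=> y y' s s' si si'; rewrite !le_min => /andP[q1 q2] /andP[q3 q4].
    have /ler_normlP[w11 w12] := ha _ _ _ _ si si' q1 q3.
    have /ler_normlP[w21 w22] := hb _ _ _ _ si si' q2 q4.
    by rewrite ler_norml; apply/andP; clear -w11 w12 w21 w22; split; lra.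
  apply: (@end_le _ _ _ _ (fun x t => w1 x t - w2 x t) x (fun t => c0 + c1 * (t - t0)) t01 uw).
    exact: (C1fun_continuous (C1fun_lin c0 c1 t0)).
  by move=> s si; exact: main.
rewrite ler_norml; apply/andP; split; last first.
  apply: (side g g') => //; first by move=> y; have /ler_normlP[q1 q2] := gg y; move: q1 q2; clear; lra.
  by move=> y; have /ler_normlP[_] := uv0 y.
rewrite lerNl opprB.
apply: (side g' g) => //; first by move=> y; have /ler_normlP[q1 q2] := gg y; move: q1 q2; clear; lra.
by move=> y; have /ler_normlP[] := uv0 y; rewrite opprB.
Qed.

Lemma scaled_ham_scale (R : realType) (d : nat) (H : 'rV[R]_d -> 'rV[R]_d -> R) (eps a c : R) :
  (fun x p => c * scaled_ham H eps a (x + 0) p) = scaled_ham H eps (c * a).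
Proof. by apply/funext => x; apply/funext => p; rewrite /scaled_ham addr0 mulrA. Qed.

Lemma scaled_forcing_scale (R : realType) (d : nat) (f : 'rV[R]_d -> R) (eps b c : R) :
  (fun x => c * scaled_forcing f eps b (x + 0)) = scaled_forcing f eps (c * b).
Proof. by apply/funext => x; rewrite /scaled_forcing addr0 mulrA. Qed.

Lemma scaled_forcing_diff (R : realType) (d : nat) (f : 'rV[R]_d -> R) (eps b b' : R) :
  (forall y, `|f y| <= 1) -> forall x, `|scaled_forcing f eps b x - scaled_forcing f eps b' x| <= `|b - b'|.
Proof. by move=> hf x; rewrite /scaled_forcing -mulrBl normrM ler_piMr. Qed.

Lemma strip_compare_forcing (R : realType) (d : nat) (H : 'rV[R]_d -> 'rV[R]_d -> R)
    (f : 'rV[R]_d -> R) (eps a b b' t0 t1 c0 : R) (u v : 'rV[R]_d -> R -> R) :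
  ham_struct H -> (forall y, `|f y| <= 1) -> unif_cont f -> 0 < eps -> 0 <= a ->
  strip_sol t0 t1 (scaled_ham H eps a) (scaled_forcing f eps b) u ->
  strip_sol t0 t1 (scaled_ham H eps a) (scaled_forcing f eps b') v ->
  (forall x, `|u x t0 - v x t0| <= c0) ->
  forall x t, t0 <= t <= t1 -> `|u x t - v x t| <= c0 + `|b - b'| * (t - t0).
Proof.
move=> hH hf uf e0 a0 su sv uv.
have hG := scaled_ham_good hH e0 a0.
apply: (@strip_compare R d t0 t1 c0 `|b - b'| (`|b| + `|b'|) _ _ _ u v hG) su sv uv => //.
- by move=> x; apply: le_trans (scaled_forcing_bound _ _ hf x) _; rewrite lerDl.
- by move=> x; apply: le_trans (scaled_forcing_bound _ _ hf x) _; rewrite lerDr.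
- exact: scaled_forcing_unif.
- exact: scaled_forcing_unif.
- exact: scaled_forcing_diff.
Qed.

(** The difference between [a * H] and [a' * H] is unbounded in the gradient, so the two equations
    cannot be compared directly. Dilating the time of [u] by [c = a' / a] gives it the amplitude
    [a']; then only the forcings [c * b] and [b'] differ, and the uniform continuity of [u] undoes
    the dilation. *)
Lemma strip_continuity_pos (R : realType) (d : nat) (H : 'rV[R]_d -> 'rV[R]_d -> R)
    (f : 'rV[R]_d -> R) (eps a b t0 t1 : R) (u : 'rV[R]_d -> R -> R) :
  ham_struct H -> (forall y, `|f y| <= 1) -> unif_cont f -> 0 < eps -> 0 < a ->
  t0 < t1 -> strip_sol t0 t1 (scaled_ham H eps a) (scaled_forcing f eps b) u ->
  forall dl, 0 < dl -> exists2 r, 0 < r & forall v a' b', 0 < a' ->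
    strip_sol t0 t1 (scaled_ham H eps a') (scaled_forcing f eps b') v ->
    `|a - a'| <= r -> `|b - b'| <= r -> (forall x, `|u x t0 - v x t0| <= r) ->
    forall x t, t0 <= t <= t1 -> `|u x t - v x t| <= dl.
Proof.
move=> hH hf uf e0 a0 t01 su dl dl0.
pose D := dl / 16; have D0 : 0 < D by rewrite divr_gt0.
have dlD : dl = 16 * D by rewrite /D; field.
clearbody D.
pose T := t1 - t0; have T0 : 0 < T by rewrite subr_gt0.
have [_ _ _ uu] := su.
have [ru ru0 hru] := uu _ D0.
have q0 : 0 < T * (`|b| / a + 1) by rewrite mulr_gt0// ltr_wpDl// divr_ge0// ltW.
(* In order: the initial error is at most [D], [c] is within [1 / 2] of [1], the dilation moves
   times by at most [ru], and the difference of the forcings accumulates to at most [D]. *)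
exists (Num.min (Num.min D (a / 2)) (Num.min (a * ru / T) (D / (T * (`|b| / a + 1))))).
  by rewrite !lt_min D0 !divr_gt0// mulr_gt0.
move=> v a' b' a'0 sv.
rewrite !le_min => /andP[/andP[_ ar1] /andP[ar2 ar3]] /andP[_ /andP[_ br3]] uv x t ti.
have uvD y : `|u y t0 - v y t0| <= D.
  by move: (uv y); rewrite !le_min => /andP[/andP[]].
pose c := a' / a; have c0 : 0 < c by rewrite divr_gt0.
have ca : c * a = a' by rewrite divfK// gt_eqF.
have c1 : `|c - 1| = `|a - a'| / a.
  have -> : c - 1 = (a' - a) / a by rewrite /c; field; rewrite gt_eqF.
  by rewrite normrM normfV (gtr0_norm a0) distrC.
have c1T : `|c - 1| * T <= ru.
  by move: ar2; rewrite c1 ler_pdivlMr// mulrAC ler_pdivrMr// mulrC [X in _ -> _ <= X]mulrC mulrC.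
have c2 : `|c - 1| <= 1 / 2.
  by rewrite c1 ler_pdivrMr//; move: ar1; clear; lra.
have cb : `|c * b - b'| * T <= D.
  have : `|c * b - b'| <= `|c - 1| * `|b| + `|b - b'|.
    have -> : c * b - b' = (c - 1) * b + (b - b') by ring.
    by rewrite -normrM; exact: ler_normD.
  move/(ler_wpM2r (ltW T0))/le_trans; apply.
  set m := D / _ in ar3 br3.
  have : `|c - 1| * `|b| + `|b - b'| <= m * (`|b| / a + 1).
    have : `|c - 1| * `|b| <= m * (`|b| / a).
      rewrite c1 mulrAC -mulrA; apply: ler_wpM2r => //.
      by rewrite divr_ge0// ltW.
    by move: br3; clear; lra.
  move/(ler_wpM2r (ltW T0))/le_trans; apply.
  have -> : m * (`|b| / a + 1) * T = m * (T * (`|b| / a + 1)) by ring.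
  by rewrite /m divfK// gt_eqF.
have /ler_normlP[c3 c4] := c2.
pose T' := Num.min T (T / c).
have T'0 : 0 < T' by rewrite lt_min T0 divr_gt0.
have T'T : T' <= T by rewrite ge_min lexx.
have cT' : c * T' <= T.
  have : T' <= T / c by rewrite ge_min lexx orbT.
  by rewrite ler_pdivlMr// mulrC.
have TT' : T - T' <= `|c - 1| * T.
  rewrite /T'; have [h|h] := leP T (T / c); first by rewrite subrr mulr_ge0// ltW.
  have c1' : 1 < c by move: h; rewrite ltr_pdivrMr// -{1}[T]mulr1 ltr_pM2l.
  rewrite gtr0_norm ?subr_gt0//.
  have -> : T - T / c = (c - 1) * T / c by field; rewrite gt_eqF.
  rewrite ler_pdivrMr// ler_peMr//; last exact: ltW.
  by rewrite mulr_ge0// ?subr_ge0 ltW.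
have TT2 : T - T' <= T'.
  apply: le_trans TT' _.
  have : T / 2 <= T'.
    rewrite le_min; apply/andP; split; first by move: T0; clear; lra.
    by rewrite ler_pM2l// lef_pV2 ?posrE//; move: c4; clear; lra.
  have := ler_wpM2r (ltW T0) c2; clear; lra.
clearbody T'.
pose t1' := t0 + T'.
pose s0 := t0 - c * t0.
have E0 : s0 + c * t0 = t0 by rewrite /s0 subrK.
have E1 : s0 + c * t1' = t0 + c * T' by rewrite /s0 /t1'; ring.
have t1'1 : t1' <= t1 by move: T'T; rewrite /t1' /T; clear; lra.
have sut : strip_sol t0 t1' (scaled_ham H eps a') (scaled_forcing f eps (c * b)) (fun x t => u (x + 0) (s0 + c * t)).
  rewrite -ca -scaled_ham_scale -scaled_forcing_scale; apply: strip_sol_affine => //.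
  rewrite E0 E1; apply: strip_sol_restrict su => //.
  by move: cT'; rewrite /T; clear; lra.
have sv' : strip_sol t0 t1' (scaled_ham H eps a') (scaled_forcing f eps b') v.
  exact: strip_sol_restrict sv.
have near_u y s : t0 <= s <= t1' -> `|u y (s0 + c * s) - u y s| <= D.
  move=> /andP[s1 s2]; apply: hru; rewrite ?subrr ?normr0 ?(ltW ru0)//.
  - have : c * (s - t0) <= c * T' by rewrite ler_pM2l//; move: s2; rewrite /t1'; clear; lra.
    have : 0 <= c * (s - t0) by rewrite mulr_ge0 ?subr_ge0// ltW.
    move: cT'; rewrite /s0 /T; clear => h1 h2 h3; apply/andP; split; lra.
  - by rewrite s1 (le_trans s2).
  - have -> : s0 + c * s - s = (c - 1) * (s - t0) by rewrite /s0; ring.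
    rewrite normrM; apply: le_trans c1T; apply: ler_wpM2l => //.
    rewrite ger0_norm ?subr_ge0//; move: s2 T'T; rewrite /t1'; clear; lra.
have cmp1 y s : t0 <= s <= t1' -> `|u y s - v y s| <= 3 * D.
  move=> si; have := @strip_compare_forcing R d H f eps a' (c * b) b' t0 t1' D _ _ hH hf uf e0 (ltW a'0) sut sv' _ y s si.
  rewrite addr0 => h; feed h.
    by move=> z; rewrite addr0 E0.
  have cbs : `|c * b - b'| * (s - t0) <= D.
    apply: le_trans cb; apply: ler_wpM2l => //.
    by case/andP: si => _; move: T'T; rewrite /t1'; clear; lra.
  have := near_u y s si; move: h cbs.
  rewrite !ler_norml => /andP[h1 h2] h3 /andP[h4 h5].
  by apply/andP; clear -h1 h2 h3 h4 h5; split; lra.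
case/andP: ti => tt0 tt1.
have [tt|tt] := leP t t1'.
  apply: le_trans (cmp1 x t _) _; first by rewrite tt0.
  by rewrite dlD; move: D0; clear; lra.
(* The dilated [u] only reaches [t1']. For the remaining time the modulus of continuity of [v] is of
   no help, not being uniform in [v]; instead [v] is compared with its own translate by [sg], a
   solution of the same equation whose initial value is close by the first part. *)
pose sg := t1 - t1'.
have sgE : sg = T - T' by rewrite /sg /t1' /T; ring.
have sg0 : 0 <= sg by rewrite subr_ge0.
have svt : strip_sol t0 t1' (scaled_ham H eps a') (scaled_forcing f eps b') (fun x t => v (x + 0) (sg + 1 * t)).
  rewrite -[a']mul1r -[b']mul1r -scaled_ham_scale -scaled_forcing_scale; apply: strip_sol_affine => //.
  rewrite !mul1r; apply: strip_sol_restrict sv; first by rewrite lerDr.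
  by rewrite /sg subrK.
have i0 : t0 <= t0 <= t1 by rewrite lexx ltW.
have ts : t0 <= t0 + sg <= t1'.
  by rewrite lerDl sg0 /t1' lerD2l sgE.
have v0 y : `|v (y + 0) (sg + 1 * t0) - v y t0| <= 5 * D.
  rewrite addr0 mul1r [sg + t0]addrC.
  have h1 := cmp1 y _ ts; have h2 := uvD y.
  have h3 : `|u y (t0 + sg) - u y t0| <= D.
    apply: hru => //; rewrite ?subrr ?normr0 ?(ltW ru0)//.
      by case/andP: ts => -> /le_trans; apply.
    by rewrite addrC addKr ger0_norm// sgE; exact: le_trans TT' c1T.
  move: h1 h2 h3; rewrite !ler_norml => /andP[h1 h2] /andP[h3 h4] /andP[h5 h6].
  by apply/andP; clear -h1 h2 h3 h4 h5 h6; split; lra.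
have si : t0 <= t - sg <= t1'.
  rewrite lerBrDr; apply/andP; split; last by move: tt1; rewrite /sg; clear; lra.
  by apply: le_trans (ltW tt); case/andP: ts.
have := strip_compare_forcing hH hf uf e0 (ltW a'0) svt sv' v0 x si.
rewrite addr0 mul1r subrr normr0 mul0r addr0 [sg + _]addrC subrK => h1.
have h2 := cmp1 x _ si.
have h3 : `|u x t - u x (t - sg)| <= D.
  apply: hru; rewrite ?subrr ?normr0 ?(ltW ru0)// ?tt0//.
    by case/andP: si => -> /le_trans; apply.
  by rewrite opprB addrC subrK ger0_norm// sgE; exact: le_trans TT' c1T.
move: h1 h2 h3; rewrite dlD !ler_norml => /andP[h1 h2] /andP[h3 h4] /andP[h5 h6].
by apply/andP; clear -h1 h2 h3 h4 h5 h6 D0; split; lra.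
Qed.

(* For [a < 0] the function [- u] solves the equation with Hamiltonian [- a * H (- p)], so that
   only nonnegative Hamiltonians have to be studied. *)
Definition signed_strip_sol (R : realType) (d : nat) (H : 'rV[R]_d -> 'rV[R]_d -> R)
    (f : 'rV[R]_d -> R) (eps t0 t1 a b : R) (u : 'rV[R]_d -> R -> R) :=
  (0 <= a -> strip_sol t0 t1 (scaled_ham H eps a) (scaled_forcing f eps b) u) /\
  (a <= 0 -> strip_sol t0 t1 (scaled_ham (reflected_ham H) eps (- a)) (scaled_forcing f eps (- b))
     (fun x t => - u x t)).

Lemma strip_continuity (R : realType) (d : nat) (H : 'rV[R]_d -> 'rV[R]_d -> R)
    (f : 'rV[R]_d -> R) (eps a b t0 t1 : R) (u : 'rV[R]_d -> R -> R) :
  ham_struct H -> (forall y, `|f y| <= 1) -> unif_cont f -> 0 < eps ->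
  t0 < t1 -> signed_strip_sol H f eps t0 t1 a b u ->
  forall dl, 0 < dl -> exists2 r, 0 < r & forall v a' b',
    signed_strip_sol H f eps t0 t1 a' b' v -> Num.sg a = Num.sg a' ->
    `|a - a'| <= r -> `|b - b'| <= r -> (forall x, `|u x t0 - v x t0| <= r) ->
    forall x t, t0 <= t <= t1 -> `|u x t - v x t| <= dl.
Proof.
move=> hH hf uf e0 t01 [sp sn] dl dl0.
have [a0|a0|a0] := ltgtP a 0.
- have na0 : 0 < - a by rewrite oppr_gt0.
  have [r r0 hr] := strip_continuity_pos (ham_struct_reflected hH) hf uf e0 na0 t01 (sn (ltW a0)) dl0.
  exists r => // v a' b' [_ sn'] sg h1 h2 h3 x t ti.
  have a'0 : a' < 0 by move: sg; rewrite ltr0_sg// => /esym/eqP; rewrite sgr_cp0.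
  have na'0 : 0 < - a' by rewrite oppr_gt0.
  have := hr (fun x t => - v x t) (- a') (- b') na'0 (sn' (ltW a'0)).
  rewrite -!opprD !normrN => /(_ h1 h2) H1.
  have := H1 _ x t ti; rewrite -!opprD !normrN; apply.
  by move=> y; rewrite -opprD normrN.
- have [r r0 hr] := strip_continuity_pos hH hf uf e0 a0 t01 (sp (ltW a0)) dl0.
  exists r => // v a' b' [sp' _] sg; apply: hr; last apply: sp'.
    by move: sg; rewrite gtr0_sg// => /esym/eqP; rewrite sgr_cp0.
  by move: sg; rewrite gtr0_sg// => /esym/eqP; rewrite sgr_cp0 => /ltW.
(* Case [a = 0]: equality of signs forces [a' = 0], both Hamiltonians vanish, and only the forcings
   are compared. *)
pose T := t1 - t0; have T0 : 0 < T by rewrite subr_gt0.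
exists (dl / (1 + T)); first by rewrite divr_gt0// addr_gt0.
move=> v a' b' [sp' _]; rewrite a0 sgr0 => /esym/eqP; rewrite sgr_eq0 => /eqP a'0 _ h2 h3 x t ti.
rewrite a0 in sp; rewrite a'0 in sp'.
have := strip_compare_forcing hH hf uf e0 (lexx 0) (sp (lexx 0)) (sp' (lexx 0)) h3 x ti.
move/le_trans; apply.
have T1 : 0 < 1 + T by rewrite addr_gt0.
have e1 : dl / (1 + T) * (1 + T) = dl by rewrite divfK// gt_eqF.
have : `|b - b'| * (t - t0) <= dl / (1 + T) * T.
  apply: ler_pM => //; first by rewrite subr_ge0; case/andP: ti.
  by rewrite lerB//; case/andP: ti.
by move: e1; clear; lra.
Qed.

Lemma walk_derive1 (R : realType) (eta : R) (X : nat -> R) (W : R -> R) k t :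
  interpolated_walk eta X W -> k%:R * eta < t < k.+1%:R * eta ->
  derive1 W t = X k / Num.sqrt eta.
Proof.
move=> [_ hW] /andP[t1 t2].
pose g s := W (k%:R * eta) + X k / Num.sqrt eta * (s - k%:R * eta).
have [hg _] := C1fun_lin (W (k%:R * eta)) (X k / Num.sqrt eta) (k%:R * eta).
have [_ dg] := hg t.
rewrite derive1E (@near_eq_derive _ _ _ W g); first by rewrite dg add0r addr0 mulr1.
have o : open `]k%:R * eta, k.+1%:R * eta[%classic by exact: interval_open.
have ti : `]k%:R * eta, k.+1%:R * eta[%classic t by rewrite /= in_itv /= t1 t2.
near=> s; rewrite /g.
have : `]k%:R * eta, k.+1%:R * eta[%classic s by near: s; exact: (open_nbhs_nbhs (conj o ti)).
rewrite /= in_itv /= => /andP[s1 s2].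
rewrite (hW k); last by rewrite !ltW.
by congr (_ + _); ring.
Unshelve. all: by end_near. Qed.

(** * Assembling the strips *)

Section solution.
Variables (R : realType) (d : nat) (H : 'rV[R]_d -> 'rV[R]_d -> R)
  (f : 'rV[R]_d -> R) (eps eta : R).
Hypotheses (hH : ham_struct H) (hf : forall y, `|f y| <= 1) (uf : unif_cont f)
  (eps0 : 0 < eps) (eta0 : 0 < eta).

Lemma signed_strip_sol_of_solution (X1 X2 : nat -> R) (W1 W2 : R -> R)
    (u : 'rV[R]_d -> path_space R) k :
  interpolated_walk eta X1 W1 -> interpolated_walk eta X2 W2 ->
  is_solution H f eps eta W1 W2 u ->
  signed_strip_sol H f eps (k%:R * eta) (k.+1%:R * eta) (X1 k / Num.sqrt eta)
    (X2 k / Num.sqrt eta) (fun x t => u x t).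
Proof.
move=> hW1 hW2 [_ hB hV].
set t0 := k%:R * eta; set t1 := k.+1%:R * eta.
set a := X1 k / _; set b := X2 k / _.
have t00 : 0 <= t0 by rewrite mulr_ge0// ltW.
have t10 : 0 < t1 by rewrite mulr_gt0// ltr0n.
have [[M bM] hU] := BUC_unif (hB t1 t10).
have inA (x : 'rV[R]_d) t : t0 <= t <= t1 -> ([set: 'rV[R]_d] `*` `[0, t1]) (x, t).
  by move=> /andP[q1 q2]; split => //=; rewrite in_itv /= q2 (le_trans t00).
have bu : bounded_on t0 t1 M (fun x t => u x t) by move=> x t ti; exact: (bM _ (inA x t ti)).
have uu : unif_on t0 t1 (fun x t => u x t).
  move=> e e0; have [r r0 hr] := hU e e0; exists r => // x y s t si ti h1 h2.
  apply: (hr _ _ (inA x s si) (inA y t ti)).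
  by rewrite prod_normE /= ge_max h1.
have [_ vs vS] := hV k.
pose F (z : 'rV[R]_d * R) (p : 'rV[R]_d) := H p (eps^-1 *: z.1) * derive1 W1 z.2 +
  f (eps^-1 *: z.1) * derive1 W2 z.2.
rewrite -/F in vs vS.
pose F0 (x p : 'rV[R]_d) := scaled_ham H eps a x p + scaled_forcing f eps b x.
have FF0 x t p : t0 < t < t1 -> F (x, t) p = F0 x p.
  move=> ti; rewrite /F /F0 /= (walk_derive1 hW1 ti) (walk_derive1 hW2 ti).
  by rewrite /scaled_ham /scaled_forcing [a * _]mulrC [b * _]mulrC.
have s1 := @sub_on_of_viscosity R d t0 t1 F F0 (fun x t => u x t) FF0 vs.
have s2 := @super_on_of_viscosity R d t0 t1 F F0 (fun x t => u x t) FF0 vS.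
split=> a0; split=> //.
- by exists M.
- have := s2; congr sub_on; apply/funext => x; apply/funext => p.
  by rewrite /F0 /scaled_ham /scaled_forcing /reflected_ham opprD !mulNr.
- have := s1; congr sub_on; first apply/funext => x; first apply/funext => p.
    by rewrite /F0 /scaled_ham /scaled_forcing /reflected_ham opprK !mulNr -opprD opprK.
  by apply/funext => x; apply/funext => t; rewrite opprK.
- by exists M => x t ti; rewrite normrN; exact: bu.
- exact: unif_onN.
Qed.

(** The error at time [k%:R * eta] is an initial error for the next strip, so the tolerances are
    fixed backwards, from the last strip to the first. *)
Lemma solution_continuity (X1 X2 : nat -> R) (W1 W2 : R -> R)
    (u : 'rV[R]_d -> path_space R) :
  interpolated_walk eta X1 W1 -> interpolated_walk eta X2 W2 ->
  is_solution H f eps eta W1 W2 u ->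
  forall k dl, 0 < dl -> exists2 r, 0 < r &
   forall (Y1 Y2 : nat -> R) (V1 V2 : R -> R) (v : 'rV[R]_d -> path_space R),
   interpolated_walk eta Y1 V1 -> interpolated_walk eta Y2 V2 ->
   is_solution H f eps eta V1 V2 v ->
   (forall i, (i < k)%N -> [/\ `|X1 i - Y1 i| <= r, `|X2 i - Y2 i| <= r &
      Num.sg (X1 i) = Num.sg (Y1 i)]) ->
   forall x t, 0 <= t <= k%:R * eta -> `|u x t - v x t| <= dl.
Proof.
move=> hW1 hW2 hu; elim=> [|k IH] dl dl0.
  exists 1 => // Y1 Y2 V1 V2 v _ _ [v0 _ _] _ x t; rewrite mul0r => t0.
  have -> : t = 0 by apply/eqP; rewrite eq_le andbC.
  by have [u0 _ _] := hu; rewrite u0 v0 subrr normr0 ltW.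
have t01 : k%:R * eta < k.+1%:R * eta by rewrite ltr_pM2r// ltr_nat.
have se0 : 0 < Num.sqrt eta by rewrite sqrtr_gt0.
have [r1 r10 hr1] := strip_continuity hH hf uf eps0 t01 (signed_strip_sol_of_solution k hW1 hW2 hu) dl0.
have [r2 r20 hr2] := IH _ (ltac:(by rewrite lt_min dl0 r10) : 0 < Num.min dl r1).
exists (Num.min r2 (r1 * Num.sqrt eta)); first by rewrite lt_min r20 mulr_gt0.
move=> Y1 Y2 V1 V2 v hV1 hV2 hv close x t /andP[tt0 tt1].
have prev : forall y s, 0 <= s <= k%:R * eta -> `|u y s - v y s| <= Num.min dl r1.
  apply: hr2 hV1 hV2 hv _ => i ik.
  have [] := close i (leqW ik).
  by rewrite !le_min => /andP[-> _] /andP[-> _] ->.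
have [tk|tk] := leP t (k%:R * eta).
  by have := prev x t; rewrite tt0 tk le_min => /(_ erefl)/andP[].
have [] := close k (leqnn _); rewrite !le_min => /andP[_ c1] /andP[_ c2] c3.
apply: (hr1 _ _ _ (signed_strip_sol_of_solution k hV1 hV2 hv)).
- by rewrite !sgrM c3.
- by rewrite -mulrBl normrM normfV (gtr0_norm se0) ler_pdivrMr.
- by rewrite -mulrBl normrM normfV (gtr0_norm se0) ler_pdivrMr.
- move=> y; have := prev y (k%:R * eta).
  by rewrite lexx mulr_ge0 ?(ltW eta0)// le_min => /(_ erefl)/andP[].
- by rewrite (ltW tk).
Qed.

Hypothesis fper : Zd_periodic f.

Lemma shiftE (x : 'rV[R]_d) (z : 'rV[int]_d) :
  eps^-1 *: (x + eps *: map_mx intr z) = eps^-1 *: x + map_mx intr z.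
Proof. by rewrite scalerDr scalerA mulVf ?gt_eqF// scale1r. Qed.

(** The translate by a period solves the same equation with the same initial value; comparison with
    equal data forces equality. *)
Lemma strip_periodic (H' : 'rV[R]_d -> 'rV[R]_d -> R) (a b t0 t1 : R)
    (u : 'rV[R]_d -> R -> R) : ham_struct H' -> 0 <= a ->
  strip_sol t0 t1 (scaled_ham H' eps a) (scaled_forcing f eps b) u ->
  cell_periodic eps (u^~ t0) -> forall t, t0 <= t <= t1 -> cell_periodic eps (u^~ t).
Proof.
move=> hH' a0 su per t ti x z.
have E (s : R) : 0 + 1 * s = s by rewrite mul1r add0r.
have sv : strip_sol t0 t1 (scaled_ham H' eps a) (scaled_forcing f eps b)
    (fun x t => u (x + eps *: map_mx intr z) (0 + 1 * t)).
  have := @strip_sol_affine R d t0 t1 0 1 (eps *: map_mx intr z) (scaled_ham H' eps a) (scaled_forcing f eps b) u ltr01.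
  rewrite !E => /(_ su); congr strip_sol.
    by apply/funext => y; apply/funext => p; rewrite /scaled_ham mul1r shiftE (hs_per hH').
  by apply/funext => y; rewrite /scaled_forcing mul1r shiftE fper.
have := strip_compare_forcing hH' hf uf eps0 a0 sv su (c0 := 0) _ x ti.
move=> h; feed h; first by move=> y; rewrite E per subrr normr0.
by move: h; rewrite subrr normr0 mul0r addr0 E normr_le0 subr_eq0 => /eqP.
Qed.

Lemma solution_periodic (X1 X2 : nat -> R) (W1 W2 : R -> R)
    (u : 'rV[R]_d -> path_space R) :
  interpolated_walk eta X1 W1 -> interpolated_walk eta X2 W2 ->
  is_solution H f eps eta W1 W2 u ->
  forall k t, k%:R * eta <= t <= k.+1%:R * eta -> cell_periodic eps (fun x => u x t).
Proof.
move=> hW1 hW2 hu.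
have step k : cell_periodic eps (fun x => u x (k%:R * eta)) ->
    forall t, k%:R * eta <= t <= k.+1%:R * eta -> cell_periodic eps (fun x => u x t).
  move=> per t ti.
  have [sp sn] := signed_strip_sol_of_solution k hW1 hW2 hu.
  have [a0|a0] := leP 0 (X1 k / Num.sqrt eta).
    exact: (strip_periodic hH a0 (sp a0) per ti).
  have na0 : 0 <= - (X1 k / Num.sqrt eta) by rewrite oppr_ge0 ltW.
  have := strip_periodic (ham_struct_reflected hH) na0 (sn (ltW a0)).
  move=> h x z; apply: oppr_inj; apply: (h _ t ti) => y w.
  by rewrite per.
elim=> [|k IH]; apply: step.
  by rewrite mul0r => x z; have [u0 _ _] := hu; rewrite !u0.
by apply: IH; rewrite lexx andbT ler_pM2r// ler_nat.
Qed.

End solution.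

Section pde_main.
Variables (R : realType) (d : nat) (f : 'rV[R]_d -> R) (eps : R).
Hypotheses (hf : forall y, `|f y| <= 1) (uf : unif_cont f) (eps0 : 0 < eps)
  (fper : Zd_periodic f) (fmax : exists y, f y = 1) (fmin : exists y, f y = -1).

(** Adding [rh * eps] makes [O'] positive and at least [4 * rho * (d%:R * eps)], the two conditions
    of [strip_osc]; it stands for the oscillation over one cell. The value [8 * C] of [H] at large
    gradients gives the speed [8 * C * a >= 8 * |b|], and [O' <= 8 * C * a * (t1 - t0)] says that
    the strip lasts a full relaxation time. *)
Lemma strip_estimates (H : 'rV[R]_d -> 'rV[R]_d -> R) (C rho : R) (a b t0 t1 O : R)
    (u : 'rV[R]_d -> R -> R) :
  ham_struct H -> 0 < C -> 0 < rho ->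
  (forall p y, rho <= `|p| -> 8 * C <= H p y) ->
  0 < a -> `|b| <= C * a -> t0 < t1 ->
  strip_sol t0 t1 (scaled_ham H eps a) (scaled_forcing f eps b) u ->
  (forall t, t0 <= t <= t1 -> cell_periodic eps (u^~ t)) ->
  (forall x y, u x t0 - u y t0 <= O) ->
  let rh := 4 * rho * d%:R + 1 in
  let O' := O + rh * eps in
  [/\ forall x y, u x t1 - u y t1 <= 5 / 4 * O',
      b = 0 -> forall x y, u x t1 - u y t1 <= O,
      O' <= 8 * C * a * (t1 - t0) -> forall x y, u x t1 - u y t1 <= rh * eps + O' / 2 &
      forall x t, t0 <= t <= t1 -> `|u x t - u x t0 + `|b| * (t - t0)| <= O + 5 / 4 * O'].
Proof.
move=> hH C0 rho0 hrho a0 ba t01 su per osc rh O'.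
have hG := scaled_ham_good hH eps0 (ltW a0).
have gb := scaled_forcing_bound eps b hf.
have ug := scaled_forcing_unif b uf eps0.
have K0 : 0 < 8 * C * a by rewrite !mulr_gt0.
have Kb : 8 * `|b| <= 8 * C * a by rewrite -mulrA ler_pM2l.
have GK (x p : 'rV[R]_d) : rho <= `|p| -> 8 * C * a <= scaled_ham H eps a x p.
  by move=> pr; rewrite /scaled_ham mulrC ler_pM2l//; exact: hrho.
have O0 : 0 <= O by have := osc 0 0; rewrite subrr.
have dr : 0 <= 4 * rho * d%:R by rewrite !mulr_ge0// ltW.
have rh0 : 0 < rh * eps by rewrite mulr_gt0// ltr_wpDl.
have O'0 : 0 < O' by rewrite ltr_wpDl.
have oscO' : forall x y, u x t0 - u y t0 <= O'.
  by move=> x y; apply: le_trans (osc x y) _; rewrite lerDl ltW.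
have Oe : 4 * rho * (d%:R * eps) <= O'.
  by rewrite /O' /rh mulrDl mul1r mulrA; move: O0 (eps0); lra.
have [h1 h2] := strip_osc hG gb ug rho0 GK K0 Kb su oscO' eps0 per O'0 Oe.
have t1i : t0 <= t1 <= t1 by rewrite lexx ltW.
split.
- by move=> x y; exact: h1.
- move=> b0 x y; have := strip_osc_basic hG gb ug su osc x y t1i.
  by rewrite b0 normr0 mulr0 mul0r addr0.
- move=> hO x y; apply: le_trans (h2 (ltW t01) hO x y) _.
  have := mulr_ge0 dr (ltW eps0); move: (eps0); rewrite /rh; lra.
have [y0 gy] : exists y0, scaled_forcing f eps b y0 = `|b|.
  have [b0|b0] := leP 0 b.
    have [y fy] := fmax; exists (eps *: y).
    by rewrite /scaled_forcing scalerA mulVf ?gt_eqF// scale1r fy mulr1 ger0_norm.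
  have [y fy] := fmin; exists (eps *: y).
  by rewrite /scaled_forcing scalerA mulVf ?gt_eqF// scale1r fy mulrN1 ltr0_norm.
move=> x t ti.
by apply: (strip_track hG gb ug gy su osc ti) => y z; exact: h1.
Qed.

(** For [X1 k < 0] the estimates are those of [- u] with the reflected Hamiltonian, [x] and [y]
    being exchanged. As [|X2 k| <= C * |X1 k|], the relaxation condition may be stated with the
    forcing [|X2 k|] alone, which removes [X1 k] from the growth of the oscillation. *)
Lemma solution_step (H : 'rV[R]_d -> 'rV[R]_d -> R) (C rho eta : R)
    (X1 X2 : nat -> R) (W1 W2 : R -> R) (u : 'rV[R]_d -> path_space R) :
  ham_struct H -> 0 < C -> 0 < rho ->
  (forall p y, rho <= `|p| -> 8 * C <= H p y) ->
  0 < eta ->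
  interpolated_walk eta X1 W1 -> interpolated_walk eta X2 W2 ->
  is_solution H f eps eta W1 W2 u ->
  forall k O, X1 k != 0 -> `|X2 k| <= C * `|X1 k| ->
  (forall x y, u x (k%:R * eta) - u y (k%:R * eta) <= O) ->
  let rh := 4 * rho * d%:R + 1 in
  let O' := O + rh * eps in
  let t1 := k.+1%:R * eta in
  [/\ forall x y, u x t1 - u y t1 <= 5 / 4 * O',
      X2 k = 0 -> forall x y, u x t1 - u y t1 <= O,
      O' <= 8 * Num.sqrt eta * `|X2 k| -> forall x y, u x t1 - u y t1 <= rh * eps + O' / 2 &
      forall x t, k%:R * eta <= t <= t1 ->
       `|u x t - u x (k%:R * eta) + Num.sg (X1 k) * `|X2 k| * ((t - k%:R * eta) / Num.sqrt eta)|
         <= O + 5 / 4 * O'].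
Proof.
move=> hH C0 rho0 hrho eta0 hW1 hW2 hu k O Xn XC osc rh O' t1.
have per := solution_periodic hH hf uf eps0 eta0 fper hW1 hW2 hu (k := k).
have [sp sn] := signed_strip_sol_of_solution eta0 k hW1 hW2 hu.
set se := Num.sqrt eta in sp sn *.
have se0 : 0 < se by rewrite sqrtr_gt0.
have see : se * se = eta by rewrite -expr2 sqr_sqrtr// ltW.
have t01 : k%:R * eta < t1 by rewrite ltr_pM2r// ltr_nat.
have tE : t1 - k%:R * eta = eta by rewrite /t1 -natr1 mulrDl mul1r addrC addKr.
have abs_ab : `|X2 k / se| <= C * `|X1 k / se|.
  by rewrite !normrM normfV (gtr0_norm se0) mulrA ler_pM2r// invr_gt0.
have bigO A : A = `|X1 k / se| -> O' <= 8 * se * `|X2 k| -> O' <= 8 * C * A * (t1 - k%:R * eta).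
  move=> -> /le_trans; apply; rewrite tE -see normrM normfV (gtr0_norm se0).
  have -> : 8 * C * (`|X1 k| / se) * (se * se) = 8 * se * (C * `|X1 k|).
    by field; rewrite gt_eqF.
  by rewrite ler_pM2l// mulr_gt0.
have [x0|x0|/eqP] := ltgtP (X1 k) 0; last by rewrite (negbTE Xn).
- have a0 : X1 k / se < 0 by rewrite ltr_pdivrMr// mul0r.
  have na0 : 0 < - (X1 k / se) by rewrite oppr_gt0.
  have nbb : `|- (X2 k / se)| <= C * - (X1 k / se).
    by rewrite normrN -(ltr0_norm a0).
  have pern t : k%:R * eta <= t <= t1 -> cell_periodic eps (fun x => - u x t).
    by move=> ti x z; congr (- _); exact: per.
  have oscn x y : - u x (k%:R * eta) - - u y (k%:R * eta) <= O.
    by rewrite opprK addrC.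
  have hrhon p y : rho <= `|p| -> 8 * C <= reflected_ham H p y.
    by move=> pr; apply: hrho; rewrite normrN.
  have [h1 h2 h3 h4] := strip_estimates (ham_struct_reflected hH) C0 rho0 hrhon na0 nbb t01 (sn (ltW a0)) pern oscn.
  split.
  + by move=> x y; have := h1 y x; rewrite opprK addrC.
  + move=> X20 x y; have := h2 _ y x; rewrite opprK addrC; apply.
    by rewrite X20 mul0r oppr0.
  + move=> hO x y; have -> : u x t1 - u y t1 = - u y t1 - - u x t1 by rewrite opprK addrC.
    by apply: h3; apply: bigO hO; rewrite ltr0_norm.
  + move=> x t ti; have := h4 x t ti.
    rewrite ltr0_sg// normrN normrM normfV (gtr0_norm se0) -(normrN (_ + _)).
    set A := - (_ + _); set B := u x t - _ + _; have -> : A = B by rewrite /A /B; ring.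
    exact.
- have a0 : 0 < X1 k / se by rewrite divr_gt0.
  have bb : `|X2 k / se| <= C * (X1 k / se) by rewrite -(gtr0_norm a0).
  have [h1 h2 h3 h4] := strip_estimates hH C0 rho0 hrho a0 bb t01 (sp (ltW a0)) per osc.
  split=> //.
  + by move=> X20 x y; apply: h2; rewrite X20 mul0r.
  + by move=> hO x y; apply: h3; apply: bigO hO; rewrite gtr0_norm.
  + move=> x t ti; have := h4 x t ti.
    rewrite gtr0_sg// mul1r normrM normfV (gtr0_norm se0).
    set A := _ + _ * _; set B := u x t - _ + _; have -> : A = B by rewrite /A /B; ring.
    exact.
Qed.

End pde_main.

(** * Integrals and independence *)

Section rintegral_prob.
Context d (T : measurableType d) (R : realType) (P : probability T R).

Lemma bounded_integrable (f : T -> R) M : measurable_fun setT f ->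
  (forall x, `|f x| <= M) -> P.-integrable setT (EFin \o f).
Proof.
move=> mf fM; apply: measurable_bounded_integrable => //.
  by rewrite (le_lt_trans (probability_le1 P measurableT))// ltry.
by exists M; split; [exact: num_real|move=> y My x _; exact: le_trans (fM x) (ltW My)].
Qed.

Lemma Rint_cst (c : R) : \int[P]_x c = c.
Proof. by rewrite Rintegral_cst// (congr1 fine (probability_setT P)) mulr1. Qed.

Lemma Rint_abs_le (f : T -> R) M : measurable_fun setT f ->
  (forall x, `|f x| <= M) -> `|\int[P]_x f x| <= M.
Proof.
move=> mf fM; have if_ := bounded_integrable mf fM.
apply: le_trans (le_normr_Rintegral measurableT if_) _.
rewrite -(Rint_cst M); apply: le_Rintegral => //.
- apply: (@bounded_integrable _ M) => [|x]; first exact: measurableT_comp.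
  by rewrite normr_id.
- by apply: (@bounded_integrable _ `|M|).
Qed.

Lemma Rint_le (f g : T -> R) M N : measurable_fun setT f -> measurable_fun setT g ->
  (forall x, `|f x| <= M) -> (forall x, `|g x| <= N) ->
  (forall x, f x <= g x) -> \int[P]_x f x <= \int[P]_x g x.
Proof.
move=> mf mg fM gN fg; apply: le_Rintegral => //.
  exact: bounded_integrable mf fM.
exact: bounded_integrable mg gN.
Qed.

Lemma Rint_dist_le (f g : T -> R) M N e : measurable_fun setT f -> measurable_fun setT g ->
  (forall x, `|f x| <= M) -> (forall x, `|g x| <= N) ->
  (forall x, `|f x - g x| <= e) -> `|\int[P]_x f x - \int[P]_x g x| <= e.
Proof.
move=> mf mg fM gN fg; rewrite -RintegralB//.
- by apply: Rint_abs_le => //; exact: measurable_funB.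
- exact: bounded_integrable mf fM.
- exact: bounded_integrable mg gN.
Qed.

Definition prb (A : set T) : R := fine (P A).

Lemma prb_ge0 A : 0 <= prb A.
Proof. exact: fine_ge0. Qed.

Lemma prbE A : measurable A -> P A = (prb A)%:E.
Proof. by move=> mA; rewrite fineK// fin_num_measure. Qed.

Lemma prb_le A B : measurable A -> measurable B -> A `<=` B -> prb A <= prb B.
Proof.
move=> mA mB AB; rewrite -lee_fin -!prbE//; apply: le_measure; rewrite ?inE//.
Qed.

Lemma prbC A : measurable A -> prb (~` A) = 1 - prb A.
Proof.
move=> mA; apply: EFin_inj; rewrite -prbE ?probability_setC//; last exact: measurableC.
by rewrite EFinB -prbE.
Qed.

Lemma prbU A B : measurable A -> measurable B -> A `&` B = set0 ->
  prb (A `|` B) = prb A + prb B.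
Proof.
move=> mA mB AB; apply: EFin_inj; rewrite EFinD -!prbE//; last exact: measurableU.
exact: measureU.
Qed.

Lemma prbU_le A B : measurable A -> measurable B -> prb (A `|` B) <= prb A + prb B.
Proof.
move=> mA mB; rewrite -lee_fin EFinD -!prbE//; last exact: measurableU.
exact: measureU2.
Qed.

Lemma Rint_indic A : measurable A -> \int[P]_x \1_A x = prb A.
Proof. by move=> mA; rewrite /Rintegral integral_indic// setIT. Qed.

Lemma measurable_indicT (A : set T) : measurable A -> measurable_fun setT (\1_A : T -> R).
Proof. by move=> mA; exact: measurable_indic. Qed.

Lemma indic_bnd (A : set T) x : `|\1_A x : R| <= 1.
Proof. by rewrite indicE; case: (_ \in _); rewrite ?normr0 ?normr1. Qed.

Lemma Rint_markov (f : T -> R) M a (A : set T) : measurable A ->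
  measurable_fun setT f -> (forall x, `|f x| <= M) -> (forall x, 0 <= f x) ->
  0 < a -> (forall x, A x -> a <= f x) -> a * prb A <= \int[P]_x f x.
Proof.
move=> mA mf fM f0 a0 fa; rewrite -Rint_indic// -RintegralZl//; last first.
  exact: (bounded_integrable (measurable_indicT mA) (indic_bnd A)).
apply: (@Rint_le _ _ a M) => //.
- by apply: measurable_funM => //; exact: measurable_indicT.
- by move=> x; rewrite normrM (gtr0_norm a0) ler_piMr ?indic_bnd// ltW.
- move=> x; rewrite indicE; case: (boolP (x \in A)) => [|_]; last by rewrite mulr0.
  by rewrite inE mulr1 => /fa.
Qed.

End rintegral_prob.

Definition mk_mfun d1 d2 (T1 : measurableType d1) (T2 : measurableType d2)
    (f : T1 -> T2) (mf : measurable_fun setT f) : {mfun T1 >-> T2} :=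
  HB.pack f (isMeasurableFun.Build _ _ _ _ f mf).

Definition indep_of d1 d2 (T : measurableType d1) (T2 : measurableType d2) (R : realType)
    (P : probability T R) (G : set (set T)) (Y : T -> T2) :=
  forall A B, <<s G >> A -> measurable B ->
    P (A `&` Y @^-1` B) = (P A * P (Y @^-1` B))%E.

Section factorization.
Context d d2 (T : measurableType d) (T2 : measurableType d2) (R : realType).
Variables (P : probability T R) (G : set (set T)) (Y : T -> T2).
Hypotheses (GT : G `<=` measurable) (mY : measurable_fun setT Y) (iY : indep_of P G Y).
Local Notation TG := (g_sigma_algebraType G).

Lemma sub_sigma_measurable : <<s G >> `<=` @measurable d T.
Proof. exact: smallest_sub (@sigma_algebra_measurable _ T) GT. Qed.

Lemma measurable_sub_sigma d' (T' : measurableType d') (f : T -> T') :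
  measurable_fun (setT : set TG) (f : TG -> T') -> measurable_fun setT f.
Proof. by move=> mf _ B mB; apply: sub_sigma_measurable; exact: (mf measurableT B mB). Qed.

Let idG : T -> TG := id.
Let midG : measurable_fun setT idG.
Proof. by move=> _ B mB; rewrite setTI; exact: sub_sigma_measurable. Qed.
Let Z (w : T) : (TG * T2)%type := (w, Y w).
Let mZ : measurable_fun setT Z.
Proof. exact: (measurable_fun_pair midG mY). Qed.

(** The space [T] is used with two sigma-algebras. Independence says that the joint law of the
    identity into [TG] and of [Y] is the product of their laws; the claim is Tonelli's theorem for
    this product, the [G]-measurable argument being frozen while [Y] is averaged. *)
Lemma ge0_factor (h : TG * T2 -> \bar R) : measurable_fun setT h ->
  (forall z, 0 <= h z)%E ->
  (\int[P]_w h (w : TG, Y w) = \int[P]_w \int[P]_w' h (w : TG, Y w'))%E.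
Proof.
move=> mh h0.
pose m1 := distribution P (mk_mfun midG).
pose m2 := distribution P (mk_mfun mY).
pose m12 := distribution P (mk_mfun mZ).
transitivity (\int[m12]_z h z)%E.
  by rewrite ge0_integral_distribution.
transitivity (\int[m1 \x m2]_z h z)%E.
  have U : forall A1 A2, measurable A1 -> measurable A2 -> m12 (A1 `*` A2) = (m1 A1 * m2 A2)%E.
    move=> A1 A2 mA1 mA2; rewrite /m12 /m1 /m2 /distribution /pushforward /=.
    have -> : Z @^-1` (A1 `*` A2) = A1 `&` Y @^-1` A2 by [].
    exact: iY.
  apply: eq_measure_integral => /= A mA _; apply/esym.
  by have := @product_measure_unique _ _ _ _ _ m1 m2 m12 U A mA.
rewrite fubini_tonelli1// /m1 ge0_integral_distribution//=; last 2 first.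
- exact: measurable_fun_fubini_tonelli_F.
- by move=> x; exact: integral_ge0.
apply: eq_integral => w _ /=; rewrite /fubini_F ge0_integral_distribution//.
by apply: measurableT_comp => //; exact: measurable_pair1.
Qed.

Lemma Rint_factor (h : TG * T2 -> R) M : measurable_fun setT h ->
  (forall z, `|h z| <= M) ->
  \int[P]_w h (w : TG, Y w) = \int[P]_w \int[P]_w' h (w : TG, Y w') /\
  measurable_fun setT (fun w : T => \int[P]_w' h (w : TG, Y w')).
Proof.
move=> mh hM.
(* Adding [M] makes the integrand nonnegative, as Tonelli's theorem requires; the constant cancels
   at the end. *)
pose h' z := ((h z + M)%:E)%E.
have h'0 z : (0 <= h' z)%E.
  by rewrite lee_fin; have /ler_normlP[] := hM z; lra.
have mh' : measurable_fun setT h'.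
  by apply/measurable_EFinP; exact: measurable_funD.
have mh1 (w : T) : measurable_fun setT (fun w' => h (w : TG, Y w')).
  apply: (measurableT_comp (measurableT_comp mh (measurable_pair1 (w : TG))) mY).
have mhd : measurable_fun setT (fun w : T => h (w : TG, Y w)).
  exact: (measurableT_comp mh mZ).
have inner (w : T) : (\int[P]_w' h' (w : TG, Y w') = (\int[P]_w' h (w : TG, Y w') + M)%:E)%E.
  rewrite /h' -[X in (_ + X)%:E](Rint_cst P M) -RintegralD//; last 2 first.
  - exact: (bounded_integrable P (mh1 w) (fun x => hM _)).
  - by apply: (@bounded_integrable _ _ _ P _ `|M|).
  rewrite /Rintegral fineK//; apply: integrable_fin_num => //.
  apply: (@bounded_integrable _ _ _ P _ (M + `|M|)).
    by apply: measurable_funD.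
  by move=> x; apply: le_trans (ler_normD _ _) _; rewrite lerD2r.
have mF : measurable_fun setT (fun w : T => \int[P]_w' h (w : TG, Y w')).
  have : measurable_fun (setT : set TG) (fun w : TG => (\int[distribution P (mk_mfun mY)]_y h' (w, y))%E).
    pose m2 : probability _ R := distribution P (mk_mfun mY).
    exact: (@measurable_fun_fubini_tonelli_F _ _ TG T2 R m2 h' mh' h'0).
  move/measurable_sub_sigma => H.
  have -> : (fun w : T => \int[P]_w' h (w : TG, Y w')) =
     (fun w : T => fine (\int[distribution P (mk_mfun mY)]_y h' (w : TG, y)) - M).
    apply/funext => w; rewrite ge0_integral_distribution//; last first.
      by apply: measurableT_comp => //; exact: measurable_pair1.
    by rewrite /= inner /= addrK.
  apply: measurable_funB => //.
  by apply: measurableT_comp => //; exact: H.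
split=> //.
have := ge0_factor mh' h'0.
under [in X in _ = X]eq_integral do rewrite inner.
rewrite /h'.
move/(congr1 fine); rewrite -!/(Rintegral _ _ _).
rewrite (RintegralD measurableT) ?(RintegralD measurableT)//.
- by move/addIr.
- apply: (@bounded_integrable _ _ _ P _ M) => // w.
  by apply: Rint_abs_le.
- by apply: (@bounded_integrable _ _ _ P _ `|M|).
- exact: (bounded_integrable P mhd (fun x => hM _)).
- by apply: (@bounded_integrable _ _ _ P _ `|M|).
Qed.

End factorization.

Section mutual_indep.
Context d (T : measurableType d) (R : realType) (P : probability T R).
Variables (I : choiceType) (Y : I -> T -> R).
Hypotheses (mY : forall i, measurable_fun setT (Y i)) (iY : mutually_independent P Y).

Definition sig_of (J : I -> Prop) : set (set T) :=
  [set E | exists2 i, J i & exists2 B, measurable B & E = Y i @^-1` B].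

(** The pi-system of finite cylinders: it generates the same sigma-algebra as [sig_of J], which is
    not closed under intersection. *)
Definition cyl_of (J : I -> Prop) : set (set T) :=
  [set E | exists s : seq I, exists A : I -> set R,
    [/\ uniq s, forall i, i \in s -> J i, forall i, measurable (A i) &
        E = \bigcap_(i in [set` s]) (Y i @^-1` A i)]].

Lemma sig_of_measurable J : sig_of J `<=` measurable.
Proof.
move=> _ [i _ [B mB ->]]; rewrite -[X in measurable X]setTI; exact: mY.
Qed.

Lemma cyl_of_measurable J : cyl_of J `<=` measurable.
Proof.
move=> _ [s [A [_ _ mA ->]]]; apply: fin_bigcap_measurable => // i _.
by rewrite -[X in measurable X]setTI; exact: mY.
Qed.

Lemma cyl_of_setI J : setI_closed (cyl_of J).
Proof.
move=> _ _ [s [A [us sJ mA ->]]] [s' [A' [us' sJ' mA' ->]]].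
exists (undup (s ++ s')), (fun i => (if i \in s then A i else setT) `&`
   (if i \in s' then A' i else setT)); split.
- exact: undup_uniq.
- by move=> i; rewrite mem_undup mem_cat => /orP[/sJ|/sJ'].
- by move=> i; apply: measurableI; case: ifP.
- apply/seteqP; split=> w.
    move=> [h1 h2] i _; split; case: ifP => // Hi; [exact: h1|exact: h2].
  move=> h; split=> i /= Hi; have := h i; rewrite /= mem_undup mem_cat Hi.
    by move=> /(_ isT)[].
  by rewrite orbT => /(_ isT)[].
Qed.

Lemma cyl_ofT J : cyl_of J setT.
Proof.
exists [::], (fun _ => setT); split => //.
by apply/seteqP; split.
Qed.

Lemma sig_cyl J : <<s sig_of J >> `<=` <<s cyl_of J >>.
Proof.
apply: smallest_sub; first exact: smallest_sigma_algebra.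
move=> _ [i Ji [B mB ->]]; apply: sub_sigma_algebra.
exists [:: i], (fun _ => B); split => //.
- by move=> j; rewrite inE => /eqP ->.
- apply/seteqP; split=> w /=.
    by move=> h j; rewrite /= inE => /eqP ->.
  by move=> h; apply: h; rewrite /= inE.
Qed.

Lemma indep_cyl J J' : (forall i, J i -> J' i -> False) -> forall A B,
  cyl_of J A -> cyl_of J' B -> P (A `&` B) = (P A * P B)%E.
Proof.
move=> JJ' _ _ [s [A [us sJ mA ->]]] [s' [A' [us' sJ' mA' ->]]].
pose C i := if i \in s then A i else A' i.
have dis i : i \in s' -> (i \in s) = false.
  by move=> is'; apply/negP => is_; exact: (JJ' i (sJ _ is_) (sJ' _ is')).
have -> : \bigcap_(i in [set` s]) (Y i @^-1` A i) `&` \bigcap_(i in [set` s']) (Y i @^-1` A' i) =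
  \bigcap_(i in [set` s ++ s']) (Y i @^-1` C i).
  apply/seteqP; split=> w.
    move=> [h1 h2] i /=; rewrite mem_cat /C; case: ifP => [Hi _|_ /= Hi]; [exact: h1|exact: h2].
  move=> h; split=> i /= Hi.
    by have := h i; rewrite /= mem_cat Hi /C Hi => /(_ isT).
  by have := h i; rewrite /= mem_cat Hi orbT /C dis// => /(_ isT).
rewrite !iY//; last 2 first.
- rewrite cat_uniq us us' andbT /=; apply/hasPn => i is'; by rewrite /= dis.
- by move=> i; rewrite /C; case: ifP.
rewrite big_cat /=; congr (_ * _)%E; apply: eq_big_seq => i Hi; rewrite /C ?Hi//.
by rewrite dis.
Qed.

(** For a fixed event, restricting [P] to it and multiplying [P] by its mass give two finite
    measures. If they agree on the pi-system of cylinders, they agree on the generated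
    sigma-algebra; this is applied to each of the two factors in turn. *)
Lemma indep_sig J J' : (forall i, J i -> J' i -> False) -> forall A B,
  <<s sig_of J >> A -> <<s sig_of J' >> B -> P (A `&` B) = (P A * P B)%E.
Proof.
move=> JJ' A B /sig_cyl sA /sig_cyl sB.
have step K (C : set T) : measurable C ->
    (forall A, cyl_of K A -> P (A `&` C) = (P A * P C)%E) ->
    forall A, <<s cyl_of K >> A -> P (A `&` C) = (P A * P C)%E.
  move=> mC h D sD.
  pose m1 := mrestr P mC.
  pose m2 := mscale (NngNum (prb_ge0 P C)) P.
  have := @g_sigma_algebra_measure_unique _ R T (cyl_of K) (@cyl_of_measurable K)
    (fun _ => setT) (fun _ => @cyl_ofT K) _ m1 m2 (@cyl_of_setI K) _ _ D sD.
  have m1E E : m1 E = P (E `&` C) by [].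
  have m2E E : m2 E = (P C * P E)%E by rewrite prbE.
  rewrite -m1E muleC -m2E; apply.
  - by rewrite bigcup_const//; exists 0%N.
  - move=> E cE; transitivity (P C * P E)%E; last exact/esym/m2E.
    by rewrite muleC -h.
  - move=> _; apply: (@le_lt_trans _ _ (P C)); last first.
      by rewrite (le_lt_trans (probability_le1 P mC))// ltry.
    by rewrite -[X in (_ <= P X)%E](setTI C).
have mB : measurable B.
  exact: (smallest_sub (@sigma_algebra_measurable _ T) (@cyl_of_measurable J')).
apply: (step J) => // E cE.
rewrite setIC muleC.
have mE : measurable E by exact: cyl_of_measurable cE.
apply: (step J') => // F cF.
by rewrite setIC muleC; exact: (indep_cyl JJ').
Qed.

Lemma measurable_sig J i : J i ->
  measurable_fun (setT : set (g_sigma_algebraType (sig_of J)))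
    (Y i : g_sigma_algebraType (sig_of J) -> R).
Proof.
move=> Ji _ B mB; rewrite setTI; apply: sub_sigma_algebra.
by exists i => //; exists B.
Qed.

Lemma indep_of_sig J J' d' (T' : measurableType d') (Z : T -> T') :
  (forall i, J i -> J' i -> False) ->
  measurable_fun (setT : set (g_sigma_algebraType (sig_of J')))
    (Z : g_sigma_algebraType (sig_of J') -> T') ->
  indep_of P (sig_of J) Z.
Proof.
move=> JJ' mZ A B sA mB; apply: (indep_sig JJ') => //.
by have := mZ measurableT B mB; rewrite setTI.
Qed.

End mutual_indep.

Section measurable_fin_dep.
Context d (T : measurableType d) (R : realType).

(** [U] depends continuously on finitely many [Y i] without being given as a function of them. Each
    point of a superlevel set lies in a rational box in the [Y i] contained in that set, and such
    boxes are countable in number. *)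
Lemma measurable_fin_dep (I : finType) (Y : I -> T -> R) (U : T -> R) :
  (forall i, measurable_fun setT (Y i)) ->
  (forall w e, 0 < e -> exists2 r, 0 < r & forall w',
     (forall i, `|Y i w - Y i w'| <= r) -> `|U w - U w'| <= e) ->
  measurable_fun setT U.
Proof.
move=> mY hU _; apply: (measurability _ (RGenOInfty.measurableE R)) => //.
move=> _ [_ [c ->] <-]; rewrite setTI.
pose rho (m : nat) : R := m.+1%:R^-1.
pose box (am : {ffun I -> rat} * nat) :=
  \bigcap_(i in [set: I]) [set w | `|Y i w - ratr (am.1 i)| < rho am.2].
pose good am := box am `<=` U @^-1` `]c, +oo[.
have -> : U @^-1` `]c, +oo[ =
    \bigcup_am (if `[<good am>] then box am else set0).
  apply/seteqP; split; last first.
    by move=> w [am _]; case: asboolP => // gam /gam.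
  move=> w /=; rewrite in_itv /= andbT => cU.
  have [r r0 hr] := hU w ((U w - c) / 2) ltac:(lra).
  (* Two points of the box are each within [rho m] of its centre, hence within [r] of one
     another. *)
  have [m hm] : exists m : nat, rho m < r / 2.
    have r20 : 0 < r / 2 by lra.
    have [N _ HN] := near_infty_natSinv_lt (PosNum r20).
    by exists N; exact: (HN N (leqnn N)).
  have m0 : 0 < rho m by rewrite invr_gt0.
  have hq i : exists q : rat, `|Y i w - ratr q| < rho m.
    have : Y i w - rho m < Y i w + rho m by move: m0; clear; lra.
    move=> /rat_in_itvoo[q]; rewrite in_itv /= => /andP[q1 q2]; exists q.
    by rewrite ltr_norml; apply/andP; move: q1 q2; clear; split; lra.
  have [q hqi] := choice hq.
  exists ([ffun i => q i], m) => //.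
  have wb : box ([ffun i => q i], m) w by move=> i _ /=; rewrite ffunE.
  case: asboolP => // -[] w' wb' /=; rewrite in_itv /= andbT.
  have /hr : forall i, `|Y i w - Y i w'| <= r.
    move=> i; have := wb i Logic.I; have := wb' i Logic.I; rewrite /= ffunE.
    move=> /ltr_normlP[] + + /ltr_normlP[].
    rewrite ler_norml => h1 h2 h3 h4; apply/andP.
    by move: h1 h2 h3 h4 hm; clear; split; lra.
  by move=> /ler_normlP[]; lra.
apply: countable_bigcupT_measurable => [|am].
  exact: countableP.
case: ifP => _; last exact: measurable0.
apply: fin_bigcap_measurable; first exact: finite_finset.
move=> i _; rewrite (_ : [set _ | _] = (fun w => `|Y i w - ratr (am.1 i)|) @^-1` `]-oo, rho am.2[); last first.
  by apply/seteqP; split => w /=; rewrite in_itv.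
rewrite -[X in measurable X]setTI; apply: measurableT_comp => //.
exact: measurable_funB.
Qed.

(** Taking whole sequences as arguments lets single coordinates be replaced without dependent types;
    the bound also forces [F] to ignore the coordinates from [q] on. *)
Definition lip_on (q : nat) (L : R) (F : (nat -> R) -> R) :=
  forall y z, `|F y - F z| <= L * \sum_(j < q) `|y j - z j|.

Lemma lip_on_ge0 q L F : (0 < q)%N -> lip_on q L F -> 0 <= L.
Proof.
move=> q0 hL; have := hL (fun _ => 1) (fun _ => 0).
under eq_bigr do rewrite subr0 normr1.
rewrite sumr_const card_ord => /(le_trans (normr_ge0 _)).
by rewrite pmulr_lge0// ltr0n.
Qed.

Lemma lip_on_eq q L F y z : lip_on q L F -> (forall j, (j < q)%N -> y j = z j) -> F y = F z.
Proof.
move=> hL yz; apply/eqP; rewrite -subr_eq0 -normr_le0 (le_trans (hL y z))//.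
by rewrite big1 ?mulr0// => j _; rewrite yz// subrr normr0.
Qed.

Lemma lip_on_measurable q L F (Z : nat -> T -> R) : lip_on q L F ->
  (forall j, (j < q)%N -> measurable_fun setT (Z j)) ->
  measurable_fun setT (fun w => F (fun j => Z j w)).
Proof.
move=> hL mZ; apply: (@measurable_fin_dep 'I_q (fun i => Z i)) => [i|w e e0].
  exact: mZ.
have L1 : 0 < `|L| + 1 by rewrite ltr_pwDr.
exists (e / (`|L| + 1) / q.+1%:R) => [|w' hw']; first by rewrite !divr_gt0.
apply: le_trans (hL _ _) _.
have S0 : 0 <= \sum_(j < q) `|Z j w - Z j w'| by exact: sumr_ge0.
apply: (@le_trans _ _ ((`|L| + 1) * \sum_(j < q) `|Z j w - Z j w'|)).
  by rewrite ler_wpM2r// (le_trans (ler_norm _))// lerDl.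
rewrite -ler_pdivlMl// mulrC.
apply: (@le_trans _ _ (\sum_(j < q) (e / (`|L| + 1) / q.+1%:R))).
  by apply: ler_sum => j _; exact: hw'.
rewrite sumr_const card_ord; have : 0 <= e / (`|L| + 1) by rewrite divr_ge0 ?(ltW e0) ?(ltW L1).
move: (e / _) => c c0; rewrite -[leLHS]mulr_natr -mulrA -[leRHS]mulr1; apply: ler_wpM2l => //.
by rewrite mulrC ler_pdivrMr// mul1r ler_nat.
Qed.

End measurable_fin_dep.

Section product_fubini.
Context d d' (T : measurableType d) (T' : measurableType d') (R : realType).
Variables (P : probability T R) (P' : probability T' R).

Lemma Rint_fubini (f : T * T' -> R) M : measurable_fun setT f ->
  (forall z, `|f z| <= M) ->
  \int[P]_w \int[P']_w' f (w, w') = \int[P']_w' \int[P]_w f (w, w').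
Proof.
move=> mf fM.
have fi : (P \x P')%E.-integrable setT (EFin \o f).
  apply: measurable_bounded_integrable => //.
    apply: (@le_lt_trans _ _ ((P \x P')%E (setT `*` setT))); last first.
      by rewrite product_measure1E// [X in (X * _)%E]probability_setT [X in (_ * X)%E]probability_setT mul1e ltry.
    by rewrite setXTT.
  by exists M; split; [exact: num_real|move=> y My x _; exact: le_trans (fM x) (ltW My)].
have := Fubini fi; rewrite /fubini_F /fubini_G /= => H.
have E1 w : (\int[P']_w' (f (w, w'))%:E)%E = (\int[P']_w' f (w, w'))%:E.
  rewrite /Rintegral fineK//; apply: integrable_fin_num => //.
  apply: bounded_integrable (fun w' => fM (w, w')).
  by apply: measurableT_comp => //; exact: measurable_pair1.
have E2 w' : (\int[P]_w (f (w, w'))%:E)%E = (\int[P]_w f (w, w'))%:E.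
  rewrite /Rintegral fineK//; apply: integrable_fin_num => //.
  apply: bounded_integrable (fun w => fM (w, w')).
  by apply: measurableT_comp => //; exact: measurable_pair2.
move: H; under eq_integral do rewrite E1.
under [X in _ = X]eq_integral do rewrite E2.
by move=> /(congr1 fine).
Qed.

End product_fubini.

Definition upd (R : Type) (v : nat -> R) k x : nat -> R := fun j => if j == k then x else v j.

(** When coordinate [k] is replaced, only the coordinates in [J] live on the same probability space
    as [Y k], the others being frozen constants; [Y k] has to be independent of those in [J], itself
    excepted. *)
Definition indep_at d (T : measurableType d) (R : realType) (P : probability T R)
    (Y : nat -> T -> R) (k : nat) (J : pred nat) :=
  exists G : set (set T), [/\ G `<=` measurable,
    forall j, J j -> j != k -> measurable_fun (setT : set (g_sigma_algebraType G)) (Y j : g_sigma_algebraType G -> R)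
  & indep_of P G (Y k)].

Section section_average.
Context d (T : measurableType d) (R : realType) (P : probability T R).
Variables (q : nat) (L M : R) (F : (nat -> R) -> R).
Hypotheses (FL : lip_on q L F) (FM : forall v, `|F v| <= M).

Definition coord_mean (k : nat) (X : T -> R) (v : nat -> R) : R := \int[P]_w F (upd v k (X w)).

Lemma coord_mean_lip k X : measurable_fun setT X -> lip_on q L (coord_mean k X).
Proof.
move=> mX y z.
have mF v : measurable_fun setT (fun w => F (upd v k (X w))).
  apply: (lip_on_measurable FL (Z := fun j w => upd v k (X w) j)) => j _.
  by rewrite /upd; case: eqP.
rewrite /coord_mean; apply: (Rint_dist_le P (mF y) (mF z) (fun w => FM _) (fun w => FM _)) => w.
apply: le_trans (FL _ _) _.
have [q0|q0] := posnP q; first by rewrite q0 !big_ord0.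
apply: ler_wpM2l; first exact: lip_on_ge0 FL.
by apply: ler_sum => j _; rewrite /upd; case: eqP => // _; rewrite subrr normr0.
Qed.

Lemma coord_mean_bnd k X v : measurable_fun setT X -> `|coord_mean k X v| <= M.
Proof.
move=> mX; apply: Rint_abs_le => //.
apply: (lip_on_measurable FL (Z := fun j w => upd v k (X w) j)) => j _.
by rewrite /upd; case: eqP.
Qed.

Variable (Y : nat -> T -> R).
Hypothesis mY : forall j, measurable_fun setT (Y j).

Lemma Rint_coord_mean (k : nat) (J : pred nat) c : (k < q)%N -> indep_at P Y k J ->
  \int[P]_w F (upd (fun j => if J j then Y j w else c j) k (Y k w)) =
  \int[P]_w coord_mean k (Y k) (fun j => if J j then Y j w else c j).
Proof.
move=> kq [G [GT mG iG]].
pose h (z : g_sigma_algebraType G * R) := F (upd (fun j => if J j then Y j z.1 else c j) k z.2).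
have mh : measurable_fun setT h.
  apply: (lip_on_measurable FL (Z := fun j (z : g_sigma_algebraType G * R) => upd (fun j => if J j then Y j z.1 else c j) k z.2 j)) => j _.
  rewrite /upd; case: eqP => [_|/eqP jk]; first exact: measurable_snd.
  have [Jj|_] := boolP (J j); last exact: measurable_cst.
  apply: (measurableT_comp (mG j Jj jk)); exact: measurable_fst.
by have [] := Rint_factor GT (mY k) iG mh (fun z => FM _).
Qed.

End section_average.

Lemma dist_telescope (R : numDomainType) (a : nat -> R) e q :
  (forall k, (k < q)%N -> `|a k.+1 - a k| <= e) -> `|a q - a 0%N| <= q%:R * e.
Proof.
elim: q => [|q IH] h; first by rewrite subrr normr0 mul0r.
rewrite -(subrK (a q) (a q.+1)) -addrA (le_trans (ler_normD _ _))//.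
have -> : q.+1%:R * e = e + q%:R * e by rewrite -[in LHS](natr1 q) mulrDl mul1r addrC.
rewrite lerD ?h//; first by apply: IH => k kq; exact/h/ltnW.
Qed.

Section hybrid.
Context d d' (T : measurableType d) (T' : measurableType d') (R : realType).
Variables (P : probability T R) (P' : probability T' R).
Variables (q : nat) (L M e : R) (F : (nat -> R) -> R).
Hypotheses (FL : lip_on q L F) (FM : forall v, `|F v| <= M).
Variables (Y : nat -> T -> R) (Y' : nat -> T' -> R).
Hypotheses (mY : forall j, measurable_fun setT (Y j)) (mY' : forall j, measurable_fun setT (Y' j)).
Hypotheses (iY : forall k, (k < q)%N -> indep_at P Y k (fun j => (j < k)%N))
  (iY' : forall k, (k < q)%N -> indep_at P' Y' k (fun j => (k <= j)%N)).
Hypothesis secP : forall k v, (k < q)%N -> `|coord_mean P F k (Y k) v - coord_mean P' F k (Y' k) v| <= e.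

Let cmb k w w' := fun j => if (j < k)%N then Y j w else Y' j w'.

Let mcmb k j : measurable_fun setT (fun z : T * T' => cmb k z.1 z.2 j).
Proof.
rewrite /cmb; case: (j < k)%N.
  by apply: measurableT_comp => //; exact: measurable_fst.
by apply: measurableT_comp => //; exact: measurable_snd.
Qed.

Let mF2 (g : (nat -> R) -> R) k w : lip_on q L g -> measurable_fun setT (fun w' => g (cmb k w w')).
Proof.
move=> gL; apply: (lip_on_measurable gL (Z := fun j w' => cmb k w w' j)) => j _.
by rewrite /cmb; case: (j < k)%N.
Qed.
Let mF (g : (nat -> R) -> R) k : lip_on q L g -> measurable_fun setT (fun z : T * T' => g (cmb k z.1 z.2)).
Proof.
move=> gL; apply: (lip_on_measurable gL (Z := fun j (z : T * T') => cmb k z.1 z.2 j)) => j _.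
exact: mcmb.
Qed.

Let H k := \int[P]_w \int[P']_w' F (cmb k w w').

Let swap (g : (nat -> R) -> R) k : lip_on q L g -> (forall v, `|g v| <= M) ->
  \int[P]_w \int[P']_w' g (cmb k w w') = \int[P']_w' \int[P]_w g (cmb k w w').
Proof.
move=> gL gM.
exact: (@Rint_fubini _ _ _ _ _ P P' (fun z => g (cmb k z.1 z.2)) M (mF k gL) (fun z => gM _)).
Qed.

(** [H k] and [H k.+1] differ in coordinate [k] only. Integrating this coordinate first turns both
    into averages over the same mixed vector [cmb k], of the two functions compared in [secP]. Here
    the integrals must be exchanged, since [Y k] lives on the outer space. *)
Let HS k : (k < q)%N -> H k.+1 = \int[P]_w \int[P']_w' coord_mean P F k (Y k) (cmb k w w').
Proof.
move=> kq; rewrite /H (swap k.+1 FL FM) (swap k (coord_mean_lip P FL FM k (mY k)) (fun v => coord_mean_bnd P FL FM k v (mY k))).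
apply: eq_Rintegral => w' _.
rewrite -(Rint_coord_mean FL FM mY (fun j => Y' j w') kq (iY kq)).
apply: eq_Rintegral => w _; congr F; apply/funext => j.
by rewrite /upd /cmb ltnS leq_eqVlt; case: eqP => [->|].
Qed.

Let H0 k : (k < q)%N -> H k = \int[P]_w \int[P']_w' coord_mean P' F k (Y' k) (cmb k w w').
Proof.
move=> kq; apply: eq_Rintegral => w _.
have cE w' : cmb k w w' = (fun j => if (k <= j)%N then Y' j w' else Y j w).
  by apply/funext => j; rewrite /cmb; case: (ltnP j k).
under [RHS]eq_Rintegral do rewrite cE.
rewrite -(Rint_coord_mean FL FM mY' (fun j => Y j w) kq (iY' kq)).
apply: eq_Rintegral => w' _; congr F; apply/funext => j.
by rewrite cE /upd; case: eqP => [->|//]; rewrite leqnn.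
Qed.

(* Lindeberg's replacement: the [Y k] are exchanged for the [Y' k] one at a time. *)
Lemma hybrid : `|\int[P]_w F (fun j => Y j w) - \int[P']_w' F (fun j => Y' j w')| <= q%:R * e.
Proof.
have -> : \int[P']_w' F (fun j => Y' j w') = H 0%N.
  by rewrite /H /cmb /= Rint_cst.
have -> : \int[P]_w F (fun j => Y j w) = H q.
  apply: eq_Rintegral => w _; rewrite -[LHS](Rint_cst P'); apply: eq_Rintegral => w' _.
  by apply: (lip_on_eq FL) => j jq; rewrite /cmb jq.
apply: dist_telescope => k kq.
rewrite HS// (H0 kq).
have s1 := coord_mean_lip P FL FM k (mY k).
have s2 := coord_mean_lip P' FL FM k (mY' k).
have b1 v := coord_mean_bnd P FL FM k v (mY k).
have b2 v := coord_mean_bnd P' FL FM k v (mY' k).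
have mI (g : (nat -> R) -> R) : lip_on q L g -> (forall v, `|g v| <= M) ->
    measurable_fun setT (fun w => \int[P']_w' g (cmb k w w')).
  move=> gL gM.
  have BL : lip_on q L (fun v => \int[P']_w' g (fun j => if (j < k)%N then v j else Y' j w')).
    move=> y z.
    have mg v : measurable_fun setT (fun w' => g (fun j => if (j < k)%N then v j else Y' j w')).
      apply: (lip_on_measurable gL (Z := fun j w' => if (j < k)%N then v j else Y' j w')) => j _.
      by case: (j < k)%N.
    apply: (Rint_dist_le P' (mg y) (mg z) (fun w => gM _) (fun w => gM _)) => w'.
    apply: le_trans (gL _ _) _; apply: ler_wpM2l; first exact: lip_on_ge0 (leq_ltn_trans _ kq) FL.
    by apply: ler_sum => j _; case: ifP => // _; rewrite subrr normr0.
  exact: (lip_on_measurable BL (Z := Y)).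
apply: (Rint_dist_le P (mI _ s1 b1) (mI _ s2 b2)) => w.
- by apply: Rint_abs_le => // w'; exact: mF2.
- by apply: Rint_abs_le => // w'; exact: mF2.
- apply: (Rint_dist_le P' (mF2 k w s1) (mF2 k w s2) (fun w => b1 _) (fun w => b2 _)) => w'.
  exact: secP.
Qed.

End hybrid.

(** * Smoothing and one-step expansions *)

Section smoothing.
Context (R : realType).
Implicit Types (f g : R -> R) (a b x y B C : R).

Lemma derive_mvt f f' a b : a <= b -> (forall x, is_derive x 1 f (f' x)) ->
  exists2 c, a <= c <= b & f b - f a = f' c * (b - a).
Proof.
move=> ab df; have cf : {within `[a, b], continuous f}.
  apply: continuous_subspaceT => x.
  by apply/differentiable_continuous/derivable1_diffP; case: (df x).
have [c cab ->] := MVT_segment ab (fun x _ => df x) cf.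
by exists c; move: cab; rewrite // in_itv.
Qed.

Lemma derive_lip f f' B : (forall x, is_derive x 1 f (f' x)) -> (forall x, `|f' x| <= B) ->
  forall x y, `|f x - f y| <= B * `|x - y|.
Proof.
move=> df fB x y; wlog xy : x y / y <= x.
  by move=> h; have [/h //|/ltW/h] := leP y x; rewrite distrC (distrC x).
have [c _ ->] := derive_mvt xy df.
by rewrite normrM ler_wpM2r.
Qed.

Lemma derive_lip0 f f' B r : (forall x, is_derive x 1 f (f' x)) ->
  (forall x, `|x| <= r -> `|f' x| <= B) ->
  forall y, `|y| <= r -> `|f y - f 0| <= B * `|y|.
Proof.
move=> df fB y yr; have [y0|/ltW y0] := leP 0 y.
  have [c /andP[c0 cy] ->] := derive_mvt y0 df.
  rewrite subr0 normrM ler_wpM2r// fB// (le_trans _ yr)// !ger0_norm//.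
have [c /andP[c0 cy] ] := derive_mvt y0 df.
rewrite sub0r distrC => ->; rewrite normrM normrN ler_wpM2r// fB// (le_trans _ yr)//.
by rewrite !ler0_norm// lerN2.
Qed.

Lemma taylor2 f f' f'' B y : (forall x, is_derive x 1 f (f' x)) ->
  (forall x, is_derive x 1 f' (f'' x)) -> f 0 = 0 -> f' 0 = 0 ->
  (forall x, `|x| <= `|y| -> `|f'' x| <= B) -> `|f y| <= B * `|y| ^+ 2.
Proof.
move=> df df' f0 f'0 fB.
have h x : `|x| <= `|y| -> `|f' x| <= B * `|y|.
  move=> xy; have := derive_lip0 df' fB xy; rewrite f'0 subr0 => /le_trans; apply.
  by rewrite ler_wpM2l// (le_trans (normr_ge0 (f'' 0)))// fB// normr0.
have := derive_lip0 df h (lexx _); rewrite f0 subr0 => /le_trans; apply.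
by rewrite -mulrA -expr2.
Qed.

(** The integral from [a] is differentiated to the right of [a]; the second property allows the base
    point to be moved, so that every real number can be reached. *)
Lemma primitive_right (g : R -> R) : continuous g -> {F : R -> R -> R |
  (forall a x, a < x -> is_derive x 1 (F a) (g x)) /\
  forall a b x y, a < x -> b < x -> x <= y -> F a y - F a x = F b y - F b x}.
Proof.
move=> cg.
have ig a b : (@lebesgue_measure R).-integrable `[a, b] (EFin \o g).
  apply: continuous_compact_integrable; first exact: segment_compact.
  exact: continuous_subspaceT.
exists (fun a x => (\int[@lebesgue_measure R]_(t in `[a, x]) g t)%R); split.
  move=> a x ax; have x1 : x < x + 1 by rewrite ltrDl.
  have [dF F'] := continuous_FTC1_closed x1 (ig a (x + 1)) ax (cg x).
  by apply: DeriveDef; [exact: dF|rewrite -derive1E; exact: F'].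
move=> a b x y ax bx xy.
rewrite (Rintegral_itvB (ig a y)) ?bnd_simp ?(ltW ax)//.
by rewrite (Rintegral_itvB (ig b y)) ?bnd_simp ?(ltW bx).
Qed.

Lemma is_derive_shift (F : R -> R) (x s a : R) :
  is_derive (x + s) 1 F a -> is_derive x 1 (fun y => F (y + s)) a.
Proof.
move=> dF; have dx : is_derive x 1 (fun y => y + s) 1.
  by rewrite -[X in is_derive _ _ _ X](addr0 1); apply: is_deriveD.
by have := @is_derive1_comp R F (fun y => y + s) x _ _ dF dx; rewrite mulr1.
Qed.

(** [A x] is the mean of [g] over [[x, x + s]]. Its base point [x - 1] moves with [x], and is frozen
    locally to compute the derivative. *)
Lemma steklov (g : R -> R) (s : R) : 0 < s -> continuous g ->
  {A : R -> R | (forall x, is_derive x 1 A (s^-1 * (g (x + s) - g x))) /\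
    forall x, exists2 c, x <= c <= x + s & A x = g c}.
Proof.
move=> s0 cg; have [F [dF FE]] := primitive_right cg.
have lt1 x : x - 1 < x by rewrite ltrBlDr ltrDl.
have les x : x <= x + s by rewrite lerDl ltW.
pose A x := s^-1 * (F (x - 1) (x + s) - F (x - 1) x).
have AE a x : a < x -> A x = s^-1 * (F a (x + s) - F a x).
  by move=> ax; rewrite /A (FE _ a x (x + s) (lt1 x) ax (les x)).
exists A; split=> x.
  have d0 : is_derive x 1 (fun y => s^-1 * (F (x - 1) (y + s) - F (x - 1) y)) (s^-1 * (g (x + s) - g x)).
    apply: is_deriveZ; apply: is_deriveB; last exact: dF.
    by apply: is_derive_shift; apply: dF; rewrite (lt_le_trans (lt1 x)).
  have eA : \forall y \near x, A y = s^-1 * (F (x - 1) (y + s) - F (x - 1) y).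
    near=> y; apply: AE; near: y; exact: lt_nbhsr.
  case: d0 => d0 d0E; apply: DeriveDef.
    by apply: near_eq_derivable d0 => //; near do apply/esym.
  by rewrite -d0E; apply: near_eq_derive.
have [c cx E] : exists2 c, c \in `[x, x + s] & F (x - 1) (x + s) - F (x - 1) x = g c * (x + s - x).
  apply: MVT_segment => // [y|].
    rewrite in_itv => /andP[xy _]; apply: dF; exact: lt_trans (lt1 x) xy.
  apply/continuous_in_subspaceT => y; rewrite inE /= in_itv /= => /andP[xy _].
  apply/differentiable_continuous/derivable1_diffP.
  by case: (dF _ _ (lt_le_trans (lt1 x) xy)).
exists c; first by move: cx; rewrite in_itv.
by rewrite /A E (addrC x) addrK mulrC -mulrA divff ?mulr1// gt_eqF.
Unshelve. all: by end_near. Qed.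

Record smooth2 C (G al be : R -> R) : Prop := Smooth2 {
  sm_d1 : forall x, is_derive x 1 G (al x) ;
  sm_d2 : forall x, is_derive x 1 al (be x) ;
  sm_al : forall x, `|al x| <= C ;
  sm_be : forall x, `|be x| <= C ;
  sm_beL : forall x y, `|be x - be y| <= C * `|x - y| }.

(* Two successive Steklov averages, whence the bound of order [s ^- 2] on the derivatives. *)
Lemma mollify L M s : 0 < s -> 0 <= L -> exists C, 0 <= C /\
  forall G, (forall x y, `|G x - G y| <= L * `|x - y|) -> (forall x, `|G x| <= M) ->
  exists G' al be, [/\ smooth2 C G' al be, forall x, `|G' x| <= M &
     forall x, `|G' x - G x| <= 2 * L * s].
Proof.
(* The terms bound the first derivative, the second derivative and the Lipschitz constant of the
   latter; none depends on [G], which the later uniformity needs. *)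
move=> s0 L0; exists (L + 2 * L / s + 4 * L / s ^+ 2).
have t1 : 0 <= 2 * L / s by rewrite divr_ge0 ?mulr_ge0// ltW.
have t2 : 0 <= 4 * L / s ^+ 2 by rewrite divr_ge0 ?mulr_ge0 ?exprn_ge0 ?(ltW s0).
split; first by rewrite !addr_ge0.
move=> G GL GM.
have lipc (g : R -> R) : (forall x y, `|g x - g y| <= L * `|x - y|) -> continuous g.
  move=> gL x; apply/cvgrPdist_le => e e0.
  have L1 : 0 < L + 1 by rewrite ltr_wpDl.
  near=> y; rewrite (le_trans (gL x y))//.
  have : `|x - y| <= e / (L + 1) by near: y; apply: cvgr_dist_le => //; rewrite divr_gt0.
  rewrite ler_pdivlMr// => h; apply: le_trans h; rewrite mulrC ler_wpM2l// lerDl//.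
have stk g : (forall x y, `|g x - g y| <= L * `|x - y|) -> (forall x, `|g x| <= M) ->
   exists A, [/\ forall x, is_derive x 1 A (s^-1 * (g (x + s) - g x)),
     forall x y, `|A x - A y| <= L * `|x - y|, forall x, `|A x| <= M &
     forall x, `|A x - g x| <= L * s].
  move=> gL gM; have [A [dA hA]] := steklov s0 (lipc g gL).
  exists A; split => // [x y|x|x].
  - apply: (derive_lip dA) => z.
    rewrite normrM gtr0_norm ?invr_gt0// mulrC ler_pdivrMr//.
    by rewrite (le_trans (gL _ _))// addrC addKr gtr0_norm.
  - by have [c _ ->] := hA x.
  - have [c /andP[c1 c2] ->] := hA x; rewrite (le_trans (gL _ _))// ler_wpM2l// ger0_norm; lra.
have [G1 [d1 L1 M1 c1]] := stk G GL GM.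
have [G2 [d2 L2 M2 c2]] := stk G1 L1 M1.
pose be x := s^-1 * (s^-1 * (G (x + s + s) - G (x + s)) - s^-1 * (G (x + s) - G x)).
have beE x y : `|be x - be y| <= 4 * L / s ^+ 2 * `|x - y|.
  have -> : be x - be y = s^-1 ^+ 2 * ((G (x + s + s) - G (y + s + s)) - 2 * (G (x + s) - G (y + s)) + (G x - G y)).
    by rewrite /be; ring.
  rewrite normrM ger0_norm ?exprn_ge0 ?invr_ge0 ?(ltW s0)// exprVn.
  rewrite [X in _ <= X * _]mulrC -mulrA ler_wpM2l ?invr_ge0 ?exprn_ge0 ?(ltW s0)//.
  have l1 := GL (x + s + s) (y + s + s); have l2 := GL (x + s) (y + s); have l3 := GL x y.
  have e1 : x + s + s - (y + s + s) = x - y by ring.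
  have e2 : x + s - (y + s) = x - y by ring.
  move: l1 l2 l3; rewrite e1 e2.
  have -> : 4 * L * `|x - y| = L * `|x - y| + 2 * (L * `|x - y|) + L * `|x - y| by ring.
  move: (G _ - G _) (G _ - G _) (G _ - G _) (L * _) => a b c D ha hb hc.
  rewrite (le_trans (ler_normD _ _))// lerD// (le_trans (ler_normB _ _))// lerD//.
  by rewrite normrM ger0_norm// ler_wpM2l.
exists G2, (fun x => s^-1 * (G1 (x + s) - G1 x)), be; split=> //.
- split => //.
  + move=> x.
    have h : is_derive x 1 (fun y => G1 (y + s) - G1 y)
        (s^-1 * (G (x + s + s) - G (x + s)) - s^-1 * (G (x + s) - G x)).
      by apply: is_deriveB; apply: is_derive_shift; exact: d1.
    exact: (is_deriveZ (s^-1) h).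
  + move=> x; rewrite normrM gtr0_norm ?invr_gt0// mulrC ler_pdivrMr//.
    rewrite (le_trans (L1 _ _))// addrC addKr gtr0_norm// ler_wpM2r ?(ltW s0)//.
    by rewrite -addrA lerDl addr_ge0.
  + move=> x; rewrite /be normrM gtr0_norm ?invr_gt0// mulrC ler_pdivrMr//.
    have st y : `|s^-1 * (G (y + s) - G y)| <= L.
      rewrite normrM gtr0_norm ?invr_gt0// mulrC ler_pdivrMr//.
      by rewrite (le_trans (GL _ _))// addrC addKr gtr0_norm.
    rewrite (le_trans (ler_normB _ _))// (le_trans (lerD (st _) (st _)))//.
    have -> : L + L = 2 * L / s * s by rewrite mulfVK ?gt_eqF//; ring.
    by rewrite ler_wpM2r ?(ltW s0)// addrAC lerDr addr_ge0.
  + move=> x y; rewrite (le_trans (beE x y))// ler_wpM2r// lerDr addr_ge0//.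
- move=> x; have := c1 x; have := c2 x => h1 h2.
  rewrite -(subrK (G1 x) (G2 x)) -addrA (le_trans (ler_normD _ _))//; lra.
Unshelve. all: by end_near. Qed.

End smoothing.

(** * Gaussian expectations *)

Section gaussian.
Context (R : realType).
Implicit Types (s l y : R).

(** The Radon-Nikodym derivative of the normal law is almost everywhere its density, both having the
    same integral over every measurable set. *)
Lemma ge0_integral_normal s (f : R -> \bar R) : (forall x, 0 <= f x)%E -> measurable_fun setT f ->
  (\int[normal_prob 0 s]_x f x = \int[lebesgue_measure]_x (f x * (normal_pdf 0 s x)%:E))%E.
Proof.
move=> f0 mf.
pose N : probability _ R := normal_prob 0 s.
have dom : N `<< @lebesgue_measure R by exact: normal_prob_dominates.
rewrite -(Radon_Nikodym_SigmaFinite.change_of_variables dom f0 measurableT mf).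
have iN := Radon_Nikodym_SigmaFinite.f_integrable dom.
have mpdf : measurable_fun setT (fun x => (normal_pdf 0 s x)%:E).
  by apply/measurable_EFinP; exact: measurable_normal_pdf.
apply: ae_eq_integral => //.
- by apply: emeasurable_funM => //; exact: measurable_int iN.
- exact: emeasurable_funM.
- apply: ae_eqe_mul2l; apply: integral_ae_eq => // E _ mE.
  by rewrite -(Radon_Nikodym_SigmaFinite.f_integral dom mE).
Qed.

Lemma measurable_expRM l : measurable_fun setT (fun x : R => expR (l * x)).
Proof.
apply: continuous_measurable_fun => x; apply: continuous_comp.
  exact: mulrl_continuous.
exact: continuous_expR.
Qed.

Lemma normal_mgf s l : 0 < s ->
  (\int[normal_prob 0 s]_x (expR (l * x))%:E = (expR (l ^+ 2 * s ^+ 2 / 2))%:E)%E.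
Proof.
move=> s0; rewrite ge0_integral_normal//; last first.
  by apply/measurable_EFinP; exact: measurable_expRM.
(* Completing the square moves the mean of the density to [l * s ^+ 2]. *)
transitivity (\int[lebesgue_measure]_x ((expR (l ^+ 2 * s ^+ 2 / 2))%:E * (normal_pdf (l * s ^+ 2) s x)%:E))%E.
  apply: eq_integral => x _; rewrite -!EFinM; congr _%:E.
  rewrite !normal_pdfE ?gt_eqF// /normal_fun mulrCA [in RHS]mulrCA -!expRD.
  congr (_ * expR _); field.
  by rewrite gt_eqF.
rewrite ge0_integralZl//.
- by rewrite integral_normal_pdf mule1.
- by apply/measurable_EFinP; exact: measurable_normal_pdf.
- by move=> x _; rewrite lee_fin normal_pdf_ge0.
Qed.

Lemma expR_bound y : `|expR y - 1| <= `|y| * expR `|y|.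
Proof.
have h (z : R) : 0 <= z -> expR z - 1 <= z * expR z.
  move=> z0; have := expR_ge1Dx (- z); rewrite expRN => h.
  have e0 := expR_gt0 z.
  have : (1 - z) * expR z <= 1 by rewrite -ler_pdivlMr// mul1r.
  by lra.
have [y0|y0] := leP 0 y.
  by rewrite !ger0_norm ?h// subr_ge0 -expR0 ler_expR.
rewrite distrC (ltr0_norm y0) ger0_norm; last by rewrite subr_ge0 -[X in _ <= X]expR0 ler_expR ltW.
have h1 : 1 - expR y <= - y by have := expR_ge1Dx y; lra.
apply: (le_trans h1); rewrite ler_peMr ?oppr_ge0 ?(ltW y0)// -expR0 ler_expR oppr_ge0 ltW//.
Qed.

Lemma cube_le_expR y : `|y| ^+ 3 <= 6 * expR `|y|.
Proof.
have := @expR_ge1Dxn R `|y| 2 (normr_ge0 y); rewrite (_ : 3`!%:R = 6 :> R)// => h.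
by rewrite mulrC -ler_pdivrMr//; apply: le_trans h; rewrite lerDr.
Qed.

(** Taylor's formula with [sinh y] and [cosh y - 1] in place of [y] and [y^2 / 2]: their Gaussian
    means follow from the moment generating function, so that no Gaussian moment has to be computed.
    They agree with the monomials to second order, hence the error stays cubic. *)
Lemma smooth2_exp_taylor C G al be y : smooth2 C G al be ->
  `|G y - (G 0 + al 0 * ((expR y - expR (- y)) / 2) + be 0 * ((expR y + expR (- y)) / 2 - 1))|
    <= 3 * C * `|y| ^+ 3 * expR `|y|.
Proof.
move=> sG.
have dE (x : R) : is_derive x 1 (@expR R) (expR x) by exact: is_derive_expR.
have dN (x : R) : is_derive x 1 (fun y : R => expR (- y)) (- expR (- x)).
  have dn : is_derive x 1 (fun y : R => - y) (- 1) by apply: is_deriveN.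
  by have := @is_derive1_comp R expR (fun y => - y) x _ _ (dE (- x)) dn; rewrite mulrN1.
pose ph y := G y - (G 0 + al 0 * ((expR y - expR (- y)) / 2) + be 0 * ((expR y + expR (- y)) / 2 - 1)).
pose ph' y := al y - (al 0 * ((expR y + expR (- y)) / 2) + be 0 * ((expR y - expR (- y)) / 2)).
pose ph'' y := be y - (al 0 * ((expR y - expR (- y)) / 2) + be 0 * ((expR y + expR (- y)) / 2)).
have d1 (x : R) : is_derive x 1 ph (ph' x).
  have h1 := sm_d1 sG x; have h2 := dE x; have h3 := dN x.
  apply: is_derive_eq; rewrite /ph' /GRing.scale /=; by field.
have d2 (x : R) : is_derive x 1 ph' (ph'' x).
  have h1 := sm_d2 sG x; have h2 := dE x; have h3 := dN x.
  apply: is_derive_eq; rewrite /ph'' /GRing.scale /=; by field.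
rewrite (_ : 3 * C * `|y| ^+ 3 * expR `|y| = 3 * C * (`|y| * expR `|y|) * `|y| ^+ 2); last by ring.
apply: (taylor2 d1 d2).
- by rewrite /ph oppr0 expR0; field.
- by rewrite /ph' oppr0 expR0; field.
move=> x xy.
have C0 : 0 <= C by exact: le_trans (normr_ge0 _) (sm_al sG 0).
have bb := sm_beL sG x 0; rewrite subr0 in bb.
have e1 : `|expR x - 1| <= `|y| * expR `|y|.
  by rewrite (le_trans (expR_bound x))// ler_pM// ?expR_ge0// ler_expR.
have e2 : `|expR (- x) - 1| <= `|y| * expR `|y|.
  by rewrite (le_trans (expR_bound _))// normrN ler_pM// ?expR_ge0// ler_expR.
have e3 : `|x| <= `|y| * expR `|y|.
  by rewrite (le_trans xy)// ler_peMr// -expR0 ler_expR.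
have -> : ph'' x = (be x - be 0) + al 0 * (((expR (- x) - 1) - (expR x - 1)) / 2)
     - be 0 * (((expR x - 1) + (expR (- x) - 1)) / 2) by rewrite /ph''; field.
have al0 := sm_al sG 0; have be0 := sm_be sG 0.
move: (`|y| * _) (expR x - 1) (expR (- x) - 1) (al 0) (be 0) (be x - be 0) `|x| e1 e2 e3 bb al0 be0 C0.
clear => D p q a b c z e1 e2 e3 bb a0 b0 C0.
have half (x : R) : `|x| <= D + D -> `|x / 2| <= D.
  by move=> h; rewrite normrM normfV (ger0_norm (ler0n R 2)) ler_pdivrMr// mulr_natr mulr2n.
have h1 : `|a * ((q - p) / 2)| <= C * D.
  by rewrite normrM ler_pM//; apply: half; rewrite (le_trans (ler_normB _ _))// lerD.
have h2 : `|b * ((p + q) / 2)| <= C * D.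
  by rewrite normrM ler_pM//; apply: half; rewrite (le_trans (ler_normD _ _))// lerD.
have h3 : `|c| <= C * D by rewrite (le_trans bb)// ler_wpM2l.
apply: le_trans (ler_normB _ _) _; apply: le_trans (lerD (ler_normD _ _) (lexx _)) _.
by rewrite (_ : 3 * C * D = C * D + C * D + C * D) ?lerD//; ring.
Qed.

End gaussian.

Section gaussian_variable.
Context d (T : measurableType d) (R : realType) (P : probability T R).
Variables (Z : T -> R) (s : R).
Hypotheses (mZ : measurable_fun setT Z) (s0 : 0 < s)
  (lawZ : forall A, measurable A -> P (Z @^-1` A) = normal_prob 0 s A).

Lemma gaussian_mgf l : (\int[P]_w (expR (l * Z w))%:E = (expR (l ^+ 2 * s ^+ 2 / 2))%:E)%E.
Proof.
rewrite -(normal_mgf l s0).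
have mf : measurable_fun setT (fun x : R => (expR (l * x))%:E).
  by apply/measurable_EFinP; exact: measurable_expRM.
pose Zm : {mfun T >-> measurableTypeR R} := @mk_mfun _ _ T (measurableTypeR R) Z mZ.
transitivity (\int[distribution P Zm]_x (expR (l * x))%:E)%E.
  by rewrite ge0_integral_distribution// => x; rewrite lee_fin expR_ge0.
by apply: eq_measure_integral => A mA _; exact: lawZ.
Qed.

Lemma integrable_gaussian l : P.-integrable setT (EFin \o (fun w => expR (l * Z w))).
Proof.
apply/integrableP; split.
  apply/measurable_EFinP; apply: (measurableT_comp (measurable_expRM l)); exact: mZ.
under eq_integral do rewrite gee0_abs ?lee_fin ?expR_ge0//.
by rewrite gaussian_mgf// ltry.
Qed.

Lemma Rint_gaussian l : \int[P]_w expR (l * Z w) = expR (l ^+ 2 * s ^+ 2 / 2).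
Proof. by rewrite /Rintegral gaussian_mgf. Qed.

(** The mean of [sinh] is [0], that of [cosh - 1] is [expR (s ^+ 2 / 2) - 1]. As [s <= 1], the error
    [|y|^3 * expR |y|] is at most [6 * s^3 * expR (2 * |y| / s)], and the exponential moments at
    [2 / s] and [- (2 / s)] both equal [expR 2]; thus [36 = 3 * 6 * 2]. *)
Lemma gaussian_step C G al be : s <= 1 -> smooth2 C G al be -> (forall y, `|G y| <= C) ->
  `|\int[P]_w G (Z w) - (G 0 + be 0 * (expR (s ^+ 2 / 2) - 1))| <= 36 * C * expR 2 * s ^+ 3.
Proof.
move=> s1 sG GC.
have C0 : 0 <= C by exact: le_trans (normr_ge0 _) (sm_al sG 0).
have mG : measurable_fun setT G.
  apply: continuous_measurable_fun => x.
  by apply/differentiable_continuous/derivable1_diffP; case: (sm_d1 sG x).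
have iG : P.-integrable setT (EFin \o (fun w => G (Z w))).
  by apply: bounded_integrable => //; exact: measurableT_comp.
have ie := integrable_gaussian.
have ic c : P.-integrable setT (EFin \o (fun=> c : R)) by apply: (@bounded_integrable _ _ _ P _ `|c|).
have iZ k f : P.-integrable setT (EFin \o f) -> P.-integrable setT (EFin \o (fun x => k * f x)).
  by move=> fi; have := integrableZl measurableT k fi.
have iD f g : P.-integrable setT (EFin \o f) -> P.-integrable setT (EFin \o g) ->
   P.-integrable setT (EFin \o (fun x => f x + g x)).
  by move=> fi gi; have := integrableD measurableT fi gi.
pose c0 := - (G 0 - be 0).
pose Q w := G (Z w) + (c0 + ((- (al 0 + be 0) / 2) * expR (1 * Z w) + ((al 0 - be 0) / 2) * expR (- 1 * Z w))).
have EQ : \int[P]_x Q x = \int[P]_w G (Z w) - (G 0 + be 0 * (expR (s ^+ 2 / 2) - 1)).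
  rewrite /Q RintegralD//; last by apply/iD => //; apply/iD; apply/iZ.
  rewrite RintegralD//; last by apply/iD; apply/iZ.
  rewrite RintegralD//; [|exact: iZ..].
  rewrite !RintegralZl// Rint_cst !Rint_gaussian// sqrrN !expr1n mul1r /c0; by field.
pose B w : R := 18 * C * s ^+ 3 * (expR (2 / s * Z w) + expR (- (2 / s) * Z w)).
have iB : P.-integrable setT (EFin \o B) by apply/iZ/iD.
have EB : \int[P]_x B x = 36 * C * expR 2 * s ^+ 3.
  rewrite /B RintegralZl//; last exact: iD.
  rewrite RintegralD// !Rint_gaussian// sqrrN.
  have -> : (2 / s) ^+ 2 * s ^+ 2 / 2 = 2 by field; rewrite gt_eqF.
  ring.
have iQ : P.-integrable setT (EFin \o Q) by apply/iD => //; apply/iD => //; apply/iD; apply/iZ.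
rewrite -EQ -EB (le_trans (le_normr_Rintegral measurableT iQ))//.
apply: le_Rintegral => //.
  by have := integrable_abse iQ.
move=> w _; pose y := Z w; have -> : Q w = G y - (G 0 + al 0 * ((expR y - expR (- y)) / 2) + be 0 * ((expR y + expR (- y)) / 2 - 1)).
  by rewrite /Q /c0 mul1r mulN1r /y; field.
rewrite (le_trans (smooth2_exp_taylor y sG))//.
have ys : `|y| ^+ 3 <= s ^+ 3 * (6 * expR (`|y| / s)).
  have := cube_le_expR (y / s); rewrite normrM normfV (gtr0_norm s0) => h.
  by rewrite -ler_pdivrMl ?exprn_gt0// mulrC -exprVn -exprMn.
have ys2 : expR `|y| <= expR (`|y| / s) by rewrite ler_expR ler_pdivlMr// ler_piMr.
have e2 : expR (`|y| / s) * expR (`|y| / s) <= expR (2 / s * y) + expR (- (2 / s) * y).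
  rewrite -expRD (_ : `|y| / s + `|y| / s = 2 / s * `|y|); last by ring.
  have [y0|y0] := leP 0 y; first by rewrite ger0_norm// lerDl expR_ge0.
  by rewrite ltr0_norm// mulrN -mulNr lerDr expR_ge0.
rewrite /B -/y -mulrA; apply: (@le_trans _ _ (3 * C * (s ^+ 3 * (6 * expR (`|y| / s)) * expR (`|y| / s)))).
  by rewrite ler_wpM2l ?mulr_ge0// ler_pM ?exprn_ge0 ?expR_ge0.
have -> : 3 * C * (s ^+ 3 * (6 * expR (`|y| / s)) * expR (`|y| / s)) =
  18 * C * s ^+ 3 * (expR (`|y| / s) * expR (`|y| / s)) by ring.
by rewrite ler_wpM2l ?mulr_ge0 ?exprn_ge0 ?(ltW s0).
Qed.

End gaussian_variable.

(** * Path space *)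

Section path_space_theory.
Context (R : realType).
Implicit Types (f g : path_space R) (n : nat).

Lemma path_dist_term_le f g n : path_dist_term f g n.+1 <= path_dist f g.
Proof.
apply: (@le_trans _ _ (series (fun k => path_dist_term f g k.+1) n.+1)).
  by rewrite /series /= big_nat_recr//= lerDr sumr_ge0// => k _; exact: path_dist_term_ge0.
apply: nondecreasing_cvgn_le; last exact: path_dist_term_cvg.
by apply: nondecreasing_series => k _ _; exact: path_dist_term_ge0.
Qed.

Lemma path_dist_ge0 f g : 0 <= path_dist f g.
Proof. exact: le_trans (path_dist_term_ge0 f g 1) (path_dist_term_le f g 0). Qed.

Lemma eval_dist f g n t : 0 <= t <= n.+1%:R -> 2 ^+ n.+1 * path_dist f g < 1 ->
  `|f t - g t| <= 2 ^+ n.+1 * path_dist f g.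
Proof.
move=> tn d1; have := path_dist_term_le f g n; rewrite /path_dist_term ler_pdivrMl ?exprn_gt0//.
rewrite ge_min => /orP[/le_lt_trans/(_ d1)|]; first by rewrite ltxx.
by apply: le_trans; exact: sup_dist_ub.
Qed.

(** The first [n] terms sum to at most [c * (1 - (2 ^+ n)^-1)]; beyond them the truncation at [1]
    leaves a geometric tail. *)
Lemma path_dist_le f g n (c : R) : 0 <= c ->
  (forall t, 0 <= t <= n%:R -> `|f t - g t| <= c) -> path_dist f g <= c + (2 ^+ n)^-1.
Proof.
move=> c0 fgc; rewrite /path_dist; apply: limr_le; first exact: path_dist_term_cvg.
pose p k : R := (2 ^+ k)^-1.
have p0 k : 0 <= p k by rewrite invr_ge0 exprn_ge0.
have pS k : p k = p k.+1 + p k.+1.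
  by rewrite /p exprS invfM; field; rewrite expf_neq0.
have sd k : (k <= n)%N -> sup_dist f g k <= c.
  move=> kn; apply: sup_dist_le => t /andP[t0 tk]; apply: fgc; rewrite t0 /=.
  by rewrite (le_trans tk)// ler_nat.
have small k : (k <= n)%N -> series (fun k => path_dist_term f g k.+1) k <= c * (1 - p k).
  rewrite /series /=; elim: k => [_|k IH kn].
    by rewrite big_geq// /p expr0 invr1 subrr mulr0.
  rewrite big_nat_recr//=; have := IH (ltnW kn); have : path_dist_term f g k.+1 <= p k.+1 * c.
    by rewrite /path_dist_term ler_wpM2l// ge_min sd// orbT.
  by rewrite (pS k); lra.
have large (m : nat) : series (fun k => path_dist_term f g k.+1) (n + m)%N <= c * (1 - p (n + m)%N) + (p n - p (n + m)%N).
  elim: m => [|m IH]; first by rewrite addn0 subrr addr0 small.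
  rewrite addnS; move: IH; rewrite /series /= big_nat_recr//=.
  have : path_dist_term f g (n + m).+1 <= p (n + m).+1.
    by rewrite /path_dist_term -[leRHS]mulr1 ler_wpM2l// ge_min lexx.
  have := mulr_ge0 c0 (p0 (n + m).+1); rewrite (pS (n + m)%N); lra.
apply: nearW => k; have cp k' := mulr_ge0 c0 (p0 k').
have [kn|/ltnW nk] := leqP k n.
  rewrite (le_trans (small k kn))//; have := cp k; have := p0 n; rewrite /p; lra.
rewrite -(subnKC nk) (le_trans (large _))//.
have := cp (n + (k - n))%N; have := p0 (n + (k - n))%N; rewrite -/(p n); lra.
Qed.

Lemma measurable_continuous_path (phi : path_space R -> R) : continuous phi -> measurable_fun setT phi.
Proof.
move=> cphi; apply: (measurability _ (RGenOpens.measurableE R)) => _ [_ [a [b ->] <-]].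
rewrite setTI; apply: sub_sigma_algebra.
by move/continuousP: cphi; apply; exact: interval_open.
Qed.

Lemma continuous_path_dist_le (phi : path_space R -> R) :
  (forall g e, 0 < e -> exists2 r, 0 < r & forall h, path_dist g h < r -> `|phi g - phi h| <= e) ->
  continuous phi.
Proof.
move=> H g A /= /nbhs_ballP[e /= e0 eA].
have [r r0 hr] := H g (e / 2) ltac:(by rewrite divr_gt0).
apply/nbhs_ballP; exists r => //= h gh; apply: eA => /=; rewrite /ball /=.
by rewrite (le_lt_trans (hr h gh))// ltr_pdivrMr// mulr_natr mulr2n ltrDl.
Qed.

Lemma continuous_eval (t : R) : 0 <= t -> continuous (fun g : path_space R => g t).
Proof.
move=> t0; pose n := Num.truncn t.
have tn : 0 <= t <= n.+1%:R by rewrite t0 ltW// truncnS_gt.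
apply: continuous_path_dist_le => g e e0.
have q0 : 0 < 2 ^+ n.+1 :> R by rewrite exprn_gt0.
exists (Num.min (2 ^+ n.+1)^-1 (e / 2 ^+ n.+1)); first by rewrite lt_min invr_gt0 q0 divr_gt0.
move=> h; rewrite lt_min -[X in _ < X]mul1r !ltr_pdivlMr// !(mulrC (path_dist _ _)) => /andP[d1 de].
by rewrite (le_trans (eval_dist tn d1))// ltW.
Qed.

Lemma measurable_eval (t : R) : 0 <= t -> measurable_fun setT (fun g : path_space R => g t).
Proof. by move=> t0; apply: measurable_continuous_path; exact: continuous_eval. Qed.

Definition clamp01 (x : R) := Num.max 0 (Num.min x 1).

Lemma clamp01_bnd x : 0 <= clamp01 x <= 1.
Proof. by rewrite /clamp01 le_max lexx /= ge_max ler01 ge_min lexx orbT. Qed.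

(** The polygon through the partial sums of [v] at the grid points [j%:R * h], constant after
    [q%:R * h]. Written as a sum of ramps it is linear in [v], so continuity and Lipschitz bounds
    are proved termwise. *)
Definition interp_fun (q : nat) (h : R) (v : nat -> R) (t : R) : R :=
  \sum_(j < q) v j * clamp01 ((t - j%:R * h) / h).

Lemma clamp01_continuous : continuous clamp01.
Proof.
move=> x; apply: (@continuous_max R R (fun=> 0) (fun x => Num.min x 1)); first exact: cvg_cst.
by apply: (@continuous_min R R id (fun=> 1)); [exact: cvg_id|exact: cvg_cst].
Qed.

Lemma interp_continuous q h v : continuous (interp_fun q h v).
Proof.
move=> t; apply: (cvg_big (op:=+%R)) => [|j _]; first exact: add_continuous.
have c : continuous (fun x : R => (x - j%:R * h) / h).
  by move=> x; apply: cvgM; [apply: cvgB; [exact: cvg_id|exact: cvg_cst]|exact: cvg_cst].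
apply: cvgM; first exact: cvg_cst.
exact: (continuous_comp (c t) (@clamp01_continuous _)).
Qed.

Lemma interp_neg q h v t : 0 < h -> t <= 0 -> interp_fun q h v t = 0.
Proof.
move=> h0 t0; rewrite /interp_fun big1// => j _.
rewrite /clamp01 (_ : Num.max _ _ = 0) ?mulr0//; apply/max_idPl.
rewrite ge_min ler_pdivrMr// mul0r subr_le0 (le_trans t0)// mulr_ge0// ltW//.
Qed.

Lemma interpE q h v i t : 0 < h -> (i < q)%N -> i%:R * h <= t <= i.+1%:R * h ->
  interp_fun q h v t = \sum_(j < i) v j + v i * ((t - i%:R * h) / h).
Proof.
move=> h0 iq /andP[t1 t2].
rewrite /interp_fun -(subnKC iq) big_split_ord /= big_ord_recr /= -addrA [X in _ + (_ + X)]big1 ?addr0; last first.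
  move=> j _; rewrite (_ : clamp01 _ = 0) ?mulr0//; apply/max_idPl.
  rewrite ge_min ler_pdivrMr// mul0r subr_le0 (le_trans t2)// ler_wpM2r ?(ltW h0)//.
  by rewrite ler_nat leq_addr.
congr (_ + _); last first.
  congr (_ * _); rewrite /clamp01; have -> : Num.min ((t - i%:R * h) / h) 1 = (t - i%:R * h) / h.
    apply/min_idPl; rewrite ler_pdivrMr// mul1r lerBlDl.
    by rewrite (le_trans t2)// -[i.+1]addn1 natrD mulrDl mul1r.
  by apply/max_idPr; rewrite divr_ge0 ?(ltW h0)// subr_ge0.
apply: eq_bigr => j _; rewrite (_ : clamp01 _ = 1) ?mulr1// /clamp01.
have -> : Num.min ((t - j%:R * h) / h) 1 = 1.
  apply/min_idPr; rewrite ler_pdivlMr// mul1r lerBrDl.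
  rewrite (le_trans _ t1)// -{2}[h]mul1r -mulrDl ler_wpM2r ?(ltW h0)//.
  by rewrite natr1 ler_nat.
by apply/max_idPr.
Qed.

Lemma interp_lip q h v v' t :
  `|interp_fun q h v t - interp_fun q h v' t| <= \sum_(j < q) `|v j - v' j|.
Proof.
rewrite /interp_fun -sumrB (le_trans (ler_norm_sum _ _ _))// ler_sum// => j _.
have /andP[c0 c1] := clamp01_bnd ((t - j%:R * h) / h).
by rewrite -mulrBl normrM (ger0_norm c0) ler_piMr.
Qed.

Definition interp_path q h (h0 : 0 < h) v : path_space R :=
  PathSpace (@interp_continuous q h v)
    (fun t t0 => etrans (interp_neg q v h0 t0) (esym (interp_neg q v h0 (lexx 0)))).

Lemma exp2V_lt (e : R) : 0 < e -> exists n, (2 ^+ n)^-1 < e.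
Proof.
move=> e0; have := @cvg_expr R 2^-1.
rewrite gtr0_norm ?invr_gt0// invf_lt1// ltr1n => /(_ isT).
move=> /cvgrPdist_lt/(_ e e0)[n _ /(_ n (leqnn n))].
by rewrite sub0r normrN exprVn ger0_norm ?invr_ge0 ?exprn_ge0//; exists n.
Qed.

Lemma path_dist_uniform f g c : (forall t, 0 <= t -> `|f t - g t| <= c) -> path_dist f g <= c.
Proof.
move=> fgc; have c0 : 0 <= c by exact: le_trans (normr_ge0 _) (fgc 0 (lexx 0)).
apply/ler_addgt0Pr => e e0.
have [n hn] := exp2V_lt e0.
rewrite (le_trans (@path_dist_le f g n c c0 _))//; last by rewrite lerD2l ltW.
by move=> t /andP[t0 _]; exact: fgc.
Qed.

Lemma interp_path_lip q h (h0 : 0 < h) v v' :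
  path_dist (interp_path q h0 v) (interp_path q h0 v') <= \sum_(j < q) `|v j - v' j|.
Proof. by apply: path_dist_uniform => t _; exact: interp_lip. Qed.

Lemma grid_index q (h t : R) : 0 < h -> (0 < q)%N -> 0 <= t <= q%:R * h ->
  exists2 i, (i < q)%N & i%:R * h <= t <= i.+1%:R * h.
Proof.
move=> h0 q0 /andP[t0 tq].
have th0 : 0 <= t / h by rewrite divr_ge0 ?(ltW h0).
have /andP[n1 n2] := truncn_itv th0.
move: n1 n2; set n := Num.truncn _; rewrite ler_pdivlMr// ltr_pdivrMr// => n1 n2.
have [nq|qn] := ltnP n q; first by exists n; rewrite // n1 ltW.
exists q.-1; rewrite ?prednK// tq andbT (le_trans _ n1)// ler_wpM2r ?(ltW h0)//.
by rewrite ler_nat (leq_trans (leq_pred q)).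
Qed.

Definition incr (g : R -> R) (h : R) (j : nat) : R := g (j.+1%:R * h) - g (j%:R * h).

Lemma sum_incr (g : R -> R) h i : g 0 = 0 -> \sum_(j < i) incr g h j = g (i%:R * h).
Proof.
move=> g0; elim: i => [|i IH]; first by rewrite big_ord0 mul0r.
by rewrite big_ord_recr /= IH /incr addrC subrK.
Qed.

(** One [om] comes from moving [t] to the grid point on its left, the other from the interpolated
    increment. The right grid point may lie beyond [T], hence the horizon [T + h]. *)
Lemma interp_close q h T (g : R -> R) (om : R) : 0 < h -> g 0 = 0 -> T <= q%:R * h ->
  (forall s t, 0 <= s <= T + h -> 0 <= t <= T + h -> `|s - t| <= h -> `|g s - g t| <= om) ->
  forall t, 0 <= t <= T -> `|g t - interp_fun q h (incr g h) t| <= 2 * om.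
Proof.
move=> h0 g0 Tq hg t tT.
have tTh : 0 <= t <= T + h by move: tT h0; clear; lra.
have tq : 0 <= t <= q%:R * h by move: tT Tq; clear; lra.
have om0 : 0 <= om.
  by apply: le_trans (normr_ge0 _) (hg t t tTh tTh _); rewrite subrr normr0 ltW.
have [q0|q0] := posnP q.
  move: tq; rewrite q0 mul0r -eq_le => /eqP <-.
  by rewrite /interp_fun big_ord0 g0 subrr normr0 mulr_ge0.
have [i iq it] := grid_index h0 q0 tq; rewrite (interpE _ h0 iq it) sum_incr//.
have /andP[t1 t2] := it.
have hi : i.+1%:R * h = i%:R * h + h by rewrite -natr1 mulrDl mul1r.
have i0 : 0 <= i%:R * h by rewrite mulr_ge0 ?(ltW h0).
have t0 := andP tT.
have h1 : `|g t - g (i%:R * h)| <= om.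
  apply: hg => //; first by move: tT h0 i0 t1; clear; lra.
  by rewrite ger0_norm; move: t1 t2; rewrite hi; clear; lra.
have h2 : `|incr g h i * ((t - i%:R * h) / h)| <= om.
  have th : 0 <= (t - i%:R * h) / h by rewrite divr_ge0 ?(ltW h0)// subr_ge0.
  rewrite normrM (ger0_norm th) -[leRHS]mulr1 ler_pM//; last by rewrite ler_pdivrMr// mul1r lerBlDl -hi.
  apply: hg; rewrite ?hi; last by rewrite addrC addKr ger0_norm// ltW.
    by move: tT h0 i0 t1; clear; lra.
  by move: tT h0 i0 t1; clear; lra.
rewrite opprD addrA (le_trans (ler_normB _ _))//; move: h1 h2; clear; lra.
Qed.

Lemma path_unif_continuous g T (e : R) : 0 < e -> exists2 r, 0 < r &
  forall s t, 0 <= s <= T -> 0 <= t <= T -> `|s - t| <= r -> `|g s - g t| <= e.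
Proof.
move=> e0; have K : compact `[0, T] by exact: segment_compact.
move/compact_near_coveringP: K.
have FF : Filter (0^'+ : set_system R) by exact: at_right_proper_filter.
move=> /(_ R 0^'+ (fun r s => forall t, `|s - t| <= r -> `|g s - g t| <= e) FF) H.
have {H} : \forall r \near (0 : R)^'+, `[0, T] `<=` (fun s => forall t, `|s - t| <= r -> `|g s - g t| <= e).
  apply: H => s _.
  have /cvgrPdist_le/(_ (e / 2))/(_ ltac:(by rewrite divr_gt0)) := @path_continuous R g s.
  move=> /nbhs_ballP[r /= r0 hr]; have r20 : 0 < r / 2 by rewrite divr_gt0.
  near=> s' r' => t /= st.
  have s's : `|s - s'| < r / 2 by near: s'; exact: (nbhsx_ballx s _ r20).
  have r'r : r' < r / 2 by near: r'; exact: nbhs_right_lt.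
  have hs' : `|g s - g s'| <= e / 2.
    by apply: hr; rewrite /ball /=; have := r20; move: s's; clear; lra.
  have ht : `|g s - g t| <= e / 2.
    apply: hr; rewrite /ball /= -(subrK s' s) -addrA (le_lt_trans (ler_normD _ _))//.
    by move: s's st r'r; clear; lra.
  rewrite -(subrK (g s) (g s')) -addrA (le_trans (ler_normD _ _))// distrC.
  by move: hs' ht; clear; lra.
move=> H; near (0 : R)^'+ => r; exists r; first by near: r; exact: nbhs_right_gt.
move=> s t sT _; have Hr : `[0, T] `<=` (fun s => forall t, `|s - t| <= r -> `|g s - g t| <= e) by near: r.
by apply: Hr; rewrite /= in_itv.
Unshelve. all: by end_near. Qed.

End path_space_theory.

(** * Borel measurability of path-valued maps *)

Section measurable_path_valued.
Context (R : realType) d (T : measurableType d).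

(** An open set with nonempty complement is where the distance [D] to the complement is positive.
    [D] of a path is the limit of [D] of its polygons, each a Lipschitz function of finitely many
    evaluations. *)
Lemma measurable_path (U : T -> path_space R) : (forall w, U w 0 = 0) ->
  (forall t, 0 <= t -> measurable_fun setT (fun w => U w t)) -> measurable_fun setT U.
Proof.
move=> U0 mU; apply: (measurability (@open (path_space R))) => //.
move=> _ [V oV <-]; rewrite setTI.
have [VT|/set0P[z Vz]] := eqVneq (~` V) set0.
  rewrite (_ : V = setT) ?preimage_setT; first exact: measurableT.
  by rewrite -(setCK V) VT setC0.
pose D g := inf [set path_dist g h | h in ~` V].
have hi g : has_inf [set path_dist g h | h in ~` V].
  split; first by exists (path_dist g z), z.
  by exists 0 => _ [h _ <-]; exact: path_dist_ge0.
have DL g g' : `|D g - D g'| <= path_dist g g'.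
  wlog : g g' / D g' <= D g => [hw|D1].
    have [/hw//|/ltW/hw] := leP (D g') (D g).
    by rewrite distrC path_dist_sym.
  rewrite ger0_norm ?subr_ge0// lerBlDr -lerBlDl.
  apply: lb_le_inf; first by exists (path_dist g' z), z.
  move=> _ [h Vh <-]; rewrite lerBlDl.
  rewrite (le_trans _ (path_dist_triangle _ _ _))//; apply: ge_inf; first exact: (hi g).2.
  by exists h.
have VD : V = [set g | 0 < D g].
  apply/seteqP; split=> g /=.
    move=> Vg; have /nbhs_ballP[r /= r0 rV] := open_nbhs_nbhs (conj oV Vg).
    apply: (lt_le_trans r0); apply: lb_le_inf; first by exists (path_dist g z), z.
    move=> _ [h Vh <-]; rewrite leNgt; apply/negP => dr; apply: Vh.
    by apply: rV; rewrite /ball.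
  apply: contraPP => Vg; apply/negP; rewrite -leNgt -(path_distxx g).
  by apply: ge_inf; [exact: (hi g).2|exists g].
suff mD : measurable_fun setT (fun w => D (U w)).
  rewrite VD (_ : _ @^-1` _ = (fun w => D (U w)) @^-1` `]0, +oo[).
    by rewrite -[X in measurable X]setTI; exact: mD.
  by apply/seteqP; split=> w /=; rewrite in_itv /= andbT.
have h0 m : 0 < m.+1%:R^-1 :> R by rewrite invr_gt0.
(* With mesh [1 / (m + 1)] and [(m + 1)^2] steps the polygons reach time [m + 1]: mesh and horizon
   improve together. *)
pose pi_ m w := interp_path (m.+1 * m.+1)%N (h0 m) (incr (U w) m.+1%:R^-1).
apply: (measurable_fun_cvg (h := fun m w => D (pi_ m w))) => [m|w _].
  apply: (@lip_on_measurable _ _ _ (m.+1 * m.+1)%N 1 (fun v => D (interp_path (m.+1 * m.+1)%N (h0 m) v))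
    (fun j w => incr (U w) m.+1%:R^-1 j)).
    by move=> v v'; rewrite mul1r (le_trans (DL _ _))// interp_path_lip.
  move=> j _; rewrite /incr; apply: measurable_funB; apply: mU; by rewrite mulr_ge0.
apply/cvgrPdist_le => e e0.
have [n hn] : exists n, (2 ^+ n)^-1 < e / 2 :> R by exact: exp2V_lt (divr_gt0 e0 _).
have [r r0 hr] := path_unif_continuous (U w) (n%:R + 1) (divr_gt0 (divr_gt0 e0 (ltr0Sn R 1)) (ltr0Sn R 1)).
near=> m; rewrite (le_trans (DL _ _))//.
have mr : m.+1%:R^-1 < r by near: m; exact: near_infty_natSinv_lt (PosNum r0).
have mn : (n <= m)%N by near: m; exact: nbhs_infty_ge.
have c := @interp_close R (m.+1 * m.+1)%N m.+1%:R^-1 n%:R (U w) (e / 2 / 2) (h0 m) (U0 w).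
feed c. by rewrite natrM mulfK// ler_nat leqW.
feed c.
  have h1 : m.+1%:R^-1 <= 1 :> R by rewrite invf_le1// ler1n.
  move=> s t s1 t1 st; apply: hr; last exact: le_trans st (ltW mr).
    by move: s1 h1; clear; move: (_^-1) => k; lra.
  by move: t1 h1; clear; move: (_^-1) => k; lra.
rewrite (le_trans (@path_dist_le _ _ _ n (e / 2) _ _))//; first by rewrite divr_ge0 ?ltW.
- by move=> t tn; rewrite (le_trans (c t tn))// mulrC mulfVK.
- by move: hn; clear; move: (_^-1) => k; lra.
Unshelve. all: by end_near. Qed.

End measurable_path_valued.

Lemma Rint_dominated d (T : measurableType d) (R : realType) (P : probability T R)
    (f_ : nat -> T -> R) (f g : T -> R) :
  (forall n, measurable_fun setT (f_ n)) -> P.-integrable setT (EFin \o g) ->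
  (forall n x, `|f_ n x| <= g x) -> (forall x, f_ n x @[n --> \oo] --> f x) ->
  \int[P]_x f_ n x @[n --> \oo] --> \int[P]_x f x.
Proof.
move=> mf ig fg ff.
have mlim : measurable_fun setT f by apply: measurable_fun_cvg mf _ => x _; exact: ff.
have [] := @dominated_convergence _ _ _ P setT measurableT (fun n => EFin \o f_ n) (EFin \o f) (EFin \o g).
- by move=> n; exact/measurable_EFinP.
- exact/measurable_EFinP.
- by apply: aeW => x _; apply: cvg_EFin; [exact: nearW|exact: ff].
- by [].
- by apply: aeW => x n _; rewrite lee_fin fg.
move=> fi _ h; have E : (\int[P]_x (EFin \o f) x)%E = (\int[P]_x f x)%:E.
  by rewrite /Rintegral fineK//; exact: integrable_fin_num.
by rewrite E in h; exact: fine_cvg h.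
Qed.

Lemma measurable_sgr (R : realType) : measurable_fun setT (Num.sg : R -> R).
Proof.
rewrite (_ : Num.sg = (fun x : R => \1_(`]0, +oo[) x - \1_(`]-oo, 0[) x)).
  by apply: measurable_funB; exact: measurable_indic.
apply/funext => x; rewrite !indicE !mem_setE !in_itv /= andbT.
by case: sgrP; rewrite ?subr0 ?sub0r ?subrr.
Qed.

Lemma smooth2_le (R : realType) (C C' : R) G al be : C <= C' -> smooth2 C G al be -> smooth2 C' G al be.
Proof.
move=> CC [d1 d2 a b l]; split => // [x|x|x y].
- exact: le_trans (a x) CC.
- exact: le_trans (b x) CC.
- by apply: le_trans (l x y) _; rewrite ler_wpM2r.
Qed.

Lemma smooth2_shift (R : realType) (C : R) G al be c : smooth2 C G al be ->
  smooth2 C (fun x => G (x + c)) (fun x => al (x + c)) (fun x => be (x + c)).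
Proof.
move=> [d1 d2 a b l]; split => // [x|x|x y]; try exact: is_derive_shift.
by rewrite (le_trans (l _ _))// opprD addrACA subrr addr0.
Qed.

Lemma smooth2_measurable (R : realType) (C : R) G al be : smooth2 C G al be -> measurable_fun setT G.
Proof.
move=> sG; apply: continuous_measurable_fun => x.
by apply/differentiable_continuous/derivable1_diffP; case: (sm_d1 sG x).
Qed.

(** The third-order error where [|x|] is small compared with [1 / r], the second-order one
    elsewhere. Its mean tends to [0] with [r] under a second moment alone, by dominated
    convergence. *)
Definition lindeberg_err (R : realType) (r x : R) : R := Num.min (r * `|x| ^+ 3) (x ^+ 2).

(** The first-order terms at [y] and [- y] cancel. The Lipschitz bound on [be] gives the cubic
    estimate, its boundedness the quadratic one. *)
Lemma smooth2_sym (R : realType) (C : R) G al be y : smooth2 C G al be ->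
  `|(G y + G (- y)) / 2 - G 0 - be 0 * y ^+ 2 / 2| <= 2 * C * Num.min (`|y| ^+ 3) (y ^+ 2).
Proof.
move=> sG.
have C0 : 0 <= C by exact: le_trans (normr_ge0 _) (sm_al sG 0).
pose ph y := G y - (G 0 + al 0 * y + be 0 * (y * y / 2)).
pose ph' y := al y - (al 0 + be 0 * y).
pose ph'' y := be y - be 0.
have d1 x : is_derive (x : R) 1 ph (ph' x).
  have h1 := sm_d1 sG x; apply: is_derive_eq; rewrite /ph' /GRing.scale /=; by field.
have d2 (x : R) : is_derive x 1 ph' (ph'' x).
  have h1 := sm_d2 sG x; apply: is_derive_eq; rewrite /ph'' /GRing.scale /=; by field.
have p0 : ph 0 = 0 by rewrite /ph; field.
have p'0 : ph' 0 = 0 by rewrite /ph'; ring.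
have bnd z : `|ph z| <= 2 * C * Num.min (`|z| ^+ 3) (z ^+ 2).
  have t1 : `|ph z| <= C * `|z| * `|z| ^+ 2.
    apply: (taylor2 d1 d2 p0 p'0) => x xz.
    by rewrite (le_trans (sm_beL sG x 0))// subr0 ler_wpM2l.
  have t2 : `|ph z| <= (C + C) * `|z| ^+ 2.
    apply: (taylor2 d1 d2 p0 p'0) => x _.
    by rewrite (le_trans (ler_normB _ _))// lerD// (sm_be sG).
  rewrite minEle; case: ifP => _; last by rewrite -(real_normK (num_real z)) mulr_natl mulr2n.
  rewrite (le_trans t1)// -mulrA -exprS mulr_natl mulr2n mulrDl lerDl mulr_ge0//.
have b1 := bnd y; have b2 := bnd (- y); rewrite normrN sqrrN in b2.
have -> : (G y + G (- y)) / 2 - G 0 - be 0 * y ^+ 2 / 2 = (ph y + ph (- y)) / 2.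
  by rewrite /ph; field.
rewrite normrM normfV (ger0_norm (ler0n R 2)) ler_pdivrMr// (le_trans (ler_normD _ _))//.
by rewrite mulr_natr mulr2n lerD.
Qed.

(** * One step of the walk *)

Section random_signs.
Context d (T : measurableType d) (R : realType) (P : probability T R).
Variables (X1 X2 : nat -> {RV P >-> R}).
Let X (ik : bool * nat) := if ik.1 then X1 ik.2 : T -> R else X2 ik.2.
Hypotheses (Xindep : mutually_independent P X)
  (X1sym : forall k, P [set w | 0 < X1 k w] = P [set w | X1 k w < 0])
  (X2id : forall k (A : set R), measurable A ->
    distribution P (X2 k) A = distribution P (X2 0%N) A)
  (X2var : forall k, ('E_P[fun w => (`|X2 k w| ^+ 2)%R] = 1)%E)
  (X1neq0 : forall k, {ae P, forall w, X1 k w != 0}).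

(* As [H >= 0] and [max f = - min f = 1], on a strip with [X1 k > 0] the solution follows
   [- |X2 k|], and on a strip with [X1 k < 0] it follows [|X2 k|]. *)
Definition xi k w : R := - (Num.sg (X1 k w) * `|X2 k w|).

Lemma measurable_X i : measurable_fun setT (X i).
Proof. by rewrite /X; case: i => -[] k /=; exact: measurable_funPT. Qed.

Lemma measurable_xi k : measurable_fun setT (xi k).
Proof.
have m1 := measurable_X (true, k); have m2 := measurable_X (false, k).
apply: measurableT_comp => //; apply: measurable_funM.
  by apply: measurableT_comp => //; exact: measurable_sgr.
exact: measurableT_comp.
Qed.

Lemma measurable_sig_xi (J : bool * nat -> Prop) k : J (true, k) -> J (false, k) ->
  measurable_fun (setT : set (g_sigma_algebraType (sig_of X J))) (xi k : g_sigma_algebraType (sig_of X J) -> R).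
Proof.
move=> J1 J2.
have m1 := measurable_sig (Y := X) J1; have m2 := measurable_sig (Y := X) J2.
apply: measurableT_comp => //; apply: measurable_funM.
  by apply: (measurableT_comp (@measurable_sgr R)); exact: m1.
by apply: measurableT_comp => //; exact: m2.
Qed.

(** [X1 k] has no mass at [0] and gives both signs the same mass; the integrand [1] then shows that
    this mass is [1 / 2]. *)
Lemma Rint_sgr k (phi : R -> R) : \int[P]_w phi (Num.sg (X1 k w)) = (phi 1 + phi (- 1)) / 2.
Proof.
have mX1 : measurable_fun setT (X1 k) by exact: measurable_funPT.
have mS (B : set R) : measurable B -> measurable (X1 k @^-1` B).
  by move=> mB; rewrite -[X in measurable X]setTI; exact: mX1.
pose A1 := X1 k @^-1` `]0, +oo[; pose A2 := X1 k @^-1` `]-oo, 0[; pose A3 := X1 k @^-1` [set 0].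
have m1 : measurable A1 by exact: mS.
have m2 : measurable A2 by exact: mS.
have m3 : measurable A3 by exact: mS.
have key f : \int[P]_w f (Num.sg (X1 k w)) = f 1 * prb P A1 + f (- 1) * prb P A2 + f 0 * prb P A3.
  have iA (A : set T) : measurable A -> P.-integrable setT (EFin \o (\1_A : T -> R)).
    move=> mA; apply: (@bounded_integrable _ _ _ P _ 1) => [|w]; last exact: indic_bnd.
    exact: measurable_indicT.
  have iZ c (A : set T) : measurable A -> P.-integrable setT (EFin \o (fun w => c * \1_A w)).
    by move=> mA; have := integrableZl measurableT c (iA A mA).
  rewrite -!(Rint_indic P)// -!RintegralZl//; [|exact: iA..].
  have i1 := iZ (f 1) A1 m1; have i2 := iZ (f (- 1)) A2 m2; have i3 := iZ (f 0) A3 m3.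
  have i12 : P.-integrable setT (EFin \o (fun w => f 1 * \1_A1 w + f (- 1) * \1_A2 w)).
    by have := integrableD measurableT i1 i2.
  rewrite -RintegralD// -RintegralD//.
  apply: eq_Rintegral => w _; rewrite !indicE /A1 /A2 /A3.
  rewrite (_ : (w \in X1 k @^-1` _) = (0 < X1 k w)); last first.
    by apply/idP/idP; rewrite inE /= in_itv /= andbT.
  rewrite (_ : (w \in X1 k @^-1` `]-oo, 0[) = (X1 k w < 0)); last first.
    by apply/idP/idP; rewrite inE /= in_itv.
  rewrite (_ : (w \in X1 k @^-1` [set 0]) = (X1 k w == 0)); last first.
    by apply/idP/eqP; rewrite inE.
  by case: sgrP => _ /=; rewrite ?(mulr1, mulr0, add0r, addr0).
have p3 : prb P A3 = 0.
  have [N [mN N0 subN]] := X1neq0 k; apply/eqP; rewrite eq_le prb_ge0 andbT.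
  rewrite -[leRHS]/(fine 0%E) -N0; apply: prb_le => //.
  by move=> w; rewrite /A3 /= => h; apply: subN; rewrite /= h eqxx.
have p12 : prb P A1 = prb P A2.
  rewrite /prb; congr fine; have := X1sym k.
  rewrite (_ : [set w | 0 < X1 k w] = A1); last by apply/seteqP; split=> w; rewrite /A1 /= in_itv /= andbT.
  by rewrite (_ : [set w | X1 k w < 0] = A2)//; apply/seteqP; split=> w; rewrite /A2 /= in_itv.
have := key (fun=> 1); rewrite Rint_cst p3 p12 => h.
rewrite key p3 p12; have -> : prb P A2 = 1 / 2 by move: h; lra.
by field.
Qed.

(** [X1 k] and [X2 k] are independent, so the sign is averaged first with [|X2 k|] frozen. This is
    what makes the steps symmetric although [X2 k] need not be. *)
Lemma Rint_xi k (G : R -> R) M a : measurable_fun setT G -> (forall x, `|G x| <= M) ->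
  \int[P]_w G (a * xi k w) = \int[P]_w ((G (a * `|X2 k w|) + G (- (a * `|X2 k w|))) / 2).
Proof.
move=> mG GM.
pose J (i : bool * nat) := i = (false, k); pose J' (i : bool * nat) := i = (true, k).
have JJ' i : J i -> J' i -> False by rewrite /J /J' => ->.
have m1 := measurable_sig (Y := X) (erefl : J (false, k)).
have m2 := measurable_sig (Y := X) (erefl : J' (true, k)).
pose Y w := Num.sg (X1 k w).
have mY : measurable_fun setT Y.
  exact: (measurableT_comp (@measurable_sgr R) (measurable_X (true, k))).
have iY : indep_of P (sig_of X J) Y.
  apply: (indep_of_sig measurable_X Xindep JJ').
  by apply: (measurableT_comp (@measurable_sgr R)); exact: m2.
pose h (z : g_sigma_algebraType (sig_of X J) * R) := G (a * - (z.2 * `|X2 k z.1|)).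
have mh : measurable_fun setT h.
  apply: (measurableT_comp mG); apply: measurable_funM => //; apply: measurableT_comp => //.
  apply: measurable_funM; first exact: measurable_snd.
  apply: measurableT_comp => //.
  by apply: (measurableT_comp m1); exact: measurable_fst.
have [H _] := Rint_factor (sig_of_measurable measurable_X (J := J)) mY iY mh (fun z => GM _).
rewrite [LHS]H; apply: eq_Rintegral => w _; rewrite /h /Y /=.
rewrite (Rint_sgr k (fun y => G (a * - (y * `|X2 k w|)))) addrC.
by rewrite mulN1r opprK mul1r mulrN.
Qed.

Lemma integrable_X2sq k : P.-integrable setT (EFin \o (fun w => X2 k w ^+ 2)).
Proof.
have m2 : measurable_fun setT (X2 k) by exact: measurable_funPT.
apply/integrableP; split; first by apply/measurable_EFinP; exact: measurable_funX.
have := X2var k; rewrite unlock => E.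
rewrite [X in (X < _)%E](_ : _ = 1%E) ?ltry// -E; apply: eq_integral => w _ /=.
by rewrite normrX.
Qed.

Lemma Rint_X2sq k : \int[P]_w (X2 k w ^+ 2) = 1.
Proof.
have := X2var k; rewrite unlock => E.
rewrite /Rintegral (_ : 1 = fine 1%E)// -E; congr fine; apply: eq_integral => w _.
by rewrite real_normK// num_real.
Qed.

Lemma Rint_X2_law k (psi : R -> R) : measurable_fun setT psi -> (forall x, 0 <= psi x) ->
  \int[P]_w psi (X2 k w) = \int[P]_w psi (X2 0%N w).
Proof.
move=> mpsi p0; rewrite /Rintegral; congr fine.
have E j : (\int[P]_w (psi (X2 j w))%:E = \int[distribution P (X2 j)]_x (psi x)%:E)%E.
  by rewrite ge0_integral_distribution//; apply/measurable_EFinP.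
rewrite !E; apply: eq_measure_integral => A mA _; exact: X2id.
Qed.

Definition lindeberg_mom r := \int[P]_w lindeberg_err r (X2 0%N w).

Lemma measurable_lindeberg r : measurable_fun setT (lindeberg_err r : R -> R).
Proof.
apply: measurable_minr; last exact: measurable_funX.
by apply: measurable_funM => //; apply: measurable_funX; exact: normr_measurable.
Qed.

Lemma lindeberg_err_bnd (r x : R) : 0 <= r -> 0 <= lindeberg_err r x <= x ^+ 2.
Proof.
by move=> r0; rewrite /lindeberg_err le_min sqr_ge0 mulr_ge0 ?exprn_ge0//= ge_min lexx orbT.
Qed.

Lemma lindeberg_mom_small e : 0 < e -> exists2 r, 0 < r & lindeberg_mom r <= e.
Proof.
move=> e0.
have r0 n : 0 < n.+1%:R^-1 :> R by rewrite invr_gt0.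
have mX2 := measurable_X (false, 0%N).
have : \int[P]_w lindeberg_err n.+1%:R^-1 (X2 0%N w) @[n --> \oo] --> \int[P]_w (0 : R).
  apply: (Rint_dominated (g := fun w => X2 0%N w ^+ 2)).
  - by move=> n; apply: (measurableT_comp (measurable_lindeberg _)); exact: mX2.
  - exact: integrable_X2sq.
  - move=> n w; have /andP[h1 h2] := lindeberg_err_bnd (X2 0%N w) (ltW (r0 n)).
    by rewrite ger0_norm.
  - move=> w; apply: (@squeeze_cvgr _ _ _ _ (fun=> 0) (fun n => n.+1%:R^-1 * `|X2 0%N w| ^+ 3)).
    + near=> n; rewrite (andP (lindeberg_err_bnd (X2 0%N w) (ltW (r0 n)))).1 /=.
      by rewrite /lindeberg_err ge_min lexx.
    + exact: cvg_cst.
    + rewrite -[X in _ --> X](mul0r (`|X2 0%N w| ^+ 3)); apply: cvgM; last exact: cvg_cst.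
      exact: cvg_harmonic.
rewrite Rint_cst => /cvgrPdist_le/(_ e e0)[n _ /(_ n (leqnn n))].
rewrite sub0r normrN => /(le_trans (ler_norm _)) h.
by exists n.+1%:R^-1.
Unshelve. all: by end_near. Qed.

(** After averaging the sign, [E |X2 k|^2 = 1] yields the term [be 0 * (eta / 2)]. The remainder is
    a minimum of [sqrt eta ^+ 3 * |x|^3] and [eta * x^2], at most [eta * lindeberg_err r x] because
    [sqrt eta <= r]. *)
Lemma xi_step C G al be k eta r : 0 <= eta -> Num.sqrt eta <= r -> smooth2 C G al be ->
  (forall x, `|G x| <= C) ->
  `|\int[P]_w G (Num.sqrt eta * xi k w) - (G 0 + be 0 * (eta / 2))| <= 2 * C * eta * lindeberg_mom r.
Proof.
move=> eta0 er sG GC; have r0 : 0 <= r by exact: le_trans (sqrtr_ge0 _) er.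
have C0 : 0 <= C by exact: le_trans (normr_ge0 _) (sm_al sG 0).
have mG := smooth2_measurable sG; have mX2 := measurable_X (false, k).
rewrite (Rint_xi k _ mG GC).
pose S w := (G (Num.sqrt eta * `|X2 k w|) + G (- (Num.sqrt eta * `|X2 k w|))) / 2.
have mS : measurable_fun setT S.
  have m1 : measurable_fun setT (fun w => Num.sqrt eta * `|X2 k w|).
    by apply: measurable_funM => //; exact: measurableT_comp.
  apply: measurable_funM => //; apply: measurable_funD.
    exact: (measurableT_comp mG m1).
  by apply: (measurableT_comp mG); exact: measurableT_comp.
have iS : P.-integrable setT (EFin \o S).
  apply: (bounded_integrable (M := C) P mS) => w.
  rewrite normrM normfV (ger0_norm (ler0n R 2)) ler_pdivrMr// (le_trans (ler_normD _ _))//.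
  by rewrite mulr_natr mulr2n lerD.
have iX := integrable_X2sq k.
have iB : P.-integrable setT (EFin \o (fun w => G 0 + be 0 * eta / 2 * (X2 k w ^+ 2))).
  have i1 : P.-integrable setT (EFin \o (fun _ : T => G 0)).
    by apply: (@bounded_integrable _ _ _ P _ `|G 0|).
  have i2 := integrableZl measurableT (be 0 * eta / 2) iX.
  by have := integrableD measurableT i1 i2.
have EB : \int[P]_w (G 0 + be 0 * eta / 2 * (X2 k w ^+ 2)) = G 0 + be 0 * (eta / 2).
  rewrite RintegralD//.
  - by rewrite Rint_cst RintegralZl// Rint_X2sq mulr1 mulrA.
  - by apply: (@bounded_integrable _ _ _ P _ `|G 0|).
  - by have := integrableZl measurableT (be 0 * eta / 2) iX.
rewrite -EB -RintegralB//.
have mE : measurable_fun setT (fun w => lindeberg_err r (X2 k w)).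
  by apply: (measurableT_comp (measurable_lindeberg _)); exact: mX2.
have iE : P.-integrable setT (EFin \o (fun w => lindeberg_err r (X2 k w))).
  apply: le_integrable iX => //; first exact/measurable_EFinP.
  move=> w _ /=; have /andP[h1 h2] := lindeberg_err_bnd (X2 k w) r0.
  by rewrite lee_fin !ger0_norm// sqr_ge0.
rewrite /lindeberg_mom -(Rint_X2_law k (measurable_lindeberg r)); last first.
  by move=> x; case/andP: (lindeberg_err_bnd x r0).
rewrite -RintegralZl//.
have iD : P.-integrable setT (EFin \o (fun w => S w - (G 0 + be 0 * eta / 2 * (X2 k w ^+ 2)))).
  by have := integrableB measurableT iS iB.
rewrite (le_trans (le_normr_Rintegral measurableT iD))//.
apply: le_Rintegral => //.
- by have := integrable_abse iD.
- by have := integrableZl measurableT (2 * C * eta) iE.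
move=> w _; have := smooth2_sym (Num.sqrt eta * `|X2 k w|) sG.
rewrite exprMn sqr_sqrtr// real_normK ?num_real//.
rewrite (_ : _ - G 0 - _ = S w - (G 0 + be 0 * eta / 2 * X2 k w ^+ 2)); last first.
  by rewrite /S; field.
move=> /le_trans; apply; rewrite -[leRHS]mulrA; apply: ler_wpM2l; first by rewrite mulr_ge0.
rewrite /lindeberg_err minr_pMr// le_min; apply/andP; split; last by rewrite ge_min lexx orbT.
rewrite ge_min; apply/orP; left; rewrite normrM normr_id (ger0_norm (sqrtr_ge0 _)) exprMn.
rewrite [leRHS]mulrA; apply: ler_wpM2r; first by rewrite exprn_ge0.
by rewrite exprS sqr_sqrtr// mulrC ler_wpM2l.
Qed.

End random_signs.

(** * Convergence of the increments *)

Lemma expR_sub1_bound (R : realType) (x : R) : 0 <= x -> x <= 2^-1 -> `|expR x - 1 - x| <= 2 * x ^+ 2.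
Proof.
move=> x0 x1; have := expR_ge1Dx x; have := expR_ge1Dx (- x); rewrite expRN => h.
have e0 := expR_gt0 x.
have h2 : (1 - x) * expR x <= 1 by rewrite -ler_pdivlMr// mul1r.
move: h2; move: (expR x) => E h2 h3.
rewrite ger0_norm; last by lra.
have u0 : 0 <= E - 1 - x by lra.
have : (E - 1 - x) * 2^-1 <= (E - 1 - x) * (1 - x) by apply: ler_wpM2l => //; lra.
have -> : (E - 1 - x) * (1 - x) = (1 - x) * E - 1 + x ^+ 2 by ring.
by lra.
Qed.

Section wiener_increments.
Context (R : realType) (W : probability (path_space R) R).
Hypothesis HW : is_wiener_measure W.

Lemma measurable_incr (h : R) j : 0 <= h -> measurable_fun setT (fun g : path_space R => incr g h j).
Proof. by move=> h0; apply: measurable_funB; apply: measurable_eval; rewrite mulr_ge0. Qed.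

Lemma wiener_indep_at (h : R) b k : 0 < h ->
  indep_at W (fun j (g : path_space R) => incr g h (b + j)) k (fun j => (k <= j)%N).
Proof.
move=> h0; have h0' := ltW h0; case: HW => _ _ /(_ (fun i => (b + i)%:R * h)) ind.
have {}ind : mutually_independent W (fun j (g : path_space R) => incr g h (b + j)).
  rewrite (_ : (fun _ => _) = (fun i (g : path_space R) => g ((b + i.+1)%:R * h) - g ((b + i)%:R * h))); last first.
    by apply/funext => j; apply/funext => g; rewrite /incr addnS.
  apply: ind; first by rewrite mulr_ge0.
  by move=> i; rewrite ler_wpM2r// ler_nat addnS.
have mY j : measurable_fun setT (fun g : path_space R => incr g h (b + j)) by exact: measurable_incr.
exists (sig_of (fun j (g : path_space R) => incr g h (b + j)) (fun j => (k < j)%N)); split.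
- exact: sig_of_measurable.
- move=> j kj jk; apply: (measurable_sig (Y := fun j (g : path_space R) => incr g h (b + j))).
  by rewrite ltn_neqAle eq_sym jk.
- apply: (indep_of_sig mY ind (J' := eq k)) => [j kj kE|]; first by rewrite kE ltnn in kj.
  exact: (measurable_sig (Y := fun j (g : path_space R) => incr g h (b + j)) (erefl k)).
Qed.

Lemma wiener_incr_law (h : R) j : 0 < h -> forall A : set R, measurable A ->
  W ((fun g : path_space R => incr g h j) @^-1` A) = normal_prob 0 (Num.sqrt h) A.
Proof.
move=> h0 A mA; case: HW => _ /(_ (j%:R * h) (j.+1%:R * h)) law _.
have hE : j.+1%:R * h - j%:R * h = h by rewrite -natr1 mulrDl mul1r addrC addKr.
rewrite -[in RHS]hE; apply: law => //; first by rewrite mulr_ge0 ?(ltW h0).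
by rewrite ltr_pM2r// ltr_nat.
Qed.

End wiener_increments.

Lemma sum_incr_shift (R : realType) (g : R -> R) (h : R) b n :
  \sum_(j < n) incr g h (b + j) = g ((b + n)%:R * h) - g (b%:R * h).
Proof.
elim: n => [|n IH]; first by rewrite big_ord0 addn0 subrr.
by rewrite big_ord_recr /= IH /incr -addnS addrC addrA subrK.
Qed.

Section walk_clt.
Context d (T : measurableType d) (R : realType) (P : probability T R).
Variables (X1 X2 : nat -> {RV P >-> R}).
Let X (ik : bool * nat) := if ik.1 then X1 ik.2 : T -> R else X2 ik.2.
Hypotheses (Xindep : mutually_independent P X)
  (X1sym : forall k, P [set w | 0 < X1 k w] = P [set w | X1 k w < 0])
  (X2id : forall k (A : set R), measurable A ->
    distribution P (X2 k) A = distribution P (X2 0%N) A)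
  (X2var : forall k, ('E_P[fun w => (`|X2 k w| ^+ 2)%R] = 1)%E)
  (X1neq0 : forall k, {ae P, forall w, X1 k w != 0}).
Variables (W : probability (path_space R) R) (HW : is_wiener_measure W).

(** [m] is a cut between strips: the earlier variables only use data before it, [Y k] only data from
    it on. *)
Lemma indep_at_before (Y : nat -> T -> R) k m :
  (forall j, (j < k)%N -> measurable_fun (setT : set (g_sigma_algebraType (sig_of X (fun i => (i.2 < m)%N))))
     (Y j : g_sigma_algebraType (sig_of X (fun i => (i.2 < m)%N)) -> R)) ->
  measurable_fun (setT : set (g_sigma_algebraType (sig_of X (fun i => (m <= i.2)%N))))
     (Y k : g_sigma_algebraType (sig_of X (fun i => (m <= i.2)%N)) -> R) ->
  indep_at P Y k (fun j => (j < k)%N).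
Proof.
move=> h1 h2; exists (sig_of X (fun i => (i.2 < m)%N)); split.
- exact: sig_of_measurable (measurable_X X1 X2) _.
- by move=> j jk _; exact: h1.
- apply: (indep_of_sig (measurable_X X1 X2) Xindep _ h2) => i /=.
  by rewrite ltnNge => /negP.
Qed.

Lemma measurable_sum_xi (J : bool * nat -> Prop) a b n : (forall i j, (b <= j < b + n)%N -> J (i, j)) ->
  measurable_fun (setT : set (g_sigma_algebraType (sig_of X J)))
    ((fun w => a * \sum_(j < n) xi X1 X2 (b + j) w) : g_sigma_algebraType (sig_of X J) -> R).
Proof.
move=> hJ; apply: measurable_funM => //; apply: measurable_sum => j.
by apply: measurable_sig_xi; apply: hJ; rewrite leq_addr ltn_add2l ltn_ord.
Qed.

(** The walk steps are replaced by Wiener increments on the same grid. It matters that [eta0] is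
    chosen before [b], [n] and [G]: the estimate is later used for blocks and for rests of blocks,
    at arbitrary places. Smoothing [G] costs [e / 4] on each side, the replacement [e / 2]. *)
Lemma clt_block L M T0 e : 0 <= L -> 0 < T0 -> 0 < e -> exists2 eta0, 0 < eta0 &
  forall eta, 0 < eta < eta0 -> forall b n, n%:R * eta <= T0 -> forall G,
  (forall x y, `|G x - G y| <= L * `|x - y|) -> (forall x, `|G x| <= M) ->
  `|\int[P]_w G (Num.sqrt eta * \sum_(j < n) xi X1 X2 (b + j) w) -
    \int[W]_g G (g ((b + n)%:R * eta) - g (b%:R * eta))| <= e.
Proof.
move=> L0 T00 e0.
pose s := e / (8 * (L + 1)).
have s0 : 0 < s by rewrite divr_gt0// mulr_gt0// ltr_wpDl.
have Ls : 2 * L * s <= e / 4.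
  rewrite /s mulrA ler_pdivrMr; last by rewrite mulr_gt0// ltr_wpDl.
  have -> : e / 4 * (8 * (L + 1)) = 2 * (L + 1) * e by field.
  by rewrite ler_wpM2r ?(ltW e0)// ler_wpM2l// lerDl.
have [C [C0 HC]] := mollify M s0 L0.
pose K := C + `|M|; have K0 : 0 <= K by rewrite addr_ge0.
have CK : C <= K by rewrite lerDl.
have MK : M <= K by rewrite (le_trans (ler_norm M))// lerDr.
(* Three errors of at most [K * eta * D] per step give at most [eta * (e / (2 * T0))], and there are
   at most [T0 / eta] steps. *)
pose D := e / (6 * T0 * (K + 1)).
have D0 : 0 < D by rewrite divr_gt0// mulr_gt0 ?mulr_gt0// ltr_wpDl.
have E2 : 0 < 36 * expR 2 :> R by rewrite mulr_gt0// expR_gt0.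
have [r r0 hr] := lindeberg_mom_small X1 X2var (divr_gt0 D0 (ltr0Sn R 1)).
pose u := D / (36 * expR 2); have u0 : 0 < u by rewrite divr_gt0.
(* In order: standard deviation at most [1] for [gaussian_step], [sqrt eta <= r] for the Lindeberg
   error, a cubic Gaussian error below [K * eta * D], and [expR (eta / 2) - 1] close to
   [eta / 2]. *)
exists (Num.min 1 (Num.min (r ^+ 2) (Num.min (u ^+ 2) D))).
  by rewrite !lt_min ltr01 D0 !exprn_gt0.
move=> eta /andP[eta0]; rewrite !lt_min => /and4P[eta1 etar etau etaD] b n nT G GL GM.
have [G' [al [be [sG GM' GG]]]] := HC G GL GM.
have {}sG := smooth2_le CK sG.
have GK x : `|G' x| <= K by exact: le_trans (GM' x) MK.
have sq0 := sqrtr_ge0 eta.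
have sqr : Num.sqrt eta <= r.
  by rewrite -(ger0_norm (ltW r0)) -sqrtr_sqr ler_sqrt// ?exprn_ge0 ?(ltW r0)// ltW.
have squ : 36 * expR 2 * Num.sqrt eta <= D.
  rewrite mulrC -ler_pdivlMr//; rewrite -/u.
  by rewrite -(ger0_norm (ltW u0)) -sqrtr_sqr ler_sqrt// ?exprn_ge0 ?(ltW u0)// ltW.
pose Y j w := Num.sqrt eta * xi X1 X2 (b + j) w.
pose Z j (g : path_space R) := incr g eta (b + j).
have mY j : measurable_fun setT (Y j).
  by apply: measurable_funM => //; exact: measurable_xi.
have mZ j : measurable_fun setT (Z j) by exact: measurable_incr (ltW eta0).
pose F (v : nat -> R) := G' (\sum_(j < n) v j).
have FL : lip_on n K F.
  move=> v v'; rewrite (le_trans (derive_lip (sm_d1 sG) (sm_al sG) _ _))//.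
  by rewrite ler_wpM2l// -sumrB ler_norm_sum.
have FM v : `|F v| <= K by exact: GK.
have iY k : (k < n)%N -> indep_at P Y k (fun j => (j < k)%N).
  move=> kn; apply: (indep_at_before (m := (b + k)%N)) => [j jk|].
    by apply: measurable_funM => //; apply: measurable_sig_xi; rewrite /= ltn_add2l.
  by apply: measurable_funM => //; apply: measurable_sig_xi => /=.
have iZ k : (k < n)%N -> indep_at W Z k (fun j => (k <= j)%N).
  by move=> _; exact: wiener_indep_at.
have sec k v : (k < n)%N -> `|coord_mean P F k (Y k) v - coord_mean W F k (Z k) v| <= eta * (e / (2 * T0)).
  move=> kn; pose c := \sum_(j < n | (j : nat) != k) v j.
  have FE x : F (upd v k x) = G' (x + c).
    rewrite /F (bigD1 (Ordinal kn)) //= {1}/upd eqxx; congr (G' (_ + _)).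
    apply: eq_big => j; first by rewrite -val_eqE.
    by rewrite -val_eqE /= => jk; rewrite /upd (negbTE jk).
  rewrite /coord_mean; under eq_Rintegral do rewrite FE.
  under [X in _ - X]eq_Rintegral do rewrite FE.
  have sG' := smooth2_shift c sG.
  have GK' x : `|G' (x + c)| <= K by [].
  have h1 := xi_step Xindep X1sym X2id X2var X1neq0 (b + k) (ltW eta0) sqr sG' GK'.
  have sq1 : Num.sqrt eta <= 1 by rewrite -(sqrtr1 R) ler_sqrt// ltW.
  have sqgt : 0 < Num.sqrt eta by rewrite sqrtr_gt0.
  have h2 := gaussian_step (mZ k) sqgt (wiener_incr_law HW (b + k) eta0) sq1 sG' GK'.
  rewrite sqr_sqrtr ?(ltW eta0)// in h2.
  have h3 : `|expR (eta / 2) - 1 - eta / 2| <= 2 * (eta / 2) ^+ 2.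
    apply: expR_sub1_bound; first by rewrite divr_ge0// ltW.
    by rewrite ler_pdivrMr// mulVf// ltW.
  have b0 : `|be (0 + c)| <= K by exact: sm_be sG _.
  rewrite add0r in h1 h2 b0.
  have h4 : `|be c * (expR (eta / 2) - 1 - eta / 2)| <= K * eta * D.
    rewrite normrM -mulrA ler_pM// (le_trans h3)//.
    have -> : 2 * (eta / 2) ^+ 2 = eta * (eta / 2) by field.
    by rewrite ler_wpM2l ?(ltW eta0)// (le_trans _ (ltW etaD))// ler_pdivrMr// ler_peMr ?(ltW eta0)// ler1n.
  have h5 : 36 * K * expR 2 * Num.sqrt eta ^+ 3 <= K * eta * D.
    have -> : 36 * K * expR 2 * Num.sqrt eta ^+ 3 = K * Num.sqrt eta ^+ 2 * (36 * expR 2 * Num.sqrt eta) by ring.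
    by rewrite sqr_sqrtr ?(ltW eta0)// ler_wpM2l// mulr_ge0// ltW.
  have h6 : 2 * K * eta * lindeberg_mom X2 r <= K * eta * D.
    have -> : 2 * K * eta * lindeberg_mom X2 r = K * eta * (2 * lindeberg_mom X2 r) by ring.
    rewrite ler_wpM2l ?mulr_ge0 ?(ltW eta0)//; move: hr; clear; move: (lindeberg_mom _ _) => a; lra.
  have -> : eta * (e / (2 * T0)) = 3 * ((K + 1) * eta * D).
    have T0n : T0 != 0 by rewrite gt_eqF.
    have K1n : K + 1 != 0 by rewrite gt_eqF// ltr_wpDl.
    by rewrite /D; field; rewrite ?T0n ?K1n.
  apply: (@le_trans _ _ (3 * (K * eta * D))); last first.
    by rewrite ler_wpM2l// ler_wpM2r ?(ltW D0)// ler_wpM2r ?(ltW eta0)// lerDl.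
  move: h1 h2 h4 h5 h6.
  move: (\int[P]_w _) (\int[W]_w _) (lindeberg_mom _ _) (Num.sqrt eta ^+ 3) => a1 a2 lm s3.
  have -> : be c * (eta / 2) = be c * (expR (eta / 2) - 1) - be c * (expR (eta / 2) - 1 - eta / 2) by ring.
  move: (be c * (expR (eta / 2) - 1)) (be c * (expR (eta / 2) - 1 - eta / 2)) (G' c) (K * eta * D) (2 * K * eta * lm) (36 * K * expR 2 * s3).
  clear=> p q g x y z; rewrite !ler_norml => /andP[h1 h1'] /andP[h2 h2'] /andP[h3' h4'] h5 h6.
  by apply/andP; split; lra.
have hyb := hybrid FL FM mY mZ iY iZ sec.
have hyb2 : n%:R * (eta * (e / (2 * T0))) <= e / 2.
  have -> : e / 2 = T0 * (e / (2 * T0)) by field; rewrite gt_eqF.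
  by rewrite mulrA ler_wpM2r// divr_ge0 ?(ltW e0)// mulr_ge0// ltW.
have cG : continuous G.
  move=> x; apply/cvgrPdist_le => e' e'0; near=> y; rewrite (le_trans (GL x y))//.
  have : `|x - y| <= e' / (L + 1) by near: y; apply: cvgr_dist_le => //; rewrite divr_gt0// ltr_wpDl.
  by rewrite ler_pdivlMr ?ltr_wpDl// => h; apply: le_trans h; rewrite mulrC ler_wpM2l// lerDl.
have mG : measurable_fun setT G by exact: continuous_measurable_fun.
have mG' := smooth2_measurable sG.
have mS1 : measurable_fun setT (fun w => \sum_(j < n) Y j w) by apply: measurable_sum.
have mS2 : measurable_fun setT (fun g => \sum_(j < n) Z j g) by apply: measurable_sum.
have E1 w : Num.sqrt eta * \sum_(j < n) xi X1 X2 (b + j) w = \sum_(j < n) Y j w by rewrite mulr_sumr.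
under eq_Rintegral do rewrite E1.
under [X in _ - X]eq_Rintegral do rewrite -sum_incr_shift.
have q1 : `|\int[P]_w G (\sum_(j < n) Y j w) - \int[P]_w F (fun j => Y j w)| <= e / 4.
  apply: (Rint_dist_le P (measurableT_comp mG mS1) (measurableT_comp mG' mS1) (fun w => GM _) (fun w => FM (fun j => Y j w))) => w.
  by rewrite distrC; exact: le_trans (GG _) Ls.
have q2 : `|\int[W]_g G (\sum_(j < n) Z j g) - \int[W]_g F (fun j => Z j g)| <= e / 4.
  apply: (Rint_dist_le W (measurableT_comp mG mS2) (measurableT_comp mG' mS2) (fun w => GM _) (fun w => FM (fun j => Z j w))) => w.
  by rewrite distrC; exact: le_trans (GG _) Ls.
move: hyb hyb2 q1 q2; rewrite /Z.
move: (\int[P]_w _) (\int[W]_w _) (\int[P]_w _) (\int[W]_w _) => a1 a2 a3 a4.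
rewrite !ler_norml => /andP[h1 h1'] h0 /andP[h2 h2'] /andP[h3' h4'].
by apply/andP; split; lra.
Unshelve. all: by end_near. Qed.

End walk_clt.

(** * Oscillation of the walk *)

Section modulus.
Context (R : realType).
Implicit Types (g : path_space R) (h : R).

Definition modulus (N : nat) h g : R :=
  sup [set r | exists s t, [/\ 0 <= s <= N.+1%:R, 0 <= t <= N.+1%:R, `|s - t| <= h & r = `|g s - g t|]].

Lemma modulus_has_sup N h g : 0 <= h ->
  has_sup [set r | exists s t, [/\ 0 <= s <= N.+1%:R, 0 <= t <= N.+1%:R, `|s - t| <= h & r = `|g s - g t|]].
Proof.
move=> h0; split; first by exists 0, 0, 0; rewrite !subrr normr0; split; rewrite ?lexx ?ler0n.
have cg : {within `[0, N.+1%:R], continuous (fun t => `|g t|)}.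
  by apply: continuous_subspaceT => t; apply: cvg_norm; exact: path_continuous.
have [c _ hc] := EVT_max (ler0n R N.+1) cg.
exists (`|g c| + `|g c|) => _ [s [t [s1 t1 _ ->]]].
by rewrite (le_trans (ler_normB _ _))// lerD// hc// in_itv.
Qed.

Lemma modulus_ub N h g s t : 0 <= s <= N.+1%:R -> 0 <= t <= N.+1%:R -> `|s - t| <= h ->
  `|g s - g t| <= modulus N h g.
Proof.
move=> s1 t1 st; apply: (sup_upper_bound (modulus_has_sup N g (le_trans (normr_ge0 _) st))).
by exists s, t.
Qed.

Lemma modulus_le N h g c : 0 <= h ->
  (forall s t, 0 <= s <= N.+1%:R -> 0 <= t <= N.+1%:R -> `|s - t| <= h -> `|g s - g t| <= c) ->
  modulus N h g <= c.
Proof.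
move=> h0 H; apply: ge_sup; first by case: (modulus_has_sup N g h0).
by move=> _ [s [t [s1 t1 st ->]]]; exact: H.
Qed.

Lemma modulus_ge0 N h g : 0 <= h -> 0 <= modulus N h g.
Proof.
move=> h0; apply: le_trans (normr_ge0 (g 0 - g 0)) _.
by apply: modulus_ub; rewrite ?lexx ?ler0n// subrr normr0.
Qed.

(** The truncation makes the modulus bounded, so its mean tends to [0] with [h] for any probability
    on paths, by continuity of each path and without moment estimates. *)
Definition modulus1 N h g := Num.min 1 (modulus N h g).

Lemma modulus1_bnd N h g : 0 <= h -> 0 <= modulus1 N h g <= 1.
Proof. by move=> h0; rewrite /modulus1 le_min ler01 modulus_ge0//= ge_min lexx. Qed.

Lemma measurable_modulus1 N h : 0 <= h -> measurable_fun setT (modulus1 N h).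
Proof.
move=> h0; apply: measurable_minr; first exact: measurable_cst.
apply: measurable_continuous_path; apply: continuous_path_dist_le => g e e0.
have q0 : 0 < 2 ^+ N.+1 :> R by rewrite exprn_gt0.
exists (Num.min (2 ^+ N.+1)^-1 (e / 2 / 2 ^+ N.+1)); first by rewrite lt_min invr_gt0 q0 !divr_gt0.
move=> g'; rewrite lt_min -[X in _ < X]mul1r !ltr_pdivlMr// !(mulrC (path_dist _ _)) => /andP[d1 de].
have close t : 0 <= t <= N.+1%:R -> `|g t - g' t| <= e / 2.
  by move=> tN; rewrite (le_trans (eval_dist tN d1))// ler_pdivlMr// ltW.
have half g1 g2 : (forall t, 0 <= t <= N.+1%:R -> `|g1 t - g2 t| <= e / 2) ->
    modulus N h g1 <= modulus N h g2 + e.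
  move=> c; apply: modulus_le => // s t s1 t1 st.
  have := modulus_ub g2 s1 t1 st; have := c s s1; have := c t t1.
  rewrite (_ : g1 s - g1 t = (g1 s - g2 s) + (g2 s - g2 t) - (g1 t - g2 t)); last by ring.
  move=> h1 h2 h3; rewrite (le_trans (ler_normB _ _))//.
  have := ler_normD (g1 s - g2 s) (g2 s - g2 t); lra.
have h1 := half _ _ close; have h2 : modulus N h g' <= modulus N h g + e.
  by apply: half => t tN; rewrite distrC close.
by rewrite ler_norml; apply/andP; split; lra.
Qed.

Lemma modulus1_small (W : probability (path_space R) R) N e : 0 < e ->
  exists2 h, 0 < h <= 1 & \int[W]_g modulus1 N h g <= e.
Proof.
move=> e0; have h0 n : 0 < n.+1%:R^-1 :> R by rewrite invr_gt0.
have : \int[W]_g modulus1 N n.+1%:R^-1 g @[n --> \oo] --> \int[W]_g (0 : R).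
  apply: (Rint_dominated (g := fun=> 1)).
  - by move=> n; apply: measurable_modulus1; exact: ltW.
  - by apply: (@bounded_integrable _ _ _ W _ 1) => // x; rewrite normr1.
  - by move=> n g; have /andP[h1 h2] := modulus1_bnd N g (ltW (h0 n)); rewrite ger0_norm.
  move=> g; apply/cvgrPdist_le => e' e'0.
  have [r r0 hr] := path_unif_continuous g N.+1%:R e'0.
  near=> n; have nr : n.+1%:R^-1 < r by near: n; exact: near_infty_natSinv_lt (PosNum r0).
  have /andP[h1 h2] := modulus1_bnd N g (ltW (h0 n)).
  rewrite sub0r normrN ger0_norm// /modulus1 ge_min; apply/orP; right.
  apply: modulus_le => [|s t s1 t1 st]; first exact: ltW.
  by apply: hr => //; exact: le_trans st (ltW nr).
rewrite Rint_cst => /cvgrPdist_le/(_ e e0)[n _ /(_ n (leqnn n))].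
rewrite sub0r normrN => /(le_trans (ler_norm _)) h.
exists n.+1%:R^-1 => //; rewrite h0 /= invf_le1// ler1n//.
Unshelve. all: by end_near. Qed.

End modulus.

Section tightness.
Context d (T : measurableType d) (R : realType) (P : probability T R).
Variables (X1 X2 : nat -> {RV P >-> R}).
Let X (ik : bool * nat) := if ik.1 then X1 ik.2 : T -> R else X2 ik.2.
Hypotheses (Xindep : mutually_independent P X)
  (X1sym : forall k, P [set w | 0 < X1 k w] = P [set w | X1 k w < 0])
  (X2id : forall k (A : set R), measurable A ->
    distribution P (X2 k) A = distribution P (X2 0%N) A)
  (X2var : forall k, ('E_P[fun w => (`|X2 k w| ^+ 2)%R] = 1)%E)
  (X1neq0 : forall k, {ae P, forall w, X1 k w != 0}).
Variables (W : probability (path_space R) R) (HW : is_wiener_measure W).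

Definition walk_sum (eta : R) b n w := Num.sqrt eta * \sum_(j < n) xi X1 X2 (b + j) w.

Lemma measurable_walk_sum eta b n : measurable_fun setT (walk_sum eta b n).
Proof. by apply: measurable_funM => //; apply: measurable_sum => j; exact: measurable_xi. Qed.

Lemma walk_sumD eta b n m w : walk_sum eta b (n + m) w = walk_sum eta b n w + walk_sum eta (b + n) m w.
Proof.
rewrite /walk_sum big_split_ord /= mulrDr; congr (_ + _ * _).
by apply: eq_bigr => j _; rewrite addnA.
Qed.

(** A second replacement, block by block: with the other blocks frozen, [F] is a Lipschitz function
    of one block sum, to which [clt_block] applies. This gives the joint law of [q] blocks. *)
Lemma clt_blocks L M T0 q e : 0 <= L -> 0 < T0 -> 0 < e -> exists2 eta0, 0 < eta0 &
  forall eta, 0 < eta < eta0 -> forall n, n%:R * eta <= T0 -> forall F,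
  lip_on q L F -> (forall v, `|F v| <= M) ->
  `|\int[P]_w F (fun i => walk_sum eta (i * n) n w) -
    \int[W]_g F (fun i => incr g (n%:R * eta) i)| <= e.
Proof.
move=> L0 T00 e0.
have e'0 : 0 < e / q.+1%:R by rewrite divr_gt0.
have [eta0 eta00 H] := clt_block Xindep X1sym X2id X2var X1neq0 HW M L0 T00 e'0.
exists eta0 => // eta etaI n nT F FL FM; have /andP[eta_gt0 _] := etaI.
have nn0 : 0 <= n%:R * eta by rewrite mulr_ge0// ltW.
(* Empty blocks are separated off because Wiener increments are only considered for a positive
   mesh. *)
case: n => [|n] in nT nn0 *.
  have E1 w : F (fun i => walk_sum eta (i * 0) 0 w) = F (fun=> 0).
    by congr F; apply/funext => i; rewrite /walk_sum big_ord0 mulr0.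
  have E2 (g : path_space R) : F (fun i => incr g (0%:R * eta) i) = F (fun=> 0).
    by congr F; apply/funext => i; rewrite /incr !mul0r !mulr0 subrr.
  under eq_Rintegral do rewrite E1.
  under [X in _ - X]eq_Rintegral do rewrite E2.
  by rewrite !Rint_cst subrr normr0 ltW.
have h0 : 0 < n.+1%:R * eta by rewrite mulr_gt0.
pose Y i w := walk_sum eta (i * n.+1) n.+1 w.
pose Z i (g : path_space R) := incr g (n.+1%:R * eta) (0 + i).
have mY i : measurable_fun setT (Y i) by exact: measurable_walk_sum.
have mZ i : measurable_fun setT (Z i) by exact: measurable_incr.
have iY k : (k < q)%N -> indep_at P Y k (fun j => (j < k)%N).
  move=> kq; apply: (indep_at_before Xindep (m := (k * n.+1)%N)) => [j jk|].
    apply: measurable_sum_xi => _ l /= /andP[_ hl]; rewrite (leq_trans hl)//.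
    by rewrite -{2}[n.+1]mul1n -mulnDl leq_mul2r addn1 jk orbT.
  by apply: measurable_sum_xi => _ l /= /andP[].
have iZ k : (k < q)%N -> indep_at W Z k (fun j => (k <= j)%N).
  by move=> _; exact: wiener_indep_at.
have sec k v : (k < q)%N -> `|coord_mean P F k (Y k) v - coord_mean W F k (Z k) v| <= e / q.+1%:R.
  move=> kq.
  have GL x y : `|F (upd v k x) - F (upd v k y)| <= L * `|x - y|.
    apply: le_trans (FL _ _) _; apply: ler_wpM2l => //.
    rewrite (bigD1 (Ordinal kq))//= big1 ?addr0 ?/upd ?eqxx// => j.
    by rewrite -val_eqE /= => /negbTE jk; rewrite jk subrr normr0.
  have := H eta etaI (k * n.+1)%N n.+1 nT _ GL (fun x => FM _).
  rewrite /coord_mean /Y /Z /walk_sum /incr add0n.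
  by rewrite !mulrA -!natrM -mulSnr.
have hyb := hybrid FL FM mY mZ iY iZ sec.
apply: le_trans hyb _.
rewrite mulrCA ler_piMr ?(ltW e0)// ler_pdivrMr// mul1r ler_nat.
exact: leqnSn.
Qed.

Section oscillation.
Variables (lam : R) (q N : nat) (h0 : R).
Hypotheses (lam0 : 0 < lam) (lam2 : lam <= 2) (h00 : 0 < h0) (qN : q%:R * h0 <= N.+1%:R).

Let il : 0 < 2 / lam. Proof. by rewrite divr_gt0. Qed.

(** A Lipschitz substitute for the indicator of [|x| >= lam], equal to [0] for [|x| <= lam / 2]: the
    comparison with Wiener increments only handles Lipschitz functions. *)
Definition excess (x : R) : R := Num.min 1 (Num.max 0 (`|x| - lam / 2) * (2 / lam)).

Let excess_ge0 x : 0 <= excess x.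
Proof. by rewrite /excess le_min ler01 mulr_ge0 ?(ltW il)// le_max lexx. Qed.

Let excess_le1 x : excess x <= 1.
Proof. by rewrite /excess ge_min lexx. Qed.

Let excess_ge1 x : lam <= `|x| -> 1 <= excess x.
Proof.
move=> lx; rewrite /excess le_min lexx /= -ler_pdivrMr// mul1r invf_div le_max; apply/orP; right.
lra.
Qed.

Let excess_eq0 x : `|x| <= lam / 2 -> excess x = 0.
Proof.
by move=> xl; rewrite /excess (_ : Num.max _ _ = 0) ?mul0r; [exact/min_idPr|apply/max_idPl; rewrite subr_le0].
Qed.

Let min1_lip (x y : R) : `|Num.min 1 x - Num.min 1 y| <= `|x - y|.
Proof.
rewrite !minEle; case: (leP 1 x) => h1; case: (leP 1 y) => h2; rewrite ?subrr ?normr0//.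
- by rewrite !ger0_norm//; lra.
- by rewrite !ler0_norm//; lra.
Qed.

Let excess_lip x y : `|excess x - excess y| <= 2 / lam * `|x - y|.
Proof.
apply: le_trans (min1_lip _ _) _.
rewrite -mulrBl normrM (gtr0_norm il) mulrC ler_wpM2l ?(ltW il)//.
move: (ler_dist_dist x y) => /(le_trans _); apply.
move: `|x| `|y| => a b.
rewrite !maxEle; case: (leP 0 (a - _)) => h1; case: (leP 0 (b - _)) => h2.
- by rewrite (_ : _ - _ - _ = a - b)//; ring.
- by rewrite subr0 !ger0_norm; lra.
- by rewrite sub0r normrN ger0_norm// ler0_norm; lra.
- by rewrite subrr normr0.
Qed.

Definition excess_sum (v : nat -> R) : R := Num.min 1 (\sum_(i < q) excess (v i)).

Let excess_sum_lip : lip_on q (2 / lam) excess_sum.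
Proof.
move=> v v'; apply: le_trans (min1_lip _ _) _.
rewrite -sumrB mulr_sumr; apply: le_trans (ler_norm_sum _ _ _) _.
by apply: ler_sum => i _; exact: excess_lip.
Qed.

Let excess_sum_ge0 v : 0 <= excess_sum v.
Proof. by rewrite /excess_sum le_min ler01 sumr_ge0. Qed.

Let excess_sum_bnd v : `|excess_sum v| <= 1.
Proof. by rewrite ger0_norm// /excess_sum ge_min lexx. Qed.

Let excess_sum_ge1 v i : (i < q)%N -> lam <= `|v i| -> 1 <= excess_sum v.
Proof.
move=> iq lv; rewrite /excess_sum le_min lexx /= (bigD1 (Ordinal iq))//=.
by rewrite (le_trans (excess_ge1 lv))// lerDl sumr_ge0.
Qed.

Let modulus1_ge (g : path_space R) : lam / 2 < modulus N h0 g -> 1 <= 2 / lam * modulus1 N h0 g.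
Proof.
move=> hm; rewrite -ler_pdivrMl// mulr1 invf_div /modulus1 le_min (ltW hm) andbT.
by rewrite ler_pdivrMr// mul1r.
Qed.

Let excess_modulus (g : path_space R) x : `|x| <= modulus N h0 g -> excess x <= 2 / lam * modulus1 N h0 g.
Proof.
move=> xm; have [xl|xl] := leP `|x| (lam / 2).
  by rewrite excess_eq0// mulr_ge0 ?(ltW il)//; case/andP: (modulus1_bnd N g (ltW h00)).
exact: le_trans (excess_le1 x) (modulus1_ge (lt_le_trans xl xm)).
Qed.

Let excess_sum_modulus (g : path_space R) v : (forall i, (i < q)%N -> `|v i| <= modulus N h0 g) ->
  excess_sum v <= 2 / lam * modulus1 N h0 g.
Proof.
move=> vm; have [xl|xl] := leP (modulus N h0 g) (lam / 2).
  rewrite /excess_sum big1 => [|i _]; last first.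
    by apply: excess_eq0; exact: le_trans (vm _ (ltn_ord i)) xl.
  rewrite (_ : Num.min _ _ = 0); last by apply/min_idPr.
  by rewrite mulr_ge0 ?(ltW il)//; case/andP: (modulus1_bnd N g (ltW h00)).
by apply: le_trans (modulus1_ge xl); rewrite /excess_sum ge_min lexx.
Qed.

Let delta := 2 / lam * \int[W]_g modulus1 N h0 g.

Let Rint_modulus : \int[W]_g (2 / lam * modulus1 N h0 g) = delta.
Proof.
rewrite RintegralZl//; apply: (@bounded_integrable _ _ _ W _ 1).
  exact: measurable_modulus1 (ltW h00).
by move=> g; have /andP[h1 h2] := modulus1_bnd N g (ltW h00); rewrite ger0_norm.
Qed.

Let mod_meas : measurable_fun setT (fun g => 2 / lam * modulus1 N h0 g).
Proof. by apply: measurable_funM => //; exact: measurable_modulus1 (ltW h00). Qed.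

Let mod_bnd (g : path_space R) : `|2 / lam * modulus1 N h0 g| <= 2 / lam.
Proof.
have /andP[h1 h2] := modulus1_bnd N g (ltW h00).
by rewrite normrM (gtr0_norm il) ger0_norm// ler_piMr// ltW.
Qed.

(* Ottaviani's inequality, the endpoints of the blocks being compared with Wiener increments. *)
Lemma walk_oscillation e1 : 0 < e1 -> delta <= 4^-1 -> exists2 eta0, 0 < eta0 &
  forall eta, 0 < eta < eta0 -> forall n, n%:R * eta <= h0 ->
  exists2 A, measurable A & prb P A <= 2 * (delta + e1) /\
    forall w, ~ A w -> forall i m, (i < q)%N -> (m <= n)%N -> `|walk_sum eta (i * n) m w| <= 2 * lam.
Proof.
move=> e10 d4.
have i4 : 0 < 4^-1 :> R by rewrite invr_gt0.
have [eta1 eta10 H1] := clt_block Xindep X1sym X2id X2var X1neq0 HW 1 (ltW il) h00 i4.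
have [eta2 eta20 H2] := clt_blocks 1 q (ltW il) h00 e10.
exists (Num.min eta1 eta2); first by rewrite lt_min eta10.
move=> eta /andP[eta0]; rewrite lt_min => /andP[etal1 etal2] n nh.
have {}H1 := H1 eta ltac:(by rewrite eta0).
have {}H2 := H2 eta ltac:(by rewrite eta0).
(* This event contains every [w] for which some whole block moves by at least [lam]; it is the only
   one whose probability is estimated through the joint law of the blocks. *)
pose E := [set w | 1 <= excess_sum (fun i => walk_sum eta (i * n) n w)].
have mF : measurable_fun setT (fun w => excess_sum (fun i => walk_sum eta (i * n) n w)).
  apply: (lip_on_measurable excess_sum_lip (Z := fun i w => walk_sum eta (i * n) n w)) => j _.
  exact: measurable_walk_sum.
have ge_meas (f : T -> R) c : measurable_fun setT f -> measurable [set w | c <= f w].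
  move=> mf; rewrite (_ : [set w | _] = setT `&` f @^-1` `[c, +oo[); first exact: mf.
  by rewrite setTI; apply/seteqP; split=> w; rewrite /= in_itv /= andbT.
have mE : measurable E by exact: ge_meas.
have grid i : (i <= q * n)%N -> 0 <= i%:R * eta <= N.+1%:R.
  move=> iq; rewrite mulr_ge0 ?(ltW eta0)//= (le_trans _ qN)//.
  apply: (@le_trans _ _ ((q * n)%:R * eta)); first by rewrite ler_wpM2r ?(ltW eta0)// ler_nat.
  by rewrite natrM -mulrA ler_wpM2l.
have pE : prb P E <= delta + e1.
  have h1 : 1 * prb P E <= \int[P]_w excess_sum (fun i => walk_sum eta (i * n) n w).
    exact: (Rint_markov P mE mF (fun w => excess_sum_bnd _) (fun w => excess_sum_ge0 _) ltr01 (fun w h => h)).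
  have h2 := H2 n nh excess_sum excess_sum_lip excess_sum_bnd.
  have h3 : \int[W]_g excess_sum (fun i => incr g (n%:R * eta) i) <= delta.
    rewrite -Rint_modulus; apply: (Rint_le W _ mod_meas (fun w => excess_sum_bnd _) mod_bnd).
      apply: (lip_on_measurable excess_sum_lip (Z := fun i (g : path_space R) => incr g (n%:R * eta) i)) => j _.
      by apply: measurable_incr; rewrite mulr_ge0// ltW.
    move=> g; apply: excess_sum_modulus => i iq; rewrite /incr !mulrA -!natrM.
    apply: modulus_ub; first by apply: grid; rewrite leq_mul2r iq orbT.
      by apply: grid; rewrite leq_mul2r ltnW ?orbT.
    by rewrite -mulrBl -natrB ?leq_mul2r ?leqnSn ?orbT// -mulnBl subSnn mul1n ger0_norm// mulr_ge0// ltW.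
  move: h1 h2 h3; rewrite mul1r; move: (prb P E) (\int[P]_w _) (\int[W]_g _) => a b c h1.
  move=> /(le_trans (ler_norm _)) h2 h3; apply: le_trans h1 _.
  by rewrite -lerBlDl (le_trans _ h2)// lerD2l lerN2.
(* Step [k] of the whole walk is step [k %% n] of block [k %/ n]. On [A k] the partial sum of the
   block is too large after this step, on [C k] the rest of the block moves by at most [lam], and
   [U k] is the union of the earlier [A j]. A first exceedance followed by [C k] leads into [E], and
   the two are independent. *)
pose A k := [set w | 2 * lam < `|walk_sum eta (k %/ n * n) (k %% n).+1 w|].
pose C k := [set w | `|walk_sum eta k.+1 ((k %/ n).+1 * n - k.+1) w| <= lam].
pose U := fix U k := if k is k'.+1 then U k' `|` A k' else set0.
have sgt J k b m : (forall i j, (b <= j < b + m)%N -> J (i, j)) ->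
   <<s sig_of X J >> [set w | k < `|walk_sum eta b m w|].
  move=> hJ; have mw : measurable_fun (setT : set (g_sigma_algebraType (sig_of X J)))
      (walk_sum eta b m : g_sigma_algebraType (sig_of X J) -> R) by exact: measurable_sum_xi.
  have := measurableT_comp (@normr_measurable R setT) mw measurableT (measurable_itv `]k, +oo[).
  by rewrite setTI; congr (<<s _ >> _); apply/seteqP; split=> w; rewrite /= in_itv /= andbT.
pose J k (i : bool * nat) := (i.2 < k)%N : Prop.
have sA k j : (j < k)%N -> <<s sig_of X (J k) >> (A j).
  by move=> jk; apply: sgt => i l /= /andP[_ hl]; rewrite /J /= (leq_trans hl)// addnS -divn_eq.
have sU k l : (k <= l)%N -> <<s sig_of X (J l) >> (U k).
  elim: k => [_|k IH kl] /=; first exact: (@measurable0 _ (g_sigma_algebraType (sig_of X (J l)))).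
  have h1 := IH (ltnW kl).
  have h2 : <<s sig_of X (J l) >> (A k) by exact: sA.
  exact: (@measurableU _ (g_sigma_algebraType (sig_of X (J l))) _ _ h1 h2).
have sub J' : <<s sig_of X J' >> `<=` @measurable _ T.
  by apply: sub_sigma_measurable => B; exact: (sig_of_measurable (measurable_X X1 X2)).
have mA k : measurable (A k) by apply: (sub (J k.+1)); exact: sA.
have mU k : measurable (U k) by apply: (sub (J k)); exact: sU.
have hB k : (k < q * n)%N -> prb P (A k `\` U k) <= 2 * prb P ((A k `\` U k) `&` E).
  move=> kq; have n0 : (0 < n)%N by case: n kq {nh E mF mE grid pE A C U sA sU mA mU} => //; rewrite muln0.
  have iq : (k %/ n < q)%N by rewrite ltn_divLR.
  have kn : (k.+1 <= (k %/ n).+1 * n)%N by rewrite ltn_ceil.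
  pose m := ((k %/ n).+1 * n - k.+1)%N.
  have CE : C k = ~` [set w | lam < `|walk_sum eta k.+1 m w|].
    apply/seteqP; split=> w; rewrite /C /= -/m; first by rewrite leNgt => /negP.
    by move/negP; rewrite -leNgt.
  have mD : measurable [set w | lam < `|walk_sum eta k.+1 m w|].
    by apply: (sub (fun=> True)); exact: sgt.
  have mC : measurable (C k) by rewrite CE; exact: measurableC.
  have mn : (m <= n)%N by rewrite /m leq_subLR mulSn addnC leq_add2r (leq_trans (leq_trunc_div k n)).
  have mh : m%:R * eta <= h0 by rewrite (le_trans _ nh)// ler_wpM2r ?(ltW eta0)// ler_nat.
  have km : (k.+1 + m)%N = ((k %/ n).+1 * n)%N by rewrite subnKC.
  have me : measurable_fun setT excess.
    have hl : lip_on 1 (2 / lam) (fun v => excess (v 0%N)) by move=> v v'; rewrite big_ord1.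
    exact: (lip_on_measurable hl (Z := fun _ x => x)).
  have eb x : `|excess x| <= 1 by rewrite ger0_norm.
  (* The complement has probability at most [delta] plus the comparison error, both at most
     [1 / 4]. *)
  have pC : 2^-1 <= prb P (C k).
    rewrite CE prbC//.
    have mex : measurable_fun setT (fun w => excess (walk_sum eta k.+1 m w)).
      exact: (measurableT_comp me (measurable_walk_sum eta k.+1 m)).
    have h1 : 1 * prb P [set w | lam < `|walk_sum eta k.+1 m w|] <= \int[P]_w excess (walk_sum eta k.+1 m w).
      exact: (Rint_markov P mD mex (fun w => eb _) (fun w => excess_ge0 _) ltr01 (fun w h => excess_ge1 (ltW h))).
    have h2 := H1 k.+1 m mh excess excess_lip eb.
    have gk : 0 <= k.+1%:R * eta <= N.+1%:R by apply: grid.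
    have gkm : 0 <= (k.+1 + m)%:R * eta <= N.+1%:R by apply: grid; rewrite km leq_mul2r iq orbT.
    have h3 : \int[W]_g excess (g ((k.+1 + m)%:R * eta) - g (k.+1%:R * eta)) <= delta.
      rewrite -Rint_modulus; apply: (Rint_le W _ mod_meas (fun w => eb _) mod_bnd).
        apply: (measurableT_comp me); apply: measurable_funB; apply: measurable_eval.
          by case/andP: gkm.
        by case/andP: gk.
      move=> g; apply: excess_modulus; apply: modulus_ub => //.
      by rewrite -mulrBl -natrB ?leq_addr// addKn ger0_norm// mulr_ge0// ltW.
    move: h1 h2 h3; rewrite mul1r -/(walk_sum eta k.+1 m _).
    move: (prb P _) (\int[P]_w _) (\int[W]_g _) => a b c h1.
    move=> /(le_trans (ler_norm _)) h2 h3.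
    have a2 : a <= 4^-1 + 4^-1.
      apply: le_trans h1 _; rewrite -lerBlDr; apply: le_trans _ h2.
      by rewrite lerD2l lerN2; exact: le_trans h3 d4.
    have : 4^-1 + 4^-1 = 2^-1 :> R by field.
    by move: a2; lra.
  have sB : <<s sig_of X (J k.+1) >> (A k `\` U k).
    apply: (@measurableD _ (g_sigma_algebraType (sig_of X (J k.+1)))); first exact: sA.
    exact: sU.
  have sC : <<s sig_of X (fun i => (k < i.2)%N) >> (C k).
    rewrite CE; apply: (@measurableC _ (g_sigma_algebraType (sig_of X _))).
    by apply: sgt => _ l /= /andP[].
  have ind := indep_sig (measurable_X X1 X2) Xindep _ sB sC.
  have {}ind : prb P ((A k `\` U k) `&` C k) = prb P (A k `\` U k) * prb P (C k).
    rewrite /prb ind; last by rewrite /J => i /=; rewrite ltnS ltnNge => h1 h2; rewrite h1 in h2.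
    rewrite fineM// fin_num_measure//; exact: measurableD.
  have mB : measurable (A k `\` U k) by exact: measurableD.
  have le1 : prb P ((A k `\` U k) `&` C k) <= prb P ((A k `\` U k) `&` E).
    apply: prb_le; try exact: measurableI.
    move=> w [Bw Cw]; split => //; rewrite /E /=.
    apply: (excess_sum_ge1 iq).
    have kE : (k %/ n * n + (k %% n).+1)%N = k.+1 by rewrite addnS -divn_eq.
    have nE : n = ((k %% n).+1 + m)%N.
      by apply/eqP; rewrite -(eqn_add2l (k %/ n * n)) addnA kE km mulSn addnC.
    have -> : walk_sum eta (k %/ n * n) n w =
        walk_sum eta (k %/ n * n) (k %% n).+1 w + walk_sum eta k.+1 m w.
      by rewrite -[X in _ + walk_sum _ X _ _]kE -walk_sumD -nE.
    move: Bw Cw => [+ _]; rewrite /A /C /= -/m; move: (walk_sum _ _ _ _) (walk_sum _ _ _ _) => a b h1 h2.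
    have := ler_normB (b + a) a; rewrite addrK; move: h1 h2; lra.
  rewrite ind in le1; have b0 := prb_ge0 P (A k `\` U k).
  have := ler_wpM2l b0 pC; lra.
have hU k : (k <= q * n)%N -> prb P (U k) <= 2 * prb P (U k `&` E).
  elim: k => [_|k IH kq].
    by rewrite /= set0I /prb measure0 mulr0.
  have UD : U k.+1 = U k `|` (A k `\` U k).
    apply/seteqP; split=> w /=; last by move=> [Uw|[Aw _]]; [left|right].
    by move=> [Uw|Aw]; [left|have [Uw|nUw] := pselect (U k w); [left|right]].
  have UB : U k `&` (A k `\` U k) = set0 by apply/seteqP; split=> w // [Uw [_]].
  rewrite UD setIUl !prbU//; try exact: measurableI; try exact: measurableD.
  - by have := IH (ltnW kq); have := hB k kq; lra.
  - by apply: measurableI => //; exact: measurableD.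
  - by rewrite setIACA UB set0I.
exists (U (q * n)%N) => //; split.
  rewrite (le_trans (hU _ (leqnn _)))// ler_wpM2l// (le_trans _ pE)//.
  by apply: prb_le => //; exact: measurableI.
move=> w UW i [|m] iq mn; first by rewrite /walk_sum big_ord0 mulr0 normr0 mulr_ge0// ltW.
have n0 : (0 < n)%N by exact: leq_ltn_trans mn.
have Uin k l : (k < l)%N -> A k w -> U l w.
  elim: l => // l IH; rewrite ltnS leq_eqVlt => /predU1P[->|kl] Akw /=; [by right|left; exact: IH].
have inq : (i * n + m < q * n)%N.
  by rewrite (leq_trans (_ : _ < i.+1 * n)%N)// ?leq_mul2r ?iq ?orbT// mulSn addnC ltn_add2r.
have : ~ A (i * n + m)%N w by move=> /(Uin _ _ inq).
by rewrite /A /= divnMDl// divn_small// addn0 modnMDl modn_small// => /negP; rewrite -leNgt.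
Qed.

End oscillation.

End tightness.

(** * Oscillation of the solution *)

Section damping.
Context d (T : measurableType d) (R : realType) (P : probability T R).
Variables (X1 X2 : nat -> {RV P >-> R}).
Let X (ik : bool * nat) := if ik.1 then X1 ik.2 : T -> R else X2 ik.2.
Hypotheses (Xindep : mutually_independent P X)
  (X2id : forall k (A : set R), measurable A ->
    distribution P (X2 k) A = distribution P (X2 0%N) A)
  (X2var : forall k, ('E_P[fun w => (`|X2 k w| ^+ 2)%R] = 1)%E).

(** The value [1] at [0] is essential: [X2 k] may vanish with probability close to [1], and a factor
    [5 / 4] there would bring the mean square above [1]. Without forcing the oscillation indeed does
    not grow. *)
Definition damp (dl x : R) : R := if x == 0 then 1 else if dl <= `|x| then 2^-1 else 5 / 4.

(* [eps * beta k] bounds the oscillation of the solution at time [k * eta]: a strip multiplies it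
   by [1 / 2] if the forcing is large, and by at most [5 / 4] in any case. *)
Fixpoint beta (dl r : R) (k : nat) (w : T) : R :=
  if k is k'.+1 then damp dl (X2 k' w) * beta dl r k' w + r else 0.

Lemma damp_bnd dl x : 0 <= damp dl x <= 5 / 4.
Proof. rewrite /damp; case: ifP => _; [|case: ifP => _]; lra. Qed.

Lemma measurable_damp dl : 0 < dl -> measurable_fun setT (damp dl).
Proof.
move=> dl0.
have E : damp dl = (fun x : R => 5 / 4 - 4^-1 * \1_[set (0 : R)] x - 3 / 4 * \1_(`[dl, +oo[) `|x|).
  apply/funext => x; rewrite /damp !indicE mem_setE in_itv /= andbT.
  rewrite (_ : (x \in [set 0]) = (x == 0)); last by apply/idP/eqP; rewrite inE.
  case: eqP => [->|_]; first by rewrite normr0 leNgt dl0 /=; field.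
  by case: ifP => _ /=; field.
rewrite E; apply: measurable_funB.
  by apply: measurable_funB => //; apply: measurable_funM => //; exact: measurable_indic.
apply: measurable_funM => //.
apply: (@measurableT_comp _ _ _ _ _ _ (\1_(`[dl, +oo[) : R -> R)); last exact: normr_measurable.
exact: measurable_indic.
Qed.

(** Otherwise all truncations of the square of [X2 0] have mean [0], and so has the square itself,
    against its normalisation. *)
Lemma prob_X2_neq0 : 0 < prb P [set w | X2 0%N w != 0].
Proof.
rewrite lt_neqAle prb_ge0 andbT eq_sym; apply/eqP => p0.
have mX2 : measurable_fun setT (X2 0%N) by exact: measurable_funPT.
have mA : measurable [set w | X2 0%N w != 0].
  rewrite (_ : [set w | _] = setT `&` X2 0%N @^-1` (~` [set 0])); first exact/mX2/measurableC.
  by rewrite setTI; apply/seteqP; split=> w /= /eqP.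
have i2 := integrable_X2sq X2var 0%N.
have msq : measurable_fun setT (fun w => X2 0%N w ^+ 2) by exact: measurable_funX.
have : \int[P]_w Num.min (X2 0%N w ^+ 2) n%:R @[n --> \oo] --> \int[P]_w (X2 0%N w ^+ 2).
  apply: (Rint_dominated (g := fun w => X2 0%N w ^+ 2)) => //.
  - by move=> n; apply: measurable_minr.
  - by move=> n w; rewrite ger0_norm ?ge_min ?lexx// le_min sqr_ge0 ler0n.
  - move=> w; apply/cvgrPdist_le => e e0; near=> n.
    rewrite (_ : Num.min _ _ = X2 0%N w ^+ 2) ?subrr ?normr0 ?ltW//; apply/min_idPl.
    by near: n; exact: nbhs_infty_ger.
rewrite (_ : (fun n => _) = fun=> 0); last first.
  apply/funext => n; apply/eqP; rewrite eq_le; apply/andP; split; last first.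
    by apply: Rintegral_ge0 => w _; rewrite le_min sqr_ge0 ler0n.
  rewrite -[leRHS](mulr0 n%:R) -p0 -(Rint_indic P mA) -RintegralZl//; last first.
    exact: (bounded_integrable P (measurable_indicT mA) (fun w => indic_bnd _ _ w)).
  apply: (Rint_le P (M := n%:R) (N := n%:R)).
  - by apply: measurable_minr.
  - by apply: measurable_funM => //; exact: measurable_indicT.
  - by move=> w; rewrite ger0_norm ?le_min ?sqr_ge0 ?ler0n// ge_min lexx orbT.
  - by move=> w; rewrite normrM ger0_norm// ler_piMr// indic_bnd.
  - move=> w; rewrite indicE; case: (boolP (w \in _)) => [_|]; first by rewrite mulr1 ge_min lexx orbT.
    by rewrite notin_setE /= => /negP; rewrite negbK => /eqP ->; rewrite expr0n /= mulr0 ge_min lexx.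
move=> /cvg_lim; rewrite lim_cst// (Rint_X2sq X2var) => /(_ (@Rhausdorff R))/eqP.
by rewrite eq_sym oner_eq0.
Unshelve. all: by end_near. Qed.

Definition damp_mom dl := \int[P]_w (damp dl (X2 0%N w) ^+ 2).

(** As [dl] tends to [0], the square of the factor tends to [1] where [X2 0 = 0] and to [1 / 4]
    elsewhere, so its mean tends to [1 - 3 / 4 * P (X2 0 <> 0)]. *)
Lemma damp_mom_lt1 : exists2 dl, 0 < dl & damp_mom dl < 1.
Proof.
have mX2 : measurable_fun setT (X2 0%N) by exact: measurable_funPT.
have dl0 n : 0 < n.+1%:R^-1 :> R by rewrite invr_gt0.
pose A := [set w | X2 0%N w != 0].
have mA : measurable A.
  rewrite (_ : A = setT `&` X2 0%N @^-1` (~` [set 0])); first exact/mX2/measurableC.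
  by rewrite setTI; apply/seteqP; split=> w /= /eqP.
have cv : damp_mom n.+1%:R^-1 @[n --> \oo] --> \int[P]_w (1 - 3 / 4 * \1_A w : R).
  apply: (Rint_dominated (g := fun=> 25 / 16)).
  - move=> n; apply: measurable_funX; exact: (measurableT_comp (measurable_damp (dl0 n))).
  - by apply: (@bounded_integrable _ _ _ P _ `|25 / 16|).
  - move=> n w; rewrite ger0_norm ?sqr_ge0//.
    have /andP[h1 h2] := damp_bnd n.+1%:R^-1 (X2 0%N w).
    have -> : 25 / 16 = (5 / 4) ^+ 2 :> R by field.
    by rewrite ler_sqr ?nnegrE//; lra.
  - move=> w; apply/cvgrPdist_le => e e0; rewrite indicE; case: (boolP (w \in A)) => [|].
      rewrite inE /A /= => X0.
      have x0 : 0 < `|X2 0%N w| by rewrite normr_gt0.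
      near=> n; have hn : n.+1%:R^-1 < `|X2 0%N w|.
        by near: n; exact: near_infty_natSinv_lt (PosNum x0).
      rewrite /damp (negbTE X0) (ltW hn) mulr1.
      have -> : 1 - 3 / 4 - 2^-1 ^+ 2 = 0 :> R by field.
      by rewrite normr0 ltW.
    rewrite notin_setE /A /= => /negP; rewrite negbK => /eqP X0.
    by near=> n; rewrite /damp X0 eqxx expr1n mulr0 subr0 subrr normr0 ltW.
have p0 := prob_X2_neq0.
have E : \int[P]_w (1 - 3 / 4 * \1_A w : R) = 1 - 3 / 4 * prb P A.
  have iA : P.-integrable setT (EFin \o (\1_A : T -> R)).
    exact: (bounded_integrable P (measurable_indicT mA) (fun w => indic_bnd _ _ w)).
  rewrite RintegralB//.
  - by rewrite Rint_cst RintegralZl// Rint_indic.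
  - by apply: (@bounded_integrable _ _ _ P _ `|1|).
  - by have := integrableZl measurableT (3 / 4 : R) iA.
rewrite E in cv; have p1 : 0 < 3 / 4 * prb P A by rewrite mulr_gt0// divr_gt0.
move/cvgrPdist_lt : cv => /(_ _ p1)[n _ hn].
exists n.+1%:R^-1 => //; have := hn n (leqnn n).
by move=> /ltr_normlP[]; lra.
Unshelve. all: by end_near. Qed.

Variables (dl r : R).
Hypotheses (dl0 : 0 < dl) (r0 : 0 <= r) (dl1 : damp_mom dl < 1).

Lemma beta_ge0 k w : 0 <= beta dl r k w.
Proof.
elim: k => //= k IH; rewrite addr_ge0// mulr_ge0//.
by case/andP: (damp_bnd dl (X2 k w)).
Qed.

Lemma beta_bnd k : exists M, forall w, beta dl r k w <= M.
Proof.
elim: k => [|k [M hM]]; first by exists 0.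
exists (5 / 4 * M + r) => w /=; have /andP[h1 h2] := damp_bnd dl (X2 k w).
by rewrite lerD2r ler_pM// beta_ge0.
Qed.

Let J k (i : bool * nat) := (i.2 < k)%N : Prop.

Lemma beta_sig k l : (k <= l)%N -> measurable_fun (setT : set (g_sigma_algebraType (sig_of X (J l))))
  (beta dl r k : g_sigma_algebraType (sig_of X (J l)) -> R).
Proof.
elim: k => [_|k IH kl] /=; first exact: measurable_cst.
have h := IH (ltnW kl); apply: measurable_funD => //; apply: measurable_funM; last exact: h.
apply: (measurableT_comp (measurable_damp dl0)).
by apply: (measurable_sig (Y := X) (J := J l) (i := (false, k))).
Qed.

Lemma measurable_beta k : measurable_fun setT (beta dl r k).
Proof.
apply: (measurable_sub_sigma (G := sig_of X (J k))); last exact: beta_sig.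
exact: (sig_of_measurable (measurable_X X1 X2)).
Qed.

Lemma beta_mom_step k th : 0 < th ->
  \int[P]_w (beta dl r k.+1 w ^+ 2) <=
  (1 + th) * damp_mom dl * \int[P]_w (beta dl r k w ^+ 2) + (1 + th^-1) * r ^+ 2.
Proof.
move=> th0; have [M' hM'] := beta_bnd k; pose M := `|M'|.
have hM w : beta dl r k w <= M by rewrite (le_trans (hM' w))// ler_norm.
have M0 : 0 <= M by exact: normr_ge0.
have mX2 : measurable_fun setT (X2 k) by exact: measurable_funPT.
(* Truncation does not change the values of [beta], but makes the integrand bounded for arbitrary
   arguments, as [Rint_factor] demands. *)
pose b (x : R) := Num.max 0 (Num.min x M).
have bE w : b (beta dl r k w) = beta dl r k w.
  rewrite /b (_ : Num.min _ _ = beta dl r k w); first by apply/max_idPr; exact: beta_ge0.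
  by apply/min_idPl; exact: hM.
have b0 x : 0 <= b x by rewrite /b le_max lexx.
have bM x : b x <= M by rewrite /b ge_max M0 ge_min lexx orbT.
have mb : measurable_fun setT b by apply: measurable_maxr => //; exact: measurable_minr.
pose h (z : g_sigma_algebraType (sig_of X (J k)) * R) := (damp dl z.2 * b (beta dl r k z.1) + r) ^+ 2.
have mh : measurable_fun setT h.
  apply: measurable_funX; apply: measurable_funD => //; apply: measurable_funM.
    by apply: (measurableT_comp (measurable_damp dl0)); exact: measurable_snd.
  apply: (measurableT_comp mb); apply: (measurableT_comp (beta_sig (leqnn k))); exact: measurable_fst.
have hbnd z : `|h z| <= (5 / 4 * M + r) ^+ 2.
  have /andP[h1 h2] := damp_bnd dl z.2.
  rewrite ger0_norm ?sqr_ge0// ler_sqr ?nnegrE; [|by rewrite addr_ge0 ?mulr_ge0..].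
  by rewrite lerD2r ler_pM.
have iX : indep_of P (sig_of X (J k)) (X2 k).
  apply: (indep_of_sig (measurable_X X1 X2) Xindep (J' := fun i => i = (false, k))).
    by move=> i + iE; rewrite iE /J ltnn.
  exact: (measurable_sig (Y := X) (J := fun i => i = (false, k)) (i := (false, k))).
have [E1 mE1] := Rint_factor (sig_of_measurable (measurable_X X1 X2) (J := J k)) mX2 iX mh hbnd.
have -> : \int[P]_w (beta dl r k.+1 w ^+ 2) = \int[P]_w h (w, X2 k w).
  by apply: eq_Rintegral => w _; rewrite /h /= bE.
rewrite E1.
have mbk := measurable_beta k.
have mb2 : measurable_fun setT (fun w => beta dl r k w ^+ 2) by exact: measurable_funX.
have bb2 w : `|beta dl r k w ^+ 2| <= M ^+ 2.
  by rewrite ger0_norm ?sqr_ge0// ler_sqr ?nnegrE ?beta_ge0.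
have ib := bounded_integrable P mb2 bb2.
have mdk : measurable_fun setT (fun w => damp dl (X2 k w) ^+ 2).
  by apply: measurable_funX; exact: (measurableT_comp (measurable_damp dl0)).
have bdk w : `|damp dl (X2 k w) ^+ 2| <= (5 / 4) ^+ 2.
  have /andP[h1 h2] := damp_bnd dl (X2 k w).
  by rewrite ger0_norm ?sqr_ge0// ler_sqr ?nnegrE//; lra.
have id := bounded_integrable P mdk bdk.
have Ed : \int[P]_w (damp dl (X2 k w) ^+ 2) = damp_mom dl.
  apply: (Rint_X2_law X2id k (psi := fun x => damp dl x ^+ 2)); last by move=> x; exact: sqr_ge0.
  by apply: measurable_funX; exact: measurable_damp.
have thp : 0 <= 1 + th by rewrite addr_ge0// ltW.
have th1 : 0 <= 1 + th^-1 by rewrite addr_ge0// invr_ge0 ltW.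
have key w : \int[P]_w' h (w, X2 k w') <= (1 + th) * damp_mom dl * beta dl r k w ^+ 2 + (1 + th^-1) * r ^+ 2.
  have -> : (1 + th) * damp_mom dl * beta dl r k w ^+ 2 + (1 + th^-1) * r ^+ 2 =
    \int[P]_w' ((1 + th) * beta dl r k w ^+ 2 * damp dl (X2 k w') ^+ 2 + (1 + th^-1) * r ^+ 2).
    rewrite RintegralD//.
    - by rewrite RintegralZl// Ed Rint_cst; congr (_ + _); ring.
    - by have := integrableZl measurableT ((1 + th) * beta dl r k w ^+ 2) id.
    - by apply: (@bounded_integrable _ _ _ P _ `|(1 + th^-1) * r ^+ 2|).
  apply: (Rint_le P (M := (5 / 4 * M + r) ^+ 2)
     (N := (1 + th) * beta dl r k w ^+ 2 * (5 / 4) ^+ 2 + (1 + th^-1) * r ^+ 2)).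
  - by apply: (measurableT_comp mh); exact: measurable_fun_pair.
  - by apply: measurable_funD => //; exact: measurable_funM.
  - by move=> w'.
  - move=> w'; rewrite ger0_norm; last first.
      apply: addr_ge0; last by apply: mulr_ge0 => //; exact: sqr_ge0.
      by apply: mulr_ge0; [apply: mulr_ge0 => //|]; exact: sqr_ge0.
    rewrite lerD2r; apply: ler_wpM2l; last exact: le_trans (ler_norm _) (bdk w').
    by apply: mulr_ge0 => //; exact: sqr_ge0.
  - move=> w'; rewrite /h /= bE; move: (damp _ _) (beta _ _ _ _) => a c.
    (* Young's inequality with weight [th], in the form of a square. *)
    rewrite -subr_ge0 (_ : _ - _ = (th * (a * c) - r) ^+ 2 / th); first by rewrite divr_ge0 ?sqr_ge0 ?ltW.
    by field; rewrite gt_eqF.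
have -> : (1 + th) * damp_mom dl * \int[P]_w (beta dl r k w ^+ 2) + (1 + th^-1) * r ^+ 2 =
   \int[P]_w ((1 + th) * damp_mom dl * beta dl r k w ^+ 2 + (1 + th^-1) * r ^+ 2).
  rewrite RintegralD//.
  - by rewrite RintegralZl// Rint_cst.
  - by have := integrableZl measurableT ((1 + th) * damp_mom dl) ib.
  - by apply: (@bounded_integrable _ _ _ P _ `|(1 + th^-1) * r ^+ 2|).
apply: (Rint_le P (M := (5 / 4 * M + r) ^+ 2) (N := `|(1 + th) * damp_mom dl| * M ^+ 2 + `|(1 + th^-1) * r ^+ 2|)).
- exact: mE1.
- by apply: measurable_funD => //; exact: measurable_funM.
- move=> w; apply: Rint_abs_le => // .
  by apply: (measurableT_comp mh); exact: measurable_fun_pair.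
- move=> w; rewrite (le_trans (ler_normD _ _))// lerD2r normrM ler_wpM2l//.
- exact: key.
Qed.

Lemma beta_mom_bnd : exists2 B, 0 < B & forall k, \int[P]_w (beta dl r k w ^+ 2) <= B.
Proof.
have D0 : 0 <= damp_mom dl by apply: Rintegral_ge0 => w _; exact: sqr_ge0.
(* With [D = damp_mom dl] this gives [1 - (1 + th) * D = (1 - D) * (1 - D / 2) > 0]; the second
   moments then stay below the fixed point [c / (1 - rho)] of the affine recursion. *)
pose th := (1 - damp_mom dl) / 2.
have th0 : 0 < th by rewrite divr_gt0// subr_gt0.
pose rho := (1 + th) * damp_mom dl.
have rho1 : rho < 1.
  rewrite /rho /th; move: D0 dl1; move: (damp_mom dl) => D D0 D1.
  rewrite -subr_gt0 (_ : _ - _ = (1 - D) * (1 - D / 2)); last by field.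
  by apply: mulr_gt0; lra.
pose c := (1 + th^-1) * r ^+ 2.
have c0 : 0 <= c by rewrite mulr_ge0 ?sqr_ge0// addr_ge0// invr_ge0 ltW.
have r10 : 0 < 1 - rho by rewrite subr_gt0.
exists (c / (1 - rho) + 1) => [|k]; first by rewrite ltr_wpDl// divr_ge0// ltW.
suff : \int[P]_w (beta dl r k w ^+ 2) <= c / (1 - rho) by move=> /le_trans; apply; rewrite lerDl.
elim: k => [|k IH].
  have -> : \int[P]_w (beta dl r 0 w ^+ 2) = 0.
    by rewrite /= -[RHS](Rint_cst P 0); apply: eq_Rintegral => w _; rewrite expr0n.
  by rewrite divr_ge0// ltW.
apply: le_trans (beta_mom_step k th0) _; rewrite -/rho -/c.
have rho0 : 0 <= rho by rewrite mulr_ge0// addr_ge0// ltW.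
apply: le_trans (lerD (ler_wpM2l rho0 IH) (lexx _)) _.
rewrite (_ : _ + _ = c / (1 - rho))//; field.
by rewrite gt_eqF.
Qed.

Lemma beta_event : exists2 B, 0 < B & forall K e, 0 < e -> (0 < K)%N ->
  exists2 A, measurable A & prb P A <= e /\
    forall w, ~ A w -> \sum_(k < K) beta dl r k w ^+ 2 <= K%:R * B / e.
Proof.
have [B B0 hB] := beta_mom_bnd; exists B => // K e e0 K0.
have KR : 0 < K%:R :> R by rewrite ltr0n.
have mS : measurable_fun setT (fun w => \sum_(k < K) beta dl r k w ^+ 2).
  by apply: measurable_sum => k; apply: measurable_funX; exact: measurable_beta.
have mA : measurable [set w | K%:R * B / e < \sum_(k < K) beta dl r k w ^+ 2].
  rewrite (_ : [set w | _] = setT `&` (fun w => \sum_(k < K) beta dl r k w ^+ 2) @^-1` `]K%:R * B / e, +oo[).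
    exact: mS.
  by rewrite setTI; apply/seteqP; split=> w; rewrite /= in_itv /= andbT.
have S0 w : 0 <= \sum_(k < K) beta dl r k w ^+ 2 by apply: sumr_ge0 => k _; exact: sqr_ge0.
have mb k : measurable_fun setT (fun w => beta dl r k w ^+ 2) by apply: measurable_funX; exact: measurable_beta.
have ib k : exists M, forall w, `|beta dl r k w ^+ 2| <= M.
  have [M hM] := beta_bnd k; exists (`|M| ^+ 2) => w.
  rewrite ger0_norm ?sqr_ge0// ler_sqr ?nnegrE ?beta_ge0//.
  by rewrite (le_trans (hM w))// ler_norm.
have IS L : (exists M, forall w, `|\sum_(k < L) beta dl r k w ^+ 2| <= M) /\
   \int[P]_w (\sum_(k < L) beta dl r k w ^+ 2) <= L%:R * B.
  elim: L => [|L [[M hM] IH]].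
    split; first by exists 0 => w; rewrite big_ord0 normr0.
    rewrite mul0r (_ : \int[P]_w _ = 0)// -[RHS](Rint_cst P 0).
    by apply: eq_Rintegral => w _; rewrite big_ord0.
  have [M' hM'] := ib L; split.
    exists (M + M') => w; rewrite big_ord_recr /= (le_trans (ler_normD _ _))// lerD//.
  under eq_Rintegral do rewrite big_ord_recr /=.
  rewrite RintegralD//.
  - by rewrite -natr1 mulrDl mul1r lerD.
  - by apply: bounded_integrable hM; apply: measurable_sum.
  - exact: bounded_integrable hM'.
have [[M hM] hI] := IS K.
exists [set w | K%:R * B / e < \sum_(k < K) beta dl r k w ^+ 2] => //; split; last first.
  by move=> w /= /negP; rewrite -leNgt.
have a0 : 0 < K%:R * B / e by rewrite divr_gt0 ?mulr_gt0.
have := Rint_markov P mA mS hM S0 a0 (fun w h => ltW h).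
move=> /le_trans/(_ hI); rewrite -ler_pdivlMl//.
by rewrite invf_div mulfVK// gt_eqF// mulr_gt0.
Qed.

End damping.

(** * Comparison of the solution with the walk, for fixed randomness *)

Section pathwise.
Context dO (T : measurableType dO) (R : realType) (P : probability T R).
Variables (X1 X2 : nat -> {RV P >-> R}) (d : nat) (f : 'rV[R]_d -> R) (eps : R).
Hypotheses (hf : forall y, `|f y| <= 1) (uf : unif_cont f) (eps0 : 0 < eps)
  (fper : Zd_periodic f) (fmax : exists y, f y = 1) (fmin : exists y, f y = - 1).
Variables (H : 'rV[R]_d -> 'rV[R]_d -> R) (C rho eta : R) (w : T) (W1 W2 : R -> R)
  (u : 'rV[R]_d -> path_space R) (dl : R) (K : nat).
Let rh := 4 * rho * d%:R + 1.
Hypotheses (hH : ham_struct H) (C0 : 0 < C) (rho0 : 0 < rho)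
  (hrho : forall p y, rho <= `|p| -> 8 * C <= H p y) (eta0 : 0 < eta)
  (hW1 : interpolated_walk eta (fun k => X1 k w) W1)
  (hW2 : interpolated_walk eta (fun k => X2 k w) W2)
  (hu : is_solution H f eps eta W1 W2 u)
  (hX : forall k, (k < K)%N -> X1 k w != 0 /\ `|X2 k w| <= C * `|X1 k w|)
  (hb : forall k, (k < K)%N -> eps * (beta X2 dl (2 * rh) k w + rh) <= 8 * Num.sqrt eta * dl).

Let rh0 : 0 <= rh.
Proof. by rewrite /rh addr_ge0// !mulr_ge0// ltW. Qed.

(** The three cases of [damp] are three clauses of [solution_step]. The additive terms are
    [5 / 4 * rh] and [3 / 2 * rh], which explains the constant [2 * rh]; for [|X2 k| >= dl] the
    hypothesis [hb] is the relaxation condition. *)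
Lemma solution_oscillation k : (k <= K)%N ->
  forall x y, u x (k%:R * eta) - u y (k%:R * eta) <= eps * beta X2 dl (2 * rh) k w.
Proof.
elim: k => [_ x y|k IH kK].
  by case: hu => u0 _ _; rewrite mul0r !u0 subrr mulr0.
have [X10 X12] := hX kK; have hbk := hb kK.
have [h1 h2 h3 _] := solution_step hf uf eps0 fper fmax fmin hH C0 rho0 hrho eta0 hW1 hW2 hu X10 X12 (IH (ltnW kK)).
move=> x y /=; rewrite -/rh in h1 h2 h3 *.
have b0 := beta_ge0 X2 dl (mulr_ge0 (ler0n R 2) rh0) k w.
have er : 0 <= eps * rh by rewrite mulr_ge0// ltW.
move: hbk h1 h2 h3; move: (beta _ _ _ _ _) b0 => b b0 hbk h1 h2 h3.
have eb : 0 <= eps * b by rewrite mulr_ge0// ltW.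
rewrite /damp; case: eqP => [X20|_].
  by apply: le_trans (h2 X20 x y) _; lra.
case: ifP => dX.
  apply: le_trans (h3 _ x y) _; last by lra.
  apply: (@le_trans _ _ (8 * Num.sqrt eta * dl)); first by move: hbk; lra.
  by rewrite ler_wpM2l// mulr_ge0// sqrtr_ge0.
by apply: le_trans (h1 x y) _; lra.
Qed.

(** The strip estimates are added up. With [O = eps * beta] and [O' = O + eps * rh], the error
    [O + 5 / 4 * O'] of one strip has the coefficients [9 / 4] and [5 / 4]. *)
Lemma solution_track x k t : (k < K)%N -> k%:R * eta <= t <= k.+1%:R * eta ->
  `|u x t - (walk_sum X1 X2 eta 0 k w + Num.sqrt eta * xi X1 X2 k w * ((t - k%:R * eta) / eta))|
    <= \sum_(j < k.+1) eps * (9 / 4 * beta X2 dl (2 * rh) j w + 5 / 4 * rh).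
Proof.
have se : Num.sqrt eta != 0 by rewrite gt_eqF// sqrtr_gt0.
have ee : eta != 0 by rewrite gt_eqF.
have see : Num.sqrt eta * Num.sqrt eta = eta by rewrite -expr2 sqr_sqrtr// ltW.
have aux (s z : R) : s != 0 -> s * s = eta -> z / s = s * (z / eta) by move=> s0 <-; field.
have step k' t' : (k' < K)%N -> k'%:R * eta <= t' <= k'.+1%:R * eta ->
    `|u x t' - u x (k'%:R * eta) - Num.sqrt eta * xi X1 X2 k' w * ((t' - k'%:R * eta) / eta)|
     <= eps * (9 / 4 * beta X2 dl (2 * rh) k' w + 5 / 4 * rh).
  move=> kK tk; have [X10 X12] := hX kK.
  have [_ _ _ h4] := solution_step hf uf eps0 fper fmax fmin hH C0 rho0 hrho eta0 hW1 hW2 hu X10 X12 (solution_oscillation (ltnW kK)).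
  have := h4 x t' tk; rewrite -/rh.
  rewrite (_ : _ - _ + _ = u x t' - u x (k'%:R * eta) - Num.sqrt eta * xi X1 X2 k' w * ((t' - k'%:R * eta) / eta)).
    by move=> /le_trans; apply; lra.
  by rewrite /xi (aux _ _ se see); ring.
have at_node k' : (k' <= K)%N -> `|u x (k'%:R * eta) - walk_sum X1 X2 eta 0 k' w| <=
    \sum_(j < k') eps * (9 / 4 * beta X2 dl (2 * rh) j w + 5 / 4 * rh).
  elim: k' => [_|k' IH kK].
    by case: hu => u0 _ _; rewrite mul0r u0 /walk_sum !big_ord0 mulr0 subrr normr0.
  have := step k' (k'.+1%:R * eta) kK _.
  rewrite lexx andbT ler_wpM2r ?ler_nat ?(ltW eta0)// => /(_ isT) h.
  rewrite big_ord_recr /=; have := lerD (IH (ltnW kK)) h => /(le_trans (ler_normD _ _)).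
  have WS : walk_sum X1 X2 eta 0 k'.+1 w = walk_sum X1 X2 eta 0 k' w + Num.sqrt eta * xi X1 X2 k' w.
    by rewrite -[in LHS]addn1 walk_sumD /walk_sum big_ord1 add0n addn0.
  have -> : (k'.+1%:R * eta - k'%:R * eta) / eta = 1.
    by rewrite -mulrBl -natrB// subSnn mul1r divff.
  by rewrite WS mulr1 addrC addrA [X in `|X| <= _ -> _](_ : _ = u x (k'.+1%:R * eta) -
    (walk_sum X1 X2 eta 0 k' w + Num.sqrt eta * xi X1 X2 k' w)) //; ring.
move=> kK tk; have h := step k t kK tk.
rewrite big_ord_recr /=; have := lerD (at_node k (ltnW kK)) h => /(le_trans (ler_normD _ _)).
by rewrite [X in `|X| <= _ -> _](_ : _ = u x t - (walk_sum X1 X2 eta 0 k w +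
  Num.sqrt eta * xi X1 X2 k w * ((t - k%:R * eta) / eta)))//; ring.
Qed.

(** Inside a block the walk and the coarse polygon both stay within [2 * lam] of their common value
    at the start of the block, hence [4 * lam]. *)
Lemma solution_interp x (q n : nat) (lam : R) : 0 <= lam -> (0 < n)%N -> (q * n <= K)%N ->
  (forall i m, (i < q)%N -> (m <= n)%N -> `|walk_sum X1 X2 eta (i * n) m w| <= 2 * lam) ->
  forall t, 0 <= t <= q%:R * (n%:R * eta) ->
  `|u x t - interp_fun q (n%:R * eta) (fun i => walk_sum X1 X2 eta (i * n) n w) t| <=
    \sum_(j < K) eps * (9 / 4 * beta X2 dl (2 * rh) j w + 5 / 4 * rh) + 4 * lam.
Proof.
move=> lam0 n0 qK osc t tq.
have h0 : 0 < n%:R * eta by rewrite mulr_gt0// ltr0n.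
have eg j : 0 <= eps * (9 / 4 * beta X2 dl (2 * rh) j w + 5 / 4 * rh).
  have b0 := beta_ge0 X2 dl (mulr_ge0 (ler0n R 2) rh0) j w.
  by rewrite mulr_ge0 ?(ltW eps0)// addr_ge0 ?mulr_ge0.
have [q0|q0] := posnP q.
  move: tq; rewrite q0 mul0r -eq_le => /eqP <-; case: hu => u0 _ _.
  rewrite u0 /interp_fun big_ord0 subrr normr0.
  by rewrite addr_ge0 ?mulr_ge0// sumr_ge0.
have [i iq it] := grid_index h0 q0 tq.
have /andP[t1 t2] := it.
have hi : i.+1%:R * (n%:R * eta) = i%:R * (n%:R * eta) + n%:R * eta by rewrite -natr1 mulrDl mul1r.
have t' : 0 <= t - i%:R * (n%:R * eta) <= n%:R * eta by move: t1 t2; rewrite hi; lra.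
have [m mn /andP[m1 m2]] := grid_index eta0 n0 t'.
pose k := (i * n + m)%N.
have kE : k%:R * eta = i%:R * (n%:R * eta) + m%:R * eta by rewrite /k natrD natrM; ring.
have kSE : k.+1%:R * eta = i%:R * (n%:R * eta) + m.+1%:R * eta by rewrite /k -addnS natrD natrM; ring.
have kK : (k < K)%N.
  have kin : (k < i.+1 * n)%N by rewrite /k mulSn addnC ltn_add2r.
  by rewrite (leq_trans _ qK)// (leq_trans kin)// leq_mul2r iq orbT.
have tk : k%:R * eta <= t <= k.+1%:R * eta by rewrite kE kSE; move: m1 m2; lra.
have tr := solution_track x kK tk.
have err : \sum_(j < k.+1) eps * (9 / 4 * beta X2 dl (2 * rh) j w + 5 / 4 * rh) <=
    \sum_(j < K) eps * (9 / 4 * beta X2 dl (2 * rh) j w + 5 / 4 * rh).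
  rewrite -(subnKC kK) big_split_ord /= lerDl sumr_ge0// => j _.
  exact: (eg (k.+1 + j)%N).
rewrite (interpE _ h0 iq it).
have SE j : \sum_(l < j) walk_sum X1 X2 eta (l * n) n w = walk_sum X1 X2 eta 0 (j * n) w.
  elim: j => [|j IH]; first by rewrite big_ord0 /walk_sum big_ord0 mulr0.
  by rewrite big_ord_recr /= IH mulSn addnC walk_sumD.
have xiE : Num.sqrt eta * xi X1 X2 k w = walk_sum X1 X2 eta (i * n) m.+1 w - walk_sum X1 X2 eta (i * n) m w.
  by rewrite -addn1 walk_sumD addrC addKr /walk_sum big_ord1 addn0.
rewrite SE; move: tr; rewrite walk_sumD add0n xiE.
have o1 := osc i m iq (ltnW mn); have o2 := osc i m.+1 iq mn; have o3 := osc i n iq (leqnn n).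
have th1 : 0 <= (t - k%:R * eta) / eta <= 1.
  rewrite divr_ge0 ?(ltW eta0) ?subr_ge0; [|by case/andP: tk..].
  rewrite ler_pdivrMr// mul1r; case/andP: tk; rewrite -[k.+1%:R]natr1; lra.
have th2 : 0 <= (t - i%:R * (n%:R * eta)) / (n%:R * eta) <= 1.
  by case/andP: t' => a b; rewrite divr_ge0 ?(ltW h0)//= ler_pdivrMr// mul1r.
move: err th1 th2 o1 o2 o3.
move: (walk_sum _ _ _ 0 _ _) (walk_sum _ _ _ _ m _) (walk_sum _ _ _ _ m.+1 _) (walk_sum _ _ _ _ n _).
move: ((t - k%:R * eta) / eta) (_ / (n%:R * eta)) (\sum_(j < K) _) (\sum_(j < k.+1) _) (u x t).
clear => th th' e2 e1 v s a b c e12 th1 th2 a2 b2 c2 tr.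
have -> : v - (s + c * th') = (v - (s + a + (b - a) * th)) + ((1 - th) * a + th * b - th' * c) by ring.
apply: le_trans (ler_normD _ _) (lerD (le_trans tr e12) _).
have [h1 h1'] := andP th1; have [h2 h2'] := andP th2.
apply: le_trans (ler_normB _ _) _; rewrite (_ : 4 * lam = 2 * lam + 2 * lam); last by ring.
apply: lerD; last first.
  rewrite normrM (ger0_norm h2); apply: le_trans c2; exact: ler_piMl.
apply: le_trans (ler_normD _ _) _; rewrite !normrM (ger0_norm h1) (@ger0_norm _ (1 - th)) ?subr_ge0//.
apply: (@le_trans _ _ ((1 - th) * (2 * lam) + th * (2 * lam))); last by rewrite -mulrDl subrK mul1r.
by rewrite lerD// ler_wpM2l// subr_ge0.
Qed.

End pathwise.

(** * Convergence in law *)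

Lemma sgr_close (R : realType) (x y : R) : `|Num.sg x - Num.sg y| <= 2^-1 -> Num.sg x = Num.sg y.
Proof.
by case: (sgrP x) => _; case: (sgrP y) => _ //; rewrite ler_norml => /andP[]; lra.
Qed.

(** * Lipschitz approximation from below *)

Section lipschitz_approximation.
Context (R : realType) (phi : path_space R -> R) (M : R).
Hypotheses (cphi : continuous phi) (phiM : forall g, `|phi g| <= M).

(** The inf-convolution of [phi] with [n%:R] times the distance, that is, the largest function below
    [phi] with Lipschitz constant [n]. *)
Definition lip_approx (n : nat) (g : path_space R) : R :=
  inf [set phi h + n%:R * path_dist g h | h in [set: path_space R]].

Let has_infS n g : has_inf [set phi h + n%:R * path_dist g h | h in [set: path_space R]].
Proof.
split; first by exists (phi g + n%:R * path_dist g g), g.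
exists (- M) => _ [h _ <-]; have /ler_normlP[h1 _] := phiM h.
have := mulr_ge0 (ler0n R n) (path_dist_ge0 g h); lra.
Qed.

Lemma lip_approx_le n g h : lip_approx n g <= phi h + n%:R * path_dist g h.
Proof. by apply: ge_inf; [exact: (has_infS n g).2|exists h]. Qed.

Lemma lip_approx_le_self n g : lip_approx n g <= phi g.
Proof. by have := lip_approx_le n g g; rewrite path_distxx mulr0 addr0. Qed.

Lemma lip_approx_ge n g c : (forall h, c <= phi h + n%:R * path_dist g h) -> c <= lip_approx n g.
Proof.
by move=> H; apply: lb_le_inf; [exact: (has_infS n g).1|move=> _ [h _ <-]; exact: H].
Qed.

Lemma lip_approx_bnd n g : `|lip_approx n g| <= M.
Proof.
rewrite ler_norml; apply/andP; split; last first.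
  exact: le_trans (lip_approx_le_self n g) (le_trans (ler_norm _) (phiM g)).
apply: lip_approx_ge => h; have /ler_normlP[h1 _] := phiM h.
have := mulr_ge0 (ler0n R n) (path_dist_ge0 g h); lra.
Qed.

Lemma lip_approx_lip n g g' : `|lip_approx n g - lip_approx n g'| <= n%:R * path_dist g g'.
Proof.
have half a b : lip_approx n a <= lip_approx n b + n%:R * path_dist a b.
  rewrite -lerBlDr; apply: lip_approx_ge => h; rewrite lerBlDr (le_trans (lip_approx_le n a h))//.
  by rewrite -addrA lerD2l -mulrDr ler_wpM2l// addrC path_dist_triangle.
have h1 := half g g'; have h2 := half g' g; rewrite path_dist_sym in h2.
by rewrite ler_norml; apply/andP; split; move: h1 h2; lra.
Qed.

Lemma lip_approx_cvg g : lip_approx n g @[n --> \oo] --> phi g.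
Proof.
apply/cvgrPdist_le => e e0.
have /nbhs_ballP[r /= r0 hr] : nbhs g [set h | `|phi g - phi h| < e].
  have := @cphi g [set y | `|phi g - y| < e]; apply.
  by apply/nbhs_ballP; exists e.
near=> n; rewrite ger0_norm ?subr_ge0 ?lip_approx_le_self// lerBlDl -lerBlDr.
apply: lip_approx_ge => h; have [gh|gh] := ltP (path_dist g h) r.
  have /ltr_normlP[_ h1] : `|phi g - phi h| < e by apply: hr.
  have := mulr_ge0 (ler0n R n) (path_dist_ge0 g h); lra.
have nr : 2 * M / r <= n%:R by near: n; exact: nbhs_infty_ger.
have : 2 * M <= n%:R * path_dist g h.
  by rewrite ler_pdivrMr// in nr; rewrite (le_trans nr)// ler_wpM2l.
have /ler_normlP[_ h1] := phiM g; have /ler_normlP[h2 _] := phiM h; lra.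
Unshelve. all: by end_near. Qed.

End lipschitz_approximation.

Lemma lip_path_continuous (R : realType) (phi : path_space R -> R) L : 0 <= L ->
  (forall g g', `|phi g - phi g'| <= L * path_dist g g') -> continuous phi.
Proof.
move=> L0 hL; apply: continuous_path_dist_le => g e e0.
exists (e / (L + 1)); first by rewrite divr_gt0// ltr_wpDl.
move=> h; rewrite ltr_pdivlMr ?ltr_wpDl// => gh; rewrite (le_trans (hL g h))//.
by rewrite (le_trans _ (ltW gh))// mulrC ler_wpM2l ?path_dist_ge0// lerDl.
Qed.

Lemma Rint_dist_off d (T : measurableType d) (R : realType) (P : probability T R)
    (f g b : T -> R) (A : set T) M M' c : measurable A ->
  measurable_fun setT f -> measurable_fun setT g -> measurable_fun setT b ->
  (forall x, `|f x| <= M) -> (forall x, `|g x| <= M) -> (forall x, 0 <= b x <= M') -> 0 <= c ->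
  (forall x, ~ A x -> `|f x - g x| <= c + b x) ->
  `|\int[P]_x f x - \int[P]_x g x| <= c + \int[P]_x b x + 2 * M * prb P A.
Proof.
move=> mA mf mg mb fM gM bM c0 fg.
have i1 := bounded_integrable P mf fM; have i2 := bounded_integrable P mg gM.
have ib : P.-integrable setT (EFin \o b).
  by apply: (bounded_integrable P mb (M := M')) => x; case/andP: (bM x) => h1 h2; rewrite ger0_norm.
have ic : P.-integrable setT (EFin \o (fun=> c)) by apply: (@bounded_integrable _ _ _ P _ `|c|).
have iA : P.-integrable setT (EFin \o (fun x => 2 * M * \1_A x)).
  have := bounded_integrable P (measurable_indicT mA) (fun w => indic_bnd _ _ w).
  by move=> h; have := integrableZl measurableT (2 * M) h.
have icb : P.-integrable setT (EFin \o (fun x => c + b x)) by have := integrableD measurableT ic ib.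
have E : c + \int[P]_x b x + 2 * M * prb P A = \int[P]_x (c + b x + 2 * M * \1_A x).
  rewrite RintegralD// RintegralD// Rint_cst RintegralZl// ?Rint_indic//.
  exact: (bounded_integrable P (measurable_indicT mA) (fun w => indic_bnd _ _ w)).
rewrite E -RintegralB//.
have iD : P.-integrable setT (EFin \o (fun x => f x - g x)) by have := integrableB measurableT i1 i2.
rewrite (le_trans (le_normr_Rintegral measurableT iD))//; apply: le_Rintegral => //.
- by have := integrable_abse iD.
- by have := integrableD measurableT icb iA.
move=> x _; rewrite indicE; case: (boolP (x \in A)) => [_|].
  rewrite mulr1 (le_trans (ler_normB _ _))// (_ : 2 * M = M + M); last by ring.
  by rewrite (le_trans (lerD (fM x) (gM x)))// lerDr addr_ge0//; case/andP: (bM x).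
by rewrite notin_setE => /fg; rewrite mulr0 addr0.
Qed.

(* The solution is continuous in the data [X1 k] and [X2 k] only as long as the signs of the
   [X1 k] are fixed, so these signs are taken as additional data. *)
Lemma measurable_solution (R : realType) (d : nat) dO (T : measurableType dO) (H : 'rV[R]_d -> 'rV[R]_d -> R)
    (f : 'rV[R]_d -> R) (eps eta : R) (X1 X2 : nat -> T -> R) (W1 W2 : T -> R -> R)
    (u : T -> 'rV[R]_d -> path_space R) :
  ham_struct H -> (forall y, `|f y| <= 1) -> unif_cont f -> 0 < eps -> 0 < eta ->
  (forall k, measurable_fun setT (X1 k)) -> (forall k, measurable_fun setT (X2 k)) ->
  (forall w, interpolated_walk eta (X1^~ w) (W1 w)) -> (forall w, interpolated_walk eta (X2^~ w) (W2 w)) ->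
  (forall w, is_solution H f eps eta (W1 w) (W2 w) (u w)) ->
  forall x, measurable_fun setT (fun w => u w x).
Proof.
move=> hH hf uf eps0 eta0 m1 m2 hW1 hW2 hu x; apply: measurable_path => [w|t t0].
  by case: (hu w) => ->.
have [k tk] : exists k : nat, t <= k%:R * eta.
  by exists (Num.truncn (t / eta)).+1; rewrite -ler_pdivrMr// ltW// truncnS_gt.
pose Y (i : 'I_k + 'I_k + 'I_k) : T -> R :=
  match i with inl (inl j) => X1 j | inl (inr j) => X2 j | inr j => fun w => Num.sg (X1 j w) end.
have mY i : measurable_fun setT (Y i).
  case: i => [[j|j]|j] /=; [exact: m1|exact: m2|].
  by apply: (measurableT_comp (@measurable_sgr R)); exact: m1.
apply: (measurable_fin_dep mY) => w e e0.
have [r r0 hr] := solution_continuity hH hf uf eps0 eta0 (hW1 w) (hW2 w) (hu w) k e0.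
(* Signs at distance at most [1 / 2] coincide, so closeness in the adjoined coordinates fixes the
   signs. *)
exists (Num.min r 2^-1); first by rewrite lt_min r0 /= invr_gt0 ltr0n.
move=> w' hw'; apply: (hr _ _ _ _ _ (hW1 w') (hW2 w') (hu w')); last by rewrite t0.
move=> i ik; pose j := Ordinal ik.
have := hw' (inl (inl j)); have := hw' (inl (inr j)); have := hw' (inr j).
rewrite !le_min /= => /andP[_ /sgr_close h3] /andP[h2 _] /andP[h1 _]; by split.
Qed.

Lemma ae_ratio_bound dO (T : measurableType dO) (R : realType) (P : probability T R)
    (X1 X2 : nat -> {RV P >-> R}) (X1neq0 : forall k, {ae P, forall w, X1 k w != 0})
    (Xratio : (ess_sup P (fun w =>
      ereal_sup (range (fun k => (`|X2 k w / X1 k w|)%:E))) < +oo)%E) :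
  exists2 C : R, 0 < C & exists2 N : set T, measurable N &
    prb P N = 0 /\ forall w, ~ N w -> forall k, X1 k w != 0 /\ `|X2 k w| <= C * `|X1 k w|.
Proof.
set s := ess_sup _ _ in Xratio.
have [C C0 sC] : exists2 C : R, 0 < C & (s <= C%:E)%E.
  move: Xratio; case: (s) => [c| |]//= _; last by exists 1; rewrite ?leNye.
  by exists (`|c| + 1); rewrite ?ltr_wpDl// lee_fin (le_trans (ler_norm c))// lerDl.
exists C => //.
have /ess_supP [N1 [mN1 PN1 hN1]] := sC.
have /ae_foralln [N2 [mN2 PN2 hN2]] := X1neq0.
exists (N1 `|` N2); first exact: measurableU.
split.
  apply/eqP; rewrite eq_le; apply/andP; split; last exact: prb_ge0.
  by rewrite (le_trans (prbU_le P mN1 mN2))// /prb PN1 PN2 /= addr0.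
move=> w /not_orP[/(contra_not (@hN1 w)) /contrapT h1 /(contra_not (@hN2 w)) /contrapT h2] k.
have x0 := h2 k; split => //.
rewrite -ler_pdivrMr ?normr_gt0// -normf_div -lee_fin (le_trans _ h1)//.
by apply: ereal_sup_ubound; exists k.
Qed.

(** Off a small event the squares of [beta] sum to at most [K%:R * B / D], where [K%:R * eta <= T0].
    Hence each [eps * beta k] is of order [sqrt (z0 * eta)] at most, small enough for the relaxation
    condition, and with [b <= b^2 + 1] the accumulated error is of order [z0]. *)
Lemma beta_small dO (T : measurableType dO) (R : realType) (P : probability T R)
    (X1 X2 : nat -> {RV P >-> R})
    (Xindep : mutually_independent P
      (fun ik : bool * nat => if ik.1 then X1 ik.2 : T -> R else X2 ik.2))
    (X2id : forall k (A : set R), measurable A -> distribution P (X2 k) A = distribution P (X2 0%N) A)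
    (dl rh lam T0 D : R) : 0 < dl -> 0 <= rh -> damp_mom X2 dl < 1 -> 0 < lam -> 0 < T0 -> 0 < D ->
  exists2 z0, 0 < z0 & forall (eps eta : R) K, 0 < eps -> 0 < eta <= 1 -> eps <= z0 * eta ->
    (0 < K)%N -> K%:R * eta <= T0 ->
    exists2 A : set T, measurable A & prb P A <= D /\ forall w, ~ A w ->
      (forall k, (k < K)%N -> eps * (beta X2 dl (2 * rh) k w + rh) <= 8 * Num.sqrt eta * dl) /\
      \sum_(j < K) eps * (9 / 4 * beta X2 dl (2 * rh) j w + 5 / 4 * rh) <= lam.
Proof.
move=> dl0 rh0 dm lam0 T00 D0.
have r0 : 0 <= 2 * rh by rewrite mulr_ge0.
have [B B0 hB] := beta_event Xindep X2id dl0 r0 dm.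
pose c3 := T0 * (9 / 4 * (1 + B / D) + 5 / 4 * rh).
have BD : 0 < B / D by rewrite divr_gt0.
have c30 : 0 < c3 by rewrite /c3 mulr_gt0//; move: BD; move: (B / D) => b b0; move: rh0 b0; clear; lra.
(* The second and third bounds give [eps * rh] and [eps * beta k] one half of [8 * sqrt eta * dl]
   each; the last one keeps the accumulated error below [lam]. *)
pose z0 := Num.min (Num.min 1 (4 * dl / (rh + 1))) (Num.min (16 * dl ^+ 2 / (T0 * (B / D))) (lam / c3)).
have z00 : 0 < z0.
  rewrite !lt_min ltr01 /= (divr_gt0 lam0 c30) andbT.
  apply/andP; split; first by apply: divr_gt0; [exact: mulr_gt0|exact: ltr_wpDl].
  by apply: divr_gt0; apply: mulr_gt0 => //; exact: exprn_gt0.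
have z01 : z0 <= 1 by rewrite !ge_min lexx.
have z1 : z0 * rh <= 4 * dl.
  have : z0 <= 4 * dl / (rh + 1) by rewrite !ge_min lexx orbT.
  rewrite ler_pdivlMr ?ltr_wpDl// => /(le_trans _); apply.
  by rewrite ler_wpM2l ?(ltW z00)// lerDl.
have z2 : z0 * (T0 * (B / D)) <= (4 * dl) ^+ 2.
  have : z0 <= 16 * dl ^+ 2 / (T0 * (B / D)) by rewrite !ge_min lexx !orbT.
  rewrite ler_pdivlMr; last exact: mulr_gt0.
  move=> /le_trans; apply; by rewrite exprMn -natrX.
have z3 : z0 * c3 <= lam.
  have : z0 <= lam / c3 by rewrite !ge_min lexx !orbT.
  by rewrite ler_pdivlMr.
exists z0 => // eps eta K eps0 /andP[eta0 eta1] ez K0 KT.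
have [A mA [PA hA]] := hB K D D0 K0.
exists A => //; split=> // w /hA {hA}; set b := fun k => beta X2 dl (2 * rh) k w => hS.
have b0 k : 0 <= b k by exact: beta_ge0.
have se0 : 0 <= Num.sqrt eta by exact: sqrtr_ge0.
have se2 : Num.sqrt eta ^+ 2 = eta by rewrite sqr_sqrtr// ltW.
have eKB : \sum_(k < K) b k ^+ 2 <= K%:R * (B / D) by rewrite mulrA.
have see : eta <= Num.sqrt eta.
  rewrite -[leLHS]se2 expr2 ler_piMr//.
  by rewrite -sqrtr1 ler_wsqrtr.
split=> [k kK|].
  have h1 : eps * rh <= 4 * Num.sqrt eta * dl.
    rewrite (le_trans (ler_wpM2r rh0 ez))// mulrAC.
    apply: (@le_trans _ _ (4 * dl * eta)); first by rewrite ler_wpM2r// ltW.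
    by rewrite -mulrA [dl * _]mulrC mulrA ler_wpM2r ?(ltW dl0)// ler_wpM2l.
  have h2 : eps * b k <= 4 * Num.sqrt eta * dl.
    rewrite -(@ler_pXn2r _ 2)// ?nnegrE ?mulr_ge0 ?(ltW eps0) ?(ltW dl0)//.
    have bk : b k ^+ 2 <= K%:R * (B / D).
      rewrite (le_trans _ eKB)// (bigD1 (Ordinal kK))//= lerDl sumr_ge0// => i _.
      by rewrite exprn_ge0.
    rewrite exprMn (_ : (4 * _ * dl) ^+ 2 = (4 * dl) ^+ 2 * eta); last by rewrite -[in RHS]se2; ring.
    apply: (@le_trans _ _ ((z0 * eta) ^+ 2 * (K%:R * (B / D)))).
      apply: ler_pM => //; rewrite ?exprn_ge0 ?(ltW eps0)//.
      by rewrite lerXn2r// nnegrE ?mulr_ge0 ?(ltW z00) ?(ltW eta0) ?(ltW eps0).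
    rewrite (_ : _ * _ = z0 * (z0 * ((K%:R * eta) * (B / D))) * eta); last by ring.
    rewrite ler_wpM2r ?(ltW eta0)//.
    have p0 : 0 <= z0 * ((K%:R * eta) * (B / D)) by rewrite !mulr_ge0 ?(ltW z00) ?(ltW eta0) ?(ltW B0) ?invr_ge0 ?(ltW D0).
    rewrite (le_trans (ler_piMl p0 z01))// (le_trans _ z2)// ler_wpM2l ?(ltW z00)//.
    by rewrite ler_wpM2r// ltW.
  rewrite (_ : 8 * _ * dl = 4 * Num.sqrt eta * dl + 4 * Num.sqrt eta * dl); last by ring.
  by rewrite mulrDr lerD.
rewrite -mulr_sumr (le_trans _ z3)//.
apply: (@le_trans _ _ (z0 * eta * (K%:R * (9 / 4 * (1 + B / D) + 5 / 4 * rh)))).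
  apply: ler_pM => //; rewrite ?(ltW eps0)//.
    by apply: sumr_ge0 => i _; rewrite addr_ge0 ?mulr_ge0 ?b0.
  apply: (@le_trans _ _ (\sum_(j < K) (9 / 4 * b j ^+ 2 + (9 / 4 + 5 / 4 * rh)))).
    apply: ler_sum => j _; rewrite -/(b j).
    have : b j <= b j ^+ 2 + 1 by have := sqr_ge0 (b j - 1); rewrite sqrrB1; move: (b0 j); lra.
    by move: (b j) (b j ^+ 2) => p q; clear; lra.
  rewrite big_split /= -mulr_sumr sumr_const card_ord -[_ *+ K]mulr_natl.
  move: eKB; move: (\sum_(k < K) _) (B / D) => S p; rewrite (_ : _ * (_ + _) = 9 / 4 * (K%:R * p) + K%:R * (9 / 4 + 5 / 4 * rh)); last by ring.
  by move: (K%:R * p) (K%:R * _) => p1 p2; clear; lra.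
rewrite -mulrA ler_wpM2l ?(ltW z00)// mulrA [eta * _]mulrC ler_wpM2r//.
by move: BD; move: (B / D) => p p0; move: rh0 p0; clear; lra.
Qed.

(** Where the modulus is at least [1], the trivial bound [2 * M] is used; elsewhere the polygon is
    within twice the modulus up to time [N], which gives [2 * L]. The term [(2 ^+ N)^-1] is the part
    of the distance beyond [N]. *)
Lemma wiener_interp_close (R : realType) (W : probability (path_space R) R) (HW : is_wiener_measure W)
    (phi : path_space R -> R) (L M : R) (N N' q : nat) (h h0 : R) (hp : 0 < h) : 0 <= L ->
  (forall g, `|phi g| <= M) -> (forall g g', `|phi g - phi g'| <= L * path_dist g g') ->
  (N <= N')%N -> h <= h0 -> h0 <= 1 -> N%:R <= q%:R * h ->
  `|\int[W]_g phi (interp_path q hp (incr g h)) - \int[W]_g phi g| <=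
    L * (2 ^+ N)^-1 + (2 * M + 2 * L) * \int[W]_g modulus1 N' h0 g.
Proof.
move=> L0 phiM phiL NN' hh h01 Nq.
have M0 : 0 <= M by rewrite (le_trans _ (phiM point)).
have h00 : 0 <= h0 by rewrite (le_trans (ltW hp)).
have mphi : measurable_fun setT phi by exact: measurable_continuous_path (lip_path_continuous L0 phiL).
have mF : measurable_fun setT (fun g : path_space R => phi (interp_path q hp (incr g h))).
  have hl : lip_on q L (fun v => phi (interp_path q hp v)).
    by move=> y z; rewrite (le_trans (phiL _ _))// ler_wpM2l// interp_path_lip.
  apply: (lip_on_measurable hl (Z := fun i (g : path_space R) => incr g h i)) => j _.
  by apply: measurable_incr; exact: ltW.
have mm := measurable_modulus1 (R := R) N' h00.
have mA0 : measurable [set g : path_space R | g 0 = 0].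
  rewrite (_ : [set g | _] = setT `&` (fun g : path_space R => g 0) @^-1` [set 0]).
    exact: (measurable_eval (lexx 0) measurableT (measurable_set1 0)).
  by rewrite setTI.
have mA := measurableC mA0.
have PA : prb W (~` [set g : path_space R | g 0 = 0]) = 0.
  by case: HW => W0 _ _; rewrite prbC// /prb W0 subrr.
have ML0 : 0 <= 2 * M + 2 * L by rewrite addr_ge0// mulr_ge0.
have := @Rint_dist_off _ _ _ W _ _ (fun g => (2 * M + 2 * L) * modulus1 N' h0 g) _ M (2 * M + 2 * L) (L * (2 ^+ N)^-1) mA mF mphi.
rewrite PA mulr0 addr0 RintegralZl//; last first.
  apply: (bounded_integrable W mm (M := 1)) => g; have /andP[a b] := modulus1_bnd N' g h00.
  by rewrite ger0_norm.
apply => //.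
- exact: measurable_funM.
- move=> g; have /andP[a b] := modulus1_bnd N' g h00.
  by rewrite mulr_ge0//= ler_piMr.
- by rewrite mulr_ge0// invr_ge0 exprn_ge0.
move=> g /= /contrapT g0; rewrite /modulus1.
have om0 := modulus_ge0 N' g h00; move E : (modulus N' h0 g) om0 => om om0.
have d1 : path_dist (interp_path q hp (incr g h)) g <= 2 * om + (2 ^+ N)^-1.
  apply: path_dist_le; first by rewrite mulr_ge0.
  move=> t tN; rewrite distrC /=; apply: (interp_close hp g0 Nq _ tN) => s s' si si' ss.
  have sub r : 0 <= r <= N%:R + h -> 0 <= r <= N'.+1%:R.
    move=> /andP[-> r1]; rewrite -natr1 (le_trans r1)// lerD ?ler_nat//.
    exact: le_trans hh h01.
  by rewrite -E; apply: modulus_ub; [exact: sub|exact: sub|exact: le_trans hh].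
have e1 := phiL (interp_path q hp (incr g h)) g.
have p2 : 0 <= L * (2 ^+ N)^-1 by rewrite mulr_ge0// invr_ge0 exprn_ge0.
have [om1|om1] := leP 1 om.
  rewrite mulr1 (le_trans (ler_normB _ _))//.
  have := lerD (phiM (interp_path q hp (incr g h))) (phiM g).
  by move: p2 L0; move: (_ * _^-1) (`|_| + `|_|) => a b; clear; lra.
have := ler_wpM2l L0 d1; rewrite mulrDr => e2.
have := mulr_ge0 M0 om0; move: (le_trans e1 e2).
have -> : (2 * M + 2 * L) * om = 2 * (M * om) + 2 * (L * om) by ring.
have -> : L * (2 * om) = 2 * (L * om) by ring.
by move: `|_ - _| (L * _^-1) (M * om) (L * om) => a b c e; clear; lra.
Qed.

(** * Passage to the limit *)

Section limit.
Context (R : realType) (d : nat) (H : 'rV[R]_d -> 'rV[R]_d -> R) (f : 'rV[R]_d -> R).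
Hypotheses (hH : ham_struct H) (hf : forall y, `|f y| <= 1) (uf : unif_cont f)
  (fper : Zd_periodic f) (fmax : exists y, f y = 1) (fmin : exists y, f y = - 1).
Context (eta : R -> R) (eta_gt0 : forall eps : R, 0 < eps -> 0 < eta eps)
  (eta_cvg0 : eta eps @[eps --> 0^'+] --> 0)
  (eps_eta_cvg0 : eps / eta eps @[eps --> 0^'+] --> 0)
  (dO : measure_display) (Omega : measurableType dO) (P : probability Omega R)
  (X1 X2 : nat -> {RV P >-> R})
  (Xindep : mutually_independent P
    (fun ik : bool * nat => if ik.1 then X1 ik.2 : Omega -> R else X2 ik.2))
  (X1sym : forall k, P [set w | 0 < X1 k w] = P [set w | X1 k w < 0])
  (X2id : forall k (A : set R), measurable A ->
    distribution P (X2 k) A = distribution P (X2 0%N) A)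
  (X2var : forall k, ('E_P[fun w => (`|X2 k w| ^+ 2)%R] = 1)%E)
  (X1neq0 : forall k, {ae P, forall w, X1 k w != 0})
  (Xratio : (ess_sup P (fun w =>
    ereal_sup (range (fun k => (`|X2 k w / X1 k w|)%:E))) < +oo)%E)
  (W1 W2 : R -> Omega -> R -> R)
  (W1walk : forall (eps : R) w, 0 < eps ->
    interpolated_walk (eta eps) (fun k => X1 k w) (W1 eps w))
  (W2walk : forall (eps : R) w, 0 < eps ->
    interpolated_walk (eta eps) (fun k => X2 k w) (W2 eps w))
  (u : R -> Omega -> 'rV[R]_d -> path_space R)
  (usol : forall (eps : R) w, 0 < eps ->
    is_solution H f eps (eta eps) (W1 eps w) (W2 eps w) (u eps w))
  (W : probability (path_space R) R) (HW : is_wiener_measure W)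
  (x : 'rV[R]_d).

Lemma measurable_solution_path eps : 0 < eps -> measurable_fun setT (fun w => u eps w x).
Proof.
move=> eps0; apply: (@measurable_solution R d dO Omega H f eps (eta eps) X1 X2 (W1 eps) (W2 eps)) => //.
- exact: eta_gt0.
- by move=> w; exact: W1walk.
- by move=> w; exact: W2walk.
- by move=> w; exact: usol.
Qed.

(** The excluded event only covers the null set of bad ratios and the failure of the damping bounds;
    the oscillation of the walk inside blocks stays a hypothesis on [w], estimated elsewhere. In
    [5 * lam], one part is accumulated error and four come from interpolation. *)
Lemma solution_path_close (lam D T0 : R) : 0 < lam -> 0 < D -> 0 < T0 ->
  exists2 z0, 0 < z0 & forall eps q n (N : nat), 0 < eps -> eta eps <= 1 -> eps <= z0 * eta eps ->
    (0 < q * n)%N -> (q * n)%:R * eta eps <= T0 -> N%:R <= q%:R * (n%:R * eta eps) ->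
    forall hp : 0 < n%:R * eta eps,
    exists2 A : set Omega, measurable A & prb P A <= D /\ forall w, ~ A w ->
      (forall i m, (i < q)%N -> (m <= n)%N -> `|walk_sum X1 X2 (eta eps) (i * n) m w| <= 2 * lam) ->
      path_dist (u eps w x) (interp_path q hp (fun i => walk_sum X1 X2 (eta eps) (i * n) n w)) <=
        5 * lam + (2 ^+ N)^-1.
Proof.
move=> lam0 D0 T00.
have [C C0 [Nul mNul [PNul hNul]]] := ae_ratio_bound X1neq0 Xratio.
have [rho rho0 hrho] := hs_coer hH (8 * C).
have [dl dl0 dm] := damp_mom_lt1 X2var.
have rh0 : 0 <= 4 * rho * d%:R + 1 by rewrite addr_ge0// !mulr_ge0// ltW.
have [z0 z00 hz] := beta_small Xindep X2id dl0 rh0 dm lam0 T00 D0.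
exists z0 => // eps q n N eps0 eta1 ez qn0 qnT Nq hp.
have eta0 := eta_gt0 eps0.
have [|A mA [PA hA]] := hz eps (eta eps) (q * n)%N eps0 _ ez qn0 qnT; first by rewrite eta0.
exists (A `|` Nul); first exact: measurableU.
split; first by rewrite (le_trans (prbU_le P mA mNul))// PNul addr0.
move=> w /not_orP[/hA [hb hs] /hNul hr] osc.
apply: path_dist_le => [|t /andP[t0 tN]]; first by rewrite mulr_ge0// ltW.
have n0 : (0 < n)%N by move: qn0; rewrite muln_gt0 => /andP[].
have := @solution_interp _ _ _ P X1 X2 _ _ _ hf uf eps0 fper fmax fmin _ _ _ _ w _ _ _ _ _ hH C0 rho0 hrho eta0
  (W1walk w eps0) (W2walk w eps0) (usol w eps0) (fun k _ => hr k) hb x q n lam (ltW lam0) n0 (leqnn _) osc t.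
rewrite t0 (le_trans tN Nq) => /(_ isT) /le_trans; apply.
by move: hs; move: (\sum_(_ < _) _) => S; lra.
Qed.

(** Three comparisons: the solution with the polygon of the walk, off an event of probability at
    most [5 * D]; the increments of the walk with Wiener increments; the Wiener polygon with the
    Wiener path. The total is within [20 * D * (L + M + 1)], whence the choice of [D]. *)
Lemma lipschitz_limit (phi : path_space R -> R) (L M e : R) : 0 <= L ->
  (forall g, `|phi g| <= M) -> (forall g g', `|phi g - phi g'| <= L * path_dist g g') -> 0 < e ->
  \forall eps \near 0^'+, `|\int[P]_w phi (u eps w x) - \int[W]_g phi g| <= e.
Proof.
have budget (a b c z p q r LD MD D l m : R) : a <= p + 2 * q -> b <= D -> c <= r + (2 * m + 2 * l) ->
  z <= a + b + c -> p <= 2 * LD -> q <= 5 * MD -> r <= LD -> l <= LD -> m <= MD ->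
  0 <= LD -> 0 <= MD -> 0 <= D -> z <= 20 * LD + 20 * MD + 20 * D by lra.
move=> L0 phiM phiL e0.
have M0 : 0 <= M by rewrite (le_trans _ (phiM point)).
have mphi : measurable_fun setT phi by exact: measurable_continuous_path (lip_path_continuous L0 phiL).
have LM : 0 < 20 * (L + M + 1) by rewrite mulr_gt0// ltr_wpDl// addr_ge0.
pose D := e / (20 * (L + M + 1)).
have D0 : 0 < D by rewrite divr_gt0.
have [N ND] := exp2V_lt D0.
pose lam := Num.min 2 (D / 5).
have lam0 : 0 < lam by rewrite lt_min ltr0n /= divr_gt0.
have lam2 : lam <= 2 by rewrite ge_min lexx.
have lamD : 5 * lam <= D by rewrite mulrC -ler_pdivlMr// ge_min lexx orbT.
(* The three bounds serve the condition [delta <= 4^-1] of Ottaviani's inequality, the probability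
   of large oscillations, and the distance of Wiener paths from their polygons. *)
pose del := Num.min (lam / 8) (Num.min (lam * D / 2) D).
have del0 : 0 < del by rewrite !lt_min D0 !divr_gt0// mulr_gt0.
have [h0 /andP[h00 h01] hmod] := modulus1_small W (2 * N)%N del0.
set m1 := \int[W]_g _ in hmod.
have m1a : m1 <= lam / 8 by rewrite (le_trans hmod)// ge_min lexx.
have m1b : m1 <= lam * D / 2 by rewrite (le_trans hmod)// !ge_min lexx !orbT.
have m1c : m1 <= D by rewrite (le_trans hmod)// !ge_min lexx !orbT.
(* The block length, a multiple of [eta eps], will only be known to lie between [h0 / 2] and [h0].
   So [q * h0 >= 2 * N] is needed for the blocks to cover [[0, N]], while [q * h0 <= 2 * N + 1]
   keeps them within the horizon of the modulus. *)
pose q := (Num.truncn (2 * N%:R / h0)).+1.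
have q1 : 2 * N%:R <= q%:R * h0 by rewrite -ler_pdivrMr// ltW// truncnS_gt.
have q2 : q%:R * h0 <= (2 * N).+1%:R.
  rewrite -[in leLHS]natr1 mulrDl mul1r -[leRHS]natr1 natrM lerD// -ler_pdivlMr//.
  by rewrite truncn_le// divr_ge0 ?(ltW h00)// mulr_ge0.
pose T0 : R := (2 * N).+1%:R.
have T00 : 0 < T0 by rewrite ltr0n.
have [eta1 eta10 H1] := clt_blocks Xindep X1sym X2id X2var X1neq0 HW M q L0 T00 D0.
have hs : 2 / lam * m1 <= 4^-1.
  rewrite mulrAC ler_pdivrMr//; move: m1a; lra.
have [eta2 eta20 H2] := walk_oscillation Xindep X1sym X2id X2var X1neq0 HW lam0 lam2 h00 q2 D0 hs.
have [z0 z00 H3] := solution_path_close lam0 D0 T00.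
near=> eps.
have eps0 : 0 < eps by near: eps; exact: nbhs_right_gt.
have zlt : eps / eta eps < z0 by near: eps; exact: (cvgr_lt _ eps_eta_cvg0).
have hlt : eta eps < Num.min (Num.min eta1 eta2) (h0 / 2).
  near: eps; apply: (cvgr_lt _ eta_cvg0).
  by rewrite !lt_min eta10 eta20 divr_gt0.
have eta0 := eta_gt0 eps0; set h := eta eps in eta0 hlt zlt *.
move: hlt; rewrite !lt_min => /andP[/andP[hlt1 hlt2] hlt3].
have ez : eps <= z0 * h by rewrite -ler_pdivrMr// ltW.
have h1 : h <= 1 by move: hlt3 h01; lra.
pose n := Num.truncn (h0 / h).
have n1 : n%:R * h <= h0 by rewrite -ler_pdivlMr// truncn_le// divr_ge0// ltW.
have n2 : h0 / 2 <= n%:R * h.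
  have : h0 <= n.+1%:R * h by rewrite -ler_pdivrMr// ltW// truncnS_gt.
  by rewrite -natr1 mulrDl mul1r; move: hlt3; lra.
have hp : 0 < n%:R * h by move: n2 (h00); lra.
have n0 : (0 < n)%N by move: hp; rewrite pmulr_lgt0// ltr0n.
have Nq : N%:R <= q%:R * (n%:R * h).
  apply: (@le_trans _ _ (q%:R * (h0 / 2))); last by rewrite ler_wpM2l.
  by move: q1; lra.
have qnT : (q * n)%:R * h <= T0 by rewrite natrM -mulrA (le_trans _ q2)// ler_wpM2l.
have nT : n%:R * h <= T0 by rewrite (le_trans n1)// (le_trans h01)// ler1n.
have qn0 : (0 < q * n)%N by rewrite muln_gt0.
pose F v := phi (interp_path q hp v).
have Flip : lip_on q L F.
  by move=> y z; rewrite (le_trans (phiL _ _))// ler_wpM2l// interp_path_lip.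
have FM v : `|F v| <= M by exact: phiM.
have [A1 mA1 [PA1 hA1]] := H2 h ltac:(by rewrite eta0) n n1.
have [A2 mA2 [PA2 hA2]] := H3 eps q n N eps0 h1 ez qn0 qnT Nq hp.
have E2 := H1 h ltac:(by rewrite eta0) n nT F Flip FM.
have E3 := wiener_interp_close HW hp L0 phiM phiL (leq_pmull N (isT : 0 < 2)%N) n1 h01 Nq.
have mu : measurable_fun setT (fun w => phi (u eps w x)).
  exact: (measurableT_comp mphi (measurable_solution_path eps0)).
have mF : measurable_fun setT (fun w => F (fun i => walk_sum X1 X2 h (i * n) n w)).
  apply: (lip_on_measurable Flip (Z := fun i w => walk_sum X1 X2 h (i * n) n w)) => j _.
  exact: measurable_walk_sum.
have E1 := @Rint_dist_off _ _ _ P _ _ (fun=> 0) _ M 0 (L * (5 * lam + (2 ^+ N)^-1))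
  (measurableU _ _ mA1 mA2) mu mF (measurable_cst _) (fun w => phiM _) (fun w => FM _) _ _ _.
have {}E1 : `|\int[P]_w phi (u eps w x) - \int[P]_w F (fun i => walk_sum X1 X2 h (i * n) n w)| <=
    L * (5 * lam + (2 ^+ N)^-1) + 2 * M * prb P (A1 `|` A2).
  rewrite -[L * _]addr0 -[X in _ + X + _](Rint_cst P 0); apply: E1.
  - by move=> _; rewrite lexx.
  - by rewrite mulr_ge0// addr_ge0 ?mulr_ge0 ?(ltW lam0)// invr_ge0 exprn_ge0.
  move=> w /not_orP[/hA1 osc /hA2 /(_ osc) close].
  by rewrite addr0 (le_trans (phiL _ _))// ler_wpM2l.
have PA : prb P (A1 `|` A2) <= 5 * D.
  rewrite (le_trans (prbU_le P mA1 mA2))//.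
  have : 2 / lam * m1 <= D by rewrite mulrAC ler_pdivrMr//; move: m1b; lra.
  by move: PA1 PA2; move: (2 / lam * m1) => y; lra.
have DE : e = 20 * D * (L + M + 1).
  by rewrite /D mulrAC mulrC divfK// gt_eqF.
have ND' := ltW ND.
have b1 : L * (5 * lam + (2 ^+ N)^-1) <= 2 * (L * D).
  rewrite mulrCA ler_wpM2l//; move: lamD ND'; move: (_^-1) => y; lra.
have b2 : M * prb P (A1 `|` A2) <= 5 * (M * D) by rewrite mulrCA ler_wpM2l.
have b3 : L * (2 ^+ N)^-1 <= L * D by rewrite ler_wpM2l.
rewrite -/m1 in E3.
have b4 := ler_wpM2l L0 m1c; have b5 := ler_wpM2l M0 m1c.
rewrite DE; have LD := mulr_ge0 L0 (ltW D0); have MD := mulr_ge0 M0 (ltW D0).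
set I1 := \int[P]_w phi _ in E1 *; set I2 := \int[P]_w F _ in E1 E2.
set I3 := \int[W]_g F _ in E2; set I4 := \int[W]_g phi g in E3 *.
have E4 : `|I1 - I4| <= `|I1 - I2| + `|I2 - I3| + `|I3 - I4|.
  by rewrite (le_trans (ler_distD I3 _ _))// lerD2r ler_distD.
have -> : 20 * D * (L + M + 1) = 20 * (L * D) + 20 * (M * D) + 20 * D by ring.
rewrite mulrDl -!mulrA in E3; rewrite -mulrA in E1.
exact: (budget _ _ _ _ _ _ _ _ _ _ _ _ E1 E2 E3 E4 b1 b2 b3 b4 b5 LD MD (ltW D0)).
Unshelve. all: by end_near. Qed.

(** An approximation from below is only needed to converge under the fixed measure [W]; under the
    law of the solution the inequality [lip_approx <= phi] is enough. This yields one side of the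
    limit without uniform approximation on compact sets. *)
Lemma continuous_limit_ge (phi : path_space R -> R) (M e : R) : continuous phi ->
  (forall g, `|phi g| <= M) -> 0 < e ->
  \forall eps \near 0^'+, \int[W]_g phi g - e <= \int[P]_w phi (u eps w x).
Proof.
move=> cphi phiM e0; have e2 : 0 < e / 2 by rewrite divr_gt0.
have ml n : measurable_fun setT (lip_approx phi n).
  by apply: measurable_continuous_path; apply: lip_path_continuous (lip_approx_lip phiM n).
have iM : W.-integrable setT (EFin \o (fun=> M)) by apply: (@bounded_integrable _ _ _ W _ `|M|).
have cv := @Rint_dominated _ _ _ W (lip_approx phi) phi (fun=> M) ml iM (lip_approx_bnd phiM) (lip_approx_cvg cphi phiM).
have lt2 : \int[W]_g phi g - e / 2 < \int[W]_g phi g by rewrite ltrBlDr ltrDl.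
have [n _ /(_ n (leqnn n)) /= hn] := cvgr_ge _ cv _ lt2.
have := lipschitz_limit (ler0n R n) (lip_approx_bnd phiM n) (lip_approx_lip phiM n) e2.
apply: filterS2 (nbhs_right_gt 0) => eps eps0.
have mu := measurable_solution_path eps0.
have : \int[P]_w lip_approx phi n (u eps w x) <= \int[P]_w phi (u eps w x).
  apply: (Rint_le P (measurableT_comp (ml n) mu) (measurableT_comp (measurable_continuous_path cphi) mu)
    (fun w => lip_approx_bnd phiM n _) (fun w => phiM _)) => w /=.
  exact: lip_approx_le_self.
by rewrite ler_norml => h1 /andP[h2 _]; move: hn h1 h2; lra.
Qed.

Lemma weak_limit : weakly_converges 0^'+ (fun eps => pushforward P (fun w => u eps w x)) W.
Proof.
move=> phi cphi [M0 [_ hM0]].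
have [M phiM] : exists M, forall g, `|phi g| <= M.
  by exists (M0 + 1) => g; apply: hM0 => //; rewrite ltrDl.
have mphi := measurable_continuous_path cphi.
(* The lower bound applied to [- phi] is the upper bound for [phi]. *)
pose psi : path_space R -> R := fun g => - 1 * phi g.
have cpsi : continuous psi 
  by move=> g; apply: (@continuous_comp _ _ _ phi ( *%R (- 1)) _ (cphi g)); exact: mulrl_continuous.
have psiM g : `|psi g| <= M by rewrite normrM normrN1 mul1r.
have EW : (\int[W]_g (phi g)%:E)%E = (\int[W]_g phi g)%:E.
  by rewrite /Rintegral fineK//; apply: integrable_fin_num => //; exact: (bounded_integrable W mphi phiM).
have iP eps : 0 < eps -> P.-integrable setT (EFin \o (fun w => phi (u eps w x))).
  move=> eps0; apply: (bounded_integrable P _ (fun w => phiM (u eps w x))).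
  exact: (measurableT_comp mphi (measurable_solution_path eps0)).
have EP : \forall eps \near 0^'+, (\int[P]_w phi (u eps w x))%:E =
    (\int[pushforward P (fun w => u eps w x)]_g (phi g)%:E)%E.
  apply: filterS (nbhs_right_gt 0) => eps eps0.
  rewrite (integral_pushforward (measurable_solution_path eps0) (f := EFin \o phi)) ?preimage_setT//.
  - by rewrite /Rintegral fineK//; apply: integrable_fin_num => //; exact: iP.
  - exact/measurable_EFinP.
  - exact: iP.
rewrite EW; apply: cvg_trans (near_eq_cvg EP) _.
apply: cvg_EFin; first by apply: nearW.
apply/cvgrPdist_le => e e0.
have h1 := continuous_limit_ge cphi phiM e0; have h2 := continuous_limit_ge cpsi psiM e0.
move: h1 h2; apply: filterS3 (nbhs_right_gt 0) => eps eps0.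
have iW := bounded_integrable W mphi phiM.
rewrite /psi !RintegralZl//; last exact: iP.
by rewrite !mulN1r => h1 h2; rewrite ler_norml; apply/andP; split; move: h1 h2; rewrite /=; lra.
Qed.

End limit.

Theorem theorem8p1 (R : realType) (d : nat)
  (H : 'rV[R]_d -> 'rV[R]_d -> R) (f : 'rV[R]_d -> R)
  (Hper : forall p, Zd_periodic (H p)) (fper : Zd_periodic f)
  (Hcoer : coercive H)
  (Hbnd : forall r : R, 0 < r ->
    [bounded H z.1 z.2 | z in [set z : 'rV[R]_d * 'rV[R]_d | `|z.1| <= r]])
  (Hlip : forall r : R, 0 < r ->
    [lipschitz H z.1 z.2 | z in [set z : 'rV[R]_d * 'rV[R]_d | `|z.1| <= r]])
  (Hge0 : forall p y, 0 <= H p y) (H0 : forall y, H 0 y = 0)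
  (fBUC : BUC [set: 'rV[R]_d] f)
  (fmax : (forall y, f y <= 1) /\ exists y, f y = 1)
  (fmin : (forall y, - 1 <= f y) /\ exists y, f y = - 1)
  (eta : R -> R) (eta_gt0 : forall eps : R, 0 < eps -> 0 < eta eps)
  (eta_cvg0 : eta eps @[eps --> 0^'+] --> 0)
  (eps_eta_cvg0 : eps / eta eps @[eps --> 0^'+] --> 0)
  (dO : measure_display) (Omega : measurableType dO) (P : probability Omega R)
  (X1 X2 : nat -> {RV P >-> R})
  (Xindep : mutually_independent P
    (fun ik : bool * nat => if ik.1 then X1 ik.2 : Omega -> R else X2 ik.2))
  (X1sym : forall k, P [set w | 0 < X1 k w] = P [set w | X1 k w < 0])
  (X2id : forall k (A : set R), measurable A ->
    distribution P (X2 k) A = distribution P (X2 0%N) A)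
  (X2var : forall k, ('E_P[fun w => (`|X2 k w| ^+ 2)%R] = 1)%E)
  (X1neq0 : forall k, {ae P, forall w, X1 k w != 0})
  (Xratio : (ess_sup P (fun w =>
    ereal_sup (range (fun k => (`|X2 k w / X1 k w|)%:E))) < +oo)%E)
  (W1 W2 : R -> Omega -> R -> R)
  (W1walk : forall (eps : R) w, 0 < eps ->
    interpolated_walk (eta eps) (fun k => X1 k w) (W1 eps w))
  (W2walk : forall (eps : R) w, 0 < eps ->
    interpolated_walk (eta eps) (fun k => X2 k w) (W2 eps w))
  (u : R -> Omega -> 'rV[R]_d -> path_space R)
  (usol : forall (eps : R) w, 0 < eps ->
    is_solution H f eps (eta eps) (W1 eps w) (W2 eps w) (u eps w))
  (wiener : probability (path_space R) R) (Hwiener : is_wiener_measure wiener)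
  (x : 'rV[R]_d) :
  (forall eps : R, 0 < eps -> measurable_fun [set: Omega] (fun w => u eps w x)) /\
  weakly_converges 0^'+ (fun eps => pushforward P (fun w => u eps w x)) wiener.
Proof.
have hH := ham_structP Hper Hcoer Hlip Hge0 H0.
have hf y : `|f y| <= 1 by rewrite ler_norml fmin.1 fmax.1.
have uf : unif_cont f.
  have [_ h] := BUC_unif fBUC; move=> e e0; have [r r0 hr] := h e e0.
  by exists r => // y z; apply: hr.
split=> [eps eps0|].
  exact: (measurable_solution_path hH hf uf eta_gt0 W1walk W2walk usol x eps0).
exact: (weak_limit hH hf uf fper fmax.2 fmin.2 eta_gt0 eta_cvg0 eps_eta_cvg0 Xindep X1sym X2id X2var
  X1neq0 Xratio W1walk W2walk usol Hwiener x).
Qed.
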